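(* Let $0<q<1$ and let $\Gamma$ be a nondegenerate hermitian and real contraction map on the left invariant 1-forms of the $4D_+$ calculus on $\mathrm{SU}_q(2)$, with parameters $\alpha=\Gamma(\omega_-,\omega_-)$ and $\nu=\Gamma(\omega_0,\omega_0)$, let $\{\cdot,\cdot\}$ be the associated sesquilinear map, and let $\langle\cdot,\cdot\rangle^L_{\mathrm{S}^2_q}$, $\langle\cdot,\cdot\rangle^R_{\mathrm{S}^2_q}$ be the associated left and right inner products on $\Omega(\mathrm{S}^2_q)$ (all defined in the context). Let $\check\mu=\check m\,\omega_-\wedge\omega_+\wedge\omega_0$ with $0\neq\check m\in\mathbb{R}$. Then there exists a unique invertible left $\mathcal{A}(\mathrm{S}^2_q)$-linear operator $\check L:\Omega^k(\mathrm{S}^2_q)\to\Omega^{3-k}(\mathrm{S}^2_q)$ (respectively a unique invertible right $\mathcal{A}(\mathrm{S}^2_q)$-linear operator $\check R:\Omega^k(\mathrm{S}^2_q)\to\Omega^{3-k}(\mathrm{S}^2_q)$), $k=0,1,2,3$, such that $$\int_{\check\mu}\theta^*\wedge\check L(\theta')=\langle\theta,\theta'\rangle^L_{\mathrm{S}^2_q},\qquad \int_{\check\mu}\theta^*\wedge\check R(\theta')=\langle\theta,\theta'\rangle^R_{\mathrm{S}^2_q}$$ for all $\theta,\theta'\in\Omega^k(\mathrm{S}^2_q)$. They are given, for $\phi\in\mathcal{L}_{-2}$ and $\phi'\in\mathcal{L}_2$, by $$\check L(1)=\check\mu,\qquad \check L(\check\mu)=\{\check\mu,\check\mu\},$$ $$\check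 L(\phi\,\omega_-)=\check m\,\alpha\,\phi\,\omega_-\wedge\omega_0,\qquad \check L(\phi\,\omega_-\wedge\omega_0)=\check m\,\{\omega_-\wedge\omega_0,\omega_-\wedge\omega_0\}\,\phi\,\omega_-,$$ $$\check L(\phi'\omega_+)=\check m\,q^2\alpha\,\phi'\,\omega_0\wedge\omega_+,\qquad \check L(\phi'\,\omega_0\wedge\omega_+)=\check m\,\{\omega_+\wedge\omega_0,\omega_+\wedge\omega_0\}\,\phi'\omega_+,$$ $$\check L(\omega_0)=-\check m\,\nu\,\omega_-\wedge\omega_+,\qquad \check L(\omega_-\wedge\omega_+)=-\check m\,\{\omega_-\wedge\omega_+,\omega_-\wedge\omega_+\}\,\omega_0,$$ and $$\check R(1)=\check\mu,\qquad \check R(\check\mu)=\{\check\mu,\check\mu\},$$ $$\check R(\omega_-\phi)=\check m\,q^2\alpha\,\omega_-\wedge\omega_0\,\phi,\qquad \check R(\omega_-\wedge\omega_0\,\phi)=\check m\,q^2\{\omega_-\wedge\omega_0,\omega_-\wedge\omega_0\}\,\omega_-\phi,$$ $$\check R(\omega_+\phi')=\check m\,\alpha\,\omega_0\wedge\omega_+\,\phi',\qquad \check R(\omega_0\wedge\omega_+\,\phi')=\check m\,q^{-2}\{\omega_+\wedge\omega_0,\omega_+\wedge\omega_0\}\,\omega_+\phi',$$ $$\check R(\omega_0)=-\check m\,\nu\,\omega_-\wedge\omega_+,\qquad \check R(\omega_-\wedge\omega_+)=-\check m\,\{\omega_-\wedge\omega_+,\omega_-\wedge\omega_+\}\,\omega_0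 .$$
   Context: **Algebras.** Fix $0<q<1$. $\mathcal{A}=\mathcal{A}(\mathrm{SU}_q(2))$ is the unital complex $*$-algebra generated by $a,c$ with relations $ac=qca$, $ac^*=qc^*a$, $cc^*=c^*c$, $a^*a+c^*c=1=aa^*+q^2cc^*$. $\mathcal{U}_q(\mathfrak{su}(2))$ is the Hopf algebra generated by $K^{\pm1},E,F$ with $K^{\pm1}E=q^{\pm1}EK^{\pm1}$, $K^{\pm1}F=q^{\mp1}FK^{\pm1}$, $[E,F]=\frac{K^2-K^{-2}}{q-q^{-1}}$ and coproduct $\Delta K^{\pm1}=K^{\pm1}\otimes K^{\pm1}$, $\Delta E=E\otimes K+K^{-1}\otimes E$, $\Delta F=F\otimes K+K^{-1}\otimes F$. It acts on the left on $\mathcal{A}$, with $h\triangleright(xy)=(h_{(1)}\triangleright x)(h_{(2)}\triangleright y)$, by $K\triangleright a=q^{-1/2}a$, $K\triangleright c=q^{-1/2}c$, $K\triangleright a^*=q^{1/2}a^*$, $K\triangleright c^*=q^{1/2}c^*$; $F\triangleright a=F\triangleright c=0$, $F\triangleright a^*=c$, $F\triangleright c^*=-q^{-1}a$; $E\triangleright a=-qc^*$, $E\triangleright c=a^*$, $E\triangleright a^*=E\triangleright c^*=0$. Put $\mathcal{L}_n=\{x\in\mathcal{A}: K\triangleright x=q^{n/2}x\}$, $n\in\mathbb{Z}$, and $\mathcal{A}(\mathrm{S}^2_q)=\mathcal{L}_0$. **The $4D_+$ calculus.** Let $L_-=q^{1/2}FK^{-1}$, $L_+=q^{-1/2}EK^{-1}$,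 $L_z=\frac{K^{-2}-1}{q-q^{-1}}$, $L_0=\frac{q(K^2-1)+q^{-1}(K^{-2}-1)}{(q-q^{-1})^2}+FE$. $\Omega^1(\mathrm{SU}_q(2))$ is the free left $\mathcal{A}$-module with basis $\omega_-,\omega_+,\omega_z,\omega_0$ (the left invariant 1-forms), $\mathrm{d}x=\sum_a(L_a\triangleright x)\omega_a$, and right module structure $\omega_-x=x\omega_-+q^{-1/2}(KE\triangleright x)\omega_0$, $\omega_+x=x\omega_++q^{-1/2}(FK\triangleright x)\omega_0$, $\omega_0x=(K^2\triangleright x)\omega_0$, $\omega_zx=(q-q^{-1})q^{1/2}(FK^{-1}\triangleright x)\omega_-+(K^{-2}\triangleright x)\omega_z+(q-q^{-1})q^{-1/2}(EK^{-1}\triangleright x)\omega_++(q-q^{-1})\big(\big(FE+q^{-1}\tfrac{K^{-2}-K^2}{(q-q^{-1})^2}\big)\triangleright x\big)\omega_0$. The $\mathcal A$-bimodule braiding $\sigma$ on $\Omega^1\otimes_{\mathcal A}\Omega^1$ is: $\sigma(\omega_j\otimes\omega_j)=\omega_j\otimes\omega_j$ for $j=-,+,0$; $\sigma(\omega_z\otimes\omega_z)=\omega_z\otimes\omega_z+(q^2-q^{-2})(\omega_z\otimes\omega_0+\omega_-\otimes\omega_+-\omega_+\otimes\omega_-)$; $\sigma(\omega_-\otimes\omega_+)=\omega_+\otimes\omega_--\omega_z\otimes\omega_0$; $\sigma(\omega_+\otimes\omega_-)=\omega_-\otimes\omega_++\omega_z\otimes\omega_0$; $\sigma(\omega_-\otimes\omega_z)=\omega_z\otimes\omega_-+(1+q^2)\omega_-\otimes\omega_0$;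 $\sigma(\omega_z\otimes\omega_-)=(1-q^{-2})\omega_z\otimes\omega_-+q^{-2}\omega_-\otimes\omega_z-(1+q^{-2})\omega_-\otimes\omega_0$; $\sigma(\omega_-\otimes\omega_0)=\omega_0\otimes\omega_-+(1-q^2)\omega_-\otimes\omega_0$; $\sigma(\omega_0\otimes\omega_-)=q^2\omega_-\otimes\omega_0$; $\sigma(\omega_z\otimes\omega_+)=q^2\omega_+\otimes\omega_z+(1-q^2)\omega_z\otimes\omega_++(1+q^2)\omega_+\otimes\omega_0$; $\sigma(\omega_+\otimes\omega_z)=\omega_z\otimes\omega_+-(1+q^{-2})\omega_+\otimes\omega_0$; $\sigma(\omega_z\otimes\omega_0)=\omega_0\otimes\omega_z+(q-q^{-1})^2(\omega_+\otimes\omega_--\omega_-\otimes\omega_+)-(q-q^{-1})^2\omega_z\otimes\omega_0$; $\sigma(\omega_0\otimes\omega_z)=\omega_z\otimes\omega_0$; $\sigma(\omega_+\otimes\omega_0)=\omega_0\otimes\omega_++(1-q^{-2})\omega_+\otimes\omega_0$; $\sigma(\omega_0\otimes\omega_+)=q^{-2}\omega_+\otimes\omega_0$. Let $\mathfrak{A}^{(k)}=\sum_{\pi\in S_k}\mathrm{sgn}(\pi)\,\sigma_\pi$ be Woronowicz's antisymmetriser on $(\Omega^1)^{\otimes k}$ ($\sigma_\pi$ is the product of the $\sigma_{i,i+1}$ along a reduced word of $\pi$; $\mathfrak A^{(2)}=1-\sigma$, $\mathfrak A^{(1)}=\mathrm{id}$). $\Omega^k(\mathrm{SU}_q(2))=(\Omega^1)^{\otimes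 k}/\ker\mathfrak{A}^{(k)}$, identified with the range of $\mathfrak{A}^{(k)}$ via $\omega_{a_1}\wedge\cdots\wedge\omega_{a_k}=\mathfrak{A}^{(k)}(\omega_{a_1}\otimes\cdots\otimes\omega_{a_k})$; $\mathrm d$ is extended as a graded derivation with $\mathrm{d}^2=0$. The free left modules $\Omega^k$, $k=0,\dots,4$, have ranks $1,4,6,4,1$. The $*$-structure is $\omega_-^*=-\omega_+$, $\omega_z^*=-\omega_z$, $\omega_0^*=-\omega_0$, $(\theta\wedge\theta')^*=(-1)^{kk'}\theta'^*\wedge\theta^*$ for forms of degree $k,k'$. $\Omega^k_{inv}$ is the complex span of the $\omega_{a_1}\wedge\cdots\wedge\omega_{a_k}$. **Eigenvectors of the antisymmetriser.** On $\Omega^2_{inv}$, $\mathfrak{A}^{(2)}$ has eigenvalue $1+q^2$ on $\omega_-\wedge\omega_0$, $\ \omega_+\wedge\omega_0-(1-q^2)\omega_+\wedge\omega_z$, $\ \omega_0\wedge\omega_z+(1-q^2)\omega_-\wedge\omega_+$, and eigenvalue $1+q^{-2}$ on $\omega_-\wedge\omega_0+(1-q^{-2})\omega_-\wedge\omega_z$, $\ \omega_+\wedge\omega_0$, $\ \omega_0\wedge\omega_z+(1-q^{-2})\omega_-\wedge\omega_+$. On $\Omega^3_{inv}$, $\mathfrak{A}^{(3)}=2(1+q^2+q^{-2})$; on $\Omega^4_{inv}$, $\mathfrak{A}^{(4)}=2(q^4+2q^2+6+2q^{-2}+q^{-4})$. For an eigenvector $\xi$ write $\mathfrak{A}^{(k)}\xi=\lambda_\xi\xi$.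 **Contraction maps.** A contraction map is a map $\Gamma:\Omega^1_{inv}\times\Omega^1_{inv}\to\mathbb{C}$, antilinear in the first and linear in the second argument. It is extended to tensors by $\Gamma(\omega_{a_1}\otimes\cdots\otimes\omega_{a_k},\omega_{b_1}\otimes\cdots\otimes\omega_{b_{k+k'}})=\big(\prod_{j=1}^k\Gamma(\omega_{a_j},\omega_{b_j})\big)\omega_{b_{k+1}}\otimes\cdots\otimes\omega_{b_{k+k'}}$, and to invariant exterior forms by evaluating on their images in the range of the antisymmetrisers: $\Gamma(\omega_{a_1}\wedge\cdots\wedge\omega_{a_k},\omega_{b_1}\wedge\cdots\wedge\omega_{b_{k+k'}})=\Gamma(\mathfrak{A}^{(k)}(\omega_{a_1}\otimes\cdots\otimes\omega_{a_k}),\mathfrak{A}^{(k+k')}(\omega_{b_1}\otimes\cdots\otimes\omega_{b_{k+k'}}))\in\Omega^{k'}_{inv}$; also $\Gamma(1,\omega)=\omega$. Let $\mu=\mu^*=\mathrm{i}\,m\,\omega_-\wedge\omega_+\wedge\omega_0\wedge\omega_z$, $0\neq m\in\mathbb{R}$. Define the linear operator $\star:\Omega^k_{inv}\to\Omega^{4-k}_{inv}$ by $\star(1)=\mu$, $\star(\omega_a)=(\Gamma(\omega_a,\mu))^*$, and $\star(\xi)=\lambda_\xi^{-1}(\Gamma(\xi,\mu))^*$ on the eigenvectors $\xi$ above for $k\ge2$. Define the sesquilinear map $\{\cdot,\cdot\}:\Omega^k_{inv}\times\Omega^k_{inv}\to\mathbb{C}$ by $\{\xi,\xi'\}\mu=\xi^*\wedge\star(\xi')$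 (it does not depend on $m$). $\Gamma$ is *hermitian* if $\{\omega_a,\omega_b\}=\Gamma(\omega_a,\omega_b)$ for all $a,b\in\{-,+,z,0\}$, and *real* if $\lambda_{\xi^*}\star(\xi^* )=(\lambda_\xi\star(\xi))^*$ on the eigenvectors $\xi$ above. For a hermitian and real contraction the only nonzero values on basis 1-forms are $\Gamma(\omega_-,\omega_-)=q^{-2}\Gamma(\omega_+,\omega_+)=\alpha$, $\Gamma(\omega_0,\omega_z)=\Gamma(\omega_z,\omega_0)=\epsilon$, $\Gamma(\omega_0,\omega_0)=\nu$, $\Gamma(\omega_z,\omega_z)=\gamma$, with real parameters such that $2\nu+(q^2-q^{-2})\epsilon=0$ and $2(\epsilon^2-\gamma\nu)+(q-q^{-1})^2(2q^2\alpha^2+\epsilon^2)=0$. Nondegenerate means that the matrix $\Gamma(\omega_a,\omega_b)$ is invertible (equivalently $\alpha\ne0$). **Inner products, sphere, integral.** $h$ is the Haar state of $\mathcal{A}$: $h((cc^* )^k)=(1+q^2+\cdots+q^{2k})^{-1}$, and $h$ vanishes on the other elements $a^ic^jc^{*l}$, $a^{*i}c^jc^{*l}$ (those with $i>0$ or $j\neq l$). On $\Omega(\mathrm{SU}_q(2))$ put $\langle x\omega,x'\omega'\rangle^L=h(x^*x')\{\omega,\omega'\}$ and $\langle\omega x,\omega'x'\rangle^R=h(x^*x')\{\omega,\omega'\}$ for $x,x'\in\mathcal{A}$ and invariant forms $\omega,\omega'$ of the same degree (different degrees being orthogonal); $\langle\cdot,\cdot\rangle^{L}_{\mathrm{S}^2_q}$,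 $\langle\cdot,\cdot\rangle^{R}_{\mathrm{S}^2_q}$ are their restrictions to $\Omega(\mathrm{S}^2_q)\subset\Omega(\mathrm{SU}_q(2))$, where $\Omega^0(\mathrm{S}^2_q)=\mathcal{L}_0$, $\Omega^1(\mathrm{S}^2_q)=\mathcal{L}_{-2}\omega_-\oplus\mathcal{L}_2\omega_+\oplus\mathcal{L}_0\omega_0=\omega_-\mathcal{L}_{-2}\oplus\omega_+\mathcal{L}_2\oplus\omega_0\mathcal{L}_0$, $\Omega^2(\mathrm{S}^2_q)=\mathcal{L}_{-2}\,\omega_-\wedge\omega_0\oplus\mathcal{L}_0\,\omega_-\wedge\omega_+\oplus\mathcal{L}_2\,\omega_0\wedge\omega_+=\omega_-\wedge\omega_0\,\mathcal{L}_{-2}\oplus\omega_-\wedge\omega_+\,\mathcal{L}_0\oplus\omega_0\wedge\omega_+\,\mathcal{L}_2$, $\Omega^3(\mathrm{S}^2_q)=\mathcal{L}_0\,\omega_-\wedge\omega_+\wedge\omega_0$. The integral $\int_{\check\mu}:\Omega(\mathrm{S}^2_q)\to\mathbb{C}$ is zero on forms of degree $0,1,2$ and $\int_{\check\mu}f\check\mu=h(f)$ for $f\in\mathcal{A}(\mathrm{S}^2_q)$. *)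

(* Defs.v *)
From HB Require Import structures.
From mathcomp Require Import all_boot all_order all_algebra.
From mathcomp Require Import boolp classical_sets functions reals.
From mathcomp Require Import complex.

Set Implicit Arguments.
Unset Strict Implicit.
Unset Printing Implicit Defensive.

Import Order.TTheory GRing.Theory Num.Theory.
Local Open Scope classical_set_scope.
Local Open Scope complex_scope.
Local Open Scope ring_scope.

Section Algebra.
Variable R : realType.
Local Notation C := R[i].

Definition star_algebra (B : algType C) (st : B -> B) : Prop :=
  [/\ involutive st,
      {morph st : x y / x + y},
      forall (z : C) x, st (z *: x) = conjc z *: st x
    & forall x y, st (x * y) = st y * st x].

Definition SUq2_relations (q : R) (B : algType C) (st : B -> B) (a c : B) :
    Prop :=
  [/\ a * c = q%:C *: (c * a),
      a * st c = q%:C *: (st c * a),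
      c * st c = st c * c,
      st a * a + st c * c = 1
    & a * st a + (q ^+ 2)%:C *: (c * st c) = 1].

(* The unital *-algebra presented by the generators a, c and the relations
   above: generated by a and c, and initial among the *-algebras with two
   elements satisfying the relations (the map phi is unique by generation). *)
Record is_SUq2 (q : R) (A : algType C) (st : A -> A) (a c : A) : Prop := {
  SUq2_star : star_algebra st ;
  SUq2_rel : SUq2_relations q st a c ;
  SUq2_gen : forall P : A -> Prop,
    P 1 -> P a -> P c ->
    (forall x y, P x -> P y -> P (x + y)) ->
    (forall x y, P x -> P y -> P (x * y)) ->
    (forall (z : C) x, P x -> P (z *: x)) ->
    (forall x, P x -> P (st x)) ->
    forall x, P x ;
  SUq2_univ : forall (B : algType C) (stB : B -> B) (b d : B),
    star_algebra stB -> SUq2_relations q stB b d ->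
    exists phi : {lrmorphism A -> B},
      [/\ phi a = b, phi c = d & forall x, phi (st x) = stB (phi x)]
}.

Definition sqrtq (q : R) : C := (Num.sqrt q)%:C.

Record is_Uq_action (q : R) (A : algType C) (st : A -> A) (a c : A)
    (K Ki E F : A -> A) : Prop := {
  Uq_KKi : cancel Ki K ;
  Uq_KiK : cancel K Ki ;
  Uq_KE : forall x, K (E x) = q%:C *: E (K x) ;
  Uq_KiE : forall x, Ki (E x) = q%:C^-1 *: E (Ki x) ;
  Uq_KF : forall x, K (F x) = q%:C^-1 *: F (K x) ;
  Uq_KiF : forall x, Ki (F x) = q%:C *: F (Ki x) ;
  Uq_EF : forall x, E (F x) - F (E x) =
                    ((q - q^-1)^-1)%:C *: (K (K x) - Ki (Ki x)) ;
  Uq_KM : {morph K : x y / x * y} ;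
  Uq_KiM : {morph Ki : x y / x * y} ;
  Uq_EM : forall x y, E (x * y) = E x * K y + Ki x * E y ;
  Uq_FM : forall x y, F (x * y) = F x * K y + Ki x * F y ;
  Uq_Ka : K a = (sqrtq q)^-1 *: a ;
  Uq_Kc : K c = (sqrtq q)^-1 *: c ;
  Uq_Kas : K (st a) = sqrtq q *: st a ;
  Uq_Kcs : K (st c) = sqrtq q *: st c ;
  Uq_Fa : F a = 0 ;
  Uq_Fc : F c = 0 ;
  Uq_Fas : F (st a) = c ;
  Uq_Fcs : F (st c) = - (q%:C^-1 *: a) ;
  Uq_Ea : E a = - (q%:C *: st c) ;
  Uq_Ec : E c = st a ;
  Uq_Eas : E (st a) = 0 ;
  Uq_Ecs : E (st c) = 0
}.

Record is_haar (q : R) (A : algType C) (st : A -> A) (a c : A) (h : A -> C) :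
    Prop := {
  haar_cc : forall k : nat,
    h ((c * st c) ^+ k) = (\sum_(i < k.+1) (q ^+ (2 * i)%N))%:C^-1 ;
  haar_a : forall i j l : nat, (0 < i)%N || (j != l) ->
    h (a ^+ i * c ^+ j * st c ^+ l) = 0 ;
  haar_as : forall i j l : nat, (0 < i)%N || (j != l) ->
    h (st a ^+ i * c ^+ j * st c ^+ l) = 0
}.

(* A(SU_q(2)) with its left U_q(su(2))-action and its Haar state; every
   component is determined, up to a unique *-isomorphism, by the axioms. *)
Record quantum_SU2 (q : R) := QuantumSU2 {
  qalg :> algType C ;
  qst : qalg -> qalg ;
  qa : qalg ;
  qc : qalg ;
  qK : {linear qalg -> qalg} ;
  qKi : {linear qalg -> qalg} ;
  qE : {linear qalg -> qalg} ;
  qF : {linear qalg -> qalg} ;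
  qh : {scalar qalg} ;
  qalgP : is_SUq2 q qst qa qc ;
  qactP : is_Uq_action q qst qa qc qK qKi qE qF ;
  qhP : is_haar q qst qa qc qh
}.

End Algebra.

Inductive gen : Type := wm | wp | wz | w0.

Definition gen_code (a : gen) : bool * bool :=
  match a with
  | wm => (false, false) | wp => (false, true)
  | wz => (true, false) | w0 => (true, true)
  end.
Definition gen_decode (x : bool * bool) : gen :=
  match x with
  | (false, false) => wm | (false, true) => wp
  | (true, false) => wz | (true, true) => w0
  end.
Lemma gen_codeK : cancel gen_code gen_decode. Proof. by case. Qed.
HB.instance Definition _ := Countable.copy gen (can_type gen_codeK).
Lemma gen_enumP : Finite.axiom [:: wm; wp; wz; w0]. Proof. by case. Qed.
HB.instance Definition _ := isFinite.Build gen gen_enumP.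

(* A tensor over the left invariant 1-forms is the function giving its
   coefficient at each basis word w_{a1} (x) ... (x) w_{ak}; coefficients stand
   on the left and lie in C (invariant tensors) or in A (elements of the free
   left module (Omega^1)^{(x)_A k}). *)
Notation tens V := (seq gen -> V) (only parsing).

Definition homog (V : zmodType) (k : nat) (t : tens V) : Prop :=
  forall w, size w != k -> t w = 0.

Section Braiding.
Variables (R : realType) (q : R).
Local Notation C := R[i].

(* sigma (w_a (x) w_b) as a list of (coefficient, (c, d)) *)
Definition sigma (a b : gen) : seq (R * (gen * gen)) :=
  match a, b with
  | wm, wm => [:: (1, (wm, wm))]
  | wp, wp => [:: (1, (wp, wp))]
  | w0, w0 => [:: (1, (w0, w0))]
  | wz, wz => [:: (1, (wz, wz)); (q ^+ 2 - q ^- 2, (wz, w0));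
                  (q ^+ 2 - q ^- 2, (wm, wp)); (- (q ^+ 2 - q ^- 2), (wp, wm))]
  | wm, wp => [:: (1, (wp, wm)); (-1, (wz, w0))]
  | wp, wm => [:: (1, (wm, wp)); (1, (wz, w0))]
  | wm, wz => [:: (1, (wz, wm)); (1 + q ^+ 2, (wm, w0))]
  | wz, wm => [:: (1 - q ^- 2, (wz, wm)); (q ^- 2, (wm, wz));
                  (- (1 + q ^- 2), (wm, w0))]
  | wm, w0 => [:: (1, (w0, wm)); (1 - q ^+ 2, (wm, w0))]
  | w0, wm => [:: (q ^+ 2, (wm, w0))]
  | wz, wp => [:: (q ^+ 2, (wp, wz)); (1 - q ^+ 2, (wz, wp));
                  (1 + q ^+ 2, (wp, w0))]
  | wp, wz => [:: (1, (wz, wp)); (- (1 + q ^- 2), (wp, w0))]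
  | wz, w0 => [:: (1, (w0, wz)); ((q - q^-1) ^+ 2, (wp, wm));
                  (- (q - q^-1) ^+ 2, (wm, wp)); (- (q - q^-1) ^+ 2, (wz, w0))]
  | w0, wz => [:: (1, (wz, w0))]
  | wp, w0 => [:: (1, (w0, wp)); (1 - q ^- 2, (wp, w0))]
  | w0, wp => [:: (q ^- 2, (wp, w0))]
  end.

Definition sigma_coef (a b c d : gen) : R :=
  \sum_(x <- sigma a b | x.2 == (c, d)) x.1.

Section Generic.
Variable V : lmodType C.

(* sigma_{i+1,i+2}, positions of letters being counted from 0 *)
Definition sigma_at (i : nat) (t : tens V) : tens V := fun w =>
  if drop i w is c :: d :: w' then
    \sum_(a : gen) \sum_(b : gen)
       (sigma_coef a b c d)%:C *: t (take i w ++ a :: b :: w')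
  else 0.

End Generic.
End Braiding.

(* A permutation of {0, .., n-1} is given by the list p of its values; the word
   is read off the Lehmer code, so its length is the number of inversions. *)
Definition redword (p : seq nat) : seq nat :=
  flatten [seq rev (iota i (count (fun x => x < nth 0 p i)%N (drop i.+1 p)))
          | i <- iota 0 (size p)].

Definition swap_adj (p : seq nat) (i : nat) : seq nat :=
  if drop i p is x :: y :: p' then take i p ++ y :: x :: p' else p.

Lemma redword_sound n : (n <= 4)%N ->
  all (fun p => foldl swap_adj (iota 0 n) (redword p) == p)
      (permutations (iota 0 n)).
Proof. by case: n => [|[|[|[|[|n]]]]]. Qed.

Section Antisymmetriser.
Variables (R : realType) (q : R) (V : lmodType R[i]).

Definition anti (t : tens V) : tens V := fun w =>
  \sum_(p <- permutations (iota 0 (size w)))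
     (-1) ^+ size (redword p) *: foldr (sigma_at q (V := V)) t (redword p) w.

(* Omega^k is the range of the antisymmetriser in degree k; [preanti] picks a
   tensor representing a given form. *)
Definition preanti (k : nat) (x : tens V) : tens V :=
  xget 0 [set t | homog k t /\ anti t = x].

End Antisymmetriser.

(* w_a^* = - w_(bar a) for a = -, +, z, 0 *)
Definition bar (a : gen) : gen :=
  match a with wm => wp | wp => wm | wz => wz | w0 => w0 end.

Definition barw (w : seq gen) : seq gen := rev [seq bar a | a <- w].

Section Invariant.
Variables (R : realType) (q : R).
Local Notation C := R[i].

Definition invform := tens (C^o).

(* w_{a1} /\ ... /\ w_{ak} *)
Definition om (w : seq gen) : invform := anti q (fun u => (u == w)%:R : C^o).

(* The bimodule structure is trivial on invariant forms multiplied by scalars,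
   so on their tensor representatives the product is the tensor product. *)
Definition wedgeI (k l : nat) (x y : invform) : invform :=
  anti q (fun u => preanti q k x (take k u) * preanti q l y (drop k u) : C^o).

(* On representatives: reverse the word and bar its letters, with the sign
   (-1)^{k(k-1)/2} of the graded rule and (-1)^k from w_a^* = - w_(bar a). *)
Definition starI (k : nat) (x : invform) : invform :=
  anti q (fun u => (-1) ^+ 'C(k.+1, 2) * conjc (preanti q k x (barw u)) : C^o).

(* Bases of Omega^k_inv made of eigenvectors of the antisymmetriser. *)
Definition ebas (k : nat) : seq invform :=
  match k with
  | 0 => [:: om [::]]
  | 1 => [:: om [:: wm]; om [:: wp]; om [:: wz]; om [:: w0]]
  | 2 => [:: om [:: wm; w0];
             om [:: wp; w0] - (1 - q ^+ 2)%:C *: om [:: wp; wz];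
             om [:: w0; wz] + (1 - q ^+ 2)%:C *: om [:: wm; wp];
             om [:: wm; w0] + (1 - q ^- 2)%:C *: om [:: wm; wz];
             om [:: wp; w0];
             om [:: w0; wz] + (1 - q ^- 2)%:C *: om [:: wm; wp]]
  | 3 => [:: om [:: wm; wp; w0]; om [:: wm; wp; wz];
             om [:: wm; w0; wz]; om [:: wp; w0; wz]]
  | 4 => [:: om [:: wm; wp; w0; wz]]
  | _ => [::]
  end.

(* The eigenvalue of the antisymmetriser at an eigenvector x; no closed formula
   is assumed. *)
Definition eigval (x : invform) : C :=
  xget 0 [set l : C | anti q x = l *: x].

(* Coefficients, in V = C or V = A, of sum_i X_i xi_i on the basis [ebas k]. *)
Definition lcomb (V : lmodType C) (k : nat)
    (X : {ffun 'I_(size (ebas k)) -> V}) : tens V :=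
  fun w => \sum_(i < size (ebas k)) ((ebas k)`_i w : C) *: X i.

Definition lcoef (V : lmodType C) (k : nat) (x : tens V) :
    {ffun 'I_(size (ebas k)) -> V} :=
  xget [ffun=> 0] [set X | lcomb X = x].

Section Contraction.
(* G a b = Gamma(w_a, w_b), extended antilinearly / linearly *)
Variables (G : gen -> gen -> C) (m : R).

Definition contract (k : nat) (x z : invform) : invform := fun w =>
  \sum_(a : k.-tuple gen) \sum_(b : k.-tuple gen)
     conjc (x a) * (\prod_(j < k) G (tnth a j) (tnth b j)) * z (b ++ w).

Definition volume : invform := ('i * m%:C) *: om [:: wm; wp; w0; wz].

Definition hodge (k : nat) (x : invform) : invform :=
  \sum_(i < size (ebas k)) (lcoef k x i : C) *:
     ((eigval (ebas k)`_i)^-1 *: starI (4 - k)%N (contract k (ebas k)`_i volume)).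

Definition brace (k : nat) (x y : invform) : C :=
  xget 0 [set z : C |
    z *: volume = wedgeI k (4 - k)%N (starI k x) (hodge k y)].

Definition hermitian_contraction : Prop :=
  forall a b : gen, brace 1 (om [:: a]) (om [:: b]) = G a b.

Definition real_contraction : Prop :=
  forall (k : nat) (i : 'I_(size (ebas k))),
    let xi := (ebas k)`_i in
    eigval (starI k xi) *: hodge k (starI k xi) =
    starI (4 - k)%N (eigval xi *: hodge k xi).

Definition nondegenerate_contraction : Prop :=
  (\matrix_(i < #|{: gen}|, j < #|{: gen}|) G (enum_val i) (enum_val j)) \in unitmx.

End Contraction.
End Invariant.

Section Forms.
Variables (R : realType) (q : R) (S : quantum_SU2 q).
Local Notation C := R[i].
Local Notation form := (tens S).

(* w_a x = sum_b (fcoef a b x) w_b *)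
Definition fcoef (a b : gen) (x : S) : S :=
  match a, b with
  | wm, wm => x
  | wm, w0 => (sqrtq q)^-1 *: qK S (qE S x)
  | wp, wp => x
  | wp, w0 => (sqrtq q)^-1 *: qF S (qK S x)
  | w0, w0 => qK S (qK S x)
  | wz, wm => ((q - q^-1)%:C * sqrtq q) *: qF S (qKi S x)
  | wz, wz => qKi S (qKi S x)
  | wz, wp => ((q - q^-1)%:C / sqrtq q) *: qE S (qKi S x)
  | wz, w0 => (q - q^-1)%:C *:
       (qF S (qE S x) +
        (q^-1 / (q - q^-1) ^+ 2)%:C *: (qKi S (qKi S x) - qK S (qK S x)))
  | _, _ => 0
  end.

Fixpoint fword (u v : seq gen) (x : S) : S :=
  match u, v with
  | [::], [::] => x
  | a :: u', b :: v' => fcoef a b (fword u' v' x)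
  | _, _ => 0
  end.

Definition lmul (x : S) (t : form) : form := fun w => x * t w.

Definition rmul (t : form) (x : S) : form := fun v =>
  \sum_(u : (size v).-tuple gen) t u * fword u v x.

(* (s (x) t) for s of degree k, with the coefficients of t moved through the
   words of s by the right module structure *)
Definition wedge (k l : nat) (x y : form) : form :=
  anti q (fun u =>
    rmul (preanti q k x) (preanti q l y (drop k u)) (take k u)).

(* (x w_{a1} (x) .. (x) w_{ak})^* = +- w_{ak}^* (x) .. (x) w_{a1}^* x^*,
   on representatives *)
Definition fstar (k : nat) (x : form) : form :=
  anti q (fun v => (-1) ^+ 'C(k.+1, 2) *:
    \sum_(u : k.-tuple gen) fword (barw u) v (qst (preanti q k x u))).

Definition of_inv (x : invform R) : form := fun w => (x w : C)%:A.

Definition omA (w : seq gen) : form := of_inv (om q w).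

(* x in L_n iff K acts on x by q^(n/2) *)
Definition Lsp (n : int) : set S := [set x | qK S x = sqrtq q ^ n *: x].

Definition OmegaS (k : nat) : set form :=
  match k with
  | 0 => [set t | exists2 f, Lsp 0 f & t = lmul f (omA [::])]
  | 1 => [set t | exists phi phi' f,
            [/\ Lsp (-2) phi, Lsp 2 phi', Lsp 0 f
              & t = lmul phi (omA [:: wm]) + lmul phi' (omA [:: wp])
                    + lmul f (omA [:: w0])]]
  | 2 => [set t | exists phi f phi',
            [/\ Lsp (-2) phi, Lsp 0 f, Lsp 2 phi'
              & t = lmul phi (omA [:: wm; w0]) + lmul f (omA [:: wm; wp])
                    + lmul phi' (omA [:: w0; wp])]]
  | 3 => [set t | exists2 f, Lsp 0 f & t = lmul f (omA [:: wm; wp; w0])]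
  | _ => [set 0]
  end.

Definition rcomb (k : nat) (X : {ffun 'I_(size (ebas q k)) -> S}) : form :=
  \sum_(i < size (ebas q k)) rmul (of_inv (ebas q k)`_i) (X i).

Definition rcoef (k : nat) (x : form) : {ffun 'I_(size (ebas q k)) -> S} :=
  xget [ffun=> 0] [set X | rcomb X = x].

Section InnerProducts.
Variables (G : gen -> gen -> C) (m mc : R).

(* <sum_i X_i xi_i, sum_j Y_j xi_j> = sum_(i,j) h(X_i^* Y_j) {xi_i, xi_j} *)
Definition ipL (k : nat) (x y : form) : C :=
  \sum_(i < size (ebas q k)) \sum_(j < size (ebas q k)) qh S (qst (lcoef q k x i) * lcoef q k y j)
                * brace q G m k (ebas q k)`_i (ebas q k)`_j.

(* the same with the coefficients on the right *)
Definition ipR (k : nat) (x y : form) : C :=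
  \sum_(i < size (ebas q k)) \sum_(j < size (ebas q k)) qh S (qst (rcoef k x i) * rcoef k y j)
                * brace q G m k (ebas q k)`_i (ebas q k)`_j.

Definition volumeS : invform R := mc%:C *: om q [:: wm; wp; w0].

(* integral of a form of degree k on the sphere *)
Definition integralS (k : nat) (x : form) : C :=
  if (k == 3)%N then
    qh S (xget 0 [set f | Lsp 0 f /\ lmul f (of_inv volumeS) = x])
  else 0.

Definition left_hodge (k : nat) (L : form -> form) : Prop :=
  [/\ set_bij (OmegaS k) (OmegaS (3 - k)%N) L,
      forall f x y, Lsp 0 f -> OmegaS k x -> OmegaS k y ->
        L (lmul f x + y) = lmul f (L x) + L y
    & forall x y, OmegaS k x -> OmegaS k y ->
        integralS (k + (3 - k))%N (wedge k (3 - k)%N (fstar k x) (L y))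
        = ipL k x y].

Definition right_hodge (k : nat) (L : form -> form) : Prop :=
  [/\ set_bij (OmegaS k) (OmegaS (3 - k)%N) L,
      forall f x y, Lsp 0 f -> OmegaS k x -> OmegaS k y ->
        L (rmul x f + y) = rmul (L x) f + L y
    & forall x y, OmegaS k x -> OmegaS k y ->
        integralS (k + (3 - k))%N (wedge k (3 - k)%N (fstar k x) (L y))
        = ipR k x y].

End InnerProducts.
End Forms.

(* Main.v *)
Require Import Defs.
From HB Require Import structures.
From Stdlib Require Import ZArith.
From mathcomp Require Import all_boot all_order all_algebra.
From mathcomp Require Import boolp classical_sets functions reals.
From mathcomp Require Import complex ssrZ.
From mathcomp Require Import ring lra zify.
Set Implicit Arguments.
Unset Strict Implicit.
Unset Printing Implicit Defensive.
Import Order.TTheory GRing.Theory Num.Theory.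
Local Open Scope classical_set_scope.
Local Open Scope complex_scope.
Local Open Scope ring_scope.

(** The theorem says that on each component of the forms on the sphere the
    inner product and the wedge pairing into the volume form are, up to a
    nonzero number, the same sesquilinear form built from the Haar state.  The
    Hodge operators are the quotients of these numbers.

    Invariant forms.  Write s for the square root of q.  All constants of the
    braiding are Laurent polynomials in s, so every identity between words of
    invariant 1-forms is an identity between finite formal sums with
    coefficients in Z[s, s^-1], decided by computation.  The antisymmetriser
    factorises as A_(n+1) = T_n (1 (x) A_n), which makes it computable on formal
    sums ([vanti_sound]).  Antisymmetrised words straighten to the words in the
    order -, +, 0, z without repetition ([om_nf]); the latter are independent,
    because each has a word at which it alone has a nonzero coefficient
    ([comb_inj]).  So Omega^k has ranks 1, 4, 6, 4, 1, and the product and the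
    adjoint, computed on any representing tensors, are well defined
    ([wedgeI_anti], [starI_anti]).

    The contraction.  Hermiticity and reality in degree 1 force G to vanish
    except for alpha, gamma, nu, epsilon, and reality in degree 2 forces
    2 nu + (q^2 - q^-2) epsilon = 0 together with a quadratic relation
    ([contraction_facts]).  With alpha <> 0 these relations make nu and the
    squared norms of the invariant components of the forms on the sphere
    nonzero.

    Forms with coefficients.  The braiding commutes with right multiplication
    ([right_linear_all]).  It suffices to see this on the generators, which form
    two doublets of the quantum group on which K, E, F act by the same
    matrices.  Hence the product and the adjoint of Omega^k, too, are computed on
    representing tensors ([wedge_anti], [fstar_anti]).

    The Haar state.  It is invariant under the action ([haar_K], [haar_E],
    [haar_F]) and commutes with t = c c^*.  The decomposition of the algebra
    over the monomials a^i c^d, with polynomials in t as coefficients, reduces faithfulness to a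
    statement on moments, which is a uniqueness of partial fractions
    ([moments]); so h(y^* x) is nondegenerate on each space L_n
    ([haar_nondeg]).

    The Hodge operators.  The component L_n w_u pairs with exactly one component
    in the complementary degree, and weights kill all other products.  The
    pairing is rho_u h(x^* y) ([left_pairing], [right_pairing]) and the inner
    product is beta_u h(x^* y) ([ip_coefs]), with beta_u = {w_u, w_u}.  In the right-handed
    version rho_u carries a power of q, from moving the coefficients across the
    volume form.  Multiplication by beta_u / rho_u on the coefficients is
    therefore a Hodge operator ([hodge_map_op]), and the only one
    ([hodge_op_unique]). *)

(** * Formal sums of words *)

(** Exponent of s, then the exponents of the parameters alpha, gamma, nu,
    epsilon; trailing zeros are dropped. *)
Definition mon := (Z * seq nat)%type.
(** Coefficients are integers and s may have negative exponents, so that identities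
    between structure constants are decided by evaluation; s and the parameters
    become real numbers only under [lpeval]. *)
Definition lpoly := seq (mon * Z).

Fixpoint natadd (u v : seq nat) : seq nat :=
  match u, v with
  | [::], _ => v
  | _, [::] => u
  | a :: u', b :: v' => (a + b)%N :: natadd u' v'
  end.
Fixpoint nateqb (u v : seq nat) : bool :=
  match u, v with
  | [::], [::] => true
  | a :: u', b :: v' => Nat.eqb a b && nateqb u' v'
  | _, _ => false
  end.
Definition mon_mul (x y : mon) : mon := (Z.add x.1 y.1, natadd x.2 y.2).
Definition mon_eqb (x y : mon) : bool := Z.eqb x.1 y.1 && nateqb x.2 y.2.

Fixpoint padd1 (x : mon * Z) (P : lpoly) : lpoly :=
  match P with
  | [::] => [:: x]
  | y :: P' => if mon_eqb x.1 y.1 then (y.1, Z.add x.2 y.2) :: P'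
               else y :: padd1 x P'
  end.
Definition padd (P Q : lpoly) : lpoly := foldr padd1 Q P.
Definition pscale (x : mon * Z) (P : lpoly) : lpoly :=
  [seq (mon_mul x.1 y.1, Z.mul x.2 y.2) | y <- P].
Definition pmul (P Q : lpoly) : lpoly :=
  foldr (fun x acc => padd (pscale x Q) acc) [::] P.
Definition pzero (P : lpoly) : bool := all (fun x => Z.eqb x.2 Z0) P.
Definition popp (P : lpoly) : lpoly := [seq (x.1, Z.opp x.2) | x <- P].

Definition geqb (a b : gen) : bool :=
  match a, b with
  | wm, wm | wp, wp | wz, wz | w0, w0 => true
  | _, _ => false
  end.
Fixpoint weqb (u v : seq gen) : bool :=
  match u, v with
  | [::], [::] => true
  | a :: u', b :: v' => geqb a b && weqb u' v'
  | _, _ => false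
  end.

Definition vec := seq (seq gen * lpoly).
Fixpoint vadd1 (x : seq gen * lpoly) (v : vec) : vec :=
  match v with
  | [::] => [:: x]
  | y :: v' => if weqb x.1 y.1 then (y.1, padd x.2 y.2) :: v'
               else y :: vadd1 x v'
  end.
Definition vadd (u v : vec) : vec := foldr vadd1 v u.
Definition vscale (c : lpoly) (v : vec) : vec := [seq (x.1, pmul c x.2) | x <- v].
Definition vbind (f : seq gen -> vec) (v : vec) : vec :=
  foldr (fun x acc => vadd (vscale x.2 (f x.1)) acc) [::] v.
Definition vopp (v : vec) : vec := [seq (x.1, popp x.2) | x <- v].
Definition vzero (v : vec) : bool := all (fun x => pzero x.2) v.
Definition veq (u v : vec) : bool := vzero (vadd u (vopp v)).

Lemma geqbP a b : reflect (a = b) (geqb a b).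
Proof. by case: a; case: b; constructor. Qed.

Lemma weqbP u v : reflect (u = v) (weqb u v).
Proof.
elim: u v => [|a u IH] [|b v] /=; try by constructor.
by apply: (iffP andP) => [[/geqbP -> /IH ->] // | [<- <-]]; split; [apply/geqbP|apply/IH].
Qed.

Lemma nateqbP u v : nateqb u v -> u = v.
Proof.
elim: u v => [|a u IH] [|b v] //= /andP [/PeanoNat.Nat.eqb_eq -> /IH -> //].
Qed.

Lemma mon_eqbP x y : mon_eqb x y -> x = y.
Proof.
by case: x y => [a u] [b v] /andP [/Z.eqb_eq /= -> /nateqbP /= ->].
Qed.

Section Eval.
Variables (R : realType) (s : R) (g : seq R).
Hypothesis s_unit : s != 0.

Definition mev (m : mon) : R :=
  s ^ (int_of_Z m.1) * \prod_(i < size g) g`_i ^+ nth 0%N m.2 i.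
Definition lpeval (P : lpoly) : R := \sum_(x <- P) (int_of_Z x.2)%:~R * mev x.1.

Lemma nth_natadd u v i : nth 0%N (natadd u v) i = (nth 0%N u i + nth 0%N v i)%N.
Proof.
elim: u v i => [|a u IH] [|b v] [|i] //=; rewrite ?addn0 //.
Qed.

Lemma mev_mul x y : mev (mon_mul x y) = mev x * mev y.
Proof.
rewrite /mev /= mulrACA -expfzDr // -big_split /=; congr (_ * _).
  by rewrite -(rmorphD int_of_Z).
by apply: eq_bigr => i _; rewrite nth_natadd exprD.
Qed.

Lemma pev_add1 x P : lpeval (padd1 x P) = (int_of_Z x.2)%:~R * mev x.1 + lpeval P.
Proof.
rewrite /lpeval; elim: P => [|y P IH] /=; first by rewrite big_cons.
case: ifP => [/mon_eqbP e|_]; rewrite !big_cons /=.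
  by rewrite (rmorphD int_of_Z) rmorphD mulrDl /= e addrA.
by rewrite IH addrCA.
Qed.

Lemma pev_add P Q : lpeval (padd P Q) = lpeval P + lpeval Q.
Proof.
rewrite /padd; elim: P => [|x P IH] /=; first by rewrite /lpeval big_nil add0r.
by rewrite pev_add1 IH addrA; congr (_ + _); rewrite /lpeval big_cons.
Qed.

Lemma pev_scale x P : lpeval (pscale x P) = (int_of_Z x.2)%:~R * mev x.1 * lpeval P.
Proof.
rewrite /lpeval /pscale big_map mulr_sumr; apply: eq_bigr => y _ /=.
by rewrite mev_mul (rmorphM int_of_Z) rmorphM /= mulrACA.
Qed.

Lemma pev_mul P Q : lpeval (pmul P Q) = lpeval P * lpeval Q.
Proof.
rewrite /pmul; elim: P => [|x P IH] /=; first by rewrite /lpeval big_nil mul0r.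
by rewrite pev_add pev_scale IH -mulrDl; congr (_ * _); rewrite /lpeval big_cons.
Qed.

Lemma pev_opp P : lpeval (popp P) = - lpeval P.
Proof.
rewrite /lpeval /popp big_map -sumrN; apply: eq_bigr => x _ /=.
by rewrite (rmorphN int_of_Z) rmorphN mulNr.
Qed.

Lemma pev0 P : pzero P -> lpeval P = 0.
Proof.
rewrite /lpeval; elim: P => [|x P IH] /=; first by rewrite big_nil.
by move=> /andP [/Z.eqb_eq e2 /IH e]; rewrite big_cons e e2 mul0r addr0.
Qed.

Variable W : lmodType R[i].

(** The linear extension of a map on words, through which each identity checked
    on formal sums is transported to forms. *)
Definition linext (f : seq gen -> W) (v : vec) : W :=
  \sum_(x <- v) (lpeval x.2)%:C *: f x.1.

Lemma vsum_add1 f x v : linext f (vadd1 x v) = (lpeval x.2)%:C *: f x.1 + linext f v.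
Proof.
rewrite /linext; elim: v => [|y v IH] /=; first by rewrite big_cons.
case: ifP => [/weqbP e|_]; rewrite !big_cons /=.
  by rewrite pev_add rmorphD scalerDl e addrA.
by rewrite IH addrCA.
Qed.

Lemma vsum_add f u v : linext f (vadd u v) = linext f u + linext f v.
Proof.
rewrite /vadd; elim: u => [|x u IH] /=; first by rewrite /linext big_nil add0r.
by rewrite vsum_add1 IH addrA; congr (_ + _); rewrite /linext big_cons.
Qed.

Lemma vsum_scale f c v : linext f (vscale c v) = (lpeval c)%:C *: linext f v.
Proof.
rewrite /linext /vscale big_map scaler_sumr; apply: eq_bigr => x _ /=.
by rewrite pev_mul rmorphM scalerA.
Qed.

Lemma vsum_opp f v : linext f (vopp v) = - linext f v.
Proof.
rewrite /linext /vopp big_map -sumrN; apply: eq_bigr => x _ /=.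
by rewrite pev_opp rmorphN scaleNr.
Qed.

Lemma vsum_bind f h v : linext f (vbind h v) = linext (fun w => linext f (h w)) v.
Proof.
rewrite /vbind; elim: v => [|x v IH] /=; first by rewrite /linext !big_nil.
by rewrite vsum_add vsum_scale IH {4}/linext big_cons.
Qed.

Lemma vsum0 f v : vzero v -> linext f v = 0.
Proof.
rewrite /linext; elim: v => [|x v IH] /=; first by rewrite big_nil.
by move=> /andP [/pev0 e /IH e']; rewrite big_cons e e' scale0r addr0.
Qed.

Lemma vsum_eq f u v : veq u v -> linext f u = linext f v.
Proof.
by move=> /(vsum0 f); rewrite vsum_add vsum_opp => /eqP; rewrite subr_eq0 => /eqP.
Qed.

Lemma eq_vsum f h v : (forall w, f w = h w) -> linext f v = linext h v.
Proof. by move=> e; apply: eq_bigr => x _; rewrite e. Qed.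

End Eval.

Delimit Scope Z_scope with ZZ.
(** * The braiding and the straightening relations on formal sums *)

Definition lm (e z : Z) : lpoly := [:: ((e, [::]), z)].
Definition lq (l : seq (Z * Z)) : lpoly := [seq ((x.1, [::]), x.2) | x <- l].

Definition lsigma (a b : gen) : vec :=
  let one := lm 0 1 in
  match a, b with
  | wm, wm => [:: ([:: wm; wm], one)]
  | wp, wp => [:: ([:: wp; wp], one)]
  | w0, w0 => [:: ([:: w0; w0], one)]
  | wz, wz => [:: ([:: wz; wz], one); ([:: wz; w0], lq [:: (4, 1); (-4, -1)]);
                  ([:: wm; wp], lq [:: (4, 1); (-4, -1)]);
                  ([:: wp; wm], lq [:: (4, -1); (-4, 1)])]
  | wm, wp => [:: ([:: wp; wm], one); ([:: wz; w0], lm 0 (-1))]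
  | wp, wm => [:: ([:: wm; wp], one); ([:: wz; w0], one)]
  | wm, wz => [:: ([:: wz; wm], one); ([:: wm; w0], lq [:: (0, 1); (4, 1)])]
  | wz, wm => [:: ([:: wz; wm], lq [:: (0, 1); (-4, -1)]); ([:: wm; wz], lm (-4) 1);
                  ([:: wm; w0], lq [:: (0, -1); (-4, -1)])]
  | wm, w0 => [:: ([:: w0; wm], one); ([:: wm; w0], lq [:: (0, 1); (4, -1)])]
  | w0, wm => [:: ([:: wm; w0], lm 4 1)]
  | wz, wp => [:: ([:: wp; wz], lm 4 1); ([:: wz; wp], lq [:: (0, 1); (4, -1)]);
                  ([:: wp; w0], lq [:: (0, 1); (4, 1)])]
  | wp, wz => [:: ([:: wz; wp], one); ([:: wp; w0], lq [:: (0, -1); (-4, -1)])]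
  | wz, w0 => [:: ([:: w0; wz], one);
                  ([:: wp; wm], lq [:: (4, 1); (0, -2); (-4, 1)]);
                  ([:: wm; wp], lq [:: (4, -1); (0, 2); (-4, -1)]);
                  ([:: wz; w0], lq [:: (4, -1); (0, 2); (-4, -1)])]
  | w0, wz => [:: ([:: wz; w0], one)]
  | wp, w0 => [:: ([:: w0; wp], one); ([:: wp; w0], lq [:: (0, 1); (-4, -1)])]
  | w0, wp => [:: ([:: wp; w0], lm (-4) 1)]
  end%ZZ.

Definition vsig1 (i : nat) (u : seq gen) : vec :=
  if drop i u is a :: b :: u' then
    [seq (take i u ++ x.1 ++ u', x.2) | x <- lsigma a b]
  else [::].
Definition vsig (i : nat) (v : vec) : vec := vbind (vsig1 i) v.

(** The alternating sum over the minimal representatives of the cosets of S_n in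
    S_(n+1): these move the first letter to an arbitrary place. *)
Fixpoint vT (c n : nat) (v : vec) : vec :=
  if n is n'.+1 then vadd v (vT c.+1 n' (vopp (vsig c v))) else v.

(** The factorisation A_(n+1) = T_n (1 (x) A_n) turns the sum over all permutations
    into a nested application of neighbouring transpositions. *)
Fixpoint vanti (u : seq gen) : vec :=
  if u is a :: u' then
    vT 0 (size u') [seq (a :: x.1, x.2) | x <- vanti u']
  else [:: ([::], lm 0%ZZ 1%ZZ)].

Definition monos (k : nat) : seq (seq gen) :=
  match k with
  | 0 => [:: [::]]
  | 1 => [:: [:: wm]; [:: wp]; [:: w0]; [:: wz]]
  | 2 => [:: [:: wm; wp]; [:: wm; w0]; [:: wm; wz]; [:: wp; w0]; [:: wp; wz];
             [:: w0; wz]]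
  | 3 => [:: [:: wm; wp; w0]; [:: wm; wp; wz]; [:: wm; w0; wz]; [:: wp; w0; wz]]
  | 4 => [:: [:: wm; wp; w0; wz]]
  | _ => [::]
  end.

Definition word1 (u : seq gen) : vec := [:: (u, lm 0%ZZ 1%ZZ)].

(** Left multiplication of a straightened word by a letter.  The rules for moving
    the letter to its place are the relations of the exterior algebra: -, +
    and 0 anticommute and have square zero, while z anticommutes with - and + up to
    powers of q, and with 0 and with itself up to multiples of w_- w_+. *)
Definition lins_m (u : seq gen) : vec :=
  if u is wm :: _ then [::] else word1 (wm :: u).
Fixpoint lins_p (u : seq gen) : vec :=
  match u with
  | wm :: u' => vopp (vbind lins_m (lins_p u'))
  | wp :: _ => [::]
  | _ => word1 (wp :: u)
  end.
Fixpoint lins_0 (u : seq gen) : vec :=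
  match u with
  | wm :: u' => vopp (vbind lins_m (lins_0 u'))
  | wp :: u' => vopp (vbind lins_p (lins_0 u'))
  | w0 :: _ => [::]
  | _ => word1 (w0 :: u)
  end.
Fixpoint lins_z (u : seq gen) : vec :=
  match u with
  | wm :: u' => vscale (lm (-4) (-1)) (vbind lins_m (lins_z u'))
  | wp :: u' => vscale (lm 4 (-1)) (vbind lins_p (lins_z u'))
  | w0 :: u' => vadd (vopp (vbind lins_0 (lins_z u')))
                  (vscale (lq [:: (4, 1); (0, -2); (-4, 1)]) (vbind lins_m (lins_p u')))
  | wz :: u' => vscale (lq [:: (4, -1); (-4, 1)]) (vbind lins_m (lins_p u'))
  | _ => word1 (wz :: u)
  end%ZZ.
Definition lins (a : gen) : seq gen -> vec :=
  match a with wm => lins_m | wp => lins_p | w0 => lins_0 | wz => lins_z end.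

Fixpoint nf (u : seq gen) : vec :=
  if u is a :: u' then vbind (lins a) (nf u') else word1 [::].

Definition gens := [:: wm; wp; wz; w0].

Definition check_lins := all (fun k => all (fun b => all (fun a =>
   veq (vanti (a :: b)) (vbind vanti (lins a b)) &&
   all (fun x => x.1 \in monos k.+1) (lins a b)) gens) (monos k)) (iota 0 4).
Lemma check_linsT : check_lins. Proof. by vm_compute. Qed.

(** Straightening is a product on the span of the ordered words; associativity
    makes the wedge product independent of the chosen representatives. *)
Definition check_assoc := all (fun kl => all (fun b => all (fun v => all (fun a =>
   veq (vbind (fun w => nf (w ++ v)) (lins a b)) (vbind (lins a) (nf (b ++ v))))
    gens) (monos kl.2)) (monos kl.1))
  [:: (0, 0); (1, 0); (2, 0); (3, 0); (0, 1); (0, 2); (0, 3);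
      (1, 1); (1, 2); (2, 1)]%N.
Lemma check_assocT : check_assoc. Proof. by vm_compute. Qed.

(** Reversing and conjugating a word is compatible with straightening. *)
Definition check_star := all (fun k => all (fun b => all (fun a =>
   veq (vbind (fun w => nf (barw w)) (lins a b)) (nf (barw (a :: b)))) gens)
  (monos k)) (iota 0 4).
Lemma check_starT : check_star. Proof. by vm_compute. Qed.

Definition check_nf := all (fun k => all (fun b =>
  veq (nf b) (word1 b)) (monos k)) (iota 0 5).
Lemma check_nfT : check_nf. Proof. by vm_compute. Qed.

(** At the word [pivot c] the antisymmetrised ordered word b has the coefficient +1 or
    -1 if b = c and 0 otherwise, so pivots read off coordinates.  Most pivots
    are reversed words; those containing both w_0 and w_z need another
    choice, since w_- w_+ has a nonzero coefficient at w_z w_0. *)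
Definition pivot (b : seq gen) : seq gen :=
  match b with
  | [:: w0; wz] => [:: w0; wz]
  | [:: wm; w0; wz] => [:: w0; wz; wm]
  | [:: wp; w0; wz] => [:: w0; wz; wp]
  | [:: wm; wp; w0; wz] => [:: w0; wz; wm; wp]
  | _ => rev b
  end.
Definition pivot_sign (b : seq gen) : Z :=
  (match b with
  | [:: _; wz] => if b is [:: w0; _] then 1 else -1
  | [:: _; _] | [:: wm; wp; _] => -1
  | _ => 1
  end)%ZZ.
Definition vget (w : seq gen) (v : vec) : lpoly :=
  foldr (fun x acc => if weqb w x.1 then padd x.2 acc else acc) [::] v.
Definition check_pivot := all (fun k => all (fun b => all (fun c =>
  pzero (padd (vget (pivot c) (vanti b))
              (if b == c then lm 0%ZZ (Z.opp (pivot_sign b)) else [::])))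
  (monos k)) (monos k)) (iota 0 5).
Lemma check_pivotT : check_pivot. Proof. by vm_compute. Qed.

Section Reflect.
Variables (R : realType) (q s : R) (g : seq R).
Hypotheses (s0 : s != 0) (qs : q = s ^+ 2).
Local Notation C := R[i].
Local Notation pev := (lpeval s g).

Lemma pev_nil : pev [::] = 0.
Proof. by rewrite /lpeval big_nil. Qed.

Lemma pev_cons0 e z P :
  pev (((e, [::]), z) :: P) = (int_of_Z z)%:~R * s ^ (int_of_Z e) + pev P.
Proof.
rewrite /lpeval big_cons /mev /= [\prod_(_ < _) _]big1 ?mulr1 // => i _.
by rewrite nth_nil expr0.
Qed.

Lemma pev1 : pev (lm 0%ZZ 1%ZZ) = 1.
Proof. by rewrite /lm pev_cons0 pev_nil addr0 expr0z mulr1. Qed.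

End Reflect.

Ltac pev_norm :=
  rewrite /lm /lq /= ?(pev_cons0, pev_nil) /=;
  repeat match goal with |- context [int_of_Z ?z] =>
    let v := eval vm_compute in (int_of_Z z) in change (int_of_Z z) with v end;
  repeat match goal with |- context [Pos.to_nat ?z] =>
    let v := eval vm_compute in (Pos.to_nat z) in change (Pos.to_nat z) with v end;
  rewrite /intmul /exprz /= ?NegzE.

Section Braid.
Variables (R : realType) (q s : R) (g : seq R).
Hypotheses (s0 : s != 0) (qs : q = s ^+ 2).
Local Notation C := R[i].
Local Notation pev := (lpeval s g).

Lemma lsigmaE a b :
  [seq (x.1, [:: x.2.1; x.2.2]) | x <- sigma q a b] =
  [seq (pev x.2, x.1) | x <- lsigma a b].
Proof.
case: a; case: b; pev_norm; repeat (congr (_ :: _)); congr pair; rewrite ?qs;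
  solve [ring | field; exact: s0].
Qed.

Lemma sigma_coefE a b c d :
  sigma_coef q a b c d = \sum_(x <- lsigma a b | x.1 == [:: c; d]) pev x.2.
Proof.
rewrite /sigma_coef.
have -> : \sum_(x <- lsigma a b | x.1 == [:: c; d]) pev x.2 =
  \sum_(x <- [seq (pev x.2, x.1) | x <- lsigma a b] | x.2 == [:: c; d]) x.1.
  by rewrite big_map.
rewrite -lsigmaE big_map; apply: eq_bigl => [[x [a' b']]] /=.
by rewrite eqseq_cons eqseq_cons eqxx andbT.
Qed.

Definition unitC (u : seq gen) : invform R := fun w => (w == u)%:R : C^o.

Lemma sum_funE (I : Type) (r : seq I) (P : pred I) (T : Type) (V : zmodType)
    (F : I -> T -> V) x :
  (\sum_(i <- r | P i) F i) x = \sum_(i <- r | P i) F i x.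
Proof. by elim/big_rec2: _ => // i y1 y2 _ <-. Qed.

Lemma vsum_fun (T : Type) (V : lmodType C) (f : seq gen -> T -> V) v x :
  linext s g f v x = linext s g (fun w => f w x) v.
Proof. by rewrite /linext sum_funE. Qed.

Lemma lsigma_size a b x : x \in lsigma a b -> size x.1 = 2%N.
Proof.
suff: all (fun x => size x.1 == 2%N) (lsigma a b) by move=> /allP h /h /eqP.
by case: a; case: b.
Qed.

Lemma size_take_drop i (u y : seq gen) a r : drop i u = a :: r -> size (take i u) = i.
Proof.
move=> e; rewrite size_takel // leqNgt; apply/negP => /ltnW h.
by move: e; rewrite drop_oversize.
Qed.

Lemma take_cat_eq i (u w y : seq gen) a r : drop i u = a :: r ->
  (w == take i u ++ y) = (take i w == take i u) && (drop i w == y).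
Proof.
move=> e; rewrite -{1}(cat_take_drop i w).
case: (ltnP (size w) i) => h; last first.
  by rewrite eqseq_cat // (size_take_drop [::] e) size_takel.
rewrite take_oversize 1?ltnW // drop_oversize 1?ltnW // cats0.
have ne : w != take i u.
  by apply/eqP => e'; move: h; rewrite e' (size_take_drop [::] e) ltnn.
rewrite (negPf ne) /=; apply/eqP => e'; move: h.
by rewrite e' size_cat (size_take_drop [::] e) ltnNge leq_addr.
Qed.

Lemma sigma_at_unit i u :
  sigma_at q i (unitC u) = linext s g unitC (vsig1 i u).
Proof.
apply: funext => w; rewrite vsum_fun /sigma_at /vsig1 /linext /unitC.
case du: (drop i u) => [|a [|b u']].
- rewrite big_nil; case dw: (drop i w) => [|c [|d w']] //.
  apply: big1 => a _; apply: big1 => b _; rewrite eq_sym (take_cat_eq _ _ dw).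
  by rewrite du andbF /= mulr0n scaler0.
- rewrite big_nil; case dw: (drop i w) => [|c [|d w']] //.
  apply: big1 => a' _; apply: big1 => b _; rewrite eq_sym (take_cat_eq _ _ dw).
  by rewrite du /= eqseq_cons andbF andbF /= mulr0n scaler0.
rewrite big_map /=.
under [RHS]eq_bigr => x _ do rewrite (take_cat_eq _ _ du).
case dw: (drop i w) => [|c [|d w']].
- rewrite big_seq big1 // => x /lsigma_size; case: (x.1) => [|c [|d []]] //= _.
  by rewrite andbF mulr0n scaler0.
- rewrite big_seq big1 // => x /lsigma_size; case: (x.1) => [|c' [|d []]] //= _.
  by rewrite eqseq_cons /= !andbF mulr0n scaler0.
rewrite (bigD1 a) //= [X in _ + X]big1 ?addr0; last first.
  move=> a' na; apply: big1 => b' _; rewrite eq_sym (take_cat_eq _ _ dw) du.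
  by rewrite eqseq_cons [a == _]eq_sym (negPf na) andbF /= mulr0n scaler0.
rewrite (bigD1 b) //= [X in _ + X]big1 ?addr0; last first.
  move=> b' nb; rewrite eq_sym (take_cat_eq _ _ dw) du.
  by rewrite !eqseq_cons [b == _]eq_sym (negPf nb) !andbF /= mulr0n scaler0.
rewrite eq_sym (take_cat_eq _ _ dw) du !eqseq_cons !eqxx /= sigma_coefE.
rewrite big_mkcond /= rmorph_sum /= scaler_suml big_seq [RHS]big_seq.
apply: eq_bigr => x /lsigma_size.
case: (x.1) => [|c' [|d' []]] //= _; rewrite eq_sym [take i u == _]eq_sym.
rewrite !eqseq_cons andbT [u' == _]eq_sym eq_sym.
rewrite -andbA; case: (take i w == _); rewrite /= ?mulr0n ?scaler0 //.
case: (w' == u'); rewrite ?andbF ?andbT /= ?mulr0n ?scaler0 //.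
rewrite andbA -[X in X && _]/(c' == c).
by case: ifP => _; rewrite /= ?scale0r ?mulr0n ?scaler0.
Qed.
End Braid.

(** * The antisymmetriser as a matrix *)

Section Linear.
Variables (R : realType) (q : R) (V : lmodType R[i]).
Local Notation C := R[i].
Local Notation sig := (sigma_at q (V := V)).

Lemma sigma_at_loc i (t t' : seq gen -> V) w :
  (forall u, size u = size w -> t u = t' u) -> sig i t w = sig i t' w.
Proof.
move=> h; rewrite /sigma_at; case dw: (drop i w) => [|c [|d w']] //.
apply: eq_bigr => a _; apply: eq_bigr => b _; rewrite h //.
by rewrite -[in RHS](cat_take_drop i w) !size_cat dw.
Qed.

Lemma foldr_sigma_loc rw (t t' : seq gen -> V) w :
  (forall u, size u = size w -> t u = t' u) ->
  foldr sig t rw w = foldr sig t' rw w.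
Proof.
elim: rw w => [|i rw IH] w h /=; first exact: h.
by apply: sigma_at_loc => u su; apply: IH => v; rewrite su; apply: h.
Qed.

Lemma sigma_at_sum (I : Type) (r : seq I) (c : I -> C) (t : I -> seq gen -> V) i w :
  sig i (fun u => \sum_(k <- r) c k *: t k u) w = \sum_(k <- r) c k *: sig i (t k) w.
Proof.
rewrite /sigma_at; case dw: (drop i w) => [|a [|b w']].
- by rewrite big1 // => k _; rewrite scaler0.
- by rewrite big1 // => k _; rewrite scaler0.
under [RHS]eq_bigr do rewrite scaler_sumr.
rewrite [RHS]exchange_big; apply: eq_bigr => a' _ /=.
under [RHS]eq_bigr do rewrite scaler_sumr.
rewrite [RHS]exchange_big; apply: eq_bigr => b' _ /=.
rewrite scaler_sumr; apply: eq_bigr => k _.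
by rewrite !scalerA mulrC.
Qed.

Lemma foldr_sigma_sum (I : Type) (r : seq I) (c : I -> C) (t : I -> seq gen -> V) rw w :
  foldr sig (fun u => \sum_(k <- r) c k *: t k u) rw w
  = \sum_(k <- r) c k *: foldr sig (t k) rw w.
Proof.
elim: rw w => [|i rw IH] w //=; rewrite -sigma_at_sum.
by apply: sigma_at_loc => u _.
Qed.

Lemma foldr_sigma_expand rw (t : seq gen -> V) w :
  foldr sig t rw w =
  \sum_(u : (size w).-tuple gen)
    (foldr (sigma_at q (V := C^o)) (unitC R u) rw w : C) *: t u.
Proof.
elim: rw w => [|i rw IH] w /=.
  rewrite (bigD1 (in_tuple w)) //= /unitC eqxx scale1r big1 ?addr0 // => u nu.
  by rewrite -val_eqE /= eq_sym in nu; rewrite (negPf nu) scale0r.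
rewrite (@sigma_at_loc _ _ (fun v => \sum_(u : (size w).-tuple gen)
    (foldr (sigma_at q (V := C^o)) (unitC R u) rw v : C) *: t u)); last first.
  by move=> v sv; rewrite IH sv.
rewrite /sigma_at; case dw: (drop i w) => [|a [|b w']].
- by rewrite big1 // => k _; rewrite scale0r.
- by rewrite big1 // => k _; rewrite scale0r.
under [RHS]eq_bigr do rewrite scaler_suml.
rewrite [RHS]exchange_big; apply: eq_bigr => a' _ /=.
under [RHS]eq_bigr do rewrite scaler_suml.
rewrite [RHS]exchange_big; apply: eq_bigr => b' _ /=.
by rewrite scaler_sumr; apply: eq_bigr => k _; rewrite scalerA.
Qed.

Lemma foldr_sigma0 rw w : foldr sig (fun=> 0) rw w = 0.
Proof. by rewrite foldr_sigma_expand big1 // => u _; rewrite scaler0. Qed.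

Lemma anti_expand (t : seq gen -> V) w :
  anti q t w = \sum_(u : (size w).-tuple gen) (om q u w : C) *: t u.
Proof.
rewrite /om /anti.
under eq_bigr => p _ do rewrite foldr_sigma_expand scaler_sumr.
rewrite exchange_big; apply: eq_bigr => u _ /=.
by rewrite scaler_suml; apply: eq_bigr => p _; rewrite scalerA.
Qed.

End Linear.

Lemma om_homog (R : realType) (q : R) u w : size w != size u -> om q u w = 0.
Proof.
move=> ne; rewrite /om anti_expand big1 // => v _.
have -> : (tval v == u) = false.
  by apply/eqP => e; move: ne; rewrite -e size_tuple eqxx.
by rewrite mulr0n scaler0.
Qed.

Definition redwords n := [seq redword p | p <- permutations (iota 0 n)].

(** The Lehmer code makes the reduced words of S_(n+1) products of a word
    moving the first letter and of a shifted reduced word of S_n. *)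
Lemma redwords_rec n : (n <= 3)%N ->
  perm_eq (redwords n.+1)
    [seq rev (iota 0 j) ++ map S r | j <- iota 0 n.+1, r <- redwords n].
Proof. by case: n => [|[|[|[|n]]]]. Qed.

Section Recursion.
Variables (R : realType) (q s : R) (g : seq R).
Hypotheses (s0 : s != 0) (qs : q = s ^+ 2).
Local Notation C := R[i].
Local Notation sig := (sigma_at q (V := C^o)).
Local Notation vsum := (linext s g).
Local Notation unit_tens := (unitC R).

Definition shift (a : gen) (t : invform R) : invform R := fun w =>
  if w is b :: w' then (b == a)%:R * t w' else 0.

Definition insert (n : nat) (t : invform R) : invform R := fun w =>
  \sum_(j < n.+1) (-1) ^+ j *: (foldr sig t (rev (iota 0 j)) w : C^o).

Lemma foldr_sigma_shift r a t t' :
  (forall w, t w = shift a t' w) ->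
  forall w, foldr sig t (map S r) w = shift a (foldr sig t' r) w.
Proof.
move=> h; elim: r => [|i r IH] w //=; rewrite /sigma_at /shift.
case: w => [|b w] //=; case dw: (drop i w) => [|c [|d w']]; rewrite ?mulr0 //.
rewrite mulr_sumr; apply: eq_bigr => c' _.
rewrite mulr_sumr; apply: eq_bigr => d' _.
by rewrite IH /= scalerAr.
Qed.

Lemma unit_tens_shift a u w : unit_tens (a :: u) w = shift a (unit_tens u) w.
Proof.
rewrite /unitC /shift; case: w => [|b w] //.
by rewrite eqseq_cons; case: (b == a); rewrite ?mul1r ?mul0r.
Qed.

Lemma om_cons a u : (size u <= 3)%N -> om q (a :: u) = insert (size u) (shift a (om q u)).
Proof.
move=> su; apply: funext => w; rewrite /insert.
have [sw|nsw] := eqVneq (size w) (size u).+1; last first.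
  rewrite om_homog // big1 // => j _.
  rewrite (@foldr_sigma_loc _ _ _ _ _ (fun=> 0)) => [|v sv].
    by rewrite foldr_sigma0 scaler0.
  rewrite /shift; case: v sv => [|b v] //= sv.
  by rewrite om_homog ?mulr0 // -eqSS sv.
rewrite {1}/om /anti sw -(big_map redword xpredT
   (fun r => (-1) ^+ size r *: (foldr sig (unit_tens (a :: u)) r w : C^o))).
rewrite (perm_big _ (redwords_rec su)) big_allpairs_dep /= -/(iota 0 _.+1).
rewrite -[iota 0 _.+1]/(index_iota 0 (size u).+1) big_mkord.
apply: eq_bigr => j _.
rewrite (@foldr_sigma_loc _ _ _ _ _ (fun v => \sum_(r <- redwords (size u))
     ((-1) ^+ size r : C) *: shift a (foldr sig (unit_tens u) r) v)) => [|v sv].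
  rewrite foldr_sigma_sum scaler_sumr; apply: eq_bigr => r _.
  rewrite scalerA -exprD size_cat size_rev size_iota size_map foldr_cat.
  congr (_ *: _); apply: foldr_sigma_loc => v _.
  by apply: foldr_sigma_shift; apply: unit_tens_shift.
rewrite /shift; case: v sv => [|b v]; first by rewrite sw.
move=> sv; rewrite {1}/om /anti.
have -> : size v = size u by move: sv; rewrite sw => -[].
rewrite /redwords big_map mulr_sumr; apply: eq_bigr => p _.
by rewrite scalerAr.
Qed.

Lemma sigma_at_vsum i f v : sig i (vsum f v) = vsum (fun w => sig i (f w)) v.
Proof.
apply: funext => w; rewrite vsum_fun /linext.
rewrite -sigma_at_sum; apply: sigma_at_loc => u _.
by rewrite sum_funE.
Qed.

Lemma vsig_sound i v : vsum unit_tens (vsig i v) = sig i (vsum unit_tens v).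
Proof.
rewrite /vsig vsum_bind // sigma_at_vsum; apply: eq_vsum => w.
by rewrite (sigma_at_unit g s0 qs).
Qed.

Lemma vT_sound c n v w : vsum unit_tens (vT c n v) w =
  \sum_(j < n.+1) (-1) ^+ j *: (foldr sig (vsum unit_tens v) (rev (iota c j)) w : C^o).
Proof.
elim: n c v => [|n IH] c v /=.
  by rewrite big_ord1 /= expr0 scale1r.
rewrite vsum_add // big_ord_recl /= expr0 scale1r; congr (_ + _).
rewrite -[LHS]/(vsum unit_tens (vT c.+1 n (vopp (vsig c v))) w) IH.
apply: eq_bigr => j _; rewrite /bump leq0n add1n /= rev_cons -cats1 foldr_cat /=.
rewrite vsum_opp vsig_sound exprS mulN1r scaleNr -scalerN; congr (_ *: _).
pose X := sig c (vsum unit_tens v).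
have -> : - sig c (vsum unit_tens v) = fun u => \sum_(k <- [:: tt]) (-1) *: (X u : C^o).
  by apply: funext => u; rewrite big_seq1 scaleN1r.
by rewrite (foldr_sigma_sum q [:: tt] (fun=> -1) (fun=> X)) big_seq1 scaleN1r.
Qed.

Lemma vcons_sound a v :
  vsum unit_tens [seq (a :: x.1, x.2) | x <- v] = shift a (vsum unit_tens v).
Proof.
apply: funext => w; rewrite vsum_fun /linext big_map /=.
under eq_bigr => x _ do rewrite /= unit_tens_shift.
rewrite /shift; case: w => [|b w]; first by rewrite big1 // => x _; rewrite scaler0.
by rewrite sum_funE mulr_sumr; apply: eq_bigr => x _; rewrite scalerAr.
Qed.

Lemma vanti_sound u : (size u <= 4)%N -> om q u = vsum unit_tens (vanti u).
Proof.
elim: u => [|a u IH] su.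
  apply: funext => w; rewrite vsum_fun /linext big_seq1 /= pev1 scale1r; case: w => [|b w]; last by rewrite om_homog.
  by rewrite /om /anti /= big_seq1 /= expr0 scale1r.
rewrite om_cons // IH 1?ltnW //; apply: funext => w /=.
by rewrite vT_sound vcons_sound.
Qed.

Lemma insert_shift_vsum a n (f : seq gen -> invform R) v :
  insert n (shift a (vsum f v)) = vsum (fun w => insert n (shift a (f w))) v.
Proof.
apply: funext => w; rewrite vsum_fun /insert /linext.
under [RHS]eq_bigr do rewrite scaler_sumr.
rewrite exchange_big; apply: eq_bigr => j _ /=.
under [RHS]eq_bigr do rewrite scalerA mulrC -scalerA.
rewrite -scaler_sumr; congr (_ *: _).
rewrite -(foldr_sigma_sum q v (fun x => (lpeval s g x.2)%:C) (fun x => shift a (f x.1))).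
apply: foldr_sigma_loc => u _; rewrite /shift.
case: u => [|b u]; first by rewrite big1 // => x _; rewrite scaler0.
by rewrite sum_funE mulr_sumr; apply: eq_bigr => x _; rewrite scalerAr.
Qed.

End Recursion.

(** * Coordinates of forms on the ordered monomials *)

Section Keys.
Variable P : pred (seq gen).
Local Notation keys := (all (fun x : seq gen * lpoly => P x.1)).

Lemma keys_add1 x v : P x.1 -> keys v -> keys (vadd1 x v).
Proof.
move=> px; elim: v => [|y v IH] /=; first by rewrite px.
by move=> /andP [py kv]; case: ifP => _ /=; rewrite py ?kv ?IH.
Qed.

Lemma keys_bind f v : (forall x, x \in v -> keys (f x.1)) -> keys (vbind f v).
Proof.
rewrite /vbind; elim: v => [|x v IH] h //=.
have kv : keys (vbind f v).
  by apply: IH => y yv; apply: h; rewrite inE yv orbT.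
have : keys (vscale x.2 (f x.1)).
  by rewrite /vscale all_map; apply: h; rewrite mem_head.
rewrite -/(vbind f v); elim: (vscale _ _) => [|y w IHw] //= /andP [py kw].
by apply: keys_add1 => //; apply: IHw.
Qed.
End Keys.

Lemma monos_size k b : b \in monos k -> size b = k.
Proof.
suff: all (fun b => size b == k) (monos k) by move=> /allP h /h /eqP.
by case: k => [|[|[|[|[|k]]]]].
Qed.

Lemma monos_uniq k : uniq (monos k).
Proof. by case: k => [|[|[|[|[|k]]]]]. Qed.

Lemma mem_gens a : a \in gens.
Proof. by case: a. Qed.

Section Coordinates.
Variables (R : realType) (q s : R) (g : seq R).
Hypotheses (s0 : s != 0) (qs : q = s ^+ 2).
Local Notation C := R[i].
Local Notation vsum := (linext s g).

Lemma eq_vsum_in (W : lmodType C) (P : pred (seq gen)) (f h : seq gen -> W) v :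
  all (fun x => P x.1) v -> (forall w, P w -> f w = h w) -> vsum f v = vsum h v.
Proof.
move=> /allP pv e; rewrite /linext big_seq [RHS]big_seq; apply: eq_bigr => x xv.
by rewrite e //; apply: pv.
Qed.

Lemma vsum_word1 (W : lmodType C) (f : seq gen -> W) u : vsum f (word1 u) = f u.
Proof. by rewrite /linext big_seq1 pev1 scale1r. Qed.

Lemma lins_check a k b : (k <= 3)%N -> b \in monos k ->
  veq (vanti (a :: b)) (vbind vanti (lins a b)) /\
  all (fun x => x.1 \in monos k.+1) (lins a b).
Proof.
move=> k3 bk; have /allP/(_ k) := check_linsT.
rewrite mem_iota => /(_ k3) /allP/(_ _ bk) /allP/(_ _ (mem_gens a)) /andP [] //.
Qed.

Lemma om_lins a k b : (k <= 3)%N -> b \in monos k ->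
  om q (a :: b) = vsum (om q) (lins a b).
Proof.
move=> k3 bk; have [e kl] := lins_check a k3 bk.
have sb : (size (a :: b) <= 4)%N by rewrite /= (monos_size bk).
rewrite (vanti_sound g s0 qs sb).
rewrite (vsum_eq _ _ _ e) vsum_bind //.
apply: (eq_vsum_in kl) => w /monos_size sw.
by rewrite (vanti_sound g s0 qs) ?sw.
Qed.

Lemma nf_keys u : (size u <= 4)%N -> all (fun x => x.1 \in monos (size u)) (nf u).
Proof.
elim: u => [|a u IH] //= su; apply: keys_bind => x xu.
have /allP/(_ _ xu) xm := IH (ltnW su).
by have [] := lins_check a (su : (size u <= 3)%N) xm.
Qed.

Lemma om_nf u : (size u <= 4)%N -> om q u = vsum (om q) (nf u).
Proof.
elim: u => [|a u IH] su; first by rewrite vsum_word1.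
rewrite om_cons // IH 1?ltnW // insert_shift_vsum /= vsum_bind //.
apply: (eq_vsum_in (nf_keys (ltnW su))) => b bm.
rewrite -(om_lins a su bm) om_cons ?(monos_size bm) //.
Qed.

Variable W : lmodType C.
Implicit Type f : seq gen -> W.

Lemma nf_mono f k b : (k <= 4)%N -> b \in monos k -> vsum f (nf b) = f b.
Proof.
move=> k4 bk; have /allP/(_ k) := check_nfT.
rewrite mem_iota => /(_ k4) /allP/(_ _ bk) /(vsum_eq s g f) ->.
exact: vsum_word1.
Qed.

Lemma nf_assoc f a k l b v : (k + l <= 3)%N -> b \in monos k -> v \in monos l ->
  vsum (fun w => vsum f (nf (w ++ v))) (lins a b)
  = vsum (fun w => vsum f (lins a w)) (nf (b ++ v)).
Proof.
move=> kl bk vl; rewrite -!vsum_bind //; apply: vsum_eq => //.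
have /allP/(_ (k, l)) := check_assocT.
have -> : (k, l) \in [:: (0, 0); (1, 0); (2, 0); (3, 0); (0, 1); (0, 2); (0, 3);
      (1, 1); (1, 2); (2, 1)]%N.
  by case: k l kl {bk vl} => [|[|[|[|k]]]] [|[|[|[|l]]]].
by move=> /(_ isT) /allP/(_ _ bk) /allP/(_ _ vl) /allP/(_ _ (mem_gens a)).
Qed.

Lemma nf_catl f l u v : (size u + l <= 4)%N -> v \in monos l ->
  vsum f (nf (u ++ v)) = vsum (fun b => vsum f (nf (b ++ v))) (nf u).
Proof.
move=> sl vl; elim: u sl f => [|a u IH] /= sl f; first by rewrite vsum_word1.
rewrite !vsum_bind // IH 1?ltnW //.
have su : (size u <= 4)%N by apply: leq_trans (leq_addr l _) (ltnW sl).
by apply: (eq_vsum_in (nf_keys su)) => b bm; rewrite (nf_assoc f a _ bm vl).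
Qed.

Lemma nf_catr f u v : (size v <= 4)%N ->
  vsum f (nf (u ++ v)) = vsum (fun b => vsum f (nf (u ++ b))) (nf v).
Proof.
move=> sv; elim: u f => [|a u IH] /= f.
  by apply: (eq_vsum_in (nf_keys sv)) => b bm; rewrite (nf_mono _ sv bm).
by rewrite vsum_bind // IH; apply: eq_vsum => b; rewrite vsum_bind.
Qed.

Lemma barw_cons a u : barw (a :: u) = barw u ++ [:: bar a].
Proof. by rewrite /barw /= rev_cons cats1. Qed.

Lemma size_barw u : size (barw u) = size u.
Proof. by rewrite /barw size_rev size_map. Qed.

Lemma nf_barw f u : (size u <= 4)%N ->
  vsum f (nf (barw u)) = vsum (fun b => vsum f (nf (barw b))) (nf u).
Proof.
elim: u f => [|a u IH] f su; first by rewrite !vsum_word1.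
have am : [:: bar a] \in monos 1 by case: (a).
rewrite barw_cons (nf_catl _ _ am) ?size_barw ?addn1 //.
rewrite IH 1?ltnW // vsum_bind //; apply: (eq_vsum_in (nf_keys (ltnW su))) => b bm.
rewrite -(nf_catl _ _ am) ?size_barw ?(monos_size bm) ?addn1 // -barw_cons.
rewrite -vsum_bind //; apply/esym/vsum_eq.
have /allP/(_ (size u)) := check_starT.
by rewrite mem_iota => /(_ su) /allP/(_ _ bm) /allP/(_ _ (mem_gens a)).
Qed.

End Coordinates.

Section Comb.
Variables (R : realType) (q s : R) (g : seq R).
Hypotheses (s0 : s != 0) (qs : q = s ^+ 2).
Local Notation C := R[i].
Local Notation vsum := (linext s g).

(** The matrix of the projection from words to ordered words. *)
Definition nfcoef (u b : seq gen) : R := lpeval s g (vget b (nf u)).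

Lemma vget_sound (v : vec) b : vsum (fun w => (b == w)%:R : C^o) v = (lpeval s g (vget b v))%:C.
Proof.
rewrite /linext; elim: v => [|x v IH] /=; first by rewrite big_nil pev_nil.
rewrite big_cons IH /=; case: weqbP => [->|/eqP ne].
  by rewrite eqxx pev_add rmorphD /= [_ *: _]mulr1.
by rewrite (negPf ne) mulr0n scaler0 add0r.
Qed.

Lemma vsum_cf (W : lmodType C) (f : seq gen -> W) u : (size u <= 4)%N ->
  vsum f (nf u) = \sum_(b <- monos (size u)) (nfcoef u b)%:C *: f b.
Proof.
move=> su.
transitivity (vsum (fun w => \sum_(b <- monos (size u)) (b == w)%:R *: f b) (nf u)).
  apply: (eq_vsum_in _ _ (nf_keys su)) => w wm.
  rewrite (bigD1_seq w) ?monos_uniq //= eqxx scale1r big1 ?addr0 // => b nb.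
  by rewrite (negPf nb) scale0r.
rewrite /linext; under eq_bigr do rewrite scaler_sumr.
rewrite exchange_big; apply: eq_bigr => b _ /=.
under eq_bigr do rewrite scalerA.
by rewrite -scaler_suml -vget_sound.
Qed.

Lemma om_cf u : (size u <= 4)%N ->
  om q u = \sum_(b <- monos (size u)) (nfcoef u b)%:C *: om q b.
Proof. by move=> su; rewrite (om_nf g s0 qs su) vsum_cf. Qed.

Lemma cf_cat u v b : (size u + size v <= 4)%N ->
  nfcoef (u ++ v) b = \sum_(b1 <- monos (size u)) \sum_(b2 <- monos (size v))
     nfcoef u b1 * nfcoef v b2 * nfcoef (b1 ++ b2) b.
Proof.
move=> suv; apply: (@complexI R).
have su : (size u <= 4)%N := leq_trans (leq_addr _ _) suv.
have sv : (size v <= 4)%N := leq_trans (leq_addl _ _) suv.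
rewrite /nfcoef -vget_sound nf_catr // vsum_cf // rmorph_sum /=.
under [RHS]eq_bigr do rewrite rmorph_sum /=.
rewrite [RHS]exchange_big big_seq [RHS]big_seq /=; apply: eq_bigr => b2 b2m.
rewrite (nf_catl _ s0 _ _ b2m) // vsum_cf // scaler_sumr; apply: eq_bigr => b1 _.
by rewrite vget_sound !rmorphM /= scalerA mulrC [(nfcoef u b1)%:C * _]mulrC mulrC.
Qed.

Lemma cf_barw u b : (size u <= 4)%N ->
  nfcoef (barw u) b = \sum_(c <- monos (size u)) nfcoef u c * nfcoef (barw c) b.
Proof.
move=> su; apply: (@complexI R).
rewrite /nfcoef -vget_sound nf_barw // vsum_cf // rmorph_sum /=; apply: eq_bigr => c _.
by rewrite vget_sound rmorphM.
Qed.

Section Forms.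
Variable V : lmodType C.
Implicit Types (t : seq gen -> V) (X : seq gen -> V).

(** By [anti_comb] these are the coordinates, on the antisymmetrised ordered words, of
    the form represented by the tensor t. *)
Definition mcoords k t (b : seq gen) : V :=
  \sum_(u : k.-tuple gen) (nfcoef u b)%:C *: t u.

Definition comb k X : seq gen -> V := fun w =>
  \sum_(b <- monos k) (om q b w : C) *: X b.

Lemma anti_comb k t : (k <= 4)%N -> homog k t -> anti q t = comb k (mcoords k t).
Proof.
move=> k4 ht; apply: funext => w; rewrite anti_expand /comb.
have [sw|nw] := eqVneq (size w) k; last first.
  rewrite big1 => [|u _]; last by rewrite ht ?size_tuple ?scaler0.
  rewrite big_seq big1 // => b /monos_size sb.
  by rewrite om_homog ?scale0r // sb.
subst k; under [RHS]eq_bigr do rewrite scaler_sumr.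
rewrite [RHS]exchange_big; apply: eq_bigr => u _ /=.
rewrite om_cf ?size_tuple // sum_funE scaler_suml; apply: eq_bigr => b _.
by rewrite scalerA mulrC.
Qed.

Definition psign (b : seq gen) : R := (int_of_Z (pivot_sign b))%:~R.

Lemma psign_neq0 b : psign b != 0.
Proof.
rewrite /psign; suff: pivot_sign b = 1%ZZ \/ pivot_sign b = (-1)%ZZ.
  by case=> ->; rewrite /= ?oppr_eq0 oner_eq0.
rewrite /pivot_sign.
repeat match goal with |- context [match ?x with _ => _ end] => destruct x end; auto.
Qed.

Lemma om_pivot k b c : (k <= 4)%N -> b \in monos k -> c \in monos k ->
  om q b (pivot c) = (if b == c then psign b else 0)%:C.
Proof.
move=> k4 bk ck; rewrite (vanti_sound g s0 qs) ?(monos_size bk) // vsum_fun.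
rewrite vget_sound; congr (_%:C).
have /allP/(_ k) := check_pivotT.
rewrite mem_iota => /(_ k4) /allP/(_ _ bk) /allP/(_ _ ck) /(pev0 s g).
rewrite pev_add => /eqP; rewrite addr_eq0 => /eqP ->.
case: ifP => _; last by rewrite pev_nil oppr0.
rewrite /lm pev_cons0 pev_nil addr0 expr0z mulr1 (rmorphN int_of_Z) rmorphN opprK.
by [].
Qed.

Lemma comb_pivot k X b : (k <= 4)%N -> b \in monos k ->
  comb k X (pivot b) = (psign b)%:C *: X b.
Proof.
move=> k4 bk; rewrite /comb (bigD1_seq b) ?monos_uniq //= (om_pivot k4 bk bk) eqxx.
rewrite big_seq_cond big1 ?addr0 // => c /andP [ck nc].
by rewrite (om_pivot k4 ck bk) (negPf nc) scale0r.
Qed.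

Lemma comb_inj k X Y : (k <= 4)%N -> comb k X = comb k Y ->
  forall b, b \in monos k -> X b = Y b.
Proof.
move=> k4 e b bk; have := congr1 (fun t => t (pivot b)) e.
rewrite !(comb_pivot _ k4 bk) => /(scalerI _); apply.
by rewrite (inj_eq (@complexI R)) psign_neq0.
Qed.

Lemma eq_comb k X Y : (forall b, b \in monos k -> X b = Y b) -> comb k X = comb k Y.
Proof.
move=> e; apply: funext => w; rewrite /comb big_seq [RHS]big_seq.
by apply: eq_bigr => b bk; rewrite e.
Qed.

(** Two tensors representing the same form have equal coordinates; whatever is
    expressed by coordinates is therefore well defined on forms. *)
Lemma anti_eq k t t' : (k <= 4)%N -> homog k t -> homog k t' -> anti q t = anti q t' ->
  forall b, b \in monos k -> mcoords k t b = mcoords k t' b.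
Proof.
move=> k4 ht ht'; rewrite !(anti_comb k4) // => e b bk.
exact: (comb_inj k4 e bk).
Qed.

Lemma preantiP k t : homog k t ->
  homog k (preanti q k (anti q t)) /\ anti q (preanti q k (anti q t)) = anti q t.
Proof. by move=> ht; rewrite /preanti; case: xgetP => [x _ //|/(_ t)]; case. Qed.

(** The coordinates of a product depend only on those of the factors. *)
Lemma mcoord_cat k l (F : seq gen -> seq gen -> V) b : (k + l <= 4)%N ->
  mcoords (k + l) (fun w => F (take k w) (drop k w)) b =
  \sum_(b1 <- monos k) \sum_(b2 <- monos l) (nfcoef (b1 ++ b2) b)%:C *:
     mcoords k (fun u => mcoords l (F u) b2) b1.
Proof.
move=> kl; rewrite /mcoords.
transitivity (\sum_(u : k.-tuple gen) \sum_(v : l.-tuple gen)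
   (nfcoef (u ++ v) b)%:C *: F u v).
  rewrite pair_big /=.
  rewrite (reindex (fun p : k.-tuple gen * l.-tuple gen => cat_tuple p.1 p.2)) /=.
    by apply: eq_bigr => -[u v] _ /=; rewrite take_size_cat ?drop_size_cat ?size_tuple.
  have h1 (w : (k + l).-tuple gen) : size (take k w) == k.
    by rewrite size_takel // size_tuple leq_addr.
  have h2 (w : (k + l).-tuple gen) : size (drop k w) == l.
    by rewrite size_drop size_tuple addKn.
  exists (fun w => (Tuple (h1 w), Tuple (h2 w))) => [[u v] _|w _] /=.
    by congr pair; apply: val_inj; rewrite /= ?take_size_cat ?drop_size_cat ?size_tuple.
  by apply: val_inj; rewrite /= cat_take_drop.
under eq_bigr => u _ do under eq_bigr => v _ do
  rewrite cf_cat ?size_tuple // rmorph_sum scaler_suml.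
under eq_bigr do rewrite exchange_big /=.
rewrite exchange_big; apply: eq_bigr => b1 _ /=.
under eq_bigr => u _ do under eq_bigr => v _ do rewrite rmorph_sum scaler_suml.
under eq_bigr do rewrite exchange_big /=.
rewrite exchange_big; apply: eq_bigr => b2 _ /=.
rewrite scaler_sumr; apply: eq_bigr => u _.
rewrite !scaler_sumr; apply: eq_bigr => v _.
by rewrite !scalerA !rmorphM mulrC -!mulrA; congr (_ *: _); rewrite mulrC -mulrA mulrCA.
Qed.

End Forms.
End Comb.

(** * Products and adjoints of invariant forms *)

Section Conj.
Variable R : realType.
Implicit Types x y : R[i].

Lemma conjcD x y : conjc (x + y) = conjc x + conjc y.
Proof. exact: (rmorphD (@conjc R)). Qed.

Lemma conjcM x y : conjc (x * y) = conjc x * conjc y.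
Proof. exact: (rmorphM (@conjc R)). Qed.

Lemma conjcR (a : R) : conjc (a%:C) = a%:C.
Proof. exact: conjc_real. Qed.

Lemma conjcZ x y : conjc (x *: (y : R[i]^o)) = conjc x * conjc y.
Proof. exact: conjcM. Qed.

End Conj.

Lemma conjc_sum (R : realType) (I : Type) (r : seq I) (P : pred I) (F : I -> R[i]^o) :
  conjc (\sum_(i <- r | P i) F i) = \sum_(i <- r | P i) conjc (F i) :> R[i]^o.
Proof.
elim/big_rec2: _ => [|i x y _ <-]; first exact: conjc0.
exact: (rmorphD (@conjc R)).
Qed.

Section InvForms.
Variables (R : realType) (q s : R).
Hypotheses (s0 : s != 0) (qs : q = s ^+ 2).
Local Notation C := R[i].
Local Notation cf := (nfcoef s [::]).
Local Notation mcoord := (mcoords s [::]).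
Implicit Types t : invform R.

Lemma anti_sum (V : lmodType C) (I : Type) (r : seq I) (c : I -> C) (t : I -> seq gen -> V) :
  anti q (fun w => \sum_(i <- r) c i *: t i w) =
  fun w => \sum_(i <- r) c i *: anti q (t i) w.
Proof.
apply: funext => w; rewrite anti_expand.
under eq_bigr do rewrite scaler_sumr.
rewrite exchange_big; apply: eq_bigr => i _ /=.
rewrite anti_expand scaler_sumr; apply: eq_bigr => u _.
by rewrite !scalerA mulrC.
Qed.

Lemma eq_anti (V : lmodType C) (t t' : seq gen -> V) : t =1 t' -> anti q t = anti q t'.
Proof. by move=> e; congr anti; apply: funext. Qed.

(** The adjoint may be computed on any representative, since its coordinates
    depend only on those of the representative. *)
Lemma starI_anti k t : (k <= 4)%N -> homog k t ->
  starI q k (anti q t) =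
  anti q (fun u => (-1) ^+ 'C(k.+1, 2) * conjc (t (barw u)) : C^o).
Proof.
move=> k4 ht; have [hp ep] := preantiP q ht; rewrite /starI.
move: (preanti q k (anti q t)) hp ep => p hp ep.
have hs (x : invform R) : homog k x ->
    homog k (fun u => (-1) ^+ 'C(k.+1, 2) * conjc (x (barw u)) : C^o).
  by move=> hx w nw; rewrite hx ?size_barw // conjc0 mulr0.
rewrite (anti_comb [::] s0 qs k4 (hs _ hp)) (anti_comb [::] s0 qs k4 (hs _ ht)); apply: eq_comb => b bk.
have coordE (x : invform R) :
    mcoord k (fun u => (-1) ^+ 'C(k.+1, 2) * conjc (x (barw u)) : C^o) b =
    (-1) ^+ 'C(k.+1, 2) *
    \sum_(c <- monos k) (cf (barw c) b)%:C * conjc (mcoord k x c).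
  rewrite /mcoords.
  have h1 (w : k.-tuple gen) : size (barw w) == k by rewrite size_barw size_tuple.
  have barK : involutive (fun w : k.-tuple gen => Tuple (h1 w)).
    move=> w; apply: val_inj => /=; rewrite /barw map_rev revK -map_comp.
    by apply: map_id_in; case.
  rewrite (reindex_inj (inv_inj barK)) /=.
  transitivity (\sum_(w : k.-tuple gen) (-1) ^+ 'C(k.+1, 2) *
     \sum_(c <- monos k) (cf (barw c) b)%:C * ((cf w c)%:C * conjc (x w))).
    apply: eq_bigr => w _.
    rewrite [_ *: _]mulrCA; congr (_ * _).
    have -> : barw (barw w) = w by have := congr1 val (barK w).
    rewrite (cf_barw _ s0) ?size_tuple // rmorph_sum mulr_suml; apply: eq_bigr => c _.
    by rewrite rmorphM /= mulrA; congr (_ * _); rewrite mulrC.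
  rewrite -mulr_sumr exchange_big; congr (_ * _); apply: eq_bigr => c _ /=.
  rewrite -mulr_sumr /mcoords conjc_sum; congr (_ * _); apply: eq_bigr => w _.
  by rewrite conjcZ conjcR.
rewrite !coordE; congr (_ * _); rewrite big_seq [RHS]big_seq; apply: eq_bigr => c ck.
by rewrite (anti_eq [::] s0 qs k4 hp ht ep ck).
Qed.

(** The product may be computed on any representatives, by [mcoord_cat]. *)
Lemma wedgeI_anti k l t t' : (k + l <= 4)%N -> homog k t -> homog l t' ->
  wedgeI q k l (anti q t) (anti q t') =
  anti q (fun u => t (take k u) * t' (drop k u) : C^o).
Proof.
move=> kl ht ht'; have [hp ep] := preantiP q ht; have [hp' ep'] := preantiP q ht'.
have k4 : (k <= 4)%N := leq_trans (leq_addr _ _) kl.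
have l4 : (l <= 4)%N := leq_trans (leq_addl _ _) kl.
have hm (x y : invform R) : homog k x -> homog l y ->
    homog (k + l) (fun u => x (take k u) * y (drop k u) : C^o).
  move=> hx hy w nw.
  have [e|ne] := eqVneq (size (take k w)) k; last by rewrite hx ?mul0r.
  rewrite hy ?mulr0 //; apply: contra nw => /eqP e'.
  by rewrite -(cat_take_drop k w) size_cat e e'.
rewrite /wedgeI.
move: (preanti q k _) hp ep (preanti q l _) hp' ep' => p hp ep p' hp' ep'.
rewrite (anti_comb [::] s0 qs kl (hm _ _ hp hp')) (anti_comb [::] s0 qs kl (hm _ _ ht ht')); apply: eq_comb => b bk.
have coordE (x y : invform R) : mcoord (k + l) (fun u => x (take k u) * y (drop k u) : C^o) b =
    \sum_(b1 <- monos k) \sum_(b2 <- monos l) (cf (b1 ++ b2) b)%:C *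
      (mcoord k x b1 * mcoord l y b2).
  rewrite (mcoord_cat [::] s0 (fun u v => x u * y v : C^o)) //.
  apply: eq_bigr => b1 _; apply: eq_bigr => b2 _; congr (_ * _).
  rewrite /mcoords mulr_suml; apply: eq_bigr => u _.
  rewrite -[RHS]mulrA; congr (_ * _); rewrite mulr_sumr; apply: eq_bigr => v _.
  by rewrite [LHS]mulrCA.
rewrite !coordE big_seq [RHS]big_seq; apply: eq_bigr => b1 b1m.
rewrite big_seq [RHS]big_seq; apply: eq_bigr => b2 b2m.
by rewrite (anti_eq [::] s0 qs k4 hp ht ep b1m) (anti_eq [::] s0 qs l4 hp' ht' ep' b2m).
Qed.

End InvForms.

Section FormCalc.
Variables (R : realType) (q s : R) (g : seq R).
Hypotheses (s0 : s != 0) (qs : q = s ^+ 2).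
Local Notation C := R[i].
Local Notation vsum := (linext s g).
Local Notation pev := (lpeval s g).
Local Notation unit_tens := (unitC R).

Definition is_form (k : nat) (x : invform R) := exists2 t, homog k t & anti q t = x.

Lemma tensD (V : zmodType) (t t' : seq gen -> V) w : (t + t') w = t w + t' w.
Proof. by []. Qed.

Lemma tensZ (V : lmodType C) z (t : seq gen -> V) w : (z *: t) w = z *: t w.
Proof. by []. Qed.

Lemma antiD (V : lmodType C) (t t' : seq gen -> V) : anti q (t + t') = anti q t + anti q t'.
Proof.
apply: funext => w; rewrite tensD !anti_expand -big_split /=.
by apply: eq_bigr => u _; rewrite -scalerDr.
Qed.

Lemma antiZ (V : lmodType C) z (t : seq gen -> V) : anti q (z *: t) = z *: anti q t.
Proof.
apply: funext => w; rewrite tensZ !anti_expand scaler_sumr.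
by apply: eq_bigr => u _; rewrite tensZ !scalerA mulrC.
Qed.

Lemma homogD (V : lmodType C) k (t t' : seq gen -> V) :
  homog k t -> homog k t' -> homog k (t + t').
Proof. by move=> h h' w nw; rewrite tensD h ?h' ?addr0. Qed.

Lemma homogZ (V : lmodType C) k z (t : seq gen -> V) : homog k t -> homog k (z *: t).
Proof. by move=> h w nw; rewrite tensZ h ?scaler0. Qed.

Lemma homog_unit u : homog (size u) (unit_tens u).
Proof. by move=> w nw; rewrite /unitC; have [e|//] := eqVneq w u; rewrite e eqxx in nw. Qed.

Lemma homog0 (V : lmodType C) k : homog k (0 : seq gen -> V).
Proof. by []. Qed.

Lemma anti0 (V : lmodType C) : anti q (0 : seq gen -> V) = 0.
Proof. by rewrite -(scale0r (0 : seq gen -> V)) antiZ !scale0r. Qed.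

Lemma is_formD k x y : is_form k x -> is_form k y -> is_form k (x + y).
Proof.
move=> [t ht <-] [t' ht' <-]; exists (t + t'); first exact: homogD.
exact: antiD.
Qed.

Lemma is_formZ k z x : is_form k x -> is_form k (z *: x).
Proof. by move=> [t ht <-]; exists (z *: t); [exact: homogZ|exact: antiZ]. Qed.

Lemma is_form0 k : is_form k 0.
Proof. by exists 0; [exact: homog0|exact: anti0]. Qed.

Lemma is_form_sum k (I : Type) (r : seq I) (F : I -> invform R) :
  (forall i, is_form k (F i)) -> is_form k (\sum_(i <- r) F i).
Proof.
move=> h; elim: r => [|i r IH]; first by rewrite big_nil; exact: is_form0.
by rewrite big_cons; apply: is_formD.
Qed.

Lemma is_form_om u : is_form (size u) (om q u).
Proof. by exists (unit_tens u); [exact: homog_unit|]. Qed.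

Lemma is_form_starI k x : (k <= 4)%N -> is_form k x -> is_form k (starI q k x).
Proof.
move=> k4 [t ht <-]; rewrite (starI_anti s0 qs k4 ht); eexists; last by reflexivity.
by move=> w nw; rewrite ht ?size_barw // conjc0 mulr0.
Qed.

Lemma starID k x y : (k <= 4)%N -> is_form k x -> is_form k y ->
  starI q k (x + y) = starI q k x + starI q k y.
Proof.
move=> k4 [t ht <-] [t' ht' <-].
apply: etrans (congr1 (starI q k) (esym (antiD t t'))) _.
apply: etrans (starI_anti s0 qs k4 (homogD ht ht')) _.
apply: etrans (esym (congr2 +%R (starI_anti s0 qs k4 ht) (starI_anti s0 qs k4 ht'))).
apply: etrans (antiD _ _).
by apply: eq_anti => w; rewrite !tensD conjcD mulrDr.
Qed.

Lemma starIZ k z x : (k <= 4)%N -> is_form k x -> starI q k (z *: x) = conjc z *: starI q k x.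
Proof.
move=> k4 [t ht <-].
apply: etrans (congr1 (starI q k) (esym (antiZ z t))) _.
apply: etrans (starI_anti s0 qs k4 (homogZ z ht)) _.
apply: etrans (esym (congr1 ( *:%R (conjc z)) (starI_anti s0 qs k4 ht))).
apply: etrans (antiZ _ _).
by apply: eq_anti => w; rewrite !tensZ conjcM mulrCA.
Qed.

Lemma starI0 k : (k <= 4)%N -> starI q k 0 = 0.
Proof. by move=> k4; rewrite -(scale0r 0) starIZ ?conjc0 ?scale0r //; exact: is_form0. Qed.

Lemma starI_sum k (I : Type) (r : seq I) (F : I -> invform R) : (k <= 4)%N ->
  (forall i, is_form k (F i)) -> starI q k (\sum_(i <- r) F i) = \sum_(i <- r) starI q k (F i).
Proof.
move=> k4 h; elim: r => [|i r IH]; first by rewrite !big_nil starI0.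
by rewrite !big_cons starID ?IH //; exact: is_form_sum.
Qed.

Lemma starI_om u : (size u <= 4)%N ->
  starI q (size u) (om q u) = (-1) ^+ 'C((size u).+1, 2) *: om q (barw u).
Proof.
move=> su; rewrite [in LHS]/om (starI_anti s0 qs su (@homog_unit u)) -antiZ.
apply: eq_anti => w; rewrite /unitC [RHS]tensZ; congr (_ * _).
have -> : (barw w == u) = (w == barw u).
  have barK x : barw (barw x) = x.
    by rewrite /barw map_rev revK -map_comp; apply: map_id_in; case.
  by apply/eqP/eqP => [<-|->]; rewrite barK.
by rewrite (rmorph_nat (@conjc R)).
Qed.

Lemma wedgeIDl k l x x' y : (k + l <= 4)%N -> is_form k x -> is_form k x' -> is_form l y ->
  wedgeI q k l (x + x') y = wedgeI q k l x y + wedgeI q k l x' y.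
Proof.
move=> kl [t ht <-] [t' ht' <-] [r hr <-].
apply: etrans (congr1 (fun z => wedgeI q k l z (anti q r)) (esym (antiD t t'))) _.
apply: etrans (wedgeI_anti s0 qs kl (homogD ht ht') hr) _.
apply: etrans (esym (congr2 +%R (wedgeI_anti s0 qs kl ht hr) (wedgeI_anti s0 qs kl ht' hr))).
apply: etrans (antiD _ _).
by apply: eq_anti => w; rewrite !tensD mulrDl.
Qed.

Lemma wedgeIDr k l x y y' : (k + l <= 4)%N -> is_form k x -> is_form l y -> is_form l y' ->
  wedgeI q k l x (y + y') = wedgeI q k l x y + wedgeI q k l x y'.
Proof.
move=> kl [t ht <-] [t' ht' <-] [r hr <-].
apply: etrans (congr1 (wedgeI q k l (anti q t)) (esym (antiD t' r))) _.
apply: etrans (wedgeI_anti s0 qs kl ht (homogD ht' hr)) _.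
apply: etrans (esym (congr2 +%R (wedgeI_anti s0 qs kl ht ht') (wedgeI_anti s0 qs kl ht hr))).
apply: etrans (antiD _ _).
by apply: eq_anti => w; rewrite !tensD mulrDr.
Qed.

Lemma wedgeIZl k l z x y : (k + l <= 4)%N -> is_form k x -> is_form l y ->
  wedgeI q k l (z *: x) y = z *: wedgeI q k l x y.
Proof.
move=> kl [t ht <-] [r hr <-].
apply: etrans (congr1 (fun x => wedgeI q k l x (anti q r)) (esym (antiZ z t))) _.
apply: etrans (wedgeI_anti s0 qs kl (homogZ z ht) hr) _.
apply: etrans (esym (congr1 ( *:%R z) (wedgeI_anti s0 qs kl ht hr))).
apply: etrans (antiZ _ _).
by apply: eq_anti => w; rewrite !tensZ; exact/esym/mulrA.
Qed.

Lemma wedgeIZr k l z x y : (k + l <= 4)%N -> is_form k x -> is_form l y ->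
  wedgeI q k l x (z *: y) = z *: wedgeI q k l x y.
Proof.
move=> kl [t ht <-] [r hr <-].
apply: etrans (congr1 (wedgeI q k l (anti q t)) (esym (antiZ z r))) _.
apply: etrans (wedgeI_anti s0 qs kl ht (homogZ z hr)) _.
apply: etrans (esym (congr1 ( *:%R z) (wedgeI_anti s0 qs kl ht hr))).
apply: etrans (antiZ _ _).
by apply: eq_anti => w; rewrite !tensZ; exact: mulrCA.
Qed.

Lemma wedgeI_suml k l (I : Type) (r : seq I) (F : I -> invform R) y : (k + l <= 4)%N ->
  (forall i, is_form k (F i)) -> is_form l y ->
  wedgeI q k l (\sum_(i <- r) F i) y = \sum_(i <- r) wedgeI q k l (F i) y.
Proof.
move=> kl h hy; elim: r => [|i r IH]; rewrite ?big_nil ?big_cons.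
  by rewrite -(scale0r 0) wedgeIZl ?scale0r //; exact: is_form0.
by rewrite wedgeIDl ?IH //; exact: is_form_sum.
Qed.

Lemma wedgeI_sumr k l (I : Type) (r : seq I) (F : I -> invform R) x : (k + l <= 4)%N ->
  (forall i, is_form l (F i)) -> is_form k x ->
  wedgeI q k l x (\sum_(i <- r) F i) = \sum_(i <- r) wedgeI q k l x (F i).
Proof.
move=> kl h hy; elim: r => [|i r IH]; rewrite ?big_nil ?big_cons.
  by rewrite -(scale0r 0) wedgeIZr ?scale0r //; exact: is_form0.
by rewrite wedgeIDr ?IH //; exact: is_form_sum.
Qed.

Lemma wedgeI_om u v : (size u + size v <= 4)%N ->
  wedgeI q (size u) (size v) (om q u) (om q v) = om q (u ++ v).
Proof.
move=> su; rewrite [in LHS]/om (wedgeI_anti s0 qs su (@homog_unit u) (@homog_unit v)).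
apply: eq_anti => w; rewrite /unitC -natrM mulnb; congr ((nat_of_bool _)%:R).
apply/andP/eqP => [[/eqP e1 /eqP e2]|->]; first by rewrite -(cat_take_drop (size u) w) e1 e2.
by rewrite take_size_cat ?drop_size_cat.
Qed.

(** ** Evaluation of formal sums of wedge words *)

Definition sized (k : nat) (v : vec) := all (fun x => size x.1 == k) v.
Definition vbar (v : vec) : vec := vbind (fun u => nf (barw u)) v.
Definition vwedge (v w : vec) : vec := vbind (fun u => vbind (fun u' => nf (u ++ u')) w) v.
Definition lin_om (v : vec) : invform R := vsum (om q) v.

Lemma vom_nil : lin_om [::] = 0.
Proof. exact: big_nil. Qed.

Lemma vom_cons x v : lin_om (x :: v) = (pev x.2)%:C *: om q x.1 + lin_om v.
Proof. exact: big_cons. Qed.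

Lemma vsum_cons (W : lmodType C) (f : seq gen -> W) x v :
  vsum f (x :: v) = (pev x.2)%:C *: f x.1 + vsum f v.
Proof. exact: big_cons. Qed.

Lemma is_form_vom k v : sized k v -> is_form k (lin_om v).
Proof.
move=> /allP h; rewrite /lin_om /linext big_seq_cond.
rewrite (eq_bigr (fun x => if size x.1 == k then (pev x.2)%:C *: om q x.1 else 0)); last first.
  by move=> x /andP [/h -> _].
rewrite -big_seq_cond; apply: is_form_sum => x.
case: eqP => [<-|_]; last exact: is_form0.
by apply: is_formZ; apply: is_form_om.
Qed.

Lemma starI_vom k v : (k <= 4)%N -> sized k v ->
  starI q k (lin_om v) = (-1) ^+ 'C(k.+1, 2) *: lin_om (vbar v).
Proof.
move=> k4 sv; rewrite {2}/lin_om /vbar vsum_bind //.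
rewrite (eq_vsum_in _ (h := fun u => om q (barw u)) _ (P := fun u => size u == k) sv); last first.
  by move=> w /eqP sw; rewrite (om_nf g s0 qs) ?size_barw ?sw.
elim: v sv => [|x v IH] /=.
  by move=> _; rewrite /linext big_nil vom_nil starI0 // scaler0.
move=> /andP [/eqP sx sv]; rewrite vom_cons vsum_cons.
rewrite starID ?IH //; last 2 first.
- by apply: is_formZ; rewrite -sx; apply: is_form_om.
- exact: is_form_vom.
rewrite scalerDr -[in starI q k _]sx starIZ ?sx //; last by rewrite -sx; apply: is_form_om.
by rewrite conjcR -[in starI q k _]sx starI_om ?sx // scalerA mulrC -scalerA.
Qed.

Lemma wedgeI_om_vom u l w : (size u + l <= 4)%N -> sized l w ->
  wedgeI q (size u) l (om q u) (lin_om w) = vsum (fun u' => om q (u ++ u')) w.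
Proof.
move=> ul; have fu := is_form_om u; elim: w => [|y w IH] /=.
  move=> _; rewrite /linext big_nil vom_nil.
  by rewrite -(scale0r 0) wedgeIZr ?scale0r //; exact: is_form0.
move=> /andP [/eqP sy sw]; rewrite vom_cons vsum_cons.
have fy : is_form l (om q y.1) by rewrite -sy; apply: is_form_om.
have e : wedgeI q (size u) l (om q u) (om q y.1) = om q (u ++ y.1).
  by rewrite -sy; apply: wedgeI_om; rewrite sy.
apply: etrans (wedgeIDr ul fu (is_formZ _ fy) (is_form_vom sw)) _.
exact: (congr2 +%R (etrans (wedgeIZr _ ul fu fy) (congr1 _ e)) (IH sw)).
Qed.

Lemma wedgeI_vom k l v w : (k + l <= 4)%N -> sized k v -> sized l w ->
  wedgeI q k l (lin_om v) (lin_om w) = lin_om (vwedge v w).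
Proof.
move=> kl sv sw; rewrite [RHS]/lin_om /vwedge vsum_bind //.
rewrite (eq_vsum_in _ (h := fun u => vsum (fun u' => om q (u ++ u')) w) _
   (P := fun u => size u == k) sv); last first.
  move=> u /eqP su; apply: etrans (vsum_bind _ s0 _ _ _) _.
  apply: (eq_vsum_in _ _ (P := fun u => size u == l) sw) => u' /eqP su'.
  by apply/esym/om_nf; rewrite ?size_cat ?su ?su'.
have fw := is_form_vom sw.
elim: v sv => [|x v IH] /=.
  move=> _; rewrite /linext big_nil vom_nil.
  by rewrite -(scale0r 0) wedgeIZl ?scale0r //; exact: is_form0.
move=> /andP [/eqP sx sv]; rewrite vom_cons vsum_cons.
have fx : is_form k (om q x.1) by rewrite -sx; apply: is_form_om.
have e : wedgeI q k l (om q x.1) (lin_om w) = vsum (fun u' => om q (x.1 ++ u')) w.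
  by rewrite -sx; apply: wedgeI_om_vom; rewrite ?sx.
apply: etrans (wedgeIDl kl (is_formZ _ fx) (is_form_vom sv) fw) _.
exact: (congr2 +%R (etrans (wedgeIZl _ kl fx fw) (congr1 _ e)) (IH sv)).
Qed.

End FormCalc.

(** * Eigenbases and contraction *)

(** The eigenvectors of degree k, as words before antisymmetrisation. *)
Definition ebw (k : nat) : seq vec :=
  match k with
  | 2 => [:: word1 [:: wm; w0];
             [:: ([:: wp; w0], lm 0%ZZ 1%ZZ); ([:: wp; wz], lq [:: (0, -1); (4, 1)]%ZZ)];
             [:: ([:: w0; wz], lm 0%ZZ 1%ZZ); ([:: wm; wp], lq [:: (0, 1); (4, -1)]%ZZ)];
             [:: ([:: wm; w0], lm 0%ZZ 1%ZZ); ([:: wm; wz], lq [:: (0, 1); (-4, -1)]%ZZ)];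
             word1 [:: wp; w0];
             [:: ([:: w0; wz], lm 0%ZZ 1%ZZ); ([:: wm; wp], lq [:: (0, 1); (-4, -1)]%ZZ)]]
  | 1 => [:: word1 [:: wm]; word1 [:: wp]; word1 [:: wz]; word1 [:: w0]]
  | _ => [seq word1 b | b <- monos k]
  end.

Section Bases.
Variables (R : realType) (q s : R) (g : seq R).
Hypotheses (s0 : s != 0) (qs : q = s ^+ 2).
Local Notation C := R[i].
Local Notation vsum := (linext s g).
Local Notation vom := (lin_om q s g).
Local Notation pev := (lpeval s g).

Lemma ebasE k : (k <= 4)%N -> ebas q k = [seq vom v | v <- ebw k].
Proof.
have w1 u : vom (word1 u) = om q u by rewrite /lin_om (vsum_word1 s g).
have w2 u v (c : R) P : pev P = c ->
  vom [:: (u, lm 0%ZZ 1%ZZ); (v, P)] = om q u + c%:C *: om q v.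
  by move=> <-; rewrite /lin_om /linext !big_cons big_nil pev1 scale1r addr0.
have e1 : pev (lq [:: (0, -1); (4, 1)]%ZZ) = - (1 - q ^+ 2).
  by pev_norm; rewrite qs; ring.
have e2 : pev (lq [:: (0, 1); (4, -1)]%ZZ) = 1 - q ^+ 2.
  by pev_norm; rewrite qs; ring.
have e3 : pev (lq [:: (0, 1); (-4, -1)]%ZZ) = 1 - q ^- 2.
  by pev_norm; rewrite qs; field; exact: s0.
case: k => [|[|[|[|[|k]]]]] // _; rewrite /= ?w1 //.
rewrite (w2 _ _ _ _ e1) !(w2 _ _ _ _ e2) !(w2 _ _ _ _ e3).
have eN : (- (1 - q ^+ 2))%:C = - (1 - q ^+ 2)%:C :> C by rewrite rmorphN.
by rewrite eN scaleNr.
Qed.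

Lemma ebas_size k : (k <= 4)%N -> size (ebas q k) = size (ebw k).
Proof. by move=> k4; rewrite ebasE // size_map. Qed.

Lemma ebas_nth k i : (k <= 4)%N -> (i < size (ebas q k))%N ->
  (ebas q k)`_i = vom (nth [::] (ebw k) i).
Proof. by move=> k4; rewrite ebas_size // => ik; rewrite ebasE // (nth_map [::]). Qed.

Lemma ebw_sized k i : sized k (nth [::] (ebw k) i).
Proof. by case: k => [|[|[|[|[|k]]]]]; case: i => [|[|[|[|[|[|i]]]]]]; rewrite /= ?nth_nil. Qed.

Lemma is_form_ebas k (i : 'I_(size (ebas q k))) : (k <= 4)%N ->
  is_form q k (ebas q k)`_i.
Proof. by move=> k4; rewrite ebas_nth //; apply: is_form_vom; apply: ebw_sized. Qed.

Lemma vom_monos k v : all (fun x => x.1 \in monos k) v ->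
  vom v = \sum_(b <- monos k) (pev (vget b v))%:C *: om q b.
Proof.
move=> kv.
rewrite /lin_om.
transitivity (vsum (fun w => \sum_(b <- monos k) (b == w)%:R *: om q b) v).
  apply: (eq_vsum_in _ _ kv) => u um.
  rewrite (bigD1_seq u) ?monos_uniq //= eqxx scale1r big1 ?addr0 // => b nb.
  by rewrite (negPf nb) scale0r.
rewrite /linext; under eq_bigr do rewrite scaler_sumr.
rewrite exchange_big; apply: eq_bigr => b _ /=.
under eq_bigr do rewrite scalerA.
by rewrite -scaler_suml -vget_sound.
Qed.

Hypotheses (q2_neq1 : q ^+ 2 != 1) (q4_neq1 : q ^+ 4 != 1).

Section LeftBasis.
Variable V : lmodType C.

Lemma lcomb_comb k (X : {ffun 'I_(size (ebas q k)) -> V}) : (k <= 4)%N ->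
  lcomb X = comb q k (fun b => \sum_(i < size (ebas q k))
     (pev (vget b (nth [::] (ebw k) i)))%:C *: X i).
Proof.
move=> k4; apply: funext => w; rewrite /lcomb /comb.
under [RHS]eq_bigr do rewrite scaler_sumr.
rewrite [RHS]exchange_big; apply: eq_bigr => i _ /=.
rewrite ebas_nth //.
have : all (fun x => x.1 \in monos k) (nth [::] (ebw k) i).
  by case: (k) i => [|[|[|[|[|k']]]]] [[|[|[|[|[|[|i]]]]]] Hi].
move: (nth _ _ _) => v kv.
rewrite (vom_monos kv).
rewrite sum_funE scaler_suml; apply: eq_bigr => b _.
by rewrite tensZ scalerA mulrC.
Qed.

(** The only nontrivial case is degree 2, where the pairs of eigenvectors with a
    common support are independent because q^2 and q^4 differ from 1. *)
Lemma ebw_free k (D : nat -> V) : (k <= 4)%N ->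
  (forall b, b \in monos k -> \sum_(i < size (ebw k))
     (pev (vget b (nth [::] (ebw k) i)))%:C *: D i = 0) ->
  forall i, (i < size (ebw k))%N -> D i = 0.
Proof.
have p1 : pev [:: ((0%ZZ, [::]), 1%ZZ)] = 1 := pev1 s g.
have e1 : pev [:: ((4%ZZ, [::]), 1%ZZ); ((0%ZZ, [::]), (-1)%ZZ)] = q ^+ 2 - 1.
  by pev_norm; rewrite qs; ring.
have e2 : pev [:: ((4%ZZ, [::]), (-1)%ZZ); ((0%ZZ, [::]), 1%ZZ)] = 1 - q ^+ 2.
  by pev_norm; rewrite qs; ring.
have e3 : pev [:: ((-4)%ZZ, [::], (-1)%ZZ); ((0%ZZ, [::]), 1%ZZ)] = 1 - q ^- 2.
  by pev_norm; rewrite qs; field; exact: s0.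
case: k => [|[|[|[|[|k]]]]] // _ h.
- have := h _ (mem_head _ _); rewrite big_ord1 /= p1 scale1r => e.
  by case=> [|i].
- have := h [:: wm] isT; have := h [:: wp] isT; have := h [:: wz] isT; have := h [:: w0] isT.
  rewrite /= !big_ord_recl !big_ord0 /= !p1 !pev_nil !scale0r !scale1r.
  rewrite /= ?add0r ?addr0 => E0 E1 E2 E3.
  by case=> [|[|[|[|i]]]].
- have := h [:: wm; w0] isT; have := h [:: wm; wz] isT.
  have := h [:: wp; w0] isT; have := h [:: wp; wz] isT.
  have := h [:: w0; wz] isT; have := h [:: wm; wp] isT.
  rewrite /= !big_ord_recl !big_ord0 /= !p1 !pev_nil e1 e2 !e3 !scale0r !scale1r.
  rewrite /= ?add0r ?addr0 => E0 E1 E2 E3 E4 E5.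
  have nz (c : R) (v : V) : c != 0 -> c%:C *: v = 0 -> v = 0.
    move=> c0 /eqP; rewrite scaler_eq0 => /orP [|/eqP //].
    by rewrite (inj_eq (@complexI R) c 0) (negPf c0).
  have qi : 1 - q ^- 2 != 0.
    by rewrite subr_eq0 eq_sym invr_eq1.
  have q2 : q ^+ 2 - 1 != 0 by rewrite subr_eq0.
  have D3 := nz _ _ qi E4; have D1 := nz _ _ q2 E2.
  have D0 : D 0%N = 0 by move: E5; rewrite /= D3 addr0.
  have D4 : D 4%N = 0 by move: E3; rewrite /= D1 add0r.
  have D5 : D 5%N = - D 2%N by apply/eqP; rewrite -addr_eq0 addrC E1.
  have D2 : D 2%N = 0.
    apply: (nz (q ^- 2 - q ^+ 2)).
      rewrite subr_eq0; apply: contra q4_neq1 => /eqP e.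
      by rewrite (exprD q 2 2) -{1}e mulVf // qs !expf_neq0.
    rewrite -[RHS]E0 /= D5 scalerN -scalerBl -rmorphB; congr (_%:C *: _).
    by ring.
  by case=> [|[|[|[|[|[|i]]]]]] // _; rewrite D5 D2 oppr0.
- have := h [:: wm; wp; w0] isT; have := h [:: wm; wp; wz] isT.
  have := h [:: wm; w0; wz] isT; have := h [:: wp; w0; wz] isT.
  rewrite /= !big_ord_recl !big_ord0 /= !p1 !pev_nil !scale0r !scale1r.
  rewrite /= ?add0r ?addr0 => E0 E1 E2 E3.
  by case=> [|[|[|[|i]]]].
- have := h _ (mem_head _ _); rewrite big_ord1 /= p1 scale1r => e.
  by case=> [|i].
Qed.

Lemma lcomb_inj k (X Y : {ffun 'I_(size (ebas q k)) -> V}) : (k <= 4)%N ->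
  lcomb X = lcomb Y -> X = Y.
Proof.
move=> k4; rewrite !lcomb_comb // => /(comb_inj g s0 qs k4) e.
pose D j := if insub j is Some i then X i - Y i else 0 : V.
have DE i : D (val i) = X i - Y i by rewrite /D valK.
apply/ffunP => i; apply/eqP; rewrite -subr_eq0 -DE; apply/eqP.
apply: (ebw_free (k := k)) => //; last by rewrite -ebas_size //; apply: (ltn_ord i).
move=> b /e eb; rewrite -ebas_size //.
under eq_bigr do rewrite DE scalerBr.
by rewrite sumrB eb subrr.
Qed.

Lemma lcoef_lcomb k (X : {ffun 'I_(size (ebas q k)) -> V}) : (k <= 4)%N ->
  lcoef q k (lcomb X) = X.
Proof.
move=> k4; rewrite /lcoef; case: xgetP => [Y _ e|/(_ X) h]; last by case: h.
exact: (lcomb_inj k4 e).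
Qed.

End LeftBasis.
End Bases.

Definition eigw (k i : nat) : lpoly :=
  match k with
  | 2 => if (i < 3)%N then lq [:: (0, 1); (4, 1)]%ZZ else lq [:: (0, 1); (-4, 1)]%ZZ
  | 3 => lq [:: (0, 2); (4, 2); (-4, 2)]%ZZ
  | _ => lm 0%ZZ 1%ZZ
  end.

(** As xi = A(v) for the formal sum v, it is an eigenvector as soon as A(v) straightens to
    a multiple of v. *)
Definition check_eig := all (fun k => all (fun i =>
   let v := nth [::] (ebw k) i in
   sized k (vbind vanti v) &&
   veq (vbind nf (vbind vanti v)) (vscale (eigw k i) v))
  (iota 0 (size (ebw k)))) (iota 0 4).
Lemma check_eigT : check_eig. Proof. by vm_compute. Qed.

Definition top := [:: wm; wp; w0; wz].

(** The forms i_b such that A(w_- w_+ w_0 w_z) is the sum of the w_b (x) i_b; the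
    contraction of the volume form with w_a is then the sum of the G a b i_b. *)
Definition iov (b : gen) : vec :=
  match b with
  | wm => [:: ([:: wp; w0; wz], lm 4 1)]
  | wp => [:: ([:: wm; w0; wz], lm (-4) (-1))]
  | wz => [:: ([:: wm; wp; w0], lm 0 (-1))]
  | w0 => [:: ([:: wm; wp; wz], lm 0 1)]
  end%ZZ.

Definition vtail (b : gen) (v : vec) : vec :=
  foldr (fun x acc => if x.1 is a :: u then if geqb a b then vadd1 (u, x.2) acc else acc
                      else acc) [::] v.

(** The exponent of s in a factor which occurs twice: w_b i_b is that multiple of the top
    form, and it relates the adjoint of i_b to i_c, where w_c = - w_b^*. *)
Definition bexp (b : gen) : Z := (match b with wm => 4 | wp => -4 | _ => 0 end)%ZZ.

Lemma check_iov : all (fun b => veq (vtail b (vanti top)) (vbind vanti (iov b))) gens.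
Proof. by vm_compute. Qed.

Lemma check_iov_bar : all (fun b =>
  veq (vbar (iov b)) (vscale (lm (bexp b) 1%ZZ) (iov (bar b)))) gens.
Proof. by vm_compute. Qed.

Lemma check_iov_wedge : all (fun d => all (fun b =>
  veq (vwedge (word1 [:: d]) (iov b))
      (if geqb d b then [:: (top, lm (bexp b) 1%ZZ)] else [::])) gens) gens.
Proof. by vm_compute. Qed.

Section Hodge.
Variables (R : realType) (q s : R).
Hypotheses (s0 : s != 0) (qs : q = s ^+ 2).
Hypotheses (q2_neq1 : q ^+ 2 != 1) (q4_neq1 : q ^+ 4 != 1).
Local Notation C := R[i].
Local Notation vsum := (linext s [::]).
Local Notation vom := (lin_om q s [::]).
Local Notation pev := (lpeval s [::]).
Variables (G : gen -> gen -> C) (m : R).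
Hypothesis m0 : m != 0.
Local Notation z := ('i * m%:C).
Local Notation mu := (om q top).

Lemma z_neq0 : z != 0 :> C.
Proof.
rewrite mulf_neq0 // ?(inj_eq (@complexI R) m 0) //.
by rewrite eq_complex /= oner_eq0 andbF.
Qed.

Lemma conjc_z : conjc z = - z :> C.
Proof.
rewrite conjcM conjcR -mulNr; congr (_ * _).
by apply/eqP; rewrite eq_complex /= oppr0 !eqxx.
Qed.

Lemma scale_om_inj u (a b : C) : (size u <= 4)%N -> u \in monos (size u) ->
  a *: om q u = b *: om q u -> a = b.
Proof.
move=> su uk e; have := congr1 (fun t => t (pivot u)) e.
rewrite !tensZ (om_pivot [::] s0 qs su uk uk) eqxx => /(mulIf _); apply.
by rewrite (inj_eq (@complexI R) _ 0) psign_neq0.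
Qed.

Lemma eigvalE x l : x != 0 -> anti q x = l *: x -> eigval q x = l.
Proof.
move=> x0 e; rewrite /eigval; case: xgetP => [l' _ e'|/(_ l) h]; last by case: h.
apply/eqP; rewrite -subr_eq0.
have : (l' - l) *: x = 0 by rewrite scalerBl -e' -e subrr.
by move=> /eqP; rewrite scaler_eq0 (negPf x0) orbF.
Qed.

Lemma lcomb_delta k (i : 'I_(size (ebas q k))) :
  lcomb (V := C^o) [ffun j => (j == i)%:R] = (ebas q k)`_i.
Proof.
apply: funext => w; rewrite /lcomb (bigD1 i) //= ffunE eqxx big1 ?addr0 ?[_ *: _]mulr1 //.
by move=> j ji; rewrite ffunE (negPf ji) scaler0.
Qed.

Lemma ebas_neq0 k (i : 'I_(size (ebas q k))) : (k <= 4)%N -> (ebas q k)`_i != 0.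
Proof.
move=> k4; apply/eqP; rewrite -lcomb_delta.
have -> : 0 = lcomb (V := C^o) (k := k) (q := q) [ffun=> 0].
  by apply: funext => w; rewrite /lcomb big1 // => j _; rewrite ffunE scaler0.
move/(lcomb_inj [::] s0 qs q2_neq1 q4_neq1 k4)/ffunP/(_ i); rewrite !ffunE eqxx.
by move/eqP; rewrite oner_eq0.
Qed.

Lemma anti_vsum (W : lmodType C) (f : seq gen -> seq gen -> W) v :
  anti q (vsum f v) = vsum (fun w => anti q (f w)) v.
Proof.
rewrite /linext; elim: v => [|x v IH]; first by rewrite !big_nil anti0.
by rewrite !big_cons antiD antiZ IH.
Qed.

Lemma anti_ebas k (i : 'I_(size (ebas q k))) : (k <= 3)%N ->
  anti q (ebas q k)`_i = (pev (eigw k i))%:C *: (ebas q k)`_i.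
Proof.
move=> k3; have k4 : (k <= 4)%N by apply: leq_trans k3 _.
have ik : (i < size (ebw k))%N by rewrite -(ebas_size [::] s0 qs k4).
rewrite (ebas_nth [::] s0 qs k4 (ltn_ord i)).
have sv := ebw_sized k i; move: (check_eigT) => /allP/(_ k).
rewrite mem_iota => /(_ k3) /allP/(_ i); rewrite mem_iota => /(_ ik).
move: (nth _ _ _) sv => v sv /andP [sw /(vsum_eq s [::] (om q))].
rewrite vsum_scale // => <-; rewrite (vsum_bind _ s0).
have -> : vom v = vsum (unitC R) (vbind vanti v).
  rewrite vsum_bind //; apply: (eq_vsum_in _ _ (P := fun u => size u == k) sv) => u /eqP su.
  by apply: (vanti_sound [::] s0 qs); rewrite su.
rewrite anti_vsum; apply: (eq_vsum_in _ _ (P := fun u => size u == k) sw) => u /eqP su.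
by apply: (om_nf [::] s0 qs); rewrite su.
Qed.

Lemma eigval_ebas k (i : 'I_(size (ebas q k))) : (k <= 3)%N ->
  eigval q (ebas q k)`_i = (pev (eigw k i))%:C.
Proof.
move=> k3; apply: eigvalE; last exact: anti_ebas.
by apply: ebas_neq0; apply: leq_trans k3 _.
Qed.

Lemma hodge_lcomb k (Y : {ffun 'I_(size (ebas q k)) -> C^o}) : (k <= 4)%N ->
  hodge q G m k (lcomb Y) =
  \sum_(i < size (ebas q k)) (Y i : C) *:
    ((eigval q (ebas q k)`_i)^-1 *:
      starI q (4 - k)%N (contract G k (ebas q k)`_i (volume q m))).
Proof. by move=> k4; rewrite /hodge (lcoef_lcomb [::] s0 qs q2_neq1 q4_neq1). Qed.

Lemma hodge_ebas k (i : 'I_(size (ebas q k))) (c : C) : (k <= 4)%N ->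
  hodge q G m k (c *: (ebas q k)`_i) =
  c *: ((eigval q (ebas q k)`_i)^-1 *:
      starI q (4 - k)%N (contract G k (ebas q k)`_i (volume q m))).
Proof.
move=> k4.
have -> : c *: (ebas q k)`_i = lcomb (V := C^o) [ffun j => c * (j == i)%:R].
  rewrite -lcomb_delta; apply: funext => w; rewrite tensZ /lcomb scaler_sumr.
  by apply: eq_bigr => j _; rewrite !ffunE; exact: mulrCA.
apply: etrans (hodge_lcomb _ k4) _.
rewrite (bigD1 i) //= ffunE eqxx mulr1 big1 ?addr0 // => j ji.
by rewrite ffunE (negPf ji) mulr0 scale0r.
Qed.

Lemma contractZ k x c (y : invform R) :
  contract G k x (c *: y) = c *: contract G k x y.
Proof.
apply: funext => w; rewrite tensZ /contract scaler_sumr; apply: eq_bigr => a _.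
rewrite scaler_sumr; apply: eq_bigr => b _; rewrite tensZ.
exact: mulrCA.
Qed.

Lemma braceE k x y (B : C) :
  wedgeI q k (4 - k) (starI q k x) (hodge q G m k y) = B *: volume q m ->
  brace q G m k x y = B.
Proof.
move=> e; rewrite /brace; case: xgetP => [B' _ e'|/(_ B) h]; last by case: h.
have : B' *: volume q m = B *: volume q m := etrans e' e.
rewrite /volume !scalerA => /(@scale_om_inj top _ _ isT isT) /mulIf; apply.
exact: z_neq0.
Qed.

Lemma sum_1tuple (V : zmodType) (F : seq gen -> V) :
  \sum_(a : 1.-tuple gen) F a = \sum_a F [:: a].
Proof.
rewrite (reindex (fun a : gen => [tuple a])) //=.
exists (@thead 0 gen) => [a _ //|u _]; apply: val_inj => /=.
by case/tupleP: u => a u; rewrite (tuple0 u) theadE.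
Qed.

Lemma om1 a : om q [:: a] = unitC R [:: a].
Proof.
rewrite (vanti_sound [::] s0 qs) //; apply: funext => w.
by rewrite vsum_fun /linext big_seq1 pev1 scale1r.
Qed.

Lemma vtail_sound b v w : vsum (unitC R) v (b :: w) = vsum (unitC R) (vtail b v) w.
Proof.
rewrite !vsum_fun; elim: v => [|[u c] v IH] /=; first by rewrite /linext !big_nil.
rewrite vsum_cons IH /=; case: u => [|a u] /=; first by rewrite /unitC scaler0 add0r.
rewrite /unitC eqseq_cons; case: geqbP => [->|ne].
  by rewrite eqxx vsum_add1.
by case: eqP ne => [->|_] // _; rewrite scaler0 add0r.
Qed.

Definition iota_b (b : gen) : invform R := vom (iov b).

Lemma mu_tail b w : mu (b :: w) = iota_b b w.
Proof.
rewrite (vanti_sound [::] s0 qs) // vtail_sound.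
have /allP/(_ _ (mem_gens b)) := check_iov.
move/(vsum_eq s [::] (unitC R)) ->; rewrite vsum_bind // /iota_b /lin_om.
congr (_ w); have sv : sized 3 (iov b) by case: (b).
apply: (eq_vsum_in _ _ (P := fun u => size u == 3) sv) => u /eqP su.
by rewrite -(vanti_sound [::] s0 qs) ?su.
Qed.

Fixpoint gprod (u v : seq gen) : C :=
  match u, v with
  | [::], _ => 1
  | a :: u', b :: v' => G a b * gprod u' v'
  | _, _ => 0
  end.

Lemma prod_tnth k (u v : k.-tuple gen) :
  \prod_(j < k) G (tnth u j) (tnth v j) = gprod u v.
Proof.
elim: k u v => [|k IH] u v; first by rewrite big_ord0 !tuple0.
case/tupleP: u => a u; case/tupleP: v => b v.
rewrite big_ord_recl !tnth0 /= -IH; congr (_ * _).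
by apply: eq_bigr => j _; rewrite !tnthS.
Qed.

Lemma contract_unit u y w :
  contract G (size u) (unitC R u) y w =
  \sum_(b : (size u).-tuple gen) gprod u b * y (b ++ w).
Proof.
rewrite /contract (bigD1 (in_tuple u)) //= [X in _ + X]big1 ?addr0 => [|a au].
  apply: eq_bigr => b _; rewrite /unitC eqxx conjc1 mul1r.
  by rewrite (prod_tnth (in_tuple u)).
rewrite big1 // => b _; rewrite -val_eqE /= in au.
by rewrite /unitC (negPf au) conjc0 !mul0r.
Qed.

Lemma contract1 a : contract G 1 (om q [:: a]) mu = \sum_b G a b *: iota_b b.
Proof.
apply: funext => w; rewrite sum_funE om1.
apply: etrans (contract_unit [:: a] _ _) _.
rewrite (sum_1tuple (fun x => gprod [:: a] x * mu (x ++ w))).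
by apply: eq_bigr => b _; rewrite tensZ /= mulr1 mu_tail.
Qed.

Definition bfac (b : gen) : R := pev (lm (bexp b) 1%ZZ).

Lemma bfacE b : bfac b = match b with wm => q ^+ 2 | wp => q ^- 2 | _ => 1 end.
Proof. by case: b; rewrite /bfac; pev_norm; rewrite ?qs; solve [ring | field; exact: s0]. Qed.

Lemma bfac_bar b : bfac b * bfac (bar b) = 1.
Proof.
have q0 : q != 0 by rewrite qs expf_neq0.
by case: b; rewrite !bfacE /= ?mulr1 ?mulfV ?mulVf ?expf_neq0.
Qed.

Lemma bfac_barC b : (bfac b)%:C * (bfac (bar b))%:C = 1 :> C.
Proof. by have := congr1 (fun x => x%:C : C) (bfac_bar b); rewrite rmorphM. Qed.

Lemma is_form_iota b : is_form q 3 (iota_b b).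
Proof. by apply: is_form_vom; case: b. Qed.

Lemma starI_iota b : starI q 3 (iota_b b) = (bfac b)%:C *: iota_b (bar b).
Proof.
have sv : sized 3 (iov b) by case: (b).
apply: etrans (starI_vom [::] s0 qs (isT : (3 <= 4)%N) sv) _.
have /allP/(_ _ (mem_gens b)) := check_iov_bar.
move/(vsum_eq s [::] (om q)); rewrite vsum_scale // => e.
by rewrite /lin_om e (_ : 'C(4, 2) = 6)%N // -signr_odd expr0 scale1r.
Qed.

Lemma wedgeI_iota d b :
  wedgeI q 1 3 (om q [:: d]) (iota_b b) = (if d == b then bfac b else 0)%:C *: mu.
Proof.
have sv : sized 3 (iov b) by case: (b).
have -> : om q [:: d] = vom (word1 [:: d]) by rewrite /lin_om vsum_word1.
apply: etrans (wedgeI_vom [::] s0 qs (isT : (1 + 3 <= 4)%N) _ sv) _ => //.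
have /allP/(_ _ (mem_gens d))/allP/(_ _ (mem_gens b)) := check_iov_wedge.
move/(vsum_eq s [::] (om q)); rewrite /lin_om => ->.
have -> : geqb d b = (d == b) by apply/geqbP/eqP.
by case: eqP => _; rewrite /linext ?big_seq1 // big_nil scale0r.
Qed.

Lemma iota_free X Y :
  \sum_c X c *: iota_b c = \sum_c Y c *: iota_b c -> X =1 Y.
Proof.
have q0 : q != 0 by rewrite qs expf_neq0.
move=> e c; have fc := is_form_om q [:: c].
have W X' : wedgeI q 1 3 (om q [:: c]) (\sum_c X' c *: iota_b c) = (X' c * (bfac c)%:C) *: mu.
  apply: etrans (wedgeI_sumr s0 qs _ (isT : (1 + 3 <= 4)%N) _ fc) _.
    by move=> d; apply: is_formZ; apply: is_form_iota.
  rewrite (bigD1 c) //= [X in _ + X]big1 ?addr0 => [|d dc].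
    apply: etrans (wedgeIZr s0 qs _ (isT : (1 + 3 <= 4)%N) fc (is_form_iota c)) _.
    by rewrite wedgeI_iota eqxx scalerA.
  apply: etrans (wedgeIZr s0 qs _ (isT : (1 + 3 <= 4)%N) fc (is_form_iota d)) _.
  by rewrite wedgeI_iota eq_sym (negPf dc) scale0r scaler0.
have : (X c * (bfac c)%:C) *: mu = (Y c * (bfac c)%:C) *: mu by rewrite -!W e.
move/(@scale_om_inj top _ _ isT isT)/mulIf; apply.
rewrite (inj_eq (@complexI R) _ 0); apply/eqP => b0; have := bfac_bar c.
by rewrite b0 mul0r => /esym/eqP; rewrite oner_eq0.
Qed.

Definition idx1 (a : gen) : nat := match a with wm => 0 | wp => 1 | wz => 2 | w0 => 3 end.

Lemma idx1P a : exists i : 'I_(size (ebas q 1)), (ebas q 1)`_i = om q [:: a].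
Proof. by exists (@Ordinal 4 (idx1 a) ltac:(by case: a)); case: a. Qed.

Lemma hodge1 a (c : C) : hodge q G m 1 (c *: om q [:: a]) =
  \sum_b (c * conjc (z * G a b) * (bfac b)%:C) *: iota_b (bar b).
Proof.
have [i ei] := idx1P a; rewrite -ei; apply: etrans (hodge_ebas _ _ _) _ => //.
rewrite eigval_ebas // /= pev1 invr1 scale1r ei /volume.
have -> : contract G 1 (om q [:: a]) (z *: mu) = \sum_b (z * G a b) *: iota_b b.
  rewrite contractZ contract1 scaler_sumr; apply: eq_bigr => b _.
  by rewrite scalerA.
have -> : starI q (4 - 1) (\sum_b (z * G a b) *: iota_b b)
   = \sum_b conjc (z * G a b) *: ((bfac b)%:C *: iota_b (bar b)).
  apply: etrans (starI_sum s0 qs _ (isT : (3 <= 4)%N) _) _.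
    by move=> b; apply: is_formZ; apply: is_form_iota.
  apply: eq_bigr => b _; rewrite -starI_iota.
  exact: (starIZ s0 qs _ _ (is_form_iota b)).
by rewrite scaler_sumr; apply: eq_bigr => b _; rewrite !scalerA.
Qed.

Lemma barK : involutive bar. Proof. by case. Qed.

Lemma starI1 a : starI q 1 (om q [:: a]) = - om q [:: bar a].
Proof.
apply: etrans (starI_om s0 qs (isT : (size [:: a] <= 4)%N)) _.
by rewrite expr1 scaleN1r.
Qed.

(** Since w_d i_b vanishes for d <> b, the brace of w_a and w_b is the
    conjugate of a single value of G. *)
Lemma hermitian_contractionE : hermitian_contraction q G m ->
  forall a b, G a b = conjc (G b a).
Proof.
move=> H a b; rewrite -(H a b); apply: braceE.
have e1 := hodge1 b 1; rewrite scale1r in e1; rewrite e1 starI1 -scaleN1r.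
have fa := is_form_om q [:: bar a].
have fs : is_form q 3 (\sum_b0 (1 * conjc (z * G b b0) * (bfac b0)%:C) *: iota_b (bar b0)).
  by apply: is_form_sum => c; apply: is_formZ; apply: is_form_iota.
apply: etrans (wedgeIZl s0 qs _ (isT : (1 + 3 <= 4)%N) fa fs) _.
have -> : wedgeI q 1 3 (om q [:: bar a])
    (\sum_b0 (1 * conjc (z * G b b0) * (bfac b0)%:C) *: iota_b (bar b0)) =
    (conjc (z * G b a)) *: mu.
  apply: etrans (wedgeI_sumr s0 qs _ (isT : (1 + 3 <= 4)%N) _ fa) _.
    by move=> c; apply: is_formZ; apply: is_form_iota.
  rewrite (bigD1 a) //= [X in _ + X]big1 ?addr0 => [|d da].
    apply: etrans (wedgeIZr s0 qs _ (isT : (1 + 3 <= 4)%N) fa (is_form_iota _)) _.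
    rewrite wedgeI_iota eqxx /= scalerA mul1r -[X in X *: _]mulrA bfac_barC mulr1.
    by [].
  apply: etrans (wedgeIZr s0 qs _ (isT : (1 + 3 <= 4)%N) fa (is_form_iota _)) _.
  by rewrite wedgeI_iota (inj_eq (inv_inj barK)) eq_sym (negPf da) scale0r scaler0.
by rewrite /volume !scalerA conjcM conjc_z mulN1r mulNr opprK mulrC.
Qed.

(** Compared on the independent forms i_b, reality in degree 1 relates each value of
    G to the value at the conjugate letters. *)
Lemma real_contraction1 : real_contraction q G m ->
  forall a b, G a b = (bfac (bar b))%:C * conjc (G (bar a) (bar b)).
Proof.
move=> H a b; have [i ei] := idx1P a; have := H 1%N i; rewrite /= ei starI1.
have [j ej] := idx1P (bar a).
have e1 : eigval q (- om q [:: bar a]) = 1.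
  apply: eigvalE; first by rewrite oppr_eq0 -ej ebas_neq0.
  rewrite scale1r -scaleN1r antiZ -ej anti_ebas //= pev1 scale1r //.
have e2 : eigval q (om q [:: a]) = 1 by rewrite -ei eigval_ebas //= pev1.
have h2 := hodge1 a 1; rewrite scale1r in h2.
rewrite e1 e2 !scale1r -scaleN1r hodge1 h2 => e.
have eL : \sum_b (- 1 * conjc (z * G (bar a) b) * (bfac b)%:C) *: iota_b (bar b) =
    \sum_b (z * ((bfac (bar b))%:C * conjc (G (bar a) (bar b)))) *: iota_b b.
  rewrite (reindex_inj (inv_inj barK)); apply: eq_bigr => c _ /=; rewrite barK.
  by rewrite conjcM conjc_z mulN1r !mulNr opprK [_%:C * conjc _]mulrC mulrA.
have eR : starI q 3 (\sum_b (1 * conjc (z * G a b) * (bfac b)%:C) *: iota_b (bar b)) =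
    \sum_b (z * G a b) *: iota_b b.
  apply: etrans (starI_sum s0 qs _ (isT : (3 <= 4)%N) _) _.
    by move=> c; apply: is_formZ; apply: is_form_iota.
  apply: eq_bigr => c _.
  apply: etrans (starIZ s0 qs _ (isT : (3 <= 4)%N) (is_form_iota _)) _.
  rewrite starI_iota barK scalerA mul1r conjcM conjcK conjcR -[X in X *: _]mulrA bfac_barC mulr1.
  by [].
have := etrans (esym eR) (etrans (esym e) eL).
by move/iota_free/(_ b)/(mulfI z_neq0).
Qed.

End Hodge.

(** The shape of a hermitian and real contraction, as established in
    [contraction_structure]. *)
Definition gpoly (a b : gen) : lpoly :=
  match a, b with
  | wm, wm => [:: ((0, [:: 1%N]), 1)]
  | wp, wp => [:: ((4, [:: 1%N]), 1)]
  | wz, wz => [:: ((0, [:: 0%N; 1%N]), 1)]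
  | w0, w0 => [:: ((0, [:: 0%N; 0%N; 1%N]), 1)]
  | wz, w0 | w0, wz => [:: ((0, [:: 0%N; 0%N; 0%N; 1%N]), 1)]
  | _, _ => [::]
  end%ZZ.
Fixpoint gprodw (u v : seq gen) : lpoly :=
  match u, v with
  | [::], _ => lm 0%ZZ 1%ZZ
  | a :: u', b :: v' => pmul (gpoly a b) (gprodw u' v')
  | _, _ => [::]
  end.
(** The contraction of a form of degree k with the volume form, as a formal tensor with
    the parameters of G as indeterminates. *)
Definition con (v : vec) : vec :=
  vbind (fun u => vbind (fun d => vscale (gprodw u d) (word1 (drop (size u) d)))
    (vanti top)) (vbind vanti v).
(** The same contraction on ordered words, with coefficients read off at the
    pivots. *)
Definition conn (k : nat) (v : vec) : vec :=
  let c := con v in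
  [seq (b, pmul (lm 0%ZZ (pivot_sign b)) (vget (pivot b) c)) | b <- monos (4 - k)].

Definition check_con := all (fun k => all (fun v =>
   sized k (vbind vanti v) && veq (con v) (vbind vanti (conn k v))) (ebw k)) [:: 2; 3]%N.
Lemma check_conT : check_con. Proof. by vm_compute. Qed.

(** The brace of two eigenvectors before division by the eigenvalue of the second;
    [brval] supplies the eigenvalue and the sign of the two adjoints. *)
Definition brw (k i j : nat) : lpoly :=
  vget top (vwedge (vbar (nth [::] (ebw k) i)) (vbar (conn k (nth [::] (ebw k) j)))).
(** If the i-th eigenvector has the j-th one, up to sign, as adjoint, this is the
    difference of the two sides of the reality condition. *)
Definition relw (i j : nat) : vec :=
  vadd (vbar (conn 2 (nth [::] (ebw 2) j)))
       (vopp (vbar (vbar (conn 2 (nth [::] (ebw 2) i))))).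
Definition check_brw := all (fun k => all (fun v => all (fun w =>
    all (fun x => x.1 \in monos 4) (vwedge (vbar v) (vbar (conn k w))))
  (ebw k)) (ebw k)) [:: 2; 3]%N.
Lemma check_brwT : check_brw. Proof. by vm_compute. Qed.

Lemma check_ebw_bar :
  veq (vopp (vbar (nth [::] (ebw 2) 0))) (nth [::] (ebw 2) 4) &&
  veq (vopp (vbar (nth [::] (ebw 2) 2))) (nth [::] (ebw 2) 5).
Proof. by vm_compute. Qed.

Definition pterm (e c : Z) (l : seq nat) : mon * Z := ((e, l), c).

Section EvalFour.
Variables (R : realType) (s al ga nu ep : R).
Let g := [:: al; ga; nu; ep].
Local Notation pev := (lpeval s g).

Lemma pev_cons4 e l c P :
  pev (((e, l), c) :: P) = (int_of_Z c)%:~R * (s ^ (int_of_Z e) *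
    (al ^+ nth 0%N l 0 * ga ^+ nth 0%N l 1 * nu ^+ nth 0%N l 2 * ep ^+ nth 0%N l 3)) + pev P.
Proof.
by rewrite /lpeval big_cons /mev /= !big_ord_recl big_ord0 /= mulr1 !mulrA.
Qed.

End EvalFour.

Ltac pev_norm4 :=
  rewrite ?(pev_cons4, pev_nil) /=;
  repeat match goal with |- context [int_of_Z ?z] =>
    let v := eval vm_compute in (int_of_Z z) in change (int_of_Z z) with v end;
  repeat match goal with |- context [Pos.to_nat ?z] =>
    let v := eval vm_compute in (Pos.to_nat z) in change (Pos.to_nat z) with v end;
  rewrite /intmul /exprz /= ?NegzE.

Section Structured.
Variables (R : realType) (q s : R).
Hypotheses (s0 : s != 0) (qs : q = s ^+ 2).
Hypotheses (q2_neq1 : q ^+ 2 != 1) (q4_neq1 : q ^+ 4 != 1).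
Variables (al ga nu ep : R).
Let g := [:: al; ga; nu; ep].
Local Notation C := R[i].
Local Notation vsum := (linext s g).
Local Notation vom := (lin_om q s g).
Local Notation pev := (lpeval s g).
Variables (G : gen -> gen -> C) (m : R).
Hypotheses (m0 : m != 0) (GE : forall a b, G a b = (pev (gpoly a b))%:C).
Local Notation z := ('i * m%:C).
Local Notation mu := (om q top).

Lemma gprod_pev u v : gprod G u v = (pev (gprodw u v))%:C.
Proof.
elim: u v => [|a u IH] [|b v] //=; rewrite ?pev1 ?pev_nil //.
by rewrite pev_mul // GE IH rmorphM.
Qed.

Lemma contract_units u d w :
  contract G (size u) (unitC R u) (unitC R d) w =
  gprod G u d * unitC R (drop (size u) d) w.
Proof.
rewrite contract_unit /unitC.
case: (leqP (size u) (size d)) => ud; last first.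
  rewrite big1 => [|b _].
    elim: u d ud => [|a u IH] [|b d] //= ud; first by rewrite mul0r.
    by rewrite -mulrA -IH ?mulr0.
  case: eqP => e; last by rewrite mulr0.
  by move: ud; rewrite -e size_cat size_tuple ltnNge leq_addr.
have sd : size (take (size u) d) == size u by rewrite size_takel.
rewrite (bigD1 (Tuple sd)) //= [X in _ + X]big1 ?addr0 => [|b bd].
  have -> : (take (size u) d ++ w == d) = (w == drop (size u) d).
    by rewrite -{2}(cat_take_drop (size u) d) eqseq_cat // eqxx.
  congr (_ * _); elim: u d ud {sd} => [|a u IH] [|b d] //= ud.
  by rewrite IH.
rewrite -val_eqE /= in bd; rewrite -{1}(cat_take_drop (size u) d) eqseq_cat.
  by rewrite (negPf bd) mulr0.
by rewrite size_tuple size_takel.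
Qed.

Lemma conjc_vsum (f : seq gen -> R[i]^o) v :
  conjc (vsum f v) = \sum_(x <- v) (pev x.2)%:C * (conjc (f x.1) : C).
Proof.
rewrite /linext; elim: v => [|x v IH]; first by rewrite !big_nil; exact: conjc0.
rewrite !big_cons -IH; apply: etrans (conjcD _ _) _; congr (_ + _).
by rewrite conjcZ conjcR.
Qed.

Lemma contract_vsum k v (y : invform R) w :
  contract G k (vsum (unitC R) v) y w =
  \sum_(x <- v) (pev x.2)%:C * (contract G k (unitC R x.1) y w : C).
Proof.
rewrite /contract.
have E (a b : k.-tuple gen) :
   conjc (vsum (unitC R) v a) * (\prod_(j < k) G (tnth a j) (tnth b j)) * y (b ++ w) =
   \sum_(x <- v) (pev x.2)%:C * ((conjc (unitC R x.1 a) *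
      (\prod_(j < k) G (tnth a j) (tnth b j)) * y (b ++ w)) : C) :> C.
  rewrite vsum_fun conjc_vsum !mulr_suml; apply: eq_bigr => x _.
  by rewrite -!mulrA.
apply: (etrans (eq_bigr _ (fun a _ => eq_bigr _ (fun b _ => E a b)))).
under [RHS]eq_bigr => x _ do rewrite mulr_sumr.
rewrite [RHS]exchange_big; apply: eq_bigr => a _ /=.
under [RHS]eq_bigr => x _ do rewrite mulr_sumr.
by rewrite [RHS]exchange_big.
Qed.

Lemma contract_vsumr k (x : invform R) v w :
  contract G k x (vsum (unitC R) v) w =
  \sum_(d <- v) (pev d.2)%:C * (contract G k x (unitC R d.1) w : C).
Proof.
rewrite /contract.
have E (a b : k.-tuple gen) :
   conjc (x a) * (\prod_(j < k) G (tnth a j) (tnth b j)) * vsum (unitC R) v (b ++ w) =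
   \sum_(d <- v) (pev d.2)%:C * ((conjc (x a) *
      (\prod_(j < k) G (tnth a j) (tnth b j)) * unitC R d.1 (b ++ w)) : C) :> C.
  rewrite vsum_fun /linext mulr_sumr; apply: eq_bigr => d _.
  exact: mulrCA.
apply: (etrans (eq_bigr _ (fun a _ => eq_bigr _ (fun b _ => E a b)))).
under [RHS]eq_bigr => d _ do rewrite mulr_sumr.
rewrite [RHS]exchange_big; apply: eq_bigr => a _ /=.
under [RHS]eq_bigr => d _ do rewrite mulr_sumr.
by rewrite [RHS]exchange_big.
Qed.

Lemma contract_con k v : sized k (vbind vanti v) ->
  contract G k (vsum (unitC R) (vbind vanti v)) mu = vsum (unitC R) (con v).
Proof.
move=> sv; apply: funext => w; rewrite contract_vsum.
have -> : mu = vsum (unitC R) (vanti top) by apply: (vanti_sound g s0 qs).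
rewrite (vsum_bind _ s0) vsum_fun.
transitivity (vsum (fun u => contract G k (unitC R u) (vsum (unitC R) (vanti top)) w
   : C^o) (vbind vanti v)) => //.
apply: (eq_vsum_in _ _ (P := fun u => size u == k) sv) => u /eqP su.
rewrite contract_vsumr (vsum_bind _ s0) vsum_fun.
transitivity (vsum (fun d => contract G k (unitC R u) (unitC R d) w : C^o)
   (vanti top)) => //.
apply: eq_vsum => d; rewrite -su contract_units vsum_scale // vsum_word1 tensZ.
by rewrite gprod_pev.
Qed.

Lemma vom_unit k v : (k <= 4)%N -> sized k v ->
  vom v = vsum (unitC R) (vbind vanti v).
Proof.
move=> k4 sv; rewrite vsum_bind //.
apply: (eq_vsum_in _ _ (P := fun u => size u == k) sv) => u /eqP su.
by apply: (vanti_sound g s0 qs); rewrite su.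
Qed.

Lemma conn_sized k v : sized (4 - k) (conn k v).
Proof.
by rewrite /sized /conn all_map; apply/allP => b /monos_size /= ->.
Qed.

Lemma contract_ebas k (i : 'I_(size (ebas q k))) : k \in [:: 2; 3]%N ->
  contract G k (ebas q k)`_i mu = vom (conn k (nth [::] (ebw k) i)).
Proof.
move=> k23; have k4 : (k <= 4)%N by move: k23; rewrite !inE => /orP [] /eqP ->.
have ik : (i < size (ebw k))%N by rewrite -(ebas_size g s0 qs k4).
rewrite (ebas_nth g s0 qs k4 (ltn_ord i)).
have sv := ebw_sized k i; have vm := mem_nth [::] ik.
move: (nth _ _ _) sv vm => v sv vm.
have /allP/(_ _ k23)/allP/(_ _ vm)/andP [sw /(vsum_eq s g (unitC R)) e] := check_conT.
rewrite (vom_unit k4 sv) contract_con // e.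
by rewrite -(vom_unit (k := (4 - k)%N)) ?leq_subr // conn_sized.
Qed.

Hypothesis q_gt0 : 0 < q.

Definition lam (k i : nat) : R := lpeval s [::] (eigw k i).

Lemma lamE k i : lam k i = match k with
  | 2 => if (i < 3)%N then 1 + q ^+ 2 else 1 + q ^- 2
  | 3 => 2 + 2 * q ^+ 2 + 2 * q ^- 2
  | _ => 1
  end.
Proof.
case: k => [|[|[|[|k]]]]; rewrite /lam /eigw ?pev1 //; last first.
  by pev_norm; rewrite qs; field; exact: s0.
by case: ifP => _; pev_norm; rewrite qs; solve [ring | field; exact: s0].
Qed.

Lemma lam_gt0 k i : 0 < lam k i.
Proof.
have q2 : 0 < q ^+ 2 by apply: exprn_gt0.
have q2i : 0 < q ^- 2 by rewrite invr_gt0.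
rewrite lamE; case: k => [|[|[|[|k]]]] //; last by lra.
by case: ifP => _; lra.
Qed.

Lemma starI_ebas k (i : 'I_(size (ebas q k))) : (k <= 4)%N ->
  starI q k (ebas q k)`_i = (-1) ^+ 'C(k.+1, 2) *: vom (vbar (nth [::] (ebw k) i)).
Proof.
move=> k4; rewrite (ebas_nth g s0 qs k4 (ltn_ord i)).
by apply: (starI_vom g s0 qs k4); apply: ebw_sized.
Qed.

Lemma starI_contract k (i : 'I_(size (ebas q k))) : k \in [:: 2; 3]%N ->
  starI q (4 - k)%N (contract G k (ebas q k)`_i (volume q m)) =
  (- z * (-1) ^+ 'C((4 - k).+1, 2)) *: vom (vbar (conn k (nth [::] (ebw k) i))).
Proof.
move=> k23; have sv := conn_sized k (nth [::] (ebw k) i).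
have k4 := leq_subr k 4.
have -> : contract G k (ebas q k)`_i (volume q m) = z *: vom (conn k (nth [::] (ebw k) i)).
  by rewrite /volume contractZ contract_ebas.
apply: etrans (starIZ s0 qs _ k4 (is_form_vom q s g sv)) _.
by rewrite (starI_vom g s0 qs k4 sv) scalerA conjc_z.
Qed.

Lemma hodge_con k (i : 'I_(size (ebas q k))) : k \in [:: 2; 3]%N ->
  hodge q G m k (ebas q k)`_i = (((lam k i)^-1)%:C * (- z * (-1) ^+ 'C((4 - k).+1, 2))) *:
    vom (vbar (conn k (nth [::] (ebw k) i))).
Proof.
move=> k23; have k3 : (k <= 3)%N by move: k23; rewrite !inE => /orP [] /eqP ->.
have := hodge_ebas s0 qs q2_neq1 q4_neq1 G m i 1 (leqW k3); rewrite !scale1r => ->.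
rewrite starI_contract // scalerA (eigval_ebas s0 qs q2_neq1 q4_neq1 _ k3).
by rewrite -[_^-1](fmorphV (real_complex R)).
Qed.

Lemma vbar_sized k v : (k <= 4)%N -> sized k v -> sized k (vbar v).
Proof.
move=> k4 /allP sv; apply: (keys_bind (P := fun u => size u == k)) => x /sv /eqP sx.
apply/allP => y; have := @nf_keys (barw x.1); rewrite size_barw sx => /(_ k4) /allP h.
by move=> /h /monos_size ->.
Qed.

Lemma wedge_top k i j : k \in [:: 2; 3]%N -> (i < size (ebw k))%N -> (j < size (ebw k))%N ->
  wedgeI q k (4 - k)%N (vom (vbar (nth [::] (ebw k) i)))
     (vom (vbar (conn k (nth [::] (ebw k) j)))) = (pev (brw k i j))%:C *: mu.
Proof.
move=> k23 ik jk; have k4 : (k <= 4)%N by move: k23; rewrite !inE => /orP [] /eqP ->.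
have kk : (k + (4 - k) <= 4)%N by rewrite subnKC.
have sA : sized k (vbar (nth [::] (ebw k) i)) by apply: vbar_sized => //; apply: ebw_sized.
have sB : sized (4 - k) (vbar (conn k (nth [::] (ebw k) j))).
  by apply: vbar_sized; [exact: leq_subr|exact: conn_sized].
apply: etrans (wedgeI_vom g s0 qs kk sA sB) _.
have /allP/(_ _ k23)/allP/(_ _ (mem_nth [::] ik))/allP/(_ _ (mem_nth [::] jk)) h := check_brwT.
by rewrite (vom_monos q s g h) big_seq1.
Qed.

Definition brval (k i j : nat) : R :=
  - (-1) ^+ ('C(k.+1, 2) + 'C((4 - k).+1, 2)) * (lam k j)^-1 * pev (brw k i j).

Lemma wedge_ebas k (i j : 'I_(size (ebas q k))) : k \in [:: 2; 3]%N ->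
  wedgeI q k (4 - k)%N (starI q k (ebas q k)`_i) (hodge q G m k (ebas q k)`_j) =
  (brval k i j)%:C *: volume q m.
Proof.
move=> k23; have k4 : (k <= 4)%N by move: k23; rewrite !inE => /orP [] /eqP ->.
have kk : (k + (4 - k) <= 4)%N by rewrite subnKC.
have ik : (i < size (ebw k))%N by rewrite -(ebas_size g s0 qs k4).
have jk : (j < size (ebw k))%N by rewrite -(ebas_size g s0 qs k4).
have fA : is_form q k (vom (vbar (nth [::] (ebw k) i))).
  by apply: is_form_vom; apply: vbar_sized => //; apply: ebw_sized.
have fB : is_form q (4 - k) (vom (vbar (conn k (nth [::] (ebw k) j)))).
  by apply: is_form_vom; apply: vbar_sized; [exact: leq_subr|exact: conn_sized].
rewrite /brval.
have -> : starI q k (ebas q k)`_i = (-1) ^+ 'C(k.+1, 2) *: vom (vbar (nth [::] (ebw k) i)).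
  exact: starI_ebas.
rewrite hodge_con //.
apply: etrans (wedgeIZl s0 qs _ kk fA (is_formZ _ fB)) _.
apply: etrans (congr1 _ (wedgeIZr s0 qs _ kk fA fB)) _.
rewrite wedge_top // /volume !scalerA; congr (_ *: _).
have -> a b (l p : R) : (- (-1) ^+ (a + b) * l * p)%:C =
    - ((-1) ^+ a * (-1) ^+ b) * l%:C * p%:C :> C.
  by rewrite !rmorphM rmorphN rmorphXn rmorphN1 exprD.
move: ((-1) ^+ _) ((-1) ^+ _) (_ %:C) (_ %:C) => x y u v.
by ring.
Qed.

Lemma brace_ebas k (i j : 'I_(size (ebas q k))) : k \in [:: 2; 3]%N ->
  brace q G m k (ebas q k)`_i (ebas q k)`_j = (brval k i j)%:C.
Proof. by move=> k23; apply: (braceE s0 qs m0); apply: wedge_ebas. Qed.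

Lemma lcomb_sum k (X : {ffun 'I_(size (ebas q k)) -> C^o}) :
  lcomb X = \sum_(i < size (ebas q k)) (X i : C) *: (ebas q k)`_i.
Proof.
apply: funext => w; rewrite sum_funE /lcomb; apply: eq_bigr => i _.
exact: mulrC.
Qed.

Lemma is_form_hodge k (i : 'I_(size (ebas q k))) : k \in [:: 2; 3]%N ->
  is_form q (4 - k) (hodge q G m k (ebas q k)`_i).
Proof.
move=> k23; rewrite hodge_con //; apply: is_formZ; apply: is_form_vom.
by apply: vbar_sized; [exact: leq_subr|exact: conn_sized].
Qed.

Lemma brace_lcomb k (X Y : {ffun 'I_(size (ebas q k)) -> C^o}) : k \in [:: 2; 3]%N ->
  brace q G m k (lcomb X) (lcomb Y) =
  \sum_i \sum_j conjc (X i) * (Y j : C) * brace q G m k (ebas q k)`_i (ebas q k)`_j.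
Proof.
move=> k23; have k4 : (k <= 4)%N by move: k23; rewrite !inE => /orP [] /eqP ->.
have kk : (k + (4 - k) <= 4)%N by rewrite subnKC.
have fe (i : 'I_(size (ebas q k))) : is_form q k (ebas q k)`_i.
  by apply: (is_form_ebas g s0 qs).
have fs (i : 'I_(size (ebas q k))) : is_form q k (starI q k (ebas q k)`_i).
  exact: (is_form_starI s0 qs k4 (fe i)).
have fh (i : 'I_(size (ebas q k))) := is_form_hodge i k23.
apply: (braceE s0 qs m0).
have eX : starI q k (lcomb X) = \sum_i conjc (X i) *: starI q k (ebas q k)`_i.
  rewrite lcomb_sum; apply: etrans (starI_sum s0 qs _ k4 _) _.
    by move=> i; apply: is_formZ.
  by apply: eq_bigr => i _; exact: (starIZ s0 qs _ k4 (fe i)).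
have eY : hodge q G m k (lcomb Y) = \sum_j (Y j : C) *: hodge q G m k (ebas q k)`_j.
  apply: etrans (hodge_lcomb s0 qs q2_neq1 q4_neq1 G m Y k4) _.
  apply: eq_bigr => j _; congr (_ *: _).
  have := hodge_ebas s0 qs q2_neq1 q4_neq1 G m j 1 k4.
  by rewrite !scale1r => ->.
rewrite eX eY scaler_suml.
apply: etrans (wedgeI_suml s0 qs _ kk _ _) _.
- by move=> i; apply: is_formZ.
- by apply: is_form_sum => j; apply: is_formZ.
apply: eq_bigr => i _.
apply: etrans (wedgeI_sumr s0 qs _ kk _ _) _.
- by move=> j; apply: is_formZ.
- by apply: is_formZ.
rewrite scaler_suml; apply: eq_bigr => j _.
apply: etrans (wedgeIZl s0 qs _ kk (fs i) (is_formZ _ (fh j))) _.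
apply: etrans (congr1 _ (wedgeIZr s0 qs _ kk (fs i) (fh j))) _.
apply: etrans (congr1 _ (congr1 _ (wedge_ebas i j k23))) _.
by rewrite brace_ebas // !scalerA mulrA.
Qed.

Lemma vom_coord0 k v : (k <= 4)%N -> all (fun x => x.1 \in monos k) v ->
  vom v = 0 -> forall b, b \in monos k -> pev (vget b v) = 0.
Proof.
move=> k4 kv e b bk; have := congr1 (fun t => t (pivot b)) e.
rewrite (vom_monos q s g kv) sum_funE (bigD1_seq b) ?monos_uniq //=.
rewrite tensZ (om_pivot g s0 qs k4 bk bk) eqxx big_seq_cond big1.
  rewrite addr0 => /eqP; rewrite mulf_eq0 !(inj_eq (@complexI R) _ 0).
  by rewrite (negPf (psign_neq0 R b)) orbF => /eqP.
move=> c /andP [ck cb]; rewrite tensZ (om_pivot g s0 qs k4 ck bk) (negPf cb).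
exact: mulr0.
Qed.

Lemma pev_eq P Q : pzero (padd P (popp Q)) -> pev P = pev Q.
Proof. by move/(pev0 s g); rewrite pev_add pev_opp => /eqP; rewrite subr_eq0 => /eqP. Qed.

Lemma brw200 : pev (brw 2 0 0) = - ((q ^+ 2 + q ^- 2) * al * nu).
Proof.
rewrite (@pev_eq _ [:: pterm 4 (-1) [:: 1; 0; 1]; pterm (-4) (-1) [:: 1; 0; 1]]%N%ZZ) //.
by rewrite /pterm; pev_norm4; rewrite qs; field; exact: s0.
Qed.

Lemma brw244 : pev (brw 2 4 4) = - ((1 + q ^+ 4) * al * nu).
Proof.
rewrite (@pev_eq _ [:: pterm 0 (-1) [:: 1; 0; 1]; pterm 8 (-1) [:: 1; 0; 1]]%N%ZZ) //.
by rewrite /pterm; pev_norm4; rewrite qs; ring.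
Qed.

Lemma brw222 i : i \in [:: 2; 5]%N -> pev (brw 2 i i) =
  2 * ep ^+ 2 - (q ^+ 2 + q ^- 2) * ga * nu - 2 * (1 - q ^+ 2) ^+ 2 * al ^+ 2.
Proof.
move=> i25; rewrite (@pev_eq _ [:: pterm 0 2 [:: 0; 0; 0; 2]; pterm 4 (-1) [:: 0; 1; 1];
  pterm (-4) (-1) [:: 0; 1; 1]; pterm 8 (-2) [:: 2]; pterm 4 4 [:: 2]; pterm 0 (-2) [:: 2]]%N%ZZ).
  by rewrite /pterm; pev_norm4; rewrite qs; field; exact: s0.
by move: i25; rewrite !inE => /orP [] /eqP ->.
Qed.

Lemma brw225 : pev (brw 2 2 5) =
  (1 + q ^- 4) * ep ^+ 2 - 2 * q ^- 2 * ga * nu + 2 * q ^- 2 * (1 - q ^+ 2) ^+ 2 * al ^+ 2.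
Proof.
rewrite (@pev_eq _ [:: pterm 0 1 [:: 0; 0; 0; 2]; pterm (-8) 1 [:: 0; 0; 0; 2];
  pterm (-4) (-2) [:: 0; 1; 1]; pterm 0 (-4) [:: 2]; pterm (-4) 2 [:: 2]; pterm 4 2 [:: 2]]%N%ZZ) //.
by rewrite /pterm; pev_norm4; rewrite qs; field; exact: s0.
Qed.

Lemma brw252 : pev (brw 2 5 2) =
  (1 + q ^+ 4) * ep ^+ 2 - 2 * q ^+ 2 * ga * nu + 2 * q ^+ 2 * (1 - q ^+ 2) ^+ 2 * al ^+ 2.
Proof.
rewrite (@pev_eq _ [:: pterm 0 1 [:: 0; 0; 0; 2]; pterm 8 1 [:: 0; 0; 0; 2];
  pterm 4 (-2) [:: 0; 1; 1]; pterm 12 2 [:: 2]; pterm 8 (-4) [:: 2]; pterm 4 2 [:: 2]]%N%ZZ) //.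
by rewrite /pterm; pev_norm4; rewrite qs; ring.
Qed.

Lemma brw300 : pev (brw 3 0 0) =
  nu * ((4 * q ^+ 2 + q ^- 2 + q ^+ 6) * al ^+ 2 + ga * nu).
Proof.
rewrite (@pev_eq _ [:: pterm 4 4 [:: 2; 0; 1]; pterm (-4) 1 [:: 2; 0; 1]; pterm 12 1 [:: 2; 0; 1];
  pterm 0 1 [:: 0; 1; 2]]%N%ZZ) //.
by rewrite /pterm; pev_norm4; rewrite qs; field; exact: s0.
Qed.

Lemma eig_hodge2 (i : 'I_(size (ebas q 2))) :
  eigval q (ebas q 2)`_i *: hodge q G m 2 (ebas q 2)`_i =
  z *: vom (vbar (conn 2 (nth [::] (ebw 2) i))).
Proof.
have sgn3 : (-1) ^+ 'C((4 - 2).+1, 2) = -1 :> C.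
  by rewrite (_ : 'C((4 - 2).+1, 2) = 3)%N // -signr_odd expr1.
rewrite hodge_con // sgn3 (eigval_ebas s0 qs q2_neq1 q4_neq1) // -/(lam 2 i) scalerA.
congr (_ *: _); rewrite mulrN1 opprK mulrA.
have : (lam 2 i * (lam 2 i)^-1)%:C = 1 :> C by rewrite mulfV // gt_eqF // lam_gt0.
by rewrite rmorphM /= => ->; rewrite mul1r.
Qed.

Lemma real_contraction2 (i j : 'I_(size (ebas q 2))) : real_contraction q G m ->
  starI q 2 (ebas q 2)`_i = (ebas q 2)`_j ->
  vom (relw i j) = 0.
Proof.
move=> H e.
have E0 : eigval q (ebas q 2)`_j *: hodge q G m 2 (ebas q 2)`_j =
   starI q 2 (eigval q (ebas q 2)`_i *: hodge q G m 2 (ebas q 2)`_i).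
  by rewrite -{1 2}e; exact: (H 2%N i).
have sv := conn_sized 2 (nth [::] (ebw 2) i).
have sb : sized 2 (vbar (conn 2 (nth [::] (ebw 2) i))) by apply: vbar_sized.
have E1 := etrans (esym (eig_hodge2 j)) (etrans E0 (congr1 (starI q 2) (eig_hodge2 i))).
have E2 := etrans E1 (etrans (starIZ s0 qs _ (isT : (2 <= 4)%N) (is_form_vom q s g sb))
   (congr1 _ (starI_vom g s0 qs (isT : (2 <= 4)%N) sb))).
have sgn3 : (-1) ^+ 'C(3, 2) = -1 :> C.
  by rewrite (_ : 'C(3, 2) = 3)%N // -signr_odd expr1.
move: E2; rewrite conjc_z sgn3 scaleN1r scalerN scaleNr opprK.
move/(scalerI (z_neq0 m0)) => E3.
rewrite /relw /lin_om vsum_add // vsum_opp //; apply/eqP; rewrite subr_eq0; apply/eqP.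
exact: E3.
Qed.

End Structured.

(** * Hermitian and real contractions *)

Section Contractions.
Variables (R : realType) (q : R).
Hypotheses (q_gt0 : 0 < q) (q_lt1 : q < 1).
Local Notation C := R[i].
Let s := Num.sqrt q.

Lemma s_neq0 : s != 0.
Proof. by rewrite sqrtr_eq0 -ltNge. Qed.
Lemma q_sqr : q = s ^+ 2.
Proof. by rewrite sqr_sqrtr // ltW. Qed.
Lemma qX_lt1 n : (0 < n)%N -> q ^+ n < 1.
Proof. by move=> n0; rewrite exprn_ilt1 ?ltW // -lt0n. Qed.
Lemma qX_neq1 n : (0 < n)%N -> q ^+ n != 1.
Proof. by move=> n0; rewrite lt_eqF // qX_lt1. Qed.
Lemma q_neq0 : q != 0. Proof. by rewrite gt_eqF. Qed.

Local Notation s0 := s_neq0.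
Local Notation qs := q_sqr.
Local Notation q2 := (qX_neq1 (isT : (0 < 2)%N)).
Local Notation q4 := (qX_neq1 (isT : (0 < 4)%N)).

Variables (G : gen -> gen -> C) (m : R).
Hypotheses (m0 : m != 0).
Local Notation z := ('i * m%:C).
Local Notation mu := (om q top).

Lemma conjc_fixed (x : C) : x = conjc x -> exists r, x = r%:C.
Proof.
case: x => a b /eqP; rewrite eq_complex /= => /andP [_ /eqP e].
by exists a; apply/eqP; rewrite eq_complex /= eqxx /=; apply/eqP; lra.
Qed.

(** Each of hermiticity and reality relates G a b to one other value.  Together
    they equate G a b with a power of q times itself, and this power differs from 1
    unless a and b are equal or both are 0 or z. *)
Lemma contraction_structure : hermitian_contraction q G m -> real_contraction q G m ->
  exists al ga nu ep, forall a b, G a b = (lpeval s [:: al; ga; nu; ep] (gpoly a b))%:C.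
Proof.
move=> /(hermitian_contractionE s0 qs q2 q4 m0) H.
move=> /(real_contraction1 s0 qs q2 q4 m0) K.
(* Hermiticity, reality, hermiticity, reality: four symmetries which compose to the
   identity on indices. *)
have KK a b : G a b = (bfac s (bar b))%:C * (bfac s a)%:C * G a b.
  rewrite {1}K -H {1}K -H !barK mulrA; congr (_ * _).
have bE b : bfac s b = match b with wm => q ^+ 2 | wp => q ^- 2 | _ => 1 end.
  exact: (bfacE s0 qs).
have off a b : bfac s (bar b) * bfac s a != 1 -> G a b = 0.
  move=> ne; have := KK a b => /eqP.
  rewrite -{1}[G a b]mul1r -subr_eq0 -mulrBl mulf_eq0 => /orP [|/eqP //].
  rewrite subr_eq0 => /eqP e; case/eqP: ne; apply: (@complexI R).
  by rewrite rmorphM /= -e.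
have q2n : q ^+ 2 != 1 := q2.
have q2i : q ^- 2 != 1 by rewrite invr_eq1.
have q4n : q ^+ 2 * q ^+ 2 != 1 by rewrite -exprD q4.
have q4i : q ^- 2 * q ^- 2 != 1 by rewrite -invfM invr_eq1.
have [al eal] := conjc_fixed (H wm wm).
have [ga ega] := conjc_fixed (H wz wz).
have [nu enu] := conjc_fixed (H w0 w0).
have ez0 : G wz w0 = G w0 wz by rewrite K -H bE /= mul1r.
have [ep eep] : exists r, G wz w0 = r%:C by apply: conjc_fixed; rewrite {1}ez0 H.
exists al, ga, nu, ep => a b.
have p0 : lpeval s [:: al; ga; nu; ep] [::] = 0 := pev_nil _ _.
have pv c l : lpeval s [:: al; ga; nu; ep] [:: ((c, l), 1%ZZ)] = s ^ (int_of_Z c) *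
    (al ^+ nth 0%N l 0 * ga ^+ nth 0%N l 1 * nu ^+ nth 0%N l 2 * ep ^+ nth 0%N l 3).
  by rewrite pev_cons4 p0 addr0 mul1r.
have epp : G wp wp = (q ^+ 2 * al)%:C.
  by rewrite K /= eal conjcR bE; exact/esym/(rmorphM (real_complex R)).
case: a; case: b; rewrite /gpoly ?p0 ?pv /= ?expr0z ?expr0 ?expr1 ?mulr1 ?mul1r //;
  try (by apply: off; rewrite !bE /= ?mulr1 ?mul1r).
- by rewrite epp qs -exprM.
- by rewrite -ez0.
Qed.

(** ** Consequences used for the Hodge operators *)

Hypotheses (ndG : nondegenerate_contraction G) (hermG : hermitian_contraction q G m)
  (realG : real_contraction q G m).

Lemma G_neq0 a : exists b, G a b != 0.
Proof.
apply: contrapT => h; move: ndG; rewrite /nondegenerate_contraction.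
set A := (X in X \in unitmx) => uA.
have : row (enum_rank a) A = 0.
  apply/rowP => j; rewrite !mxE enum_rankK; apply/eqP; apply/negPn/negP => ne.
  by apply: h; exists (enum_val j).
move=> r0; have : row (enum_rank a) (A *m invmx A) = 0 by rewrite row_mul r0 mul0mx.
rewrite mulmxV // => /rowP /(_ (enum_rank a)); rewrite !mxE eqxx => /eqP.
by rewrite oner_eq0.
Qed.

(** The two relations are the coefficients at w_+ w_0 and w_0 w_z of the reality
    condition on two eigenvectors of degree 2.  If epsilon vanished, the first
    would give nu = 0 and then the second alpha = 0, against nondegeneracy. *)
Lemma contraction_facts : exists al ga nu ep,
  [/\ forall a b, G a b = (lpeval s [:: al; ga; nu; ep] (gpoly a b))%:C,
      al != 0, ep != 0 /\ nu != 0,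
      2 * nu + (q ^+ 2 - q ^- 2) * ep = 0
    & (q ^+ 2 + q ^- 2) * ep ^+ 2 - 2 * ga * nu + 2 * (1 - q ^+ 2) ^+ 2 * al ^+ 2 = 0].
Proof.
have [al [ga [nu [ep GE]]]] := contraction_structure hermG realG.
exists al, ga, nu, ep.
pose g := [:: al; ga; nu; ep].
have al0 : al != 0.
  have [b] := G_neq0 wm; rewrite GE; apply: contra => /eqP al0.
  by case: b; rewrite /= ?pev_nil ?pev_cons4 ?pev_nil //= al0 expr1 !mul0r mulr0 mulr0 addr0.
have key (i j : nat) (ij : (i, j) \in [:: (0, 4); (2, 5)]%N) b : b \in monos 2 ->
    lpeval s g (vget b (relw i j)) = 0.
  have iP : (i < size (ebas q 2))%N by move: ij; rewrite !inE => /orP [] /eqP [-> _].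
  have jP : (j < size (ebas q 2))%N by move: ij; rewrite !inE => /orP [] /eqP [_ ->].
  apply: (vom_coord0 s0 qs) => //; last first.
    apply: (real_contraction2 s0 qs q2 q4 m0 GE q_gt0 (i := Ordinal iP) (j := Ordinal jP) realG).
    apply: etrans (starI_ebas s0 qs al ga nu ep (Ordinal iP) (isT : (2 <= 4)%N)) _.
    have sgn3 : (-1) ^+ 'C(3, 2) = -1 :> C.
      by rewrite (_ : 'C(3, 2) = 3)%N // -signr_odd expr1.
    rewrite sgn3 scaleN1r (ebas_nth g s0 qs (isT : (2 <= 4)%N) jP) /=.
    have /andP [c1 c2] := check_ebw_bar.
    move: ij; rewrite !inE => /orP [] /eqP [-> ->].
      exact: (etrans (esym (vsum_opp s g (om q) _)) (vsum_eq s g (om q) c1)).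
    exact: (etrans (esym (vsum_opp s g (om q) _)) (vsum_eq s g (om q) c2)).
have e1 := key 0%N 4%N isT [:: wp; w0] isT.
have e2 := key 2%N 5%N isT [:: w0; wz] isT.
rewrite (@pev_eq _ s al ga nu ep _ [:: pterm 8 (-1) [:: 1; 0; 0; 1]; pterm 4 (-1) [:: 1; 0; 0; 1];
  pterm 4 (-2) [:: 1; 0; 1]; pterm 0 1 [:: 1; 0; 0; 1]; pterm 0 (-2) [:: 1; 0; 1];
  pterm (-4) 1 [:: 1; 0; 0; 1]]%N%ZZ) in e1; last by vm_compute.
rewrite (@pev_eq _ s al ga nu ep _ [:: pterm (-4) 1 [:: 0; 0; 0; 2]; pterm 0 (-2) [:: 0; 1; 1];
  pterm 4 1 [:: 0; 0; 0; 2]; pterm 4 (-4) [:: 2]; pterm 0 2 [:: 2]; pterm 8 2 [:: 2]]%N%ZZ) in e2;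
  last by vm_compute.
have E1 : 2 * nu + (q ^+ 2 - q ^- 2) * ep = 0.
  (* The coefficient checked is - (1 + q^2) alpha times the first relation. *)
have n0 : - (1 + q ^+ 2) * al != 0.
    rewrite mulf_neq0 // oppr_eq0 gt_eqF //.
    by have := exprn_gt0 2 q_gt0; lra.
  apply: (mulfI n0); rewrite mulr0 -[RHS]e1 /pterm; pev_norm4; rewrite qs.
  by field; exact: s0.
have E2 : (q ^+ 2 + q ^- 2) * ep ^+ 2 - 2 * ga * nu + 2 * (1 - q ^+ 2) ^+ 2 * al ^+ 2 = 0.
  rewrite -[RHS]e2 /pterm; pev_norm4; rewrite qs.
  by field; exact: s0.
split=> //.
have q2lt := qX_lt1 (isT : (0 < 2)%N).
have ep0 : ep != 0.
  apply/eqP => z0; move: E1 E2; rewrite z0 expr0n /= !mulr0 addr0 => /eqP.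
  rewrite mulf_eq0 pnatr_eq0 /= => /eqP ->; rewrite mulr0 subr0 add0r => /eqP.
  rewrite mulf_eq0 expf_eq0 (negPf al0) andbF orbF mulf_eq0 pnatr_eq0 /= expf_eq0 /=.
  by rewrite subr_eq0 eq_sym (negPf q2).
split=> //; apply/eqP => n0; move: E1; rewrite n0 mulr0 add0r => /eqP.
rewrite mulf_eq0 (negPf ep0) orbF subr_eq0 => /eqP e.
have := q4; rewrite (exprD q 2 2) {1}e mulVf ?eqxx //.
by rewrite expf_neq0 // q_neq0.
Qed.

Lemma Gpp : G wp wp = (q ^+ 2)%:C * G wm wm.
Proof.
have [al [ga [nu [ep [GE _ _ _ _]]]]] := contraction_facts.
rewrite !GE /=; pev_norm4; rewrite qs -[RHS](rmorphM (real_complex R)); congr (_%:C).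
by ring.
Qed.

Lemma Gmm_neq0 : G wm wm != 0.
Proof.
have [al [ga [nu [ep [GE al0 _ _ _]]]]] := contraction_facts.
rewrite GE /=; pev_norm4; rewrite (inj_eq (@complexI R) _ 0).
by rewrite (_ : _ + 0 = al) //; ring.
Qed.

Lemma G00_neq0 : G w0 w0 != 0.
Proof.
have [al [ga [nu [ep [GE _ [_ nu0] _ _]]]]] := contraction_facts.
rewrite GE /=; pev_norm4; rewrite (inj_eq (@complexI R) _ 0).
by rewrite (_ : _ + 0 = nu) //; ring.
Qed.

Local Notation e2 i := ((ebas q 2)`_i).

Lemma lam_neq0 k i : (lam s k i)^-1 != 0.
Proof. by rewrite invr_eq0 gt_eqF // (lam_gt0 s0 qs q_gt0). Qed.

Lemma brace_mo_neq0 : brace q G m 2 (om q [:: wm; w0]) (om q [:: wm; w0]) != 0.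
Proof.
have [al [ga [nu [ep [GE al0 [_ nu0] _ _]]]]] := contraction_facts.
pose i : 'I_(size (ebas q 2)) := @Ordinal 6 0 isT.
have -> : om q [:: wm; w0] = e2 i by [].
rewrite (brace_ebas s0 qs q2 q4 m0 GE) // (inj_eq (@complexI R) _ 0) /brval.
rewrite mulf_neq0 ?mulf_neq0 ?oppr_eq0 ?expf_neq0 ?oppr_eq0 ?oner_eq0 ?lam_neq0 //.
rewrite (brw200 s0 qs) oppr_eq0 !mulf_neq0 // gt_eqF // addr_gt0 ?invr_gt0 ?exprn_gt0 //.
Qed.

Lemma brace_po_neq0 : brace q G m 2 (om q [:: wp; w0]) (om q [:: wp; w0]) != 0.
Proof.
have [al [ga [nu [ep [GE al0 [_ nu0] _ _]]]]] := contraction_facts.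
pose i : 'I_(size (ebas q 2)) := @Ordinal 6 4 isT.
have -> : om q [:: wp; w0] = e2 i by [].
rewrite (brace_ebas s0 qs q2 q4 m0 GE) // (inj_eq (@complexI R) _ 0) /brval.
rewrite mulf_neq0 ?mulf_neq0 ?oppr_eq0 ?expf_neq0 ?oppr_eq0 ?oner_eq0 ?lam_neq0 //.
by rewrite (brw244 qs) oppr_eq0 !mulf_neq0 // gt_eqF // addr_gt0 ?exprn_gt0.
Qed.

Lemma brace_mpo_neq0 : brace q G m 3 (om q [:: wm; wp; w0]) (om q [:: wm; wp; w0]) != 0.
Proof.
have [al [ga [nu [ep [GE al0 [ep0 nu0] _ E]]]]] := contraction_facts.
pose i : 'I_(size (ebas q 3)) := @Ordinal 4 0 isT.
have -> : om q [:: wm; wp; w0] = (ebas q 3)`_i by [].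
rewrite (brace_ebas s0 qs q2 q4 m0 GE) // (inj_eq (@complexI R) _ 0) /brval.
rewrite mulf_neq0 ?mulf_neq0 ?oppr_eq0 ?expf_neq0 ?oppr_eq0 ?oner_eq0 ?lam_neq0 //.
rewrite (brw300 s0 qs) mulf_neq0 // gt_eqF //.
have a2 : 0 < al ^+ 2 by rewrite exprn_even_gt0.
have p2 : 0 < ep ^+ 2 by rewrite exprn_even_gt0.
have x1 : 0 < q ^+ 2 by rewrite exprn_gt0.
have x2 : 0 < q ^- 2 by rewrite invr_gt0 exprn_gt0.
have x3 : 0 < q ^+ 6 by rewrite exprn_gt0.
have y1 : 0 < (q ^+ 2 + q ^- 2) * ep ^+ 2 by rewrite mulr_gt0 // addr_gt0.
have y2 : 0 <= 2 * (1 - q ^+ 2) ^+ 2 * al ^+ 2.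
  by rewrite mulr_ge0 ?(ltW a2) // mulr_ge0 // sqr_ge0.
have y3 : 0 < (4 * q ^+ 2 + q ^- 2 + q ^+ 6) * al ^+ 2.
  by rewrite mulr_gt0 // !addr_gt0 // mulr_gt0.
have : 2 * (ga * nu) = (q ^+ 2 + q ^- 2) * ep ^+ 2 + 2 * (1 - q ^+ 2) ^+ 2 * al ^+ 2.
  by rewrite mulrA; apply/eqP; rewrite -subr_eq0 -oppr_eq0 -[X in _ == X]E; apply/eqP; ring.
by move=> e; lra.
Qed.

Lemma brace_mpo_scale c : brace q G m 3 (c%:C *: om q [:: wm; wp; w0]) (c%:C *: om q [:: wm; wp; w0]) =
  (c ^+ 2)%:C * brace q G m 3 (om q [:: wm; wp; w0]) (om q [:: wm; wp; w0]).
Proof.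
have [al [ga [nu [ep [GE _ _ _ _]]]]] := contraction_facts.
pose i : 'I_(size (ebas q 3)) := @Ordinal 4 0 isT.
have E (x : R) : x%:C *: om q [:: wm; wp; w0] =
    lcomb (V := C^o) [ffun j : 'I_(size (ebas q 3)) => x%:C * (j == i)%:R].
  apply: funext => w; rewrite tensZ /lcomb (bigD1 i) //= ffunE eqxx mulr1 big1 ?addr0.
    exact: mulrC.
  by move=> j ji; rewrite ffunE (negPf ji) mulr0 scaler0.
rewrite E (brace_lcomb s0 qs q2 q4 m0 GE) // (bigD1 i) //= [X in _ + X]big1 ?addr0; last first.
  by move=> j ji; rewrite big1 // => k _; rewrite !ffunE (negPf ji) mulr0 conjc0 !mul0r.
rewrite (bigD1 i) //= [X in _ + X]big1 ?addr0; last first.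
  by move=> j ji; rewrite !ffunE (negPf ji) !mulr0 mul0r.
rewrite !ffunE eqxx mulr1 conjcR; congr (_ * _).
by rewrite expr2; exact/esym/(rmorphM (real_complex R)).
Qed.

(** w_- w_+ is this multiple of the difference of the two eigenvectors with
    support w_0 w_z, w_- w_+. *)
Definition mp_scale : R := (q ^- 2 - q ^+ 2)^-1.

Definition mp_coef (i : nat) : R :=
  match i with 2 => mp_scale | 5 => - mp_scale | _ => 0 end.

Lemma mp_scale_neq0 : q ^- 2 - q ^+ 2 != 0.
Proof.
rewrite subr_eq0; apply/eqP => e; have := q4; rewrite (exprD q 2 2) -{1}e mulVf ?eqxx //.
by rewrite expf_neq0 // q_neq0.
Qed.

Lemma mp_coef_sum (W : lmodType C) (f : nat -> W) :
  \sum_(i < 6) (mp_coef i)%:C *: f i = mp_scale%:C *: (f 2%N - f 5%N).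
Proof.
rewrite !big_ord_recl big_ord0 /= /bump /= !scale0r !add0r !addr0.
have -> : (- mp_scale)%:C = - mp_scale%:C :> C by exact: (rmorphN (real_complex R)).
by rewrite scaleNr -scalerBr.
Qed.

Lemma mp_coef_sum2 (B : nat -> nat -> R) :
  \sum_(i < 6) \sum_(j < 6) mp_coef i * mp_coef j * B i j =
  mp_scale ^+ 2 * (B 2%N 2%N - B 2%N 5%N - B 5%N 2%N + B 5%N 5%N).
Proof.
have S (F : nat -> R) : \sum_(i < 6) mp_coef i * F i = mp_scale * (F 2%N - F 5%N).
  by rewrite !big_ord_recl big_ord0 /= /bump /=; ring.
under eq_bigr => i _ do under eq_bigr => j _ do rewrite -mulrA.
under eq_bigr => i _ do rewrite -mulr_sumr (S (B i)).
by rewrite (S (fun i => mp_scale * (B i 2%N - B i 5%N))); ring.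
Qed.

Lemma mp_scale_sub (W : lmodType C) (x y : W) :
  mp_scale%:C *: (x + (1 - q ^+ 2)%:C *: y - (x + (1 - q ^- 2)%:C *: y)) = y.
Proof.
rewrite opprD addrACA subrr add0r -scalerBl scalerA.
rewrite -(rmorphB (real_complex R)) -(rmorphM (real_complex R)).
rewrite (_ : 1 - q ^+ 2 - (1 - q ^- 2) = q ^- 2 - q ^+ 2); last by ring.
by rewrite mulVf ?mp_scale_neq0 // rmorph1 scale1r.
Qed.

Lemma om_mp : om q [:: wm; wp] =
  \sum_(i < size (ebas q 2)) (mp_coef i)%:C *: (ebas q 2)`_i.
Proof.
apply: esym; apply: etrans (mp_coef_sum (fun i => (ebas q 2)`_i)) _.
exact: mp_scale_sub.
Qed.

Lemma brace_mp : brace q G m 2 (om q [:: wm; wp]) (om q [:: wm; wp]) =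
  \sum_(i < size (ebas q 2)) \sum_(j < size (ebas q 2))
    (mp_coef i)%:C * (mp_coef j)%:C * brace q G m 2 (e2 i) (e2 j).
Proof.
have [al [ga [nu [ep [GE _ _ _ _]]]]] := contraction_facts.
have -> : om q [:: wm; wp] =
    lcomb (V := C^o) [ffun i : 'I_(size (ebas q 2)) => (mp_coef i)%:C : C^o].
  by rewrite om_mp lcomb_sum; apply: eq_bigr => i _; rewrite ffunE.
rewrite (brace_lcomb s0 qs q2 q4 m0 GE) //; apply: eq_bigr => i _; apply: eq_bigr => j _.
by rewrite !ffunE conjcR.
Qed.

(** By the quadratic relation the two eigenvectors are orthogonal.  The same relation,
    solved for gamma nu, makes the common factor of their squared norms a
    negative combination of epsilon^2 and alpha^2. *)
Lemma brace_mp_neq0 : brace q G m 2 (om q [:: wm; wp]) (om q [:: wm; wp]) != 0.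
Proof.
have [al [ga [nu [ep [GE al0 [ep0 nu0] _ E]]]]] := contraction_facts.
have bv i j : brval s al ga nu ep 2 i j =
    - (lam s 2 j)^-1 * lpeval s [:: al; ga; nu; ep] (brw 2 i j).
  by rewrite /brval (_ : 'C(3, 2) + 'C((4 - 2).+1, 2) = 6)%N // -signr_odd expr0 mulN1r.
have q20 : q ^+ 2 != 0 by rewrite expf_neq0 // q_neq0.
have p25 : lpeval s [:: al; ga; nu; ep] (brw 2 2 5) = 0.
  rewrite (brw225 s0 qs); apply: (mulfI q20); rewrite mulr0 -[RHS]E.
  by field; exact: q_neq0.
have p52 : lpeval s [:: al; ga; nu; ep] (brw 2 5 2) = 0.
  rewrite (brw252 qs); apply: (mulfI (invr_neq0 q20)); rewrite mulr0 -[RHS]E.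
  by field; exact: q_neq0.
have -> : brace q G m 2 (om q [:: wm; wp]) (om q [:: wm; wp]) =
   (- mp_scale ^+ 2 * ((lam s 2 2)^-1 + (lam s 2 5)^-1) *
      (2 * ep ^+ 2 - (q ^+ 2 + q ^- 2) * ga * nu - 2 * (1 - q ^+ 2) ^+ 2 * al ^+ 2))%:C.
  rewrite brace_mp.
  transitivity ((\sum_(i < 6) \sum_(j < 6) mp_coef i * mp_coef j *
      brval s al ga nu ep 2 i j)%:C : C).
    rewrite rmorph_sum; apply: eq_bigr => i _; rewrite rmorph_sum; apply: eq_bigr => j _.
    by rewrite (brace_ebas s0 qs q2 q4 m0 GE) // !rmorphM.
  congr (_%:C); rewrite (mp_coef_sum2 (brval s al ga nu ep 2)) !bv p25 p52.
  rewrite !(brw222 s0 qs) //; move: (lam s 2 2)^-1 (lam s 2 5)^-1 => l2 l5.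
  by ring.
have c0 : mp_scale ^+ 2 != 0 by rewrite expf_neq0 // invr_eq0 mp_scale_neq0.
rewrite (inj_eq (@complexI R) _ 0) !mulf_neq0 ?oppr_eq0 //.
  by rewrite gt_eqF // addr_gt0 // invr_gt0 (lam_gt0 s0 qs q_gt0).
rewrite lt_eqF //.
have a2 : 0 < al ^+ 2 by rewrite exprn_even_gt0.
have p2 : 0 <= (q ^+ 2 - q ^- 2) ^+ 2 * ep ^+ 2 by rewrite mulr_ge0 ?sqr_ge0.
have x1 : 0 < q ^+ 2 by rewrite exprn_gt0.
have x2 : 0 < q ^- 2 by rewrite invr_gt0 exprn_gt0.
have y2 : 0 < (1 - q ^+ 2) ^+ 2 * al ^+ 2.
  by rewrite mulr_gt0 // exprn_even_gt0 //= subr_eq0 eq_sym q2.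
have y3 : 0 < (q ^+ 2 + q ^- 2) * ((1 - q ^+ 2) ^+ 2 * al ^+ 2).
  by rewrite mulr_gt0 // addr_gt0.
have e : (q ^+ 2 + q ^- 2) * (2 * ga * nu) = (q ^+ 2 - q ^- 2) ^+ 2 * ep ^+ 2 + 4 * ep ^+ 2 +
    2 * ((q ^+ 2 + q ^- 2) * ((1 - q ^+ 2) ^+ 2 * al ^+ 2)).
  have -> : 2 * ga * nu = (q ^+ 2 + q ^- 2) * ep ^+ 2 + 2 * (1 - q ^+ 2) ^+ 2 * al ^+ 2.
    by apply/eqP; rewrite -subr_eq0 -oppr_eq0 -[X in _ == X]E; apply/eqP; ring.
  by field; exact: q_neq0.
have -> : 2 * ep ^+ 2 - (q ^+ 2 + q ^- 2) * ga * nu - 2 * (1 - q ^+ 2) ^+ 2 * al ^+ 2 =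
   2 * ep ^+ 2 - 2^-1 * ((q ^+ 2 + q ^- 2) * (2 * ga * nu)) - 2 * ((1 - q ^+ 2) ^+ 2 * al ^+ 2).
  by field; exact: q_neq0.
by rewrite e; lra.
Qed.

Lemma brace_unit : brace q G m 0 (om q [::]) (om q [::]) = 1.
Proof.
apply: (braceE s0 qs m0).
have u0 : om q [::] = unitC R [::].
  rewrite (vanti_sound [::] s0 qs) //; apply: funext => w.
  by rewrite vsum_fun /linext big_seq1 pev1 scale1r.
have f0 := is_form_om q [::]; have f4 := is_form_om q top.
pose i : 'I_(size (ebas q 0)) := @Ordinal 1 0 isT.
have ei : om q [::] = (ebas q 0)`_i by [].
have sgn10 : (-1) ^+ 'C(5, 2) = 1 :> C.
  by rewrite (_ : 'C(5, 2) = 10)%N // -signr_odd expr0.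
have st : starI q 4 (om q top) = - om q top.
  apply: etrans (starI_om s0 qs (isT : (size top <= 4)%N)) _.
  rewrite sgn10 scale1r (om_nf [::] s0 qs) //.
  have c : veq (nf (barw top)) (vopp (word1 top)) by vm_compute.
  by apply: etrans (vsum_eq _ _ _ c) _; rewrite vsum_opp vsum_word1.
have eh : hodge q G m 0 (om q [::]) = volume q m.
  have := hodge_ebas s0 qs q2 q4 G m i 1 isT; rewrite !scale1r -ei => ->.
  have -> : eigval q (om q [::]) = 1.
    by apply: etrans (eigval_ebas s0 qs q2 q4 i isT) _; rewrite pev1.
  rewrite invr1 scale1r.
  have -> : contract G 0 (om q [::]) (volume q m) = volume q m.
    apply: funext => w; rewrite u0; apply: etrans (contract_unit G [::] _ _) _.
    rewrite (bigD1 [tuple]) //= [X in _ + X]big1 ?addr0 ?mul1r // => b.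
    by case/negP; apply/eqP; exact: tuple0.
  apply: etrans (starIZ s0 qs _ (isT : (4 <= 4)%N) f4) _.
  by rewrite st conjc_z scalerN scaleNr opprK.
have es : starI q 0 (om q [::]) = om q [::].
  by apply: etrans (starI_om s0 qs (isT : (size (@nil gen) <= 4)%N)) _; rewrite expr0 scale1r.
rewrite eh es scale1r; apply: etrans (wedgeIZr s0 qs _ (isT : (0 + 4 <= 4)%N) f0 f4) _.
by congr (_ *: _); apply: (wedgeI_om s0 qs (u := [::]) (v := top)).
Qed.

End Contractions.

(** * The bimodule structure *)

Section Bimodule.
Variables (R : realType) (q : R).
Hypotheses (q_gt0 : 0 < q) (q_lt1 : q < 1).
Variable S : quantum_SU2 q.
Local Notation C := R[i].
Let s := Num.sqrt q.
Local Notation K := (qK S).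
Local Notation Ki := (qKi S).
Local Notation E := (qE S).
Local Notation F := (qF S).
Local Notation st := (@qst R q S).
Local Notation ga := (@qa R q S).
Local Notation gc := (@qc R q S).
Local Notation act := (qactP S).
Local Notation s0 := (s_neq0 q_gt0).
Local Notation qs := (q_sqr q_gt0).
Implicit Types x y : S.

Lemma sC_neq0 : s%:C != 0 :> C.
Proof. by rewrite (inj_eq (@complexI R) _ 0) s0. Qed.
Lemma sqrtqE : sqrtq q = s%:C. Proof. by []. Qed.
Lemma qCE : q%:C = s%:C * s%:C :> C.
Proof. by rewrite -(rmorphM (real_complex R)) -expr2 -qs. Qed.

Lemma qdiff_neq0 : q - q^-1 != 0.
Proof.
rewrite subr_eq0; apply/eqP => e; have := qX_neq1 q_gt0 q_lt1 (isT : (0 < 2)%N).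
by rewrite expr2 {1}e mulVf ?eqxx // gt_eqF.
Qed.

Lemma fcoefP a b (c : C) x y : fcoef a b (c *: x + y) = c *: fcoef a b x + fcoef a b y.
Proof.
have Z (k : C) u v : k *: (c *: u + v) = c *: (k *: u) + k *: v :> S.
  by rewrite scalerDr !scalerA mulrC.
have Z0 (k l : C) u u' u'' v v' v'' : k *: (c *: u + v + l *: (c *: u' + v' - (c *: u'' + v'')))
    = c *: (k *: (u + l *: (u' - u''))) + k *: (v + l *: (v' - v'')) :> S.
  by rewrite opprD addrACA -scalerBr Z addrACA -scalerDr Z.
case: a; case: b; rewrite /= ?scaler0 ?addr0 //;
  rewrite ?[K (c *: _ + _)]linearP ?[E (c *: _ + _)]linearP
          ?[F (c *: _ + _)]linearP ?[Ki (c *: _ + _)]linearP /=;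
  rewrite ?[K (c *: _ + _)]linearP ?[E (c *: _ + _)]linearP
          ?[F (c *: _ + _)]linearP ?[Ki (c *: _ + _)]linearP /= ?Z0 ?Z //.
Qed.

Lemma fcoef0 a b : fcoef a b (0 : S) = 0.
Proof. by have := fcoefP a b (-1) 0 0; rewrite scaler0 addr0 scaleN1r addNr. Qed.

Lemma fcoefD a b x y : fcoef a b (x + y) = fcoef a b x + fcoef a b y.
Proof. by have := fcoefP a b 1 x y; rewrite !scale1r. Qed.

Lemma fcoefZ a b (c : C) x : fcoef a b (c *: x) = c *: fcoef a b x.
Proof. by have := fcoefP a b c x 0; rewrite !addr0 fcoef0 addr0. Qed.

Lemma fcoef_sum a b (I : Type) (r : seq I) (Q : pred I) (f : I -> S) :
  fcoef a b (\sum_(i <- r | Q i) f i) = \sum_(i <- r | Q i) fcoef a b (f i).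
Proof. by elim/big_rec2: _ => [|i u v _ <-]; rewrite ?fcoef0 ?fcoefD. Qed.

Lemma fword0 u v : fword u v (0 : S) = 0.
Proof. by elim: u v => [|a u IH] [|b v] //=; rewrite IH fcoef0. Qed.

Lemma fwordD u v x y : fword u v (x + y) = fword u v x + fword u v y.
Proof.
by elim: u v => [|a u IH] [|b v] //=; rewrite ?addr0 // IH fcoefD.
Qed.

Lemma fwordZ u v (c : C) x : fword u v (c *: x) = c *: fword u v x.
Proof.
by elim: u v => [|a u IH] [|b v] //=; rewrite ?scaler0 // IH fcoefZ.
Qed.

Lemma fword_sum u v (I : Type) (r : seq I) (Q : pred I) (f : I -> S) :
  fword u v (\sum_(i <- r | Q i) f i) = \sum_(i <- r | Q i) fword u v (f i).
Proof. by elim/big_rec2: _ => [|i a b _ <-]; rewrite ?fword0 ?fwordD. Qed.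

Lemma fword_size u v x : size u != size v -> fword u v x = 0.
Proof.
elim: u v => [|a u IH] [|b v] //= ne; rewrite IH ?fcoef0 //.
Qed.

Lemma fword_cat u1 u2 v1 v2 x : size u1 = size v1 ->
  fword (u1 ++ u2) (v1 ++ v2) x = fword u1 v1 (fword u2 v2 x).
Proof.
by elim: u1 v1 => [|a u IH] [|b v] //= [e]; rewrite IH.
Qed.

(** The action is a module-algebra action, so the structure functions of the
    right module form a matrix corepresentation. *)
Lemma fcoefM a b x y : fcoef a b (x * y) = \sum_c fcoef a c x * fcoef c b y.
Proof.
have sg (f : gen -> S) : \sum_c f c = f wm + f wp + f wz + f w0.
  rewrite (bigD1 wm) //= (bigD1 wp) //= (bigD1 wz) //= (bigD1 w0) //= big1.
    by rewrite addr0 !addrA.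
  by case.
rewrite sg; case: a; case: b; rewrite /= ?mulr0 ?mul0r ?addr0 ?add0r //.
- rewrite (Uq_EM act) linearD /= !(Uq_KM act) (Uq_KKi act) scalerDr.
  by rewrite -scalerAl -scalerAr addrC.
- rewrite (Uq_KM act) (Uq_FM act) scalerDr (Uq_KiK act).
  by rewrite -scalerAl -scalerAr addrC.
- rewrite (Uq_KiM act) (Uq_FM act) (Uq_KKi act) scalerDr.
  by rewrite -scalerAl -scalerAr.
- rewrite (Uq_KiM act) (Uq_EM act) (Uq_KKi act) scalerDr.
  by rewrite -scalerAl -scalerAr.
- by rewrite !(Uq_KiM act).
- rewrite (Uq_EM act) [F (_ + _)]linearD /= !(Uq_FM act) !(Uq_KM act) !(Uq_KiM act).
  rewrite (Uq_KiE act) sqrtqE qCE.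
  move: (F (E x)) (K (K y)) (E (Ki x)) (F (K y)) (F (Ki x)) (K (E y)) (Ki (Ki x))
    (F (E y)) (Ki (Ki y)) (K (K x)) => a b a1 b1 a2 b2 a3 b3 b4 a5.
  set d := (q - q^-1)%:C; set e := (q^-1 / _)%:C.
  have sn := sC_neq0.
  rewrite -!scalerAl -!scalerAr !scalerA mulfK // invfM.
  rewrite !(mulrDl, mulrDr, mulrBl, mulrBr, scalerDr, scalerBr) -?scalerAl -?scalerAr !scalerA.
  rewrite ?(mulrDl, mulrDr, mulrBl, mulrBr, scalerDr, scalerBr) ?scalerA.
  rewrite !(mulrN, mulNr, scalerN) [d * (_ / _)]mulrA !addrA.
  by rewrite [RHS](ACl (6*2*1*3*4*8*5*7))%AC /= subrK.
- by rewrite !(Uq_KM act).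
Qed.

Lemma sum_tuple_cons k (V : zmodType) (f : seq gen -> V) :
  \sum_(u : k.+1.-tuple gen) f u = \sum_a \sum_(u : k.-tuple gen) f (a :: u).
Proof.
rewrite pair_big /= (reindex (fun p : gen * k.-tuple gen => [tuple of p.1 :: p.2])) //=.
exists (fun u => (thead u, [tuple of behead u])) => [[a u] _|u _] /=.
  by congr pair; apply: val_inj.
by rewrite [RHS]tuple_eta; apply: val_inj.
Qed.

Lemma fwordM k u v x y : size u = k -> size v = k ->
  fword u v (x * y) = \sum_(w : k.-tuple gen) fword u w x * fword w v y.
Proof.
elim: k u v => [|k IH] [|a u] [|b v] //= => [_ _|[su] [sv]].
  by rewrite (bigD1 [tuple]) //= big1 ?addr0 // => w; case/negP; apply/eqP; exact: tuple0.
rewrite (sum_tuple_cons _ (fun w => fword (a :: u) w x * fword w (b :: v) y)) /=.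
rewrite IH // fcoef_sum exchange_big; apply: eq_bigr => w _ /=.
by rewrite fcoefM.
Qed.

Lemma rmulE k (t : seq gen -> S) x v : size v = k ->
  rmul t x v = \sum_(u : k.-tuple gen) t u * fword u v x.
Proof. by move=> <-. Qed.

Lemma rmulM (t : seq gen -> S) x y : rmul (rmul t x) y = rmul t (x * y).
Proof.
apply: funext => v; rewrite !(rmulE _ _ (erefl (size v))).
under eq_bigr => u _ do rewrite (rmulE _ _ (size_tuple u)) mulr_suml.
rewrite exchange_big; apply: eq_bigr => u _ /=.
rewrite (fwordM x y (size_tuple u) (erefl (size v))).
by rewrite mulr_sumr; apply: eq_bigr => w _; rewrite mulrA.
Qed.

(** ** The braiding is right linear *)

(** The (a, b; c', d') entry of the identity sigma (w_a (x) w_b x) =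
    sigma (w_a (x) w_b) x, both sides having left coefficients. *)
Definition right_linear x := forall a b c' d',
  \sum_c \sum_d (sigma_coef q c d c' d')%:C *: fcoef a c (fcoef b d x) =
  \sum_c \sum_d (sigma_coef q a b c d)%:C *: fcoef c c' (fcoef d d' x).

Lemma right_linearD x y : right_linear x -> right_linear y -> right_linear (x + y).
Proof.
move=> hx hy a b c' d'.
under eq_bigr => c _ do under eq_bigr => d _ do rewrite !fcoefD scalerDr.
under [RHS]eq_bigr => c _ do under eq_bigr => d _ do rewrite !fcoefD scalerDr.
under eq_bigr do rewrite big_split /=.
under [RHS]eq_bigr do rewrite big_split /=.
by rewrite !big_split /= hx hy.
Qed.

Lemma right_linearZ (z : C) x : right_linear x -> right_linear (z *: x).
Proof.
move=> hx a b c' d'.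
under eq_bigr => c _ do under eq_bigr => d _ do rewrite !fcoefZ scalerA mulrC -scalerA.
under [RHS]eq_bigr => c _ do under eq_bigr => d _ do rewrite !fcoefZ scalerA mulrC -scalerA.
under eq_bigr do rewrite -scaler_sumr.
under [RHS]eq_bigr do rewrite -scaler_sumr.
by rewrite -!scaler_sumr hx.
Qed.

Lemma fcoef2M a c b d x y : fcoef a c (fcoef b d (x * y)) =
  \sum_e \sum_f fcoef a e (fcoef b f x) * fcoef e c (fcoef f d y).
Proof.
rewrite fcoefM fcoef_sum exchange_big; apply: eq_bigr => f _ /=.
by rewrite fcoefM.
Qed.

(** By [fcoefM] the structure functions of a product are a matrix product, and
    the constant matrix sigma commutes with each factor. *)
Lemma right_linearM x y : right_linear x -> right_linear y -> right_linear (x * y).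
Proof.
move=> hx hy a b c' d'.
transitivity (\sum_e \sum_f fcoef a e (fcoef b f x) *
   \sum_c \sum_d (sigma_coef q c d c' d')%:C *: fcoef e c (fcoef f d y)).
  under eq_bigr => c _ do under eq_bigr => d _ do rewrite fcoef2M scaler_sumr.
  under [RHS]eq_bigr => e _ do under eq_bigr => f _ do rewrite mulr_sumr.
  under eq_bigr => c _ do rewrite exchange_big /=.
  rewrite exchange_big; apply: eq_bigr => e _ /=.
  under eq_bigr => c _ do under eq_bigr => d _ do rewrite scaler_sumr.
  under eq_bigr => c _ do rewrite exchange_big /=.
  rewrite exchange_big; apply: eq_bigr => f _ /=.
  apply: eq_bigr => c _; rewrite mulr_sumr; apply: eq_bigr => d _.
  by rewrite scalerAr.
under eq_bigr => e _ do under eq_bigr => f _ do rewrite hy.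
transitivity (\sum_g \sum_h (\sum_e \sum_f (sigma_coef q e f g h)%:C *:
   fcoef a e (fcoef b f x)) * fcoef g c' (fcoef h d' y)).
  under eq_bigr => e _ do under eq_bigr => f _ do rewrite mulr_sumr.
  under [RHS]eq_bigr => g _ do under eq_bigr => h _ do rewrite mulr_suml.
  under eq_bigr => e _ do rewrite exchange_big /=.
  rewrite exchange_big; apply: eq_bigr => g _ /=.
  rewrite [RHS]exchange_big; apply: eq_bigr => e _ /=.
  under [RHS]eq_bigr => h _ do rewrite mulr_suml.
  rewrite [RHS]exchange_big; apply: eq_bigr => f _ /=.
  rewrite mulr_sumr; apply: eq_bigr => h _.
  by rewrite -scalerAl scalerAr.
under eq_bigr => g _ do under eq_bigr => h _ do rewrite hx.
under [RHS]eq_bigr => m _ do under eq_bigr => n _ do rewrite fcoef2M scaler_sumr.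
under eq_bigr => g _ do under eq_bigr => h _ do rewrite mulr_suml.
under [RHS]eq_bigr => m _ do rewrite exchange_big /=.
rewrite [RHS]exchange_big; apply: eq_bigr => g _ /=.
rewrite exchange_big; apply: eq_bigr => m _ /=.
under eq_bigr => h _ do rewrite mulr_suml.
rewrite exchange_big; apply: eq_bigr => n _ /=.
rewrite scaler_sumr; apply: eq_bigr => h _.
by rewrite scalerAl.
Qed.

End Bimodule.

(** The structure functions on a doublet v1, v2 with K v1 = s^-1 v1, K v2 = s v2, E v1 =
    v2, F v2 = v1, the words w_- and w_+ standing for v1 and v2. *)
Definition fm (a b : gen) (w : seq gen) : vec :=
  match a, b, w with
  | wm, wm, _ | wp, wp, _ => word1 w
  | w0, w0, [:: wm] => [:: (w, lm (-2) 1)]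
  | w0, w0, [:: wp] => [:: (w, lm 2 1)]
  | wz, wz, [:: wm] => [:: (w, lm 2 1)]
  | wz, wz, [:: wp] => [:: (w, lm (-2) 1)]
  | wm, w0, [:: wm] => word1 [:: wp]
  | wp, w0, [:: wp] => word1 [:: wm]
  | wz, wm, [:: wp] => [:: ([:: wm], lq [:: (2, 1); (-2, -1)])]
  | wz, wp, [:: wm] => [:: ([:: wp], lq [:: (2, 1); (-2, -1)])]
  | wz, w0, [:: wm] => [:: (w, lm 2 1)]
  | wz, w0, [:: wp] => [:: (w, lm (-2) (-1))]
  | _, _, _ => [::]
  end%ZZ.

Definition vsum_gen (f : gen -> vec) : vec := foldr (fun a acc => vadd (f a) acc) [::] gens.

Definition dblt := [:: [:: wm]; [:: wp]].

Definition check_dblt := all (fun a => all (fun b => all (fun c' => all (fun d' => all (fun w =>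
  veq (vsum_gen (fun c => vsum_gen (fun d =>
        vscale (vget [:: c'; d'] (lsigma c d)) (vbind (fm a c) (fm b d w)))))
      (vsum_gen (fun c => vsum_gen (fun d =>
        vscale (vget [:: c; d] (lsigma a b)) (vbind (fm c c') (fm d d' w))))))
  dblt) gens) gens) gens) gens.
Lemma check_dbltT : check_dblt. Proof. by vm_compute. Qed.

Definition check_fm := all (fun a => all (fun b => all (fun w =>
  all (fun x => x.1 \in dblt) (fm a b w)) dblt) gens) gens.
Lemma check_fmT : check_fm. Proof. by []. Qed.

Section PevSmall.
Variables (R : realType) (q s : R).
Hypotheses (s0 : s != 0) (qs : q = s ^+ 2).
Local Notation pev := (lpeval s [::]).

Lemma pev_diff : pev (lq [:: (2, 1); (-2, -1)]%ZZ) = q - q^-1.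
Proof. by pev_norm; rewrite qs; field; exact: s0. Qed.
Lemma pev_p2 : pev (lm 2%ZZ 1%ZZ) = s * s.
Proof. by pev_norm; ring. Qed.
Lemma pev_m2 : pev (lm (-2)%ZZ 1%ZZ) = s^-1 * s^-1.
Proof. by pev_norm; field; exact: s0. Qed.
Lemma pev_m2N : pev (lm (-2)%ZZ (-1)%ZZ) = - (s^-1 * s^-1).
Proof. by pev_norm; field; exact: s0. Qed.
Lemma zz_top1 : q - q^-1 != 0 ->
  (q - q^-1) * (1 + q^-1 / (q - q^-1) ^+ 2 * (s * s - s^-1 * s^-1)) = s * s.
Proof.
move=> d0; have -> : s * s - s^-1 * s^-1 = q - q^-1 by rewrite qs; field; exact: s0.
have -> : s * s = q by rewrite qs.
have q0 : q != 0 by rewrite qs expf_neq0.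
have e (d : R) : d != 0 -> d * (1 + q^-1 / d ^+ 2 * d) = d + q^-1.
  by move=> dn; field; rewrite dn q0.
by rewrite e // subrK.
Qed.
Lemma zz_top2 : q - q^-1 != 0 ->
  (q - q^-1) * (q^-1 / (q - q^-1) ^+ 2 * (s^-1 * s^-1 - s * s)) = - (s^-1 * s^-1).
Proof.
move=> d0; have -> : s^-1 * s^-1 - s * s = - (q - q^-1) by rewrite qs; field; exact: s0.
have -> : s^-1 * s^-1 = q^-1 by rewrite qs expr2 invfM.
have q0 : q != 0 by rewrite qs expf_neq0.
by move: (q - q^-1) d0 => d d0; field; rewrite q0 d0.
Qed.
End PevSmall.

Section RightLinear.
Variables (R : realType) (q : R).
Hypotheses (q_gt0 : 0 < q) (q_lt1 : q < 1).
Variable S : quantum_SU2 q.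
Local Notation C := R[i].
Let s := Num.sqrt q.
Local Notation K := (qK S).
Local Notation Ki := (qKi S).
Local Notation E := (qE S).
Local Notation F := (qF S).
Local Notation st := (@qst R q S).
Local Notation ga := (@qa R q S).
Local Notation gc := (@qc R q S).
Local Notation act := (qactP S).
Local Notation s0 := (s_neq0 q_gt0).
Local Notation qs := (q_sqr q_gt0).
Implicit Types x y : S.
Local Notation vsum := (linext s [::]).
Local Notation pev := (lpeval s [::]).

Lemma sigma_coef_vget a b c d :
  sigma_coef q a b c d = pev (vget [:: c; d] (lsigma a b)).
Proof.
rewrite (sigma_coefE [::] s0 qs); elim: (lsigma a b) => [|x v IH].
  by rewrite big_nil pev_nil.
rewrite big_cons IH -[vget _ (x :: v)]/(if weqb [:: c; d] x.1 then padd x.2 (vget [:: c; d] v)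
  else vget [:: c; d] v).
case: (weqbP [:: c; d] x.1) => [<-|/eqP ne].
  by rewrite eqxx pev_add.
by rewrite eq_sym (negPf ne).
Qed.

Lemma vsum_vsum_gen (W : lmodType C) (f : seq gen -> W) (h : gen -> vec) :
  vsum f (vsum_gen h) = \sum_a vsum f (h a).
Proof.
rewrite /vsum_gen /= !vsum_add (bigD1 wm) //= (bigD1 wp) //= (bigD1 wz) //= (bigD1 w0) //=.
by rewrite big1 => [|[]] //; rewrite /linext big_nil.
Qed.

Section Doublet.
Variables v1 v2 : S.
Hypotheses (K1 : K v1 = s%:C^-1 *: v1) (K2 : K v2 = s%:C *: v2).
Hypotheses (Ki1 : Ki v1 = s%:C *: v1) (Ki2 : Ki v2 = s%:C^-1 *: v2).
Hypotheses (E1 : E v1 = v2) (E2 : E v2 = 0) (F1 : F v1 = 0) (F2 : F v2 = v1).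

Definition dbl (w : seq gen) : S :=
  match w with [:: wm] => v1 | [:: wp] => v2 | _ => 0 end.

Lemma fcoef_dbl a b w : w \in dblt -> fcoef a b (dbl w) = vsum dbl (fm a b w).
Proof.
have sn : s%:C != 0 :> C := sC_neq0 q_gt0.
have pl P c u : (pev P)%:C = c -> vsum dbl [:: (u, P)] = c *: dbl u.
  by move=> <-; rewrite /linext big_seq1.
have vn : vsum dbl [::] = 0 by rewrite /linext big_nil.
have sM : (s * s)%:C = s%:C * s%:C :> C := rmorphM (real_complex R) _ _.
have sV : s^-1%:C = s%:C^-1 :> C := fmorphV (real_complex R) _.
have sM' : (s^-1 * s^-1)%:C = s%:C^-1 * s%:C^-1 :> C.
  by rewrite -sV; exact: (rmorphM (real_complex R)).
have l2 u : vsum dbl [:: (u, lm 2%ZZ 1%ZZ)] = (s%:C * s%:C) *: dbl u.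
  by apply: pl; rewrite pev_p2.
have lm2 u : vsum dbl [:: (u, lm (-2)%ZZ 1%ZZ)] = (s%:C^-1 * s%:C^-1) *: dbl u.
  by apply: pl; rewrite (pev_m2 s0) sM'.
have lm2N u : vsum dbl [:: (u, lm (-2)%ZZ (-1)%ZZ)] = - (s^-1 * s^-1)%:C *: dbl u.
  apply: pl; rewrite (pev_m2N s0); exact: (rmorphN (real_complex R)).
have ld u : vsum dbl [:: (u, lq [:: (2, 1); (-2, -1)]%ZZ)] = (q - q^-1)%:C *: dbl u.
  by apply: pl; rewrite (pev_diff s0 qs).
have d0 := qdiff_neq0 q_gt0 q_lt1.
have ss : s%:C^-1 * s%:C = 1 :> C by rewrite mulVf.
rewrite !inE => /orP [] /eqP ->; case: a; case: b;
  rewrite /= ?vsum_word1 ?vn ?l2 ?lm2 ?lm2N ?ld //=;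
  rewrite ?sqrtqE ?(K1, K2, Ki1, Ki2, E1, E2, F1, F2, linear0, scaler0) //;
  rewrite ?[K (_ *: _)]linearZ ?[Ki (_ *: _)]linearZ ?[E (_ *: _)]linearZ ?[F (_ *: _)]linearZ /=;
  rewrite ?(K1, K2, Ki1, Ki2, E1, E2, F1, F2, linear0, scaler0) ?scalerA ?ss ?scale1r //.
- by rewrite -/s divfK.
- rewrite -scalerBl scalerA -{1}[v1]scale1r -scalerDl scalerA; congr (_ *: _).
  rewrite -sM -sM' -(rmorphB (real_complex R)) -(rmorphM (real_complex R)).
  rewrite -(rmorph1 (real_complex R)) -(rmorphD (real_complex R)) -(rmorphM (real_complex R)).
  by rewrite (zz_top1 s0 qs d0).
- by rewrite -/s mulfK.
- rewrite add0r -scalerBl !scalerA; congr (_ *: _).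
  rewrite -sM -sM' -(rmorphB (real_complex R)) -!(rmorphM (real_complex R)).
  rewrite -mulrA (zz_top2 s0 qs d0); exact: (rmorphN (real_complex R)).
Qed.

Lemma fcoef_vsum a b (v : vec) : all (fun k : seq gen * lpoly => k.1 \in dblt) v ->
  fcoef a b (vsum dbl v) = vsum dbl (vbind (fm a b) v).
Proof.
move=> kv; rewrite (vsum_bind _ s0).
rewrite {1 2}/linext fcoef_sum big_seq [RHS]big_seq; apply: eq_bigr => k kin.
by rewrite fcoefZ -fcoef_dbl //; move/allP: kv; apply.
Qed.

Lemma right_linear_dbl w : w \in dblt -> right_linear (dbl w).
Proof.
move=> wd a b c' d'.
have fk (x y : gen) : all (fun k : seq gen * lpoly => k.1 \in dblt) (fm x y w).
  have := check_fmT => /allP/(_ _ (mem_gens x))/allP/(_ _ (mem_gens y))/allP/(_ _ wd).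
  by [].
have e (x y z t : gen) : fcoef x y (fcoef z t (dbl w)) = vsum dbl (vbind (fm x y) (fm z t w)).
  by rewrite fcoef_dbl // fcoef_vsum.
under eq_bigr => c _ do under eq_bigr => d _ do
  rewrite sigma_coef_vget e -(vsum_scale [::] s0).
under [RHS]eq_bigr => c _ do under eq_bigr => d _ do
  rewrite sigma_coef_vget e -(vsum_scale [::] s0).
under eq_bigr do rewrite -vsum_vsum_gen.
under [RHS]eq_bigr do rewrite -vsum_vsum_gen.
rewrite -!vsum_vsum_gen; apply: vsum_eq.
have := check_dbltT => /allP/(_ _ (mem_gens a))/allP/(_ _ (mem_gens b)).
by move=> /allP/(_ _ (mem_gens c'))/allP/(_ _ (mem_gens d'))/allP/(_ _ wd).
Qed.

End Doublet.

Lemma Ki_eig x (c : C) : c != 0 -> K x = c *: x -> Ki x = c^-1 *: x.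
Proof.
move=> c0 e; apply: (can_inj (Uq_KiK act)); rewrite (Uq_KKi act) linearZ /= e.
by rewrite scalerA mulVf // scale1r.
Qed.

(** The two doublets are (a, - q c^* ) and (c, a^* ). *)
Lemma right_linear_gens : [/\ right_linear ga, right_linear gc, right_linear (st ga)
  & right_linear (st gc)].
Proof.
have sn : s%:C != 0 :> C := sC_neq0 q_gt0.
have si : s%:C^-1 != 0 :> C by rewrite invr_eq0.
have qn : q%:C != 0 :> C by rewrite qCE // mulf_neq0.
have D v1 v2 : K v1 = s%:C^-1 *: v1 -> K v2 = s%:C *: v2 -> E v1 = v2 -> E v2 = 0 ->
    F v1 = 0 -> F v2 = v1 -> right_linear v1 /\ right_linear v2.
  move=> k1 k2 e1 e2 f1 f2.
  have i1 : Ki v1 = s%:C *: v1 by rewrite (Ki_eig si k1) invrK.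
  have i2 : Ki v2 = s%:C^-1 *: v2 by rewrite (Ki_eig sn k2).
  have h := right_linear_dbl k1 k2 i1 i2 e1 e2 f1 f2.
  by split; [apply: (h [:: wm])|apply: (h [:: wp])].
have [a1 a2] : right_linear ga /\ right_linear (- q%:C *: st gc).
  apply: D; rewrite ?linearZ /= ?(Uq_Ka act) ?(Uq_Kcs act) ?(Uq_Ea act) ?(Uq_Ecs act)
    ?(Uq_Fa act) ?(Uq_Fcs act) ?scaler0 ?scaleNr //.
  by rewrite scalerN opprK scalerA mulfV // scale1r.
have [c1 c2] : right_linear gc /\ right_linear (st ga).
  apply: D; rewrite ?(Uq_Kc act) ?(Uq_Kas act) ?(Uq_Ec act) ?(Uq_Eas act)
    ?(Uq_Fc act) ?(Uq_Fas act) //.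
split=> //; have := right_linearZ (- q%:C)^-1 a2.
by rewrite scalerA mulVf ?scale1r // oppr_eq0.
Qed.

Lemma st1 : st 1 = 1.
Proof.
have [inv _ _ stM] := SUq2_star (qalgP S).
have e x : st 1 * x = x.
  by rewrite -{2}(inv x) -[in RHS](mulr1 (st x)) stM inv.
by rewrite -[RHS]e mulr1.
Qed.

(** The elements x such that x and x^* satisfy the identity form a
    *-subalgebra, which contains the generators. *)
Lemma right_linear_all x : right_linear x.
Proof.
have [inv stD stZ stM] := SUq2_star (qalgP S).
have [ra rc ras rcs] := right_linear_gens.
have r1 : right_linear (1 : S).
  have [_ _ _ <- _] := SUq2_rel (qalgP S).
  by apply: right_linearD; apply: right_linearM.
suff [] : right_linear x /\ right_linear (st x) by [].
move: x; apply: (SUq2_gen (qalgP S)) => //.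
- by rewrite st1.
- move=> x y [x1 x2] [y1 y2]; rewrite stD; split; exact: right_linearD.
- move=> x y [x1 x2] [y1 y2]; rewrite stM; split; exact: right_linearM.
- move=> z x [x1 x2]; rewrite stZ; split; exact: right_linearZ.
- by move=> x [x1 x2]; rewrite inv.
Qed.

End RightLinear.

(** * Products and adjoints of forms with coefficients *)

Section AForms.
Variables (R : realType) (q : R).
Hypotheses (q_gt0 : 0 < q) (q_lt1 : q < 1).
Variable S : quantum_SU2 q.
Local Notation C := R[i].
Let s := Num.sqrt q.
Local Notation st := (@qst R q S).
Local Notation s0 := (s_neq0 q_gt0).
Local Notation qs := (q_sqr q_gt0).
Implicit Types x y z : S.
Local Notation vsum := (linext s [::]).
Local Notation pev := (lpeval s [::]).
Local Notation form := (seq gen -> S).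
Local Notation sigS := (sigma_at q (V := S)).
Local Notation sigC := (sigma_at q (V := C^o)).
Implicit Types t : form.

Lemma sum_unit_vsum k (f : seq gen -> S) v :
  (forall w, size w != k -> f w = 0) ->
  \sum_(w : k.-tuple gen) (vsum (unitC R) v w : C) *: f w = vsum f v.
Proof.
move=> h; transitivity (\sum_(w : k.-tuple gen) \sum_(a <- v)
    (pev a.2)%:C *: ((unitC R a.1 w : C) *: f w)).
  apply: eq_bigr => w _; rewrite vsum_fun /linext scaler_suml.
  by apply: eq_bigr => a _; rewrite scalerA.
rewrite exchange_big /linext; apply: eq_bigr => a _ /=.
rewrite -scaler_sumr; congr (_ *: _).
have [e|ne] := eqVneq (size a.1) k; last first.
  rewrite h // big1 // => w _; rewrite /unitC.
  case: eqP => [e|_]; last by rewrite scale0r.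
  by rewrite -e size_tuple eqxx in ne.
move/eqP: e => e; rewrite (bigD1 (Tuple e)) //= big1 => [|w wn].
  by rewrite /unitC eqxx scale1r addr0.
by rewrite -val_eqE /= in wn; rewrite /unitC (negPf wn) scale0r.
Qed.

Lemma sigma_coef_vsum a b (f : seq gen -> S) :
  \sum_c \sum_d (sigma_coef q a b c d)%:C *: f [:: c; d] = vsum f (lsigma a b).
Proof.
transitivity (\sum_c \sum_d \sum_(k <- lsigma a b)
    (pev k.2)%:C *: ((k.1 == [:: c; d])%:R *: f [:: c; d])).
  apply: eq_bigr => c _; apply: eq_bigr => d _.
  rewrite (sigma_coefE [::] s0 qs) rmorph_sum scaler_suml big_mkcond /=.
  by apply: eq_bigr => k _; case: ifP => _; rewrite ?scale1r ?scale0r ?scaler0.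
under eq_bigr do rewrite exchange_big /=.
rewrite exchange_big /linext big_seq [RHS]big_seq /=; apply: eq_bigr => k /lsigma_size.
case: k => [[|c [|d []]] P] //= _.
rewrite (bigD1 c) //= (bigD1 d) //= eqxx scale1r big1 ?addr0 => [|d' nd]; last first.
  by rewrite !eqseq_cons eqxx eq_sym (negPf nd) scale0r scaler0.
rewrite big1 ?addr0 // => c' nc; rewrite big1 // => d' _.
by rewrite !eqseq_cons eq_sym (negPf nc) scale0r scaler0.
Qed.

Lemma sigma_at_fword i u x v :
  sigS i (fun v => fword u v x) v = vsum (fun w => fword w v x) (vsig1 i u).
Proof.
rewrite /sigma_at /vsig1.
case du: (drop i u) => [|a [|b u']].
- rewrite /linext big_nil; case dv: (drop i v) => [|c [|d v']] //.
  apply: big1 => c' _; apply: big1 => d' _; rewrite fword_size ?scaler0 //.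
  rewrite size_cat (size_take_drop [::] dv) /=; apply/eqP => e.
  by move: (congr1 size du); rewrite size_drop e /=; lia.
- rewrite /linext big_nil; case dv: (drop i v) => [|c [|d v']] //.
  apply: big1 => c' _; apply: big1 => d' _; rewrite fword_size ?scaler0 //.
  rewrite size_cat (size_take_drop [::] dv) /=; apply/eqP => e.
  by move: (congr1 size du); rewrite size_drop e /=; lia.
rewrite /linext big_map /=.
have su := size_take_drop [::] du.
case dv: (drop i v) => [|c' [|d' v']].
- rewrite big_seq big1 // => a' /lsigma_size sa; rewrite fword_size ?scaler0 //.
  rewrite !size_cat su sa; apply/eqP => e.
  by move: (congr1 size dv); rewrite size_drop -e /=; lia.
- rewrite big_seq big1 // => a' /lsigma_size sa; rewrite fword_size ?scaler0 //.
  rewrite !size_cat su sa; apply/eqP => e.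
  by move: (congr1 size dv); rewrite size_drop -e /=; lia.
have sv := size_take_drop [::] dv.
have eu : u = take i u ++ [:: a; b] ++ u' by rewrite -{1}(cat_take_drop i u) du.
have ev : v = take i v ++ [:: c'; d'] ++ v' by rewrite -{1}(cat_take_drop i v) dv.
have suv : size (take i u) = size (take i v) by rewrite su sv.
transitivity (fword (take i u) (take i v) (\sum_c \sum_d
    (sigma_coef q c d c' d')%:C *: fcoef a c (fcoef b d (fword u' v' x)))).
  rewrite fword_sum; apply: eq_bigr => c _; rewrite fword_sum; apply: eq_bigr => d _.
  by rewrite fwordZ eu -[in fword _ (_ ++ _)]/([:: c; d] ++ v') fword_cat -?eu.
rewrite (right_linear_all q_gt0 q_lt1).
rewrite (sigma_coef_vsum a b (fun w => fword w [:: c'; d'] (fword u' v' x))).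
rewrite /linext fword_sum big_seq [RHS]big_seq; apply: eq_bigr => k /lsigma_size sk.
by rewrite fwordZ [in RHS]ev !fword_cat.
Qed.

Lemma foldr_fword rw u x v :
  foldr sigS (fun v => fword u v x) rw v =
  \sum_(w : (size v).-tuple gen) (foldr sigC (unitC R u) rw w : C) *: fword w v x.
Proof.
have zero k (w : seq gen) v' : size v' = k -> size w != k -> fword w v' x = 0.
  by move=> <-; apply: fword_size.
elim: rw v => [|i rw IH] v /=.
  have [e|ne] := eqVneq (size u) (size v); last first.
    rewrite fword_size // big1 // => w _; rewrite /unitC.
    case: eqP => [e|_]; last by rewrite scale0r.
    by rewrite -e size_tuple eqxx in ne.
  move/eqP: e => e; rewrite (bigD1 (Tuple e)) //= big1 => [|w wn].
    by rewrite /unitC eqxx scale1r addr0.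
  by rewrite -val_eqE /= in wn; rewrite /unitC (negPf wn) scale0r.
pose T : invform R := foldr sigC (unitC R u) rw.
transitivity (sigS i (fun v' => \sum_(w : (size v).-tuple gen) (T w : C) *: fword w v' x) v).
  by apply: sigma_at_loc => v' sv'; rewrite IH sv'.
rewrite (sigma_at_sum q (index_enum _) (fun w : (size v).-tuple gen => T w : C)
   (fun w v' => fword w v' x)).
transitivity (\sum_(w : (size v).-tuple gen) \sum_(w' : (size v).-tuple gen)
   (T w : C) *: ((sigC i (unitC R w) w' : C) *: fword w' v x)).
  apply: eq_bigr => w _; rewrite -scaler_sumr; congr (_ *: _).
  rewrite sigma_at_fword (sigma_at_unit [::] s0 qs) (@sum_unit_vsum _ (fun w => fword w v x)) //.
  by move=> w'; apply: zero.
rewrite exchange_big; apply: eq_bigr => w' _ /=.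
have := foldr_sigma_expand q [:: i] T w'; rewrite /= => ->.
rewrite scaler_suml size_tuple; apply: eq_bigr => w _.
by rewrite scalerA mulrC.
Qed.

(** Right linearity on words: the antisymmetriser may act before or after x is
    moved to the left. *)
Lemma anti_fword u x v : anti q (fun v => fword u v x) v =
  \sum_(w : (size v).-tuple gen) (om q u w : C) *: fword w v x.
Proof.
rewrite /anti.
under eq_bigr => p _ do rewrite foldr_fword scaler_sumr.
rewrite exchange_big; apply: eq_bigr => w _ /=.
rewrite /om /anti size_tuple scaler_suml; apply: eq_bigr => p _.
by rewrite scalerA; congr (_ *: _).
Qed.

Lemma anti_loc t t' v : (forall u, size u = size v -> t u = t' u) ->
  anti q t v = anti q t' v.
Proof.
by move=> h; rewrite !anti_expand; apply: eq_bigr => u _; rewrite h ?size_tuple.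
Qed.

Lemma anti_lmul x t : anti q (lmul x t) = lmul x (anti q t).
Proof.
apply: funext => v; rewrite /lmul !anti_expand mulr_sumr; apply: eq_bigr => u _.
by rewrite scalerAr.
Qed.

Lemma anti_rmul t x : anti q (rmul t x) = rmul (anti q t) x.
Proof.
apply: funext => v; rewrite (rmulE _ _ (erefl (size v))).
rewrite (anti_loc (t' := fun v' => \sum_(u : (size v).-tuple gen) 1 *: lmul (t u) (fun v => fword u v x) v')).
  rewrite (anti_sum q (index_enum _) (fun=> 1) (fun u : (size v).-tuple gen => lmul (t u) (fun v => fword u v x))).
  under eq_bigr => u _ do rewrite scale1r anti_lmul /lmul anti_fword mulr_sumr.
  rewrite exchange_big; apply: eq_bigr => w _ /=.
  rewrite anti_expand size_tuple mulr_suml; apply: eq_bigr => u _.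
  by rewrite -scalerAr -scalerAl.
move=> u su; rewrite (rmulE _ _ su); apply: eq_bigr => w _.
by rewrite scale1r.
Qed.

End AForms.

Section Wedge.
Variables (R : realType) (q : R).
Hypotheses (q_gt0 : 0 < q) (q_lt1 : q < 1).
Variable S : quantum_SU2 q.
Local Notation C := R[i].
Let s := Num.sqrt q.
Local Notation K := (qK S).
Local Notation Ki := (qKi S).
Local Notation E := (qE S).
Local Notation F := (qF S).
Local Notation st := (@qst R q S).
Local Notation act := (qactP S).
Local Notation s0 := (s_neq0 q_gt0).
Local Notation qs := (q_sqr q_gt0).
Implicit Types x y z : S.
Local Notation form := (seq gen -> S).
Implicit Types t : form.
Local Notation cf := (nfcoef s [::]).
Local Notation mcoord := (mcoords s [::]).

Definition unitA (u : seq gen) : form := fun w => (w == u)%:R.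
Local Notation omS := (@omA R q S).

Lemma homog_unitA u : homog (size u) (unitA u).
Proof. by move=> w nw; rewrite /unitA; have [e|//] := eqVneq w u; rewrite e eqxx in nw. Qed.

Lemma omA_anti u : omS u = anti q (unitA u).
Proof.
apply: funext => w; rewrite /omA /of_inv {1}/om !anti_expand scaler_suml.
apply: eq_bigr => v _; rewrite /unitA; case: eqP => _; rewrite ?scaler0 ?scale0r //.
by congr (_ *: _); exact: mulr1.
Qed.

Lemma lmulE x t w : lmul x t w = x * t w. Proof. by []. Qed.

Lemma homog_lmul k x t : homog k t -> homog k (lmul x t).
Proof. by move=> h w /h e; rewrite /lmul e mulr0. Qed.

Lemma homog_rmul k x t : homog k t -> homog k (rmul t x).
Proof.
by move=> h w nw; rewrite (rmulE _ _ (erefl _)) big1 // => u _; rewrite h ?mul0r // size_tuple.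
Qed.

Lemma rmul_unitA u x v : rmul (unitA u) x v = fword u v x.
Proof.
rewrite (rmulE _ _ (erefl _)).
have [e|ne] := eqVneq (size u) (size v); last first.
  rewrite fword_size // big1 // => w _; rewrite /unitA.
  case: eqP => [e|_]; last by rewrite mul0r.
  by rewrite -e size_tuple eqxx in ne.
move/eqP: e => e; rewrite (bigD1 (Tuple e)) //= big1 => [|w wn].
  by rewrite /unitA eqxx mul1r addr0.
by rewrite -val_eqE /= in wn; rewrite /unitA (negPf wn) mul0r.
Qed.

Lemma lmul_omA x u : lmul x (omS u) = anti q (lmul x (unitA u)).
Proof. by rewrite omA_anti anti_lmul. Qed.

Lemma rmul_omA x u : rmul (omS u) x = anti q (rmul (unitA u) x).
Proof. by rewrite omA_anti (anti_rmul q_gt0 q_lt1). Qed.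

Lemma rmulDl t t' x : rmul (t + t') x = rmul t x + rmul t' x.
Proof.
apply: funext => v; rewrite [RHS]tensD !(rmulE _ _ (erefl (size v))) -big_split /=.
by apply: eq_bigr => u _; rewrite -mulrDl.
Qed.

Lemma rmulDr t x y : rmul t (x + y) = rmul t x + rmul t y.
Proof.
apply: funext => v; rewrite [RHS]tensD !(rmulE _ _ (erefl (size v))) -big_split /=.
by apply: eq_bigr => u _; rewrite fwordD mulrDr.
Qed.

Lemma rmulZl (c : C) t x : rmul (c *: t) x = c *: rmul t x.
Proof.
apply: funext => v; rewrite [RHS]tensZ !(rmulE _ _ (erefl (size v))) scaler_sumr.
by apply: eq_bigr => u _; rewrite scalerAl.
Qed.

Lemma rmulZr (c : C) t x : rmul t (c *: x) = c *: rmul t x.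
Proof.
apply: funext => v; rewrite [RHS]tensZ !(rmulE _ _ (erefl (size v))) scaler_sumr.
by apply: eq_bigr => u _; rewrite fwordZ scalerAr.
Qed.

Lemma rmul0 t : rmul t 0 = 0.
Proof. by rewrite -(scale0r (0 : S)) rmulZr scale0r. Qed.

Lemma rmul_sumr (I : Type) (r : seq I) (P : pred I) (f : I -> S) t :
  rmul t (\sum_(i <- r | P i) f i) = \sum_(i <- r | P i) rmul t (f i).
Proof. by elim/big_rec2: _ => [|i a b _ <-]; rewrite ?rmul0 ?rmulDr. Qed.

Lemma rmul_suml (I : Type) (r : seq I) (P : pred I) (f : I -> form) x :
  rmul (\sum_(i <- r | P i) f i) x = \sum_(i <- r | P i) rmul (f i) x.
Proof.
have rmul0l : rmul (0 : form) x = 0 by rewrite -(scale0r (0 : form)) rmulZl !scale0r.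
by elim/big_rec2: _ => [//|i a b _ e]; rewrite rmulDl e.
Qed.

(** Tensor product over the algebra of two tensors with left coefficients. *)
Definition tensA k t t' : form := fun w => rmul t (t' (drop k w)) (take k w).

Lemma homog_tensA k l t t' : homog k t -> homog l t' -> homog (k + l) (tensA k t t').
Proof.
move=> ht ht' w nw; rewrite /tensA.
have [e|ne] := eqVneq (size (drop k w)) l; last by rewrite ht' // rmul0.
apply: (homog_rmul _ ht); apply/eqP => e'; move/eqP: nw; apply.
by rewrite -(cat_take_drop k w) size_cat e e'.
Qed.

(** The product is computed on any representatives because both left and right
    multiplication commute with the antisymmetriser. *)
Lemma wedge_anti k l t t' : (k + l <= 4)%N -> homog k t -> homog l t' ->
  wedge k l (anti q t) (anti q t') = anti q (tensA k t t').
Proof.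
move=> kl ht ht'.
have k4 : (k <= 4)%N by apply: leq_trans kl; apply: leq_addr.
have l4 : (l <= 4)%N by apply: leq_trans kl; apply: leq_addl.
have [hp ep] := preantiP q ht; have [hp' ep'] := preantiP q ht'.
rewrite /wedge -/(tensA k (preanti q k (anti q t)) (preanti q l (anti q t'))).
rewrite (anti_comb [::] s0 qs kl (homog_tensA hp hp')) (anti_comb [::] s0 qs kl (homog_tensA ht ht')).
apply: eq_comb => b bk.
have T a a' : mcoord (k + l) (tensA k a a') b = \sum_(b1 <- monos k) \sum_(b2 <- monos l)
   (cf (b1 ++ b2) b)%:C *: mcoord k (rmul a (mcoord l a' b2)) b1.
  rewrite (mcoord_cat [::] s0 (fun u v => rmul a (a' v) u)) //.
  apply: eq_bigr => b1 _; apply: eq_bigr => b2 _; congr (_ *: _).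
  apply: eq_bigr => u _; congr (_ *: _).
  rewrite /mcoords rmul_sumr sum_funE; apply: eq_bigr => v _.
  by rewrite rmulZr.
rewrite !T big_seq [RHS]big_seq; apply: eq_bigr => b1 b1k.
rewrite big_seq [RHS]big_seq; apply: eq_bigr => b2 b2l; congr (_ *: _).
rewrite (anti_eq [::] s0 qs l4 hp' ht' ep' b2l).
apply: (anti_eq [::] s0 qs k4 _ _ _ b1k); try exact: homog_rmul.
by rewrite !(anti_rmul q_gt0 q_lt1) ?ep.
Qed.

Lemma antiS (I : Type) (r : seq I) (P : pred I) (f : I -> form) :
  anti q (\sum_(i <- r | P i) f i) = \sum_(i <- r | P i) anti q (f i).
Proof.
have a0 : anti q (0 : form) = 0 by exact: anti0.
by elim/big_rec2: _ => [//|i a b _ e]; rewrite antiD e.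
Qed.

(** ** Products of decomposable forms *)

(** Adjacent inner coefficients multiply and are then moved to the left; this is
    the shape of the product of an adjoint with a form having left
    coefficients. *)
Lemma wedge_rl k l u v y z : size u = k -> size v = l -> (k + l <= 4)%N ->
  wedge k l (rmul (omS u) y) (lmul z (omS v)) =
  \sum_(w : k.-tuple gen) lmul (fword u w (y * z)) (omS (w ++ v)).
Proof.
move=> su sv kl; rewrite rmul_omA lmul_omA.
have hu : homog k (unitA u) by rewrite -su; apply: homog_unitA.
have hv : homog l (unitA v) by rewrite -sv; apply: homog_unitA.
rewrite (wedge_anti kl (homog_rmul _ hu) (homog_lmul _ hv)).
under [RHS]eq_bigr do rewrite lmul_omA.
rewrite -antiS; congr anti; apply: funext => w.
rewrite sum_funE /tensA (rmulM q_gt0) lmulE rmul_unitA.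
have [e|ne] := eqVneq (drop k w) v; last first.
  rewrite /unitA (negPf ne) !mulr0 fword0 big1 // => w' _.
  rewrite lmulE /unitA; case: eqP => [e|]; last by rewrite mulr0.
  by move: ne; rewrite e drop_size_cat ?size_tuple ?eqxx.
rewrite {1}/unitA e eqxx mulr1.
have [sw|nw] := eqVneq (size (take k w)) k; last first.
  rewrite fword_size ?su 1?eq_sym // big1 // => w' _.
  rewrite lmulE /unitA; case: eqP => [e'|]; last by rewrite mulr0.
  by move: nw; rewrite e' take_size_cat ?size_tuple ?eqxx.
move/eqP: sw => sw; rewrite (bigD1 (Tuple sw)) //= big1 => [|w' nw].
  by rewrite addr0 lmulE /unitA -e cat_take_drop eqxx mulr1.
rewrite lmulE /unitA; case: eqP => [e'|]; last by rewrite mulr0.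
by case/eqP: nw; apply: val_inj; rewrite /= e' take_size_cat ?size_tuple.
Qed.

(** Outer coefficients stay where they are; this is the shape met with right
    coefficients. *)
Lemma wedge_lr k l u v x y : size u = k -> size v = l -> (k + l <= 4)%N ->
  wedge k l (lmul x (omS u)) (rmul (omS v) y) = lmul x (rmul (omS (u ++ v)) y).
Proof.
move=> su sv kl; transitivity (anti q (lmul x (rmul (unitA (u ++ v)) y))); last first.
  by rewrite anti_lmul rmul_omA.
rewrite lmul_omA rmul_omA.
have hu : homog k (unitA u) by rewrite -su; apply: homog_unitA.
have hv : homog l (unitA v) by rewrite -sv; apply: homog_unitA.
rewrite (wedge_anti kl (homog_lmul _ hu) (homog_rmul _ hv)); congr anti.
apply: funext => w; rewrite /tensA lmulE.
have e t : rmul (lmul x t) (rmul (unitA v) y (drop k w)) (take k w)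
  = x * rmul t (rmul (unitA v) y (drop k w)) (take k w).
  rewrite !(rmulE _ _ (erefl (size (take k w)))) mulr_sumr.
  by apply: eq_bigr => u' _; rewrite lmulE mulrA.
rewrite e !rmul_unitA; congr (x * _).
have [sw|nw] := eqVneq (size (take k w)) k.
  by rewrite -[in RHS](cat_take_drop k w) fword_cat // su.
rewrite fword_size ?su 1?eq_sym // fword_size // size_cat.
move: nw; rewrite size_take; case: ltnP => [_|h nw]; first by rewrite eqxx.
by rewrite su; apply/eqP => e'; move: nw h; rewrite -e'; lia.
Qed.

(** ** The adjoint *)

(** The adjoint on tensors: the word is reversed, its letters are conjugated, and the
    coefficient, now on the right, is moved back to the left. *)
Definition star_tens k t : form := fun v => (-1) ^+ 'C(k.+1, 2) *:
    \sum_(u : k.-tuple gen) fword (barw u) v (st (t u)).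

Lemma star_tensE k t : star_tens k t =
  (-1) ^+ 'C(k.+1, 2) *: \sum_(u : k.-tuple gen) rmul (unitA (barw u)) (st (t u)).
Proof.
apply: funext => v; rewrite tensZ sum_funE; congr (_ *: _).
by apply: eq_bigr => u _; rewrite rmul_unitA.
Qed.

Lemma st_sum (I : Type) (r : seq I) (P : pred I) (f : I -> S) :
  st (\sum_(i <- r | P i) f i) = \sum_(i <- r | P i) st (f i).
Proof.
have [inv stD stZ stM] := SUq2_star (qalgP S).
have st0 : st 0 = 0 by rewrite -(scale0r (0 : S)) stZ conjc0 !scale0r.
by elim/big_rec2: _ => [|i a b _ e]; rewrite ?st0 ?stD ?e.
Qed.

Lemma anti_star_tens k t : (k <= 4)%N -> anti q (star_tens k t) =
  (-1) ^+ 'C(k.+1, 2) *: \sum_(b <- monos k) rmul (omS (barw b)) (st (mcoord k t b)).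
Proof.
have [inv stD stZ stM] := SUq2_star (qalgP S).
move=> k4; rewrite star_tensE antiZ antiS; congr (_ *: _).
under eq_bigr => u _ do rewrite -rmul_omA.
transitivity (\sum_(u : k.-tuple gen) \sum_(b <- monos k)
   rmul (omS (barw b)) ((cf u b)%:C *: st (t u))).
  apply: eq_bigr => u _.
  have e w : omS w = of_inv S (om q w) by [].
  have -> : omS (barw u) = \sum_(b <- monos k) (cf u b)%:C *: omS (barw b).
    apply: funext => w; rewrite sum_funE /omA /of_inv.
    rewrite (om_cf [::] s0 qs) ?size_barw ?size_tuple //.
    rewrite (eq_bigr (fun c => \sum_(b <- monos k) (cf u b)%:C *: ((nfcoef s [::] (barw b) c)%:C *: om q c))); last first.
      move=> c _; rewrite (cf_barw [::] s0) ?size_tuple // rmorph_sum scaler_suml.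
      by apply: eq_bigr => b _; rewrite rmorphM scalerA.
    rewrite exchange_big sum_funE scaler_suml big_seq [RHS]big_seq; apply: eq_bigr => b bk.
    rewrite -scaler_sumr tensZ -scalerA; congr (_ *: _).
    by rewrite (om_cf [::] s0 qs (u := barw b)) size_barw (monos_size bk).
  by rewrite rmul_suml; apply: eq_bigr => b _; rewrite rmulZl rmulZr.
rewrite exchange_big; apply: eq_bigr => b _ /=.
rewrite -rmul_sumr st_sum; congr rmul; apply: eq_bigr => u _.
by rewrite stZ conjcR.
Qed.

(** The antisymmetrised adjoint depends on a tensor only through its coordinates,
    so any representative computes it. *)
Lemma fstar_anti k t : (k <= 4)%N -> homog k t ->
  fstar k (anti q t) = anti q (star_tens k t).
Proof.
move=> k4 ht; have [hp ep] := preantiP q ht.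
rewrite /fstar -/(star_tens k (preanti q k (anti q t))).
rewrite !anti_star_tens //; congr (_ *: _).
rewrite big_seq [RHS]big_seq; apply: eq_bigr => b bk.
by rewrite (anti_eq [::] s0 qs k4 hp ht ep bk).
Qed.

Lemma fstar_lmul k x u : size u = k -> (k <= 4)%N ->
  fstar k (lmul x (omS u)) = (-1) ^+ 'C(k.+1, 2) *: rmul (omS (barw u)) (st x).
Proof.
have [inv stD stZ stM] := SUq2_star (qalgP S).
have st0 : st 0 = 0 by rewrite -(scale0r (0 : S)) stZ conjc0 !scale0r.
move=> su k4; have hu : homog k (unitA u) by rewrite -su; apply: homog_unitA.
rewrite lmul_omA fstar_anti //; last exact: homog_lmul.
rewrite star_tensE antiZ; congr (_ *: _); rewrite rmul_omA; congr anti.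
move/eqP: su => su; rewrite (bigD1 (Tuple su)) //= big1 => [|w nw].
  by rewrite addr0 lmulE /unitA eqxx mulr1.
by rewrite -val_eqE /= in nw; rewrite lmulE /unitA (negPf nw) mulr0 st0 rmul0.
Qed.

Lemma fstar_sum k (I : Type) (r : seq I) (P : pred I) (f : I -> form) : (k <= 4)%N ->
  (forall i, homog k (f i)) ->
  fstar k (\sum_(i <- r | P i) anti q (f i)) = \sum_(i <- r | P i) fstar k (anti q (f i)).
Proof.
have [inv stD stZ stM] := SUq2_star (qalgP S).
move=> k4 hf; rewrite -antiS fstar_anti //; last first.
  by move=> w nw; rewrite sum_funE big1 // => i _; apply: hf.
under [RHS]eq_bigr do rewrite fstar_anti //.
rewrite -antiS; congr anti; apply: funext => v; rewrite sum_funE /star_tens.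
rewrite -scaler_sumr exchange_big; congr (_ *: _); apply: eq_bigr => u _ /=.
by rewrite sum_funE st_sum fword_sum.
Qed.

Lemma wedge_sum k l (I J : Type) (r : seq I) (r' : seq J) (f : I -> form) (g : J -> form) :
  (k + l <= 4)%N -> (forall i, homog k (f i)) -> (forall j, homog l (g j)) ->
  wedge k l (\sum_(i <- r) anti q (f i)) (\sum_(j <- r') anti q (g j)) =
  \sum_(i <- r) \sum_(j <- r') wedge k l (anti q (f i)) (anti q (g j)).
Proof.
move=> kl hf hg; rewrite -!antiS wedge_anti //.
- under [RHS]eq_bigr => i _ do under eq_bigr => j _ do rewrite wedge_anti //.
  under [RHS]eq_bigr do rewrite -antiS.
  rewrite -antiS; congr anti; apply: funext => w; rewrite /tensA !sum_funE rmul_suml sum_funE.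
  by apply: eq_bigr => i _; rewrite rmul_sumr !sum_funE.
- by move=> w nw; rewrite sum_funE big1 // => i _; apply: hf.
- by move=> w nw; rewrite sum_funE big1 // => i _; apply: hg.
Qed.

(** ** Adjoints and the action *)

(** The compatibility of the action with the adjoint is multiplicative, so it
    is enough to have it on the generators. *)
Lemma K_st x : K (st x) = st (Ki x) /\ Ki (st x) = st (K x).
Proof.
have [inv stD stZ stM] := SUq2_star (qalgP S).
have sn : s%:C != 0 :> C := sC_neq0 q_gt0.
have si : s%:C^-1 != 0 :> C by rewrite invr_eq0.
have sV : s^-1%:C = s%:C^-1 :> C := fmorphV (real_complex R) _.
have cs : conjc (s%:C^-1) = s%:C^-1 :> C by rewrite -sV conjcR.
have D y (c : C) : c != 0 -> conjc c = c -> K y = c *: y -> K (st y) = c^-1 *: st y ->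
    K (st y) = st (Ki y) /\ Ki (st y) = st (K y).
  move=> c0 cc e1 e2; rewrite (Ki_eig c0 e1) (Ki_eig _ e2) ?invr_eq0 // e2 e1 !stZ invrK cc.
  have -> // : conjc c^-1 = c^-1.
  by apply: (etrans (fmorphV (@conjc R) c)); congr (_^-1).
have one (f g : S -> S) : {morph f : x y / x * y} -> cancel g f -> f 1 = 1.
  by move=> fM gK; have := fM 1 (g 1); rewrite mul1r gK mulr1.
have K1 : K 1 = 1 := one _ _ (Uq_KM act) (Uq_KKi act).
have Ki1 : Ki 1 = 1 := one _ _ (Uq_KiM act) (Uq_KiK act).
move: x; apply: (SUq2_gen (qalgP S)).
- by rewrite !(st1 S) K1 Ki1 !(st1 S).
- apply: D si cs (Uq_Ka act) _; rewrite invrK; exact: (Uq_Kas act).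
- apply: D si cs (Uq_Kc act) _; rewrite invrK; exact: (Uq_Kcs act).
- by move=> x y [x1 x2] [y1 y2]; rewrite stD !linearD /= !stD x1 y1 x2 y2.
- by move=> x y [x1 x2] [y1 y2]; rewrite stM !(Uq_KM act) !(Uq_KiM act) !stM x1 y1 x2 y2.
- by move=> z x [x1 x2]; rewrite stZ !linearZ /= !stZ x1 x2.
- by move=> x [x1 x2]; rewrite !inv x1 x2 !inv.
Qed.

(** The pair of identities is stable under products and under the adjoint, so
    that a and c suffice. *)
Lemma E_st x : E x = - (q%:C *: st (F (st x))) /\ E (st x) = - (q%:C *: st (F x)).
Proof.
have [inv stD stZ stM] := SUq2_star (qalgP S).
have qn : q%:C != 0 :> C by rewrite (inj_eq (@complexI R) _ 0) q_neq0.
have K1 : K 1 = 1.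
  by have := Uq_KM act 1 (Ki 1); rewrite mul1r (Uq_KKi act) mulr1.
have Ki1 : Ki 1 = 1.
  by have := Uq_KiM act 1 (K 1); rewrite mul1r (Uq_KiK act) mulr1.
have E1 : E 1 = 0.
  have := Uq_EM act 1 1; rewrite K1 Ki1 !mulr1 mul1r => e.
  by apply: (addrI (E 1)); rewrite -e addr0.
have F1 : F 1 = 0.
  have := Uq_FM act 1 1; rewrite K1 Ki1 !mulr1 mul1r => e.
  by apply: (addrI (F 1)); rewrite -e addr0.
have st0 : st 0 = 0 by rewrite -(scale0r (0 : S)) stZ conjc0 !scale0r.
have D y z u v : E y = - (q%:C *: st v) -> F z = v -> E z = - (q%:C *: st u) -> F y = u ->
   z = st y -> E y = - (q%:C *: st (F (st y))) /\ E (st y) = - (q%:C *: st (F y)).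
  by move=> e1 f1 e2 f2 e; rewrite -e e1 f1 e2 f2.
have sN y : st (- y) = - st y by rewrite -scaleN1r stZ (rmorphN1 (@conjc R)) scaleN1r.
have sq : st (- (q%:C^-1 *: qa S)) = - (q%:C^-1 *: st (qa S)).
  by rewrite sN stZ -(fmorphV (real_complex R)) conjcR.
have stM' y z : st (y * z) = st z * st y by exact: stM.
move: x; apply: (SUq2_gen (qalgP S)).
- by rewrite (st1 S) E1 F1 st0 scaler0 oppr0.
- by apply: (D _ _ _ _ _ (Uq_Fas act) _ (Uq_Fa act)); rewrite ?(Uq_Ea act) ?(Uq_Eas act) ?st0 ?scaler0 ?oppr0.
- apply: (D _ _ _ _ _ (Uq_Fcs act) _ (Uq_Fc act)); rewrite ?(Uq_Ec act) ?(Uq_Ecs act) ?st0 ?scaler0 ?oppr0 //.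
  by rewrite sq scalerN opprK scalerA mulfV // scale1r.
- by move=> x y [x1 x2] [y1 y2]; rewrite stD !linearD /= !stD x1 y1 x2 y2 !scalerDr !opprD.
- move=> x y [x1 x2] [y1 y2]; rewrite !stM' !(Uq_EM act) !(Uq_FM act) !stD !stM'.
  have [kx kix] := K_st x; have [ky kiy] := K_st y.
  rewrite x1 y1 x2 y2 kx kiy !inv !scalerDr !opprD.
  by rewrite !mulrN !mulNr -!scalerAl -!scalerAr; split; rewrite addrC.
- move=> z x [x1 x2]; rewrite stZ !linearZ /= !stZ x1 x2 conjcK.
  by rewrite !scalerN !scalerA ![q%:C * _]mulrC.
- by move=> x [x1 x2]; rewrite !inv x1 x2.
Qed.

Lemma F_st x : F (st x) = - (q%:C^-1 *: st (E x)).
Proof.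
have [inv stD stZ stM] := SUq2_star (qalgP S).
have qn : q%:C != 0 :> C by rewrite (inj_eq (@complexI R) _ 0) q_neq0.
have [-> _] := E_st x; have sN y : st (- y) = - st y.
  by rewrite -scaleN1r stZ (rmorphN1 (@conjc R)) scaleN1r.
by rewrite sN stZ conjcR inv scalerN opprK scalerA mulVf // scale1r.
Qed.

(** The antilinear map taking the coefficients of a form to those of its
    adjoint exchanges left and right coefficients, since the adjoint of
    w_a x is x^* w_a^*. *)
Lemma fcoef_st a d x : a != wz ->
  \sum_b fcoef (bar b) d (st (fcoef a b x)) = (d == bar a)%:R *: st x.
Proof.
have [inv stD stZ stM] := SUq2_star (qalgP S).
have sn : s%:C != 0 :> C := sC_neq0 q_gt0.
have sV : s^-1%:C = s%:C^-1 :> C := fmorphV (real_complex R) _.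
have cs : conjc (s%:C^-1) = s%:C^-1 :> C by rewrite -sV conjcR.
have cq : conjc (q%:C^-1) = q%:C^-1 :> C.
  by apply: (etrans (congr1 (@conjc R) (esym (fmorphV (real_complex R) q)))); rewrite conjcR fmorphV.
have st0 : st 0 = 0 by rewrite -(scale0r (0 : S)) stZ conjc0 !scale0r.
have sN y : st (- y) = - st y.
  by rewrite -scaleN1r stZ (rmorphN1 (@conjc R)) scaleN1r.
have KK y : K (K (st (K (K y)))) = st y.
  by have [-> _] := K_st (K (K y)); have [-> _] := K_st (Ki (K (K y))); rewrite !(Uq_KiK act).
have sg (f : gen -> S) : \sum_c f c = f wm + f wp + f wz + f w0.
  rewrite (bigD1 wm) //= (bigD1 wp) //= (bigD1 wz) //= (bigD1 w0) //= big1.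
    by rewrite addr0 !addrA.
  by case.
have ss : s%:C^-1 * s%:C^-1 = q%:C^-1 :> C by rewrite (qCE q_gt0) invfM.
have sq : s%:C^-1 * q%:C = s%:C :> C by rewrite (qCE q_gt0) mulrA mulVf // mul1r.
have KKst y : K (K (st y)) = st (Ki (Ki y)).
  by have [-> _] := K_st y; have [-> _] := K_st (Ki y).
have Kst y : K (st y) = st (Ki y) by have [-> _] := K_st y.
have [_ Est] := E_st x.
rewrite sg; case: a => // _; case: d; rewrite /= ?st0 ?linear0 ?fcoef0 ?scaler0 ?addr0 ?add0r ?scale0r ?scale1r ?KK ?(scaler0, addr0, add0r) //.
- rewrite sqrtqE stZ cs !linearZ /= KKst Kst F_st (Uq_KiK act) (Uq_KiE act).
  by rewrite stZ cq scalerN addNr.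
- rewrite sqrtqE stZ cs Est !linearN /= ![K (_ *: _)]linearZ /= KKst Kst !(Uq_KiF act).
  rewrite ?[Ki (_ *: _)]linearZ /= ?(Uq_KiF act) ?(Uq_KiK act) !stZ !conjcR. by rewrite addNr.
Qed.

Lemma fword_st k u v x : size u = k -> wz \notin u ->
  \sum_(w : k.-tuple gen) fword (barw w) v (st (fword u w x)) = (v == barw u)%:R *: st x.
Proof.
elim: k u v x => [|k IH] [|a u] v x //= => [_ _|[su]].
  rewrite (bigD1 [tuple]) //= big1 ?addr0 => [|w]; last by case/negP; apply/eqP; exact: tuple0.
  by case: v => [|b v]; rewrite /= ?scale1r ?scale0r.
rewrite inE negb_or eq_sym => /andP [az uz].
rewrite (sum_tuple_cons _ (fun w => fword (barw w) v (st (fword (a :: u) w x)))).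
case/lastP: v => [|v d].
  rewrite big1 => [|b _].
    by rewrite barw_cons cats1; case: (barw u) => [|? ?]; rewrite scale0r.
  rewrite big1 // => w _; apply: fword_size.
  by rewrite barw_cons cats1 size_rcons.
have [sv|nv] := eqVneq (size v) k; last first.
  rewrite barw_cons cats1 eqseq_rcons.
  have -> : (v == barw u) = false.
    by apply/eqP => e; case/eqP: nv; rewrite e size_barw su.
  rewrite scale0r big1 // => b _; rewrite big1 // => w _; apply: fword_size.
  by rewrite barw_cons cats1 !size_rcons size_barw size_tuple eqSS eq_sym.
rewrite exchange_big /=.
transitivity (\sum_(w : k.-tuple gen) fword (barw w) v
    (\sum_b fcoef (bar b) d (st (fcoef a b (fword u w x))))).
  apply: eq_bigr => w _; rewrite fword_sum; apply: eq_bigr => b _.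
  by rewrite barw_cons -cats1 fword_cat // size_barw size_tuple sv.
under eq_bigr => w _ do rewrite fcoef_st // fwordZ.
rewrite -scaler_sumr IH // scalerA barw_cons cats1 eqseq_rcons mulrC.
by case: (v == _); case: (d == _); rewrite ?mulr1 ?mulr0 ?mul0r.
Qed.

(** By [fcoef_st] the coefficient passes to the other side letter by letter. *)
Lemma fstar_rmul k x u : size u = k -> (k <= 4)%N -> wz \notin u ->
  fstar k (rmul (omS u) x) = (-1) ^+ 'C(k.+1, 2) *: lmul (st x) (omS (barw u)).
Proof.
move=> su k4 uz; have hu : homog k (unitA u) by rewrite -su; apply: homog_unitA.
rewrite rmul_omA fstar_anti //; last exact: homog_rmul.
transitivity (anti q ((-1) ^+ 'C(k.+1, 2) *: lmul (st x) (unitA (barw u)))); last first.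
  by rewrite antiZ lmul_omA.
congr anti; apply: funext => v; rewrite /star_tens tensZ; congr (_ *: _).
under eq_bigr => w _ do rewrite rmul_unitA.
rewrite fword_st // lmulE /unitA; case: (v == _); rewrite ?scale1r ?mulr1 //.
by rewrite scale0r mulr0.
Qed.

End Wedge.

(** * The Haar state *)

Lemma kap_step (R : realFieldType) (s b : R) l : s != 0 ->
  - (s ^- 2 * s ^+ l.+1) + s^-1 * - (s ^- 2 * s ^+ l ^- 3 * b) * s ^- 2 =
  - (s ^- 2 * s ^+ l.+1 ^- 3 * (b + s ^+ 2 ^+ (2 * l.+1))).
Proof.
move=> sn; have un : s ^+ l != 0 by rewrite expf_neq0.
have -> : s ^+ 2 ^+ (2 * l.+1) = s ^+ 4 * (s ^+ l) ^+ 4.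
  by rewrite -!exprM -exprD; congr (_ ^+ _); lia.
rewrite [s ^+ l.+1]exprS; move: (s ^+ l) un => u un; field.
by rewrite sn un.
Qed.

Lemma kap_cancel (R : realFieldType) (s b : R) j : s != 0 -> b != 0 ->
  b + s ^+ 2 ^+ (2 * j.+1) != 0 ->
  s / (b + s ^+ 2 ^+ (2 * j.+1)) + s^-1 * (s ^+ j * (- (s ^- 2 * s ^+ j ^- 3 * b) *
    (s ^- 2 ^+ j * (b^-1 - (b + s ^+ 2 ^+ (2 * j.+1))^-1)))) = 0.
Proof.
move=> sn; have un : s ^+ j != 0 by rewrite expf_neq0.
have -> : s ^+ 2 ^+ (2 * j.+1) = s ^+ 4 * (s ^+ j) ^+ 4.
  by rewrite -!exprM -exprD; congr (_ ^+ _); lia.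
have -> : s ^- 2 ^+ j = (s ^+ j) ^- 2 by rewrite exprVn exprAC.
move: (s ^+ j) un => u un b0 b1; field.
by rewrite exprMn b0 sn un b1.
Qed.

Section Haar.
Variables (R : realType) (q : R).
Hypotheses (q_gt0 : 0 < q) (q_lt1 : q < 1).
Variable S : quantum_SU2 q.
Local Notation C := R[i].
Let s := Num.sqrt q.
Local Notation K := (qK S).
Local Notation Ki := (qKi S).
Local Notation E := (qE S).
Local Notation F := (qF S).
Local Notation h := (qh S).
Local Notation st := (@qst R q S).
Local Notation ga := (@qa R q S).
Local Notation gc := (@qc R q S).
Local Notation act := (qactP S).
Local Notation s0 := (s_neq0 q_gt0).
Local Notation qs := (q_sqr q_gt0).
Implicit Types x y z : S.

Definition qcomm (c : C) x y := x * y = c *: (y * x).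

Lemma skewMr c d x y z : qcomm c x y -> qcomm d x z -> qcomm (c * d) x (y * z).
Proof.
by move=> e f; rewrite /qcomm mulrA e -scalerAl -(mulrA y x z) f -scalerAr scalerA mulrA.
Qed.

Lemma skewMl c d x y z : qcomm c x z -> qcomm d y z -> qcomm (c * d) (x * y) z.
Proof.
move=> e f; rewrite /qcomm -(mulrA x y z) f -scalerAr (mulrA x z y) e -scalerAl scalerA (mulrA z).
by rewrite [d * c]mulrC.
Qed.

Lemma skewXr c x y n : qcomm c x y -> qcomm (c ^+ n) x (y ^+ n).
Proof.
move=> e; elim: n => [|n IH]; first by rewrite /qcomm !expr0 mulr1 mul1r scale1r.
by rewrite !exprS; apply: skewMr.
Qed.

Lemma skewXl c x y n : qcomm c x y -> qcomm (c ^+ n) (x ^+ n) y.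
Proof.
move=> e; elim: n => [|n IH]; first by rewrite /qcomm !expr0 mulr1 mul1r scale1r.
by rewrite !exprS; apply: skewMl.
Qed.

Lemma skew_sym c x y : c != 0 -> qcomm c x y -> qcomm c^-1 y x.
Proof. by move=> c0 e; rewrite /qcomm e scalerA mulVf // scale1r. Qed.

Lemma qC_neq0 : q%:C != 0 :> C.
Proof. by rewrite (inj_eq (@complexI R) _ 0) q_neq0. Qed.
Local Notation qn := qC_neq0.

Lemma skew_ca : qcomm q%:C^-1 gc ga.
Proof. by apply: skew_sym qn _; have [] := SUq2_rel (qalgP S). Qed.

Lemma skew_csa : qcomm q%:C^-1 (st gc) ga.
Proof. by apply: skew_sym qn _; have [] := SUq2_rel (qalgP S). Qed.

Lemma skew_cas : qcomm q%:C gc (st ga).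
Proof.
have [inv stD stZ stM] := SUq2_star (qalgP S).
have [_ e _ _ _] := SUq2_rel (qalgP S).
by rewrite /qcomm -{1 2}(inv gc) -!stM e stZ conjcR.
Qed.

Lemma skew_csas : qcomm q%:C (st gc) (st ga).
Proof.
have [inv stD stZ stM] := SUq2_star (qalgP S).
have [e _ _ _ _] := SUq2_rel (qalgP S).
by rewrite /qcomm -!stM e stZ conjcR.
Qed.

Lemma c_comm : gc * st gc = st gc * gc. Proof. by have [] := SUq2_rel (qalgP S). Qed.
Lemma asa : st ga * ga = 1 - st gc * gc.
Proof. by have [_ _ _ <- _] := SUq2_rel (qalgP S); rewrite addrK. Qed.
Lemma aas : ga * st ga = 1 - (q ^+ 2)%:C *: (gc * st gc).
Proof. by have [_ _ _ _ <-] := SUq2_rel (qalgP S); rewrite addrK. Qed.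

(** With a^* in the role of the inverse of a, the relations c a = q^-1 a c and
    c a^* = q a^* c become one commutation rule, and the two families of ordered
    monomials are one family indexed by the integers. *)
Definition ae (i : int) : S := match i with Posz n => ga ^+ n | Negz n => st ga ^+ n.+1 end.
Definition mn (i : int) (j l : nat) : S := ae i * gc ^+ j * st gc ^+ l.

Lemma skew_c_ae i : qcomm (q%:C ^ (- i)) gc (ae i).
Proof.
case: i => n; first by rewrite /= -exprz_inv; apply: skewXr skew_ca.
by rewrite NegzE opprK -NegzE; apply: skewXr skew_cas.
Qed.

Lemma skew_cs_ae i : qcomm (q%:C ^ (- i)) (st gc) (ae i).
Proof.
case: i => n; first by rewrite /= -exprz_inv; apply: skewXr skew_csa.
by rewrite NegzE opprK -NegzE; apply: skewXr skew_csas.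
Qed.

Lemma c_mn i j l : gc * mn i j l = q%:C ^ (- i) *: mn i j.+1 l.
Proof. by rewrite /mn !mulrA (skew_c_ae i) -!scalerAl -!mulrA [gc * (gc ^+ j * _)]mulrA -exprS. Qed.

Lemma cs_mn i j l : st gc * mn i j l = q%:C ^ (- i) *: mn i j l.+1.
Proof.
have e : GRing.comm (st gc) (gc ^+ j) by apply: commrX; rewrite /GRing.comm c_comm.
rewrite /mn !mulrA (skew_cs_ae i) -!scalerAl; congr (_ *: _).
by rewrite -!mulrA (mulrA (st gc)) e -!mulrA -exprS.
Qed.

(** The span of the ordered monomials is stable under left multiplication by the
    four generators, hence is the whole algebra; so a linear statement need only
    be proved on monomials. *)
Lemma mn_ind (P : S -> Prop) : (forall x y, P x -> P y -> P (x + y)) ->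
  (forall c x, P x -> P (c *: x)) -> (forall i j l, P (mn i j l)) -> forall x, P x.
Proof.
have [inv stD stZ stM] := SUq2_star (qalgP S).
move=> PD PZ Pm; pose Sp x := forall Q : S -> Prop, (forall x y, Q x -> Q y -> Q (x + y)) ->
  (forall c x, Q x -> Q (c *: x)) -> (forall i j l, Q (mn i j l)) -> Q x.
have SD x y : Sp x -> Sp y -> Sp (x + y).
  by move=> hx hy Q QD QZ Qm; apply: (QD); [apply: hx|apply: hy].
have SZ c x : Sp x -> Sp (c *: x) by move=> hx Q QD QZ Qm; apply: (QZ); apply: hx.
have Sm i j l : Sp (mn i j l) by move=> Q QD QZ Qm; apply: Qm.
pose cl z := forall y, Sp y -> Sp (z * y).
have clm z : (forall i j l, Sp (z * mn i j l)) -> cl z.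
  move=> hz y hy; apply: (hy (fun y => Sp (z * y))) => [u v hu hv|c u hu|//].
    by rewrite mulrDr; apply: SD.
  by rewrite -scalerAr; apply: SZ.
have cc : cl gc by apply: clm => i j l; rewrite c_mn; apply: SZ.
have ccs : cl (st gc) by apply: clm => i j l; rewrite cs_mn; apply: SZ.
have ca : cl ga.
  apply: clm => -[] n j l; first by rewrite /mn /= !mulrA -exprS; exact: (Sm (Posz n.+1)).
  have [k ek] : exists k, ae k = st ga ^+ n by case: n => [|n]; [exists 0|exists (Negz n)].
  have -> : ga * mn (Negz n) j l = mn k j l + (- (q ^+ 2)%:C) *: (gc * (st gc * mn k j l)).
    by rewrite /mn /= exprS !mulrA aas ek !mulrBl mul1r -!scalerAl scaleNr.
  by apply: SD => //; apply: SZ; apply: cc; apply: ccs.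
have cas : cl (st ga).
  apply: clm => -[] n j l; last by rewrite /mn /= !mulrA -exprS; exact: (Sm (Negz n.+1)).
  case: n => [|n]; first by rewrite /mn /= expr0 mul1r mulrA -(expr1 (st ga)); exact: (Sm (Negz 0)).
  have -> : st ga * mn (Posz n.+1) j l = mn (Posz n) j l + (- 1) *: (st gc * (gc * mn (Posz n) j l)).
    by rewrite /mn /= exprS !mulrA asa !mulrBl mul1r scaleN1r.
  by apply: SD => //; apply: SZ; apply: ccs; apply: cc.
have cl1 : cl 1 by move=> y; rewrite mul1r.
have all x : cl x /\ cl (st x).
  move: x; apply: (SUq2_gen (qalgP S)) => //.
  - by rewrite st1.
  - move=> x y [x1 x2] [y1 y2]; rewrite stD; split=> z hz; rewrite mulrDl; apply: SD; auto.
  - move=> x y [x1 x2] [y1 y2]; rewrite stM; split=> z hz; rewrite -mulrA; auto.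
  - move=> c x [x1 x2]; rewrite stZ; split=> z hz; rewrite -scalerAl; apply: SZ; auto.
  - by move=> x [x1 x2]; rewrite inv.
move=> x; rewrite -(mulr1 x); have [cx _] := all x; apply: (cx _ _ P) => //.
by rewrite -(mulr1 1) -{1}(mul1r 1); exact: (Sm 0 0%N 0%N).
Qed.

(** ** Weights *)

Local Notation sq := (sqrtq q : C).
Local Notation L := (@Lsp R q S).

Lemma sq_neq0 : sq != 0. Proof. exact: (sC_neq0 q_gt0). Qed.

Lemma sq_exp_neq1 (n : int) : n != 0 -> sq ^ n != 1.
Proof.
have s_gt0 : 0 < s by rewrite sqrtr_gt0.
have s1 : s != 1.
  by apply/eqP => e; have := qX_neq1 q_gt0 q_lt1 (isT : (0 < 1)%N); rewrite expr1 qs -/s e expr1n eqxx.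
move=> n0; rewrite -(fmorphXz (real_complex R)) -(rmorph1 (real_complex R)).
rewrite (inj_eq (@complexI R)) -[X in _ != X](expr0z s).
by rewrite (inj_eq (ieexprIz s_gt0 s1)).
Qed.

Lemma K1 : K 1 = 1.
Proof. by have := Uq_KM act 1 (Ki 1); rewrite mul1r (Uq_KKi act) mulr1. Qed.

Lemma Lsp1 : L 0 1. Proof. by rewrite /Lsp /= K1 expr0z scale1r. Qed.

Lemma LspM m n x y : L m x -> L n y -> L (m + n) (x * y).
Proof.
rewrite /Lsp /= => ex ey; rewrite (Uq_KM act) ex ey -scalerAl -scalerAr scalerA.
by rewrite expfzDr ?sq_neq0.
Qed.

Lemma LspX n x k : L n x -> L (n *+ k) (x ^+ k).
Proof.
move=> e; elim: k => [|k IH]; first by rewrite expr0 mulr0n; exact: Lsp1.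
by rewrite exprS mulrS; apply: LspM.
Qed.

Lemma LspD n x y : L n x -> L n y -> L n (x + y).
Proof. by rewrite /Lsp /= => ex ey; rewrite linearD /= ex ey scalerDr. Qed.

Lemma LspZ n c x : L n x -> L n (c *: x).
Proof. by rewrite /Lsp /= => e; rewrite linearZ /= e !scalerA mulrC. Qed.

Lemma Lsp0 n : L n 0. Proof. by rewrite /Lsp /= linear0 scaler0. Qed.

Lemma LspN n x : L n x -> L n (- x).
Proof. by rewrite -scaleN1r; apply: LspZ. Qed.

Lemma Lsp_sum n (I : Type) (r : seq I) (P : pred I) (f : I -> S) :
  (forall i, P i -> L n (f i)) -> L n (\sum_(i <- r | P i) f i).
Proof. by move=> hf; elim/big_ind: _ => //; [exact: Lsp0|move=> x y; exact: LspD]. Qed.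

Lemma Lsp_Ki n x : L n x -> Ki x = sq ^ (- n) *: x.
Proof.
by move=> e; rewrite (Ki_eig _ e) ?expfz_neq0 ?sq_neq0 // invr_expz.
Qed.

Lemma sq2 : sq ^ 2 = q%:C.
Proof. by rewrite (qCE q_gt0). Qed.

Lemma Lsp_E n x : L n x -> L (n + 2) (E x).
Proof.
rewrite /Lsp /= => e; rewrite (Uq_KE act) e linearZ /= scalerA.
by rewrite expfzDr ?sq_neq0 // sq2 mulrC.
Qed.

Lemma Lsp_F n x : L n x -> L (n - 2) (F x).
Proof.
rewrite /Lsp /= => e; rewrite (Uq_KF act) e linearZ /= scalerA.
by rewrite expfzDr ?sq_neq0 // -invr_expz sq2 mulrC.
Qed.

Lemma conj_sq (n : int) : conjc (sq ^ n) = sq ^ n.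
Proof. by rewrite -(fmorphXz (real_complex R)) conjcR. Qed.

Lemma Lsp_st n x : L n x -> L (- n) (st x).
Proof.
have [inv stD stZ stM] := SUq2_star (qalgP S).
move=> e; rewrite /Lsp /=; have [-> _] := K_st q_gt0 x.
by rewrite (Lsp_Ki e) stZ conj_sq.
Qed.

Lemma Lsp_ae i : L (- i) (ae i).
Proof.
case: i => n.
  have -> : - Posz n = (-1) *+ n by rewrite mulNrn natz.
  by apply: LspX; rewrite /Lsp /= (Uq_Ka act) exprN1.
have -> : - Negz n = 1 *+ n.+1 by rewrite NegzE opprK natz.
by apply: LspX; rewrite /Lsp /= (Uq_Kas act).
Qed.

Lemma Lsp_mn i j l : L (l%:Z - j%:Z - i) (mn i j l).
Proof.
have -> : l%:Z - j%:Z - i = - i + (-1) *+ j + 1 *+ l.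
  by rewrite mulNrn !natz; ring.
apply: LspM; last by apply: LspX; rewrite /Lsp /= (Uq_Kcs act).
apply: LspM; first exact: Lsp_ae.
by apply: LspX; rewrite /Lsp /= (Uq_Kc act) exprN1.
Qed.

(** ** Invariance and symmetry of the Haar state *)

Definition brk n : R := \sum_(i < n) q ^+ (2 * i)%N.

Lemma brk_neq0 n : brk n.+1 != 0.
Proof.
rewrite gt_eqF // /brk big_ord_recl /= muln0 expr0 ltr_pwDl //.
by apply: sumr_ge0 => i _; rewrite exprn_ge0 // ltW.
Qed.

Lemma brkS n : brk n.+1 = brk n + q ^+ (2 * n)%N.
Proof. by rewrite /brk big_ord_recr. Qed.

Lemma mn_t j : mn 0 j j = (gc * st gc) ^+ j.
Proof.
rewrite /mn /= mul1r exprMn_comm //; exact: c_comm.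
Qed.

Lemma haar_mn0 i j l : (i != 0) || (j != l) -> h (mn i j l) = 0.
Proof.
case: i => n nz; first by apply: (haar_a (qhP S)); case: n nz.
by apply: (haar_as (qhP S)).
Qed.

Lemma haar_mn j : h (mn 0 j j) = (brk j.+1)%:C^-1.
Proof. by rewrite mn_t; exact: (haar_cc (qhP S)). Qed.

Lemma haar_K x : h (K x) = h x.
Proof.
move: x; apply: mn_ind => [x y ex ey|c x ex|i j l].
- by rewrite !linearD /= ex ey.
- by rewrite !linearZ /= ex.
rewrite (Lsp_mn i j l) linearZ /=.
have [->|i0] := eqVneq i 0; last by rewrite haar_mn0 ?i0 //; exact: mulr0.
have [->|jl] := eqVneq j l; last by rewrite haar_mn0 ?jl //; exact: mulr0.
by rewrite subrr subr0 expr0z; exact: mul1r.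
Qed.

Lemma haar_weight n x : L n x -> n != 0 -> h x = 0.
Proof.
move=> e n0; have := haar_K x; rewrite e linearZ /= => /eqP.
rewrite -subr_eq0 -[X in _ - X]mul1r.
rewrite (_ : sq ^ n *: h x - 1 * h x = (sq ^ n - 1) * h x); last first.
  by rewrite mulrBl.
by rewrite mulf_eq0 subr_eq0 (negPf (sq_exp_neq1 n0)) => /eqP.
Qed.

Lemma haar_st x : h (st x) = conjc (h x).
Proof.
have [inv stD stZ stM] := SUq2_star (qalgP S).
have stX y k : st (y ^+ k) = st y ^+ k.
  by elim: k => [|k IH]; rewrite ?expr0 ?(st1 S) // exprS stM IH -exprSr.
move: x; apply: mn_ind => [x y ex ey|c x ex|i j l].
- by rewrite stD !linearD /= ex ey.
- by rewrite stZ !linearZ /= ex; exact: (esym (conjcM c (h x))).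
have [k [ek ki]] : exists k, st (ae i) = ae k /\ (k == 0) = (i == 0).
  case: i => [[|n]|n]; first by exists 0; rewrite /= !expr0 (st1 S).
    by exists (Negz n); rewrite /= stX.
  by exists (Posz n.+1); rewrite /= stX inv.
have e : st (mn i j l) = (q%:C ^ (- k)) ^+ l * (q%:C ^ (- k)) ^+ j *: mn k l j.
  rewrite /mn !stM !stX inv ek mulrA.
  rewrite (skewMl (skewXl l (skew_c_ae k)) (skewXl j (skew_cs_ae k))).
  by rewrite mulrA.
rewrite e linearZ /=.
have [i0|i0] := eqVneq i 0; last first.
  by rewrite !haar_mn0 ?ki ?i0 // conjc0; exact: mulr0.
have [<-|jl] := eqVneq j l; last first.
  by rewrite !haar_mn0 1?[l == j]eq_sym ?jl ?orbT // conjc0; exact: mulr0.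
have k0 : k = 0 by apply/eqP; rewrite ki i0.
rewrite i0 k0 haar_mn oppr0 expr0z !expr1n !mul1r.
by rewrite -(fmorphV (real_complex R)) conjcR.
Qed.

(** Moving t across a monomial multiplies it by a power of q, which is 1 unless
    the exponent of a is nonzero, and then both sides vanish. *)
Lemma haar_t x : h (gc * st gc * x) = h (x * (gc * st gc)).
Proof.
move: x; apply: mn_ind => [x y ex ey|c x ex|i j l].
- by rewrite mulrDr mulrDl !linearD /= ex ey.
- by rewrite -scalerAl -scalerAr !linearZ /= ex.
have -> : gc * st gc * mn i j l = (q%:C ^ (- i) * q%:C ^ (- i)) *: mn i j.+1 l.+1.
  by rewrite -mulrA cs_mn -scalerAr c_mn scalerA.
have -> : mn i j l * (gc * st gc) = mn i j.+1 l.+1.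
  rewrite /mn -mulrA (mulrA _ gc) -(commrX l c_comm) -!mulrA -exprSr (mulrA (gc ^+ j)).
  by rewrite -exprSr.
rewrite linearZ /=; have [->|i0] := eqVneq i 0; last by rewrite haar_mn0 ?i0 //; exact: mulr0.
by rewrite oppr0 expr0z mulr1; exact: mul1r.
Qed.

Lemma F1 : F 1 = 0.
Proof.
have := Uq_FM act 1 1; rewrite K1 (_ : Ki 1 = 1) ?mulr1 ?mul1r => [e|].
  by apply: (addrI (F 1)); rewrite -e addr0.
by rewrite -{2}(Uq_KiK act 1) K1.
Qed.

Lemma FX0 x n : F x = 0 -> F (x ^+ n) = 0.
Proof.
move=> e; elim: n => [|n IH]; first by rewrite expr0 F1.
by rewrite exprS (Uq_FM act) e IH mul0r mulr0 addr0.
Qed.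

(** The coefficient of a c^*l in F(c^*(l+1)), obtained by summing the twisted Leibniz
    rule over the l + 1 letters. *)
Definition kap l : R := - (s ^- 2 * (s ^+ l) ^- 3 * brk l.+1).

Lemma F_cs l : F (st gc ^+ l.+1) = (kap l)%:C *: (ga * st gc ^+ l).
Proof.
have sn : s != 0 := s0.
have lc : L 1 (st gc) by rewrite /Lsp /= (Uq_Kcs act).
elim: l => [|l IH].
  rewrite expr1 (Uq_Fcs act) expr0 mulr1 -scaleNr; congr (_ *: _).
  rewrite -(fmorphV (real_complex R)); apply: etrans (esym (rmorphN (real_complex R) _)) _.
  congr (_%:C); rewrite /kap /brk big_ord1 muln0 expr0 expr1n invr1 !mulr1.
  by rewrite qs.
rewrite exprS (Uq_FM act) IH (Uq_Fcs act) (LspX l.+1 lc) (Lsp_Ki lc).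
have e1 u v y : - (u *: ga) * (v *: y) = (- (u * v)) *: (ga * y).
  by rewrite mulNr -scalerAl -scalerAr scalerA scaleNr.
have e2 u v y : (u *: st gc) * (v *: (ga * y)) = (u * v * q%:C^-1) *: (ga * (st gc * y)).
  by rewrite -scalerAl -scalerAr (mulrA (st gc)) skew_csa -scalerAl !scalerA mulrA.
rewrite e1 e2 -exprS -scalerDl; congr (_ *: _).
have -> : sq ^ (1 *+ l.+1 : int) = (s ^+ l.+1)%:C.
  by rewrite natz rmorphXn.
rewrite exprN1 /sqrtq -/s -!(fmorphV (real_complex R)) -!(rmorphM (real_complex R)).
rewrite -(rmorphN (real_complex R)) -(rmorphD (real_complex R)); congr (_%:C).
rewrite /kap [brk l.+2]brkS qs; exact: kap_step.
Qed.

Definition an n j l := st ga ^+ n * gc ^+ j * st gc ^+ l.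

Lemma haar_an n j l : (n != 0%N) || (j != l) -> h (an n j l) = 0.
Proof. by rewrite -lt0n; apply: (haar_as (qhP S)). Qed.

Lemma F_as n : exists c, F (st ga ^+ n.+1) = c *: (gc * st ga ^+ n).
Proof.
have la : L 1 (st ga) by rewrite /Lsp /= (Uq_Kas act).
elim: n => [|n [c IH]]; first by exists 1; rewrite expr1 (Uq_Fas act) expr0 mulr1 scale1r.
rewrite exprS (Uq_FM act) IH (Uq_Fas act) (LspX n.+1 la) (Lsp_Ki la).
have e u v y : (u *: st ga) * (v *: (gc * y)) = (u * v * q%:C^-1) *: (gc * (st ga * y)).
  rewrite -scalerAl -scalerAr (mulrA (st ga)) (skew_sym qn skew_cas) -scalerAl !scalerA.
  by rewrite mulrA.
by rewrite e -scalerAr -exprS -scalerDl; eexists.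
Qed.

Lemma as_cj_a n j l : st ga ^+ n.+1 * gc ^+ j * (ga * st gc ^+ l) =
  q%:C^-1 ^+ j *: (an n j l - an n j.+1 l.+1).
Proof.
rewrite mulrA -(mulrA _ (gc ^+ j)) (skewXl j skew_ca) -scalerAr -scalerAl; congr (_ *: _).
rewrite exprSr mulrA -(mulrA _ (st ga)) asa mulrBr mulr1 !mulrBl; congr (_ - _).
rewrite /an -c_comm -!mulrA; congr (_ * _).
by rewrite (mulrA (st gc)) (commrX j (esym c_comm)) -!mulrA -exprS mulrA -exprS.
Qed.

(** As h vanishes on most monomials, only a^* c^j c^*(j+1) needs a computation.  Applying
    F to a^* yields a multiple of t^(j+1), applying it to the powers of c^*
    yields t^j - t^(j+1) times a constant, and the values of h on powers of t
    make the two contributions cancel ([kap_cancel]). *)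
Lemma haar_F x : h (F x) = 0.
Proof.
have sn : s != 0 := s0.
have lc : L (-1) gc by rewrite /Lsp /= (Uq_Kc act) exprN1.
have la : L (-1) ga by rewrite /Lsp /= (Uq_Ka act) exprN1.
have las : L 1 (st ga) by rewrite /Lsp /= (Uq_Kas act).
have lcs : L 1 (st gc) by rewrite /Lsp /= (Uq_Kcs act).
have Z c y : h (c *: y) = c * h y by rewrite linearZ.
move: x; apply: mn_ind => [x y ex ey|c x ex|i j l].
- by rewrite !linearD /= ex ey addr0.
- by rewrite linearZ Z ex mulr0.
have Fc : F (gc ^+ j) = 0 by apply: FX0 (Uq_Fc act).
case: i => n.
  have Fac : F (ga ^+ n * gc ^+ j) = 0.
    by rewrite (Uq_FM act) Fc (FX0 n (Uq_Fa act)) mul0r mulr0 addr0.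
  rewrite /mn /= (Uq_FM act) Fac mul0r add0r.
  case: l => [|l]; first by rewrite expr0 F1 mulr0 linear0.
  rewrite (Lsp_Ki (LspM (LspX n la) (LspX j lc))) F_cs -scalerAl -scalerAr !Z.
  have -> : ga ^+ n * gc ^+ j * (ga * st gc ^+ l) = q%:C^-1 ^+ j *: mn (Posz n.+1) j l.
    rewrite mulrA -(mulrA _ (gc ^+ j)) (skewXl j skew_ca) -scalerAr -scalerAl.
    by rewrite mulrA -exprSr.
  by rewrite Z haar_mn0 // !mulr0.
rewrite /mn /= -mulrA (Uq_FM act) linearD /= (Uq_FM act) Fc mul0r add0r.
rewrite (LspM (LspX j lc) (LspX l lcs)) (Lsp_Ki (LspX n.+1 las)) (Lsp_Ki (LspX j lc)).
rewrite -!scalerAl -!scalerAr !Z.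
have second l' : h (st ga ^+ n.+1 * (gc ^+ j * F (st gc ^+ l'.+1))) =
    (kap l')%:C * (q%:C^-1 ^+ j * (h (an n j l') - h (an n j.+1 l'.+1))).
  by rewrite F_cs -!scalerAr Z mulrA as_cj_a Z linearB.
case: n second => [|n] second.
  rewrite expr1 (Uq_Fas act) (mulrA gc) -exprS.
  have -> : gc ^+ j.+1 * st gc ^+ l = an 0 j.+1 l by rewrite /an expr0 mul1r.
  case: l second => [|l] second.
    by rewrite F1 !mulr0 linear0 !mulr0 haar_an ?orbT // mulr0 addr0.
  rewrite -(expr1 (st ga)) second.
  have [<-|jl] := eqVneq j l; last by rewrite !haar_an ?eqSS ?jl ?orbT // subrr !mulr0 addr0.
  have an0 k : an 0 k k = mn 0 k k by [].
  rewrite !an0 !haar_mn.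
  have e1 : sq ^ (-1 *+ j + j.+1%:R : int) = s%:C.
    by rewrite mulNrn !natz (_ : - j%:Z + j.+1%:Z = 1) //; lia.
  have e2 : sq ^ (1 *- 1 : int) = s^-1%:C.
    by rewrite (fmorphV (real_complex R)) -exprN1.
  have e3 : sq ^ (-1 *- j : int) = (s ^+ j)%:C.
    by rewrite -mulNrn opprK natz rmorphXn.
  rewrite e1 e2 e3 -(fmorphV (real_complex R)) -!(fmorphV (real_complex R)) -!(rmorphXn (real_complex R)).
  rewrite -(rmorphB (real_complex R)) -!(rmorphM (real_complex R)) -(rmorphD (real_complex R)).
  rewrite -(rmorph0 (real_complex R)); congr (_%:C).
  have b1 := brk_neq0 j; have b2 := brk_neq0 j.+1.
  rewrite /kap; move: b1 b2; rewrite [brk j.+2]brkS qs.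
  exact: kap_cancel.
have [c ->] := F_as n.+1.
have -> : c *: (gc * st ga ^+ n.+1) * (gc ^+ j * st gc ^+ l) =
    (c * q%:C ^+ n.+1) *: an n.+1 j.+1 l.
  by rewrite (skewXr n.+1 skew_cas) -!scalerAl scalerA !mulrA -(mulrA _ gc) -exprS.
rewrite Z haar_an // !mulr0 add0r.
case: l second => [|l] second; first by rewrite F1 !mulr0 linear0 !mulr0.
by rewrite second !haar_an // subrr !mulr0.
Qed.

Lemma haar_E x : h (E x) = 0.
Proof.
have [-> _] := E_st q_gt0 x; rewrite linearN linearZ /=.
by rewrite haar_st haar_F conjc0 [_ * _]mulr0 oppr0.
Qed.

End Haar.

(** * Faithfulness of the Haar state *)

Section Moments.
Variables (Fd : fieldType) (p : Fd).
Hypotheses (p_inj : injective (fun n => p ^+ n)) (p0 : p != 0).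

(** After multiplication by the denominators the hypothesis says that a polynomial
    vanishes at all powers p^(m+1), hence is zero; its value at p^-(k+1) isolates
    the k-th term. *)
Lemma moments n (g : nat -> Fd) :
  (forall m, \sum_(k < n) g k / (1 - p ^+ (m + k).+2) = 0) ->
  forall k, (k < n)%N -> g k = 0.
Proof.
move=> h.
have pn1 k : 1 - p ^+ k.+1 != 0.
  by rewrite subr_eq0 eq_sym -[X in _ != X](expr0 p) (inj_eq p_inj).
pose fac (l : nat) : {poly Fd} := 1 - p ^+ l.+1 *: 'X.
have facE l x : (fac l).[x] = 1 - p ^+ l.+1 * x by rewrite /fac !hornerE.
(* The numerator of the sum of the g k / (1 - p^(k+1) x); its hypothesised zeros are
   x = p^(m+1). *)
pose Q := \sum_(k < n) g k *: \prod_(l < n | l != k) fac l.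
have Q0 : Q = 0.
  apply: (@roots_geq_poly_eq0 _ _ [seq p ^+ m.+1 | m <- iota 0 (size Q)]).
  - apply/allP => _ /mapP [m _ ->]; rewrite /root /Q horner_sum.
    transitivity ((\prod_(l < n) (1 - p ^+ (m + l).+2)) * (\sum_(k < n) g k / (1 - p ^+ (m + k).+2)) == 0);
      last by rewrite h mulr0 eqxx.
    congr (_ == _); rewrite mulr_sumr; apply: eq_bigr => k _.
    have G (a b c : Fd) : a != 0 -> a * b * (c / a) = c * b by move=> a0; field.
    rewrite hornerZ horner_prod [in RHS](bigD1 k) //= G; last exact: pn1.
    congr (_ * _); apply: eq_bigr => l _; rewrite facE -exprD.
    by congr (1 - p ^+ _); lia.
  - by rewrite map_inj_uniq ?iota_uniq // => i j /p_inj [].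
  - by rewrite size_map size_iota.
move=> k0 k0n; have := congr1 (fun P : {poly Fd} => P.[p ^- k0.+1]) Q0.
rewrite horner0 /Q horner_sum (bigD1 (Ordinal k0n)) //=.
rewrite [X in _ + X]big1 => [|k nk]; last first.
  rewrite hornerZ horner_prod (bigD1 (Ordinal k0n)) /=; last by rewrite eq_sym.
  by rewrite facE mulfV ?expf_neq0 // subrr mul0r mulr0.
rewrite addr0 hornerZ horner_prod => /eqP; rewrite mulf_eq0 => /orP [/eqP //|].
rewrite prodf_seq_eq0 => /hasP [l _] /andP [nl].
rewrite facE subr_eq0 eq_sym => /eqP e.
have /p_inj [] : p ^+ l.+1 = p ^+ k0.+1.
  by rewrite -[RHS]mul1r -e mulfVK // expf_neq0.
by move=> ll; case/eqP: nl; apply: val_inj.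
Qed.

End Moments.

Lemma exprz_quad (F : fieldType) (x y : F) (n : int) : x != 0 -> y = x * x ->
  x ^ (n *+ 4) = y ^ n * y ^ n.
Proof. by move=> x0 ->; rewrite expfzMl !mulrS mulr0n addr0 !expfzDr // !mulrA. Qed.

Lemma lin_neq0 (F : fieldType) (c : F) : 1 - c *: 'X != 0.
Proof.
apply/eqP => /(congr1 (fun f : {poly F} => f`_0)) /eqP.
by rewrite coefB coefZ coefX mulr0 subr0 coef1 coef0 oner_eq0.
Qed.

Section Faithful.
Variables (R : realType) (q : R).
Hypotheses (q_gt0 : 0 < q) (q_lt1 : q < 1).
Variable S : quantum_SU2 q.
Local Notation C := R[i].
Local Notation h := (qh S).
Local Notation st := (@qst R q S).
Local Notation ga := (@qa R q S).
Local Notation gc := (@qc R q S).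
Local Notation act := (qactP S).
Local Notation sq := (sqrtq q : C).
Local Notation L := (@Lsp R q S).
Implicit Types x y z : S.

Definition tt : S := gc * st gc.
Definition pt (f : {poly C}) : S := horner_alg tt f.

Lemma pt_expand f : pt f = \sum_(k < size f) f`_k *: tt ^+ k.
Proof.
rewrite /pt -{1}[f]coefK poly_def rmorph_sum; apply: eq_bigr => k _ /=.
by rewrite linearZ /= rmorphXn /= horner_algX mulr_algl.
Qed.

Lemma comm_pt x f : GRing.comm x tt -> GRing.comm x (pt f).
Proof.
move=> c; rewrite /GRing.comm pt_expand mulr_sumr mulr_suml; apply: eq_bigr => k _.
by rewrite -scalerAl -scalerAr (commrX k c).
Qed.

Lemma comm_c : GRing.comm gc tt.
Proof. by rewrite /GRing.comm /tt -[RHS]mulrA -(c_comm S). Qed.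

Lemma comm_cs : GRing.comm (st gc) tt.
Proof. by rewrite /GRing.comm /tt mulrA -(c_comm S). Qed.

Definition ce (d : int) : S := match d with Posz n => gc ^+ n | Negz n => st gc ^+ n.+1 end.
(** The monomials a^i c^d with integer exponents, c^* in the role of the inverse of c: a
    basis of the algebra over the polynomials in t. *)
Definition ee (k : int * int) : S := ae S k.1 * ce k.2.

Lemma comm_ce d : GRing.comm (ce d) tt.
Proof.
by apply: commr_sym; case: d => n; apply: commrX; apply: commr_sym; [exact: comm_c|exact: comm_cs].
Qed.

Lemma mn_ee i j l : mn S i j l = ee (i, j%:Z - l%:Z) * tt ^+ minn j l.
Proof.
rewrite /mn /ee /= -!mulrA; congr (_ * _).
rewrite /tt exprMn_comm; last exact: c_comm.
have [lj|jl] := leqP l j.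
  by rewrite (_ : j%:Z - l%:Z = Posz (j - l)) ?mulrA -?exprD ?subnK //; lia.
have [k ek] : exists k, (l = j + k.+1)%N by exists (l - j).-1; lia.
rewrite (_ : j%:Z - l%:Z = Negz k); last by rewrite NegzE ek; lia.
have cm : GRing.comm (gc ^+ j) (st gc ^+ k.+1).
  by apply: commrX; apply: commr_sym; apply: commrX; exact/esym/c_comm.
by rewrite /= mulrA -cm -mulrA -exprD ek addnC.
Qed.

Lemma Lsp_ee k : L (- k.1 - k.2) (ee k).
Proof.
case: k => i d; apply: (LspM q_gt0); first exact: Lsp_ae.
have lc : L (-1) gc by rewrite /Lsp /= (Uq_Kc act) exprN1.
have lcs : L 1 (st gc) by rewrite /Lsp /= (Uq_Kcs act).
case: d => n /=.
  have -> : - Posz n = (-1) *+ n by rewrite mulNrn natz.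
  exact: (LspX q_gt0).
have -> : - Negz n = 1 *+ n.+1 by rewrite NegzE opprK natz.
exact: (LspX q_gt0).
Qed.

Lemma Lsp_tt : L 0 tt.
Proof.
have lc : L (-1) gc by rewrite /Lsp /= (Uq_Kc act) exprN1.
have lcs : L 1 (st gc) by rewrite /Lsp /= (Uq_Kcs act).
exact: (LspM q_gt0 lc lcs).
Qed.

Lemma Lsp_ttX n : L 0 (tt ^+ n).
Proof. by have := LspX q_gt0 n Lsp_tt; rewrite mul0rn. Qed.

Lemma Lsp_pt f : L 0 (pt f).
Proof. by rewrite pt_expand; apply: Lsp_sum => k _; apply: LspZ; exact: Lsp_ttX. Qed.

Definition zt (i : int) : C := sq ^ (- i *+ 4).

Lemma skew_t_ae i : qcomm (zt i) tt (ae S i).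
Proof.
have -> : zt i = q%:C ^ (- i) * q%:C ^ (- i) := exprz_quad _ (sq_neq0 q_gt0) (qCE q_gt0).
exact: skewMl (skew_c_ae q_gt0 S i) (skew_cs_ae q_gt0 S i).
Qed.

Lemma zt_neq0 i : zt i != 0.
Proof. by rewrite expfz_neq0 // (sq_neq0 q_gt0). Qed.

Lemma skew1 x y : GRing.comm x y -> qcomm 1 x y.
Proof. by move=> e; rewrite /qcomm scale1r. Qed.

Lemma skew_t_ee k : qcomm (zt k.1) tt (ee k).
Proof.
rewrite -[zt _]mulr1; apply: skewMr; first exact: skew_t_ae.
by apply: skew1; apply: commr_sym; exact: comm_ce.
Qed.

Lemma st_tt : st tt = tt.
Proof. by have [inv stD stZ stM] := SUq2_star (qalgP S); rewrite /tt stM inv. Qed.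

Lemma skew_see_t k : qcomm (zt k.1) (st (ee k)) tt.
Proof.
have [inv stD stZ stM] := SUq2_star (qalgP S).
have := congr1 st (skew_t_ee k); rewrite stM stZ stM st_tt conj_sq.
by [].
Qed.

(** Moving t around under h multiplies the value by c, which differs from 1. *)
Lemma haar_skew x c m : qcomm c x tt -> c != 1 -> h (tt ^+ m.+1 * x) = 0.
Proof.
move=> e c1.
have : h (tt ^+ m.+1 * x) = c * h (tt ^+ m.+1 * x).
  have ht y : h (tt * y) = h (y * tt) := haar_t q_gt0 y.
  rewrite {1}exprS -mulrA ht -mulrA e -scalerAr.
  by rewrite linearZ /= exprSr -mulrA.
move/eqP; rewrite -subr_eq0 -{1}[h _]mul1r -mulrBl mulf_eq0 subr_eq0 eq_sym.
by rewrite (negPf c1) => /eqP.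
Qed.

Lemma pt1 : pt 1 = 1. Proof. exact: rmorph1. Qed.
Lemma ptM f g : pt (f * g) = pt f * pt g. Proof. exact: rmorphM. Qed.
Lemma ptB f g : pt (f - g) = pt f - pt g. Proof. exact: rmorphB. Qed.
Lemma ptX : pt 'X = tt. Proof. exact: horner_algX. Qed.
Lemma ptXn n : pt 'X^n = tt ^+ n. Proof. by rewrite /pt rmorphXn /= horner_algX. Qed.
Lemma ptZ c f : pt (c *: f) = c *: pt f.
Proof. by rewrite /pt linearZ /= mulr_algl. Qed.

Lemma pow_pow (x x' : S) c d n : x' * x = 1 - d *: tt -> qcomm c tt x ->
  exists2 f, f != 0 & x' ^+ n * x ^+ n = pt f.
Proof.
move=> e cx; elim: n => [|n [f f0 IH]]; first by exists 1; rewrite ?oner_eq0 // !expr0 mulr1 pt1.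
exists (f * (1 - (d * c ^+ n) *: 'X)); first by rewrite mulf_neq0 ?lin_neq0.
rewrite exprSr exprS mulrA -(mulrA _ x') e mulrBr mulr1 mulrBl IH -scalerAr -scalerAl.
rewrite -mulrA (skewXr n cx) -scalerAr mulrA IH ptM ptB pt1 ptZ ptX mulrBr mulr1.
by rewrite -scalerAr scalerA.
Qed.

(** Successive cancellation of a^* a = 1 - t or a a^* = 1 - q^2 t leaves a product of
    nonzero linear factors in t. *)
Lemma see_ee k : exists2 f, f != 0 & st (ee k) * ee k = pt f.
Proof.
have [inv stD stZ stM] := SUq2_star (qalgP S).
have stX y n : st (y ^+ n) = st y ^+ n.
  by elim: n => [|n IH]; rewrite ?expr0 ?(st1 S) // exprS stM IH -exprSr.
have asa' : st ga * ga = 1 - 1 *: tt by rewrite asa scale1r /tt (c_comm S).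
have aas' : ga * st ga = 1 - (q ^+ 2)%:C *: tt by rewrite aas.
have ca := skewMl (skew_ca q_gt0 S) (skew_csa q_gt0 S).
have cas := skewMl (skew_cas S) (skew_csas S).
case: k => i d; rewrite /ee /=.
have [f f0 ef] : exists2 f, f != 0 & st (ae S i) * ae S i = pt f.
  case: i => n; rewrite /= stX ?inv; first exact: pow_pow asa' ca.
  exact: pow_pow aas' cas.
have [g g0 eg] : exists2 g, g != 0 & st (ce d) * ce d = pt g.
  have ttX n : tt ^+ n = gc ^+ n * st gc ^+ n by rewrite /tt exprMn_comm //; exact: c_comm.
  case: d => n; rewrite /= stX ?inv.
    exists ('X^n : {poly C}); rewrite ?monic_neq0 ?monicXn // ptXn ttX.
    exact: (commrX _ (commr_sym (commrX _ (c_comm S)))).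
  by exists ('X^(n.+1) : {poly C}); rewrite ?monic_neq0 ?monicXn // ptXn ttX.
exists (g * f); first by rewrite mulf_neq0.
rewrite stM mulrA -(mulrA _ _ (ae S i)) ef -mulrA -(comm_pt f (comm_ce d)) mulrA eg.
by rewrite ptM.
Qed.

Lemma haar_tt k : h (tt ^+ k) = (brk q k.+1)%:C^-1.
Proof. exact: (haar_cc (qhP S)). Qed.

Lemma q2X_inj : injective (fun n => (q ^+ 2)%:C ^+ n : C).
Proof.
move=> i j; rewrite /= -!(rmorphXn (real_complex R)) => /(@complexI R).
have p1 : q ^+ 2 != 1 := qX_neq1 q_gt0 q_lt1 (isT : (0 < 2)%N).
have p0 : 0 < q ^+ 2 by rewrite exprn_gt0.
by move=> e; have /(ieexprIz p0 p1) [] : q ^+ 2 ^ i%:Z = q ^+ 2 ^ j%:Z by [].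
Qed.

(** The values of h on powers of t are inverse geometric sums, so the moments of
    g against t^(m+1) are those of [moments] with p = q^2. *)
Lemma pt_moments g : (forall m, h (tt ^+ m.+1 * pt g) = 0) -> g = 0.
Proof.
move=> hg; have p0 : (q ^+ 2)%:C != 0 :> C.
  by rewrite (inj_eq (@complexI R) _ 0) expf_neq0 // q_neq0.
have Z : forall k, (k < size g)%N -> g`_k = 0.
  apply: (moments q2X_inj p0) => m; have := hg m.
  rewrite pt_expand mulr_sumr linear_sum /= => e.
  have q21 : 1 - q ^+ 2 != 0.
    by rewrite subr_eq0 eq_sym (qX_neq1 q_gt0 q_lt1).
  have q21C : (1 - q ^+ 2)%:C != 0 :> C by rewrite (inj_eq (@complexI R) _ 0).
  apply: (mulfI q21C); rewrite mulr0 -[RHS]e mulr_sumr; apply: eq_bigr => k _.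
  have Zh c y : h (c *: y) = c * h y by rewrite linearZ.
  rewrite -scalerAr -exprD Zh haar_tt mulrCA; congr (_ * _).
  rewrite -(rmorphXn (real_complex R)) -(rmorph1 (real_complex R)).
  rewrite -(rmorphB (real_complex R)) -!(fmorphV (real_complex R)) -(rmorphM (real_complex R)).
  congr (_%:C); have pn : 1 - q ^+ 2 ^+ (m + k).+2 != 0.
    by rewrite subr_eq0 eq_sym -exprM (qX_neq1 q_gt0 q_lt1).
  have -> : brk q (m.+1 + k).+1 = (1 - q ^+ 2 ^+ (m + k).+2) / (1 - q ^+ 2).
    apply: (mulIf q21); rewrite divfK // mulrC.
    have G (x : R) n : 1 - x ^+ n = (1 - x) * \sum_(i < n) x ^+ i.
      by rewrite -[1 - x ^+ n]opprB subrX1 -[1 - x]opprB mulNr.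
    rewrite (G (q ^+ 2)); congr (_ * _).
    by apply: eq_bigr => i _; rewrite exprM.
  by rewrite invf_div.
apply/polyP => k; rewrite coef0; have [/Z //|] := ltnP k (size g).
by move=> ?; rewrite nth_default.
Qed.

Local Notation key := (int * int)%type.

Lemma sum_uniq_sub (r r' : seq key) (f : key -> S) : uniq r -> uniq r' -> {subset r <= r'} ->
  \sum_(k <- r') (if k \in r then f k else 0) = \sum_(k <- r) f k.
Proof.
move=> ur ur' rr'; rewrite -big_mkcond /= -big_filter; apply: perm_big.
apply: uniq_perm; rewrite ?filter_uniq // => k; rewrite mem_filter.
by case kr : (k \in r) => //=; rewrite rr'.
Qed.

Lemma ee_span x : exists r (f : key -> {poly C}), uniq r /\ x = \sum_(k <- r) ee k * pt (f k).
Proof.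
move: x; apply: (mn_ind q_gt0) => [x y [r [f [ur ->]]] [r' [f' [ur' ->]]]|c x [r [f [ur ->]]]|i j l].
- exists (undup (r ++ r')).
  exists (fun k => (if k \in r then f k else 0) + (if k \in r' then f' k else 0)).
  split; first exact: undup_uniq.
  rewrite -(sum_uniq_sub _ ur (undup_uniq (r ++ r'))) => [|k kr]; last first.
    by rewrite mem_undup mem_cat kr.
  rewrite -(sum_uniq_sub _ ur' (undup_uniq (r ++ r'))) => [|k kr]; last first.
    by rewrite mem_undup mem_cat kr orbT.
  rewrite -big_split; apply: eq_bigr => k _ /=.
  have p0 : pt 0 = 0 by exact: rmorph0.
  have pD f1 f2 : pt (f1 + f2) = pt f1 + pt f2 by exact: rmorphD.
  by rewrite pD mulrDr; case: (k \in r); case: (k \in r'); rewrite ?p0 ?mulr0.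
- exists r, (fun k => c *: f k); split=> //.
  by rewrite scaler_sumr; apply: eq_bigr => k _; rewrite ptZ -scalerAr.
exists [:: (i, j%:Z - l%:Z)], (fun=> 'X^(minn j l)); split=> //.
by rewrite big_seq1 ptXn mn_ee.
Qed.

Lemma sq_exp_inj : injective (fun n : int => sq ^ n).
Proof.
move=> m n /= e; apply/eqP; rewrite -subr_eq0; apply: contraT => /(sq_exp_neq1 q_gt0 q_lt1).
rewrite expfzDr ?(sq_neq0 q_gt0) // e -expfzDr ?(sq_neq0 q_gt0) // subrr expr0z.
by rewrite eqxx.
Qed.

(** Distinct monomials have distinct K-weights or distinct commutation factors
    with t, and either of these makes them orthogonal. *)
Lemma haar_ortho k0 k f m : k != k0 -> h (tt ^+ m.+1 * (st (ee k0) * (ee k * pt f))) = 0.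
Proof.
move=> nk; have [e1|n1] := eqVneq k.1 k0.1.
  have w : L (0 + (- (- k0.1 - k0.2) + ((- k.1 - k.2) + 0))) (tt ^+ m.+1 * (st (ee k0) * (ee k * pt f))).
    apply: (LspM q_gt0); first exact: Lsp_ttX.
    apply: (LspM q_gt0); first by apply: (Lsp_st q_gt0); exact: Lsp_ee.
    by apply: (LspM q_gt0); [exact: Lsp_ee|exact: Lsp_pt].
  apply: (haar_weight q_gt0 q_lt1 w).
  rewrite e1 (_ : _ + _ = k0.2 - k.2); last by ring.
  rewrite subr_eq0; apply: contra nk => /eqP e2.
  by case: k e1 e2 {w} => a b; case: (k0) => a' b' /= -> ->.
have cpt : qcomm 1 (pt f) tt by apply: skew1; apply: commr_sym; exact: comm_pt.
have c := skewMl (skew_see_t k0) (skewMl (skew_sym (zt_neq0 _) (skew_t_ee k)) cpt).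
apply: (haar_skew _ c); rewrite mulr1; apply: contra n1 => /eqP e.
have : zt k0.1 = zt k.1 by rewrite -[RHS]mul1r -e mulfVK // zt_neq0.
move/sq_exp_inj => e'; apply/eqP/esym; apply: oppr_inj.
by apply: (pmulrnI (isT : (0 < 4)%N)); exact: e'.
Qed.

(** Testing x against t^(m+1) times the adjoint of a monomial isolates the coefficient
    of that monomial, by [haar_ortho]; all its moments vanish, so it is zero.
    The positive power of t serves to compare commutation factors. *)
Lemma haar_faithful x : (forall y, h (y * x) = 0) -> x = 0.
Proof.
move=> hx; have [r [f [ur ex]]] := ee_span x.
rewrite ex big_seq big1 // => k0 kr; have [g g0 eg] := see_ee k0.
suff /eqP : g * f k0 = 0.
  by rewrite mulf_eq0 (negPf g0) /= => /eqP ->; rewrite /pt rmorph0 mulr0.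
apply: pt_moments => m; have := hx (tt ^+ m.+1 * st (ee k0)).
rewrite ex mulr_sumr linear_sum (bigD1_seq k0) //= big1 => [|k nk].
  by rewrite addr0 ptM -eg !mulrA.
by rewrite -mulrA haar_ortho.
Qed.

(** Spaces of different weights are orthogonal, which restricts the test elements of
    [haar_faithful] to the weight of x. *)
Lemma haar_nondeg n x : L n x -> (forall y, L n y -> h (st y * x) = 0) -> x = 0.
Proof.
have [inv stD stZ stM] := SUq2_star (qalgP S).
move=> Lx hx; apply: haar_faithful => y; rewrite -(inv y).
move: (st y) => {}y; move: y; apply: (mn_ind q_gt0) => [y z hy hz|c y hy|i j l].
- by rewrite stD mulrDl linearD /= hy hz addr0.
- by rewrite stZ -scalerAl linearZ /= hy; exact: mulr0.
have Lm := Lsp_mn q_gt0 S i j l.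
have [e|ne] := eqVneq (l%:Z - j%:Z - i) n; first by apply: hx; rewrite -e.
apply: (haar_weight q_gt0 q_lt1 (LspM q_gt0 (Lsp_st q_gt0 Lm) Lx)).
by rewrite addrC subr_eq0 eq_sym.
Qed.

End Faithful.

(** * Forms on the quantum sphere *)

(** The coefficient of w_u in a form on the sphere has weight - [wt u]. *)
Definition wtg (a : gen) : int := match a with wm => 2 | wp => -2 | _ => 0 end.
Definition wt (u : seq gen) : int := foldr (fun a n => wtg a + n) 0 u.

(** In the exterior algebra of w_-, w_+, w_0 alone the products are classical, so
    that three letters multiply with the sign of their permutation. *)
Definition eps3 (u : seq gen) : Z :=
  match u with
  | [:: wm; wp; w0] | [:: wp; w0; wm] | [:: w0; wm; wp] => 1
  | [:: wp; wm; w0] | [:: wm; w0; wp] | [:: w0; wp; wm] => -1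
  | _ => 0
  end%ZZ.

Definition check_eps3 : bool :=
  all (fun a => all (fun b => all (fun c =>
    veq (nf [:: a; b; c]) [:: ([:: wm; wp; w0], lm 0%ZZ (eps3 [:: a; b; c]))])
    [:: wm; wp; w0]) [:: wm; wp; w0]) [:: wm; wp; w0].
Lemma check_eps3T : check_eps3. Proof. by vm_compute. Qed.

Lemma eps3_wt u : size u = 3 -> eps3 u != 0%ZZ -> wt u = 0.
Proof. by case: u => [|[] [|[] [|[] []]]]. Qed.

Definition comps (k : nat) : seq (seq gen) :=
  match k with
  | 0 => [:: [::]]
  | 1 => [:: [:: wm]; [:: wp]; [:: w0]]
  | 2 => [:: [:: wm; w0]; [:: wm; wp]; [:: w0; wp]]
  | 3 => [:: [:: wm; wp; w0]]
  | _ => [::]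
  end.

(** The word completing the adjoint of w_u to the top word, oriented as in the formulas
    for the Hodge operators.  It has the weight of u because the top word has
    weight zero and the adjoint changes the sign of weights. *)
Definition dual (u : seq gen) : seq gen :=
  match u with
  | [::] => [:: wm; wp; w0] | [:: wm; wp; w0] => [::]
  | [:: wm] => [:: wm; w0] | [:: wm; w0] => [:: wm]
  | [:: wp] => [:: w0; wp] | [:: w0; wp] => [:: wp]
  | [:: w0] => [:: wm; wp] | [:: wm; wp] => [:: w0]
  | _ => [::]
  end.

Lemma comps_case (P : nat -> seq gen -> Prop) :
  P 0%N [::] -> P 1%N [:: wm] -> P 1%N [:: wp] -> P 1%N [:: w0] ->
  P 2%N [:: wm; w0] -> P 2%N [:: wm; wp] -> P 2%N [:: w0; wp] -> P 3%N [:: wm; wp; w0] ->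
  forall k u, u \in comps k -> P k u.
Proof.
move=> p0 p1 p2 p3 p4 p5 p6 p7 [|[|[|[|k]]]] u; rewrite /= ?inE //.
- by move/eqP->.
- by case/or3P => /eqP ->.
- by case/or3P => /eqP ->.
- by move/eqP->.
Qed.

Lemma comps_uniq k : uniq (comps k). Proof. by case: k => [|[|[|[|k]]]]. Qed.

Lemma comps_size k u : u \in comps k -> size u = k.
Proof. by apply: (comps_case (P := fun k u => size u = k)). Qed.

Lemma comps_zfree k u : u \in comps k -> wz \notin u.
Proof. by apply: (comps_case (P := fun k u => wz \notin u)). Qed.

Lemma dualK k u : u \in comps k -> dual (dual u) = u.
Proof. by apply: (comps_case (P := fun k u => dual (dual u) = u)). Qed.

Lemma wt_dual k u : u \in comps k -> wt (dual u) = wt u.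
Proof. by apply: (comps_case (P := fun k u => wt (dual u) = wt u)). Qed.

Lemma dual_comps k u : u \in comps k -> dual u \in comps (3 - k).
Proof. by apply: (comps_case (P := fun k u => dual u \in comps (3 - k)%N)). Qed.

Lemma dual_zfree k u : u \in comps k -> wz \notin dual u.
Proof. by move/dual_comps/comps_zfree. Qed.

Lemma perm_dual k : (k <= 3)%N -> perm_eq [seq dual u | u <- comps k] (comps (3 - k)).
Proof. by case: k => [|[|[|[|k]]]]. Qed.

Lemma wt_barw u : wt (barw u) = - wt u.
Proof.
have wtc v w : wt (v ++ w) = wt v + wt w.
  by elim: v => [|a v IH] /=; rewrite ?add0r // IH addrA.
elim: u => [|a u IH] //; rewrite barw_cons wtc IH /= addr0 opprD addrC; congr (_ + _).
by case: (a).
Qed.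

Lemma barw_zfree u : wz \notin u -> wz \notin barw u.
Proof.
rewrite /barw mem_rev; apply: contra => /mapP [a au].
by case: a au.
Qed.

Lemma wt_inj k u v : u \in comps k -> v \in comps k -> wt u = wt v -> u = v.
Proof.
move=> uk; apply: (comps_case (P := fun k u => forall v, v \in comps k -> wt u = wt v -> u = v)) uk v;
  by move=> v; rewrite !inE; first [move/eqP->|case/or3P => /eqP ->].
Qed.

(** Sign of the pairing of a component with its dual in the top degree. *)
Definition psgn (u : seq gen) : Z :=
  match u with [:: w0] | [:: wm; wp] => -1 | _ => 1 end%ZZ.

Lemma eps3_dual k u v : u \in comps k -> v \in comps k ->
  (-1) ^+ 'C(k.+1, 2) * int_of_Z (eps3 (barw u ++ dual v)) =
  (if u == v then int_of_Z (psgn u) else 0).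
Proof.
move=> uk; apply: (comps_case (P := fun k u => forall v, v \in comps k -> (-1) ^+ 'C(k.+1, 2) *
  int_of_Z (eps3 (barw u ++ dual v)) = (if u == v then int_of_Z (psgn u) else 0))) uk v;
  by move=> v; rewrite !inE; first [move/eqP->|case/or3P => /eqP ->].
Qed.

Section Components.
Variables (R : realType) (q : R).
Hypotheses (q_gt0 : 0 < q) (q_lt1 : q < 1).
Variable S : quantum_SU2 q.
Local Notation C := R[i].
Let s := Num.sqrt q.
Local Notation K := (qK S).
Local Notation E := (qE S).
Local Notation F := (qF S).
Local Notation h := (qh S).
Local Notation st := (@qst R q S).
Local Notation act := (qactP S).
Local Notation s0 := (s_neq0 q_gt0).
Local Notation qs := (q_sqr q_gt0).
Local Notation sq := (sqrtq q : C).
Local Notation L := (@Lsp R q S).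
Local Notation omS := (@omA R q S).
Local Notation mpo := [:: wm; wp; w0].
Implicit Types x y z : S.

Lemma fcoef_z a x : a != wz -> fcoef a wz x = 0.
Proof. by case: a. Qed.

Lemma fword_z u v x : wz \notin u -> wz \in v -> fword u v x = 0.
Proof.
elim: u v => [|a u IH] [|b v] //=; rewrite !inE negb_or => /andP [az uz].
case/orP => [/eqP <-|vz]; first by rewrite fcoef_z // eq_sym.
by rewrite IH ?fcoef0.
Qed.

Lemma Lsp_K n x : L n x -> L n (K x).
Proof. by move=> e; rewrite e; apply: LspZ. Qed.

Lemma Lsp_fcoef a b n x : a != wz -> L n x -> L (n + wtg a - wtg b) (fcoef a b x).
Proof.
move=> az Lx; case: a az => // _; case: b => //=; rewrite ?addr0 ?subr0 ?addrK //;
  try exact: Lsp0; try exact: Lsp_K (Lsp_K _).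
- by apply: LspZ; apply: Lsp_K; apply: (Lsp_E q_gt0).
- by apply: LspZ; apply: (Lsp_F q_gt0); apply: Lsp_K.
Qed.

Lemma Lsp_fword u v n x : wz \notin u -> L n x -> L (n + wt u - wt v) (fword u v x).
Proof.
elim: u v n => [|a u IH] [|b v] n //=; rewrite ?addr0 ?subr0 //; try by move=> *; exact: Lsp0.
rewrite inE negb_or eq_sym => /andP [az uz] Lx.
have := Lsp_fcoef b az (IH v n uz Lx); congr (L _ _); ring.
Qed.

(** Invariance of the Haar state: h(K^n x) = h(x) and h kills the images of E and F. *)
Lemma haar_fcoef a b x : a != wz -> h (fcoef a b x) = (if a == b then h x else 0).
Proof.
have Z c y : h (c *: y) = c * h y by rewrite linearZ.
case: a => // _; case: b => //=; rewrite ?linear0 ?Z ?(haar_K q_gt0) //.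
- by rewrite (haar_E q_gt0 q_lt1) mulr0.
- by rewrite (haar_F q_gt0 q_lt1) mulr0.
Qed.

Lemma haar_fword u v x : size u = size v -> wz \notin u ->
  h (fword u v x) = (if u == v then h x else 0).
Proof.
elim: u v => [|a u IH] [|b v] //= [suv]; rewrite inE negb_or eq_sym => /andP [az uz].
rewrite haar_fcoef // IH // eqseq_cons; by case: (a == b); case: (u == v).
Qed.

Definition eps u : C := (int_of_Z (eps3 u))%:~R.

Lemma omA_eps u : size u = 3 -> wz \notin u -> omS u = eps u *: omS mpo.
Proof.
move=> su uz; have e : om q u = eps u *: om q mpo.
  rewrite (om_nf [::] s0 qs) ?su //.
  have -> : linext s [::] (om q) (nf u) = linext s [::] (om q) [:: (mpo, lm 0%ZZ (eps3 u))].
    apply: vsum_eq; case: u su uz => [|a [|b [|c []]]] //= _; rewrite !inE !negb_or.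
    move=> /and3P [az bz cz].
    have m3 d : wz != d -> d \in [:: wm; wp; w0] by case: d.
    have := check_eps3T => /allP/(_ a (m3 _ az))/allP/(_ b (m3 _ bz))/allP/(_ c (m3 _ cz)).
    by [].
  rewrite /linext big_seq1 /lm; congr (_ *: _).
  by rewrite pev_cons0 pev_nil addr0 expr0z mulr1 (rmorph_int (real_complex R)).
by apply: funext => w; rewrite tensZ /omA /of_inv e tensZ scalerA.
Qed.

End Components.

Section Pairing.
Variables (R : realType) (q : R).
Hypotheses (q_gt0 : 0 < q) (q_lt1 : q < 1).
Variable S : quantum_SU2 q.
Local Notation C := R[i].
Let s := Num.sqrt q.
Local Notation K := (qK S).
Local Notation E := (qE S).
Local Notation F := (qF S).
Local Notation h := (qh S).
Local Notation st := (@qst R q S).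
Local Notation act := (qactP S).
Local Notation s0 := (s_neq0 q_gt0).
Local Notation qs := (q_sqr q_gt0).
Local Notation sq := (sqrtq q : C).
Local Notation L := (@Lsp R q S).
Local Notation omS := (@omA R q S).
Local Notation mpo := [:: wm; wp; w0].
Local Notation form := (seq gen -> S).
Implicit Types x y z : S.
Local Notation psg u := ((int_of_Z (psgn u))%:~R : C).

Definition formA k (x : form) := exists2 t : form, homog k t & anti q t = x.

Lemma formA_lmul k x u : size u = k -> formA k (lmul x (omS u)).
Proof.
move=> <-; exists (lmul x (unitA S u)); last by rewrite lmul_omA.
by apply: homog_lmul; apply: homog_unitA.
Qed.

Lemma formA_rmul k x u : size u = k -> formA k (rmul (omS u) x).
Proof.
move=> <-; exists (rmul (unitA S u) x); last by rewrite (rmul_omA q_gt0 q_lt1).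
by apply: homog_rmul; apply: homog_unitA.
Qed.

Lemma fstar_sumF (I : eqType) k (r : seq I) (T : I -> form) : (k <= 4)%N ->
  (forall i, i \in r -> formA k (T i)) ->
  fstar k (\sum_(i <- r) T i) = \sum_(i <- r) fstar k (T i).
Proof.
move=> k4 hT; pose t i := if i \in r then preanti q k (T i) else 0.
have e i : i \in r -> T i = anti q (t i).
  by move=> ir; rewrite /t ir; have [t' ht' <-] := hT i ir; have [_ ->] := preantiP q ht'.
have ht i : homog k (t i).
  rewrite /t; case: ifP => [ir|_]; last by move=> w _.
  by have [t' ht' <-] := hT i ir; have [] := preantiP q ht'.
rewrite (eq_big_seq (fun i => anti q (t i)) e) (fstar_sum q_gt0 q_lt1) //.
by apply: eq_big_seq => i ir; rewrite -e.
Qed.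

Lemma wedge_sumF (I J : eqType) k l (r : seq I) (r' : seq J) (T : I -> form) (U : J -> form) :
  (k + l <= 4)%N ->
  (forall i, i \in r -> formA k (T i)) -> (forall j, j \in r' -> formA l (U j)) ->
  wedge k l (\sum_(i <- r) T i) (\sum_(j <- r') U j) =
  \sum_(i <- r) \sum_(j <- r') wedge k l (T i) (U j).
Proof.
move=> kl hT hU; pose t i := if i \in r then preanti q k (T i) else 0.
pose u j := if j \in r' then preanti q l (U j) else 0.
have e i : i \in r -> T i = anti q (t i).
  by move=> ir; rewrite /t ir; have [t' ht' <-] := hT i ir; have [_ ->] := preantiP q ht'.
have ht i : homog k (t i).
  rewrite /t; case: ifP => [ir|_]; last by move=> w _.
  by have [t' ht' <-] := hT i ir; have [] := preantiP q ht'.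
have e' i : i \in r' -> U i = anti q (u i).
  by move=> ir; rewrite /u ir; have [t' ht' <-] := hU i ir; have [_ ->] := preantiP q ht'.
have hu i : homog l (u i).
  rewrite /u; case: ifP => [ir|_]; last by move=> w _.
  by have [t' ht' <-] := hU i ir; have [] := preantiP q ht'.
rewrite (eq_big_seq (fun i => anti q (t i)) e) (eq_big_seq (fun i => anti q (u i)) e').
rewrite (wedge_sum q_gt0 q_lt1) //.
by apply: eq_big_seq => i ir; apply: eq_big_seq => j jr; rewrite -e // -e'.
Qed.

Lemma lmulZl (c : C) x (t : form) : lmul (c *: x) t = c *: lmul x t.
Proof. by apply: funext => w; rewrite tensZ !lmulE scalerAl. Qed.
Lemma lmulZr (c : C) x (t : form) : lmul x (c *: t) = c *: lmul x t.
Proof. by apply: funext => w; rewrite tensZ !lmulE tensZ scalerAr. Qed.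
Lemma lmulDl x y (t : form) : lmul (x + y) t = lmul x t + lmul y t.
Proof. by apply: funext => w; rewrite tensD !lmulE mulrDl. Qed.
Lemma lmulDr x (t t' : form) : lmul x (t + t') = lmul x t + lmul x t'.
Proof. by apply: funext => w; rewrite tensD !lmulE tensD mulrDr. Qed.
Lemma lmulM x y (t : form) : lmul (x * y) t = lmul x (lmul y t).
Proof. by apply: funext => w; rewrite !lmulE mulrA. Qed.
Lemma lmul0 (t : form) : lmul 0 t = 0.
Proof. by apply: funext => w; rewrite lmulE mul0r. Qed.
Lemma lmulr0 x : lmul x (0 : form) = 0.
Proof. by apply: funext => w; rewrite lmulE mulr0. Qed.
Lemma lmul_suml (I : Type) (r : seq I) (P : pred I) (f : I -> S) t :
  lmul (\sum_(i <- r | P i) f i) t = \sum_(i <- r | P i) lmul (f i) t.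
Proof. by elim/big_rec2: _ => [|i a b _ e]; rewrite ?lmul0 ?lmulDl ?e. Qed.
Lemma lmul_sumr (I : Type) (r : seq I) (P : pred I) (f : I -> form) x :
  lmul x (\sum_(i <- r | P i) f i) = \sum_(i <- r | P i) lmul x (f i).
Proof. by elim/big_rec2: _ => [|i a b _ e]; rewrite ?lmulr0 ?lmulDr ?e. Qed.

Lemma lmul_top_inj x y : lmul x (omS mpo) = lmul y (omS mpo) -> x = y.
Proof.
move/(congr1 (fun t => t (pivot mpo))); rewrite !lmulE /omA /of_inv.
rewrite (@om_pivot _ q s [::] s0 qs 3 mpo mpo) // eqxx -!scalerAr !mulr1.
by move/(scalerI _); apply; rewrite (inj_eq (@complexI R) _ 0) psign_neq0.
Qed.

(** The function integrated is determined by the form because the top word does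
    not vanish. *)
Lemma integralS_top (mc : R) f : mc != 0 -> L 0 f ->
  integralS mc 3 (lmul f (omS mpo)) = (mc^-1)%:C * h f.
Proof.
move=> m0 Lf; rewrite /integralS eqxx.
have volE : of_inv S (volumeS q mc) = mc%:C *: omS mpo.
  by apply: funext => w; rewrite tensZ /omA /of_inv /volumeS tensZ scalerA.
have mC : mc%:C != 0 :> C by rewrite (inj_eq (@complexI R) _ 0).
have mE : (mc^-1)%:C * mc%:C = 1 :> C by rewrite (fmorphV (real_complex R)) mulVf.
case: xgetP => [g _ [Lg e]|/(_ ((mc^-1)%:C *: f)) []]; last first.
  by split; [exact: LspZ|rewrite volE lmulZl lmulZr scalerA mE scale1r].
have : lmul (mc%:C *: g) (omS mpo) = lmul f (omS mpo) by rewrite lmulZl -lmulZr -volE.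
by move/lmul_top_inj <-; rewrite linearZ /= mulrA mE mul1r.
Qed.

Lemma rmul_expand k u x : size u = k ->
  rmul (omS u) x = \sum_(w : k.-tuple gen) lmul (fword u w x) (omS w).
Proof.
move=> su; rewrite (rmul_omA q_gt0 q_lt1).
under eq_bigr do rewrite lmul_omA.
rewrite -antiS; congr anti; apply: funext => v; rewrite rmul_unitA sum_funE.
have [sv|nv] := eqVneq (size v) k; last first.
  rewrite fword_size ?su 1?eq_sym // big1 // => w _; rewrite lmulE /unitA.
  by case: eqP => [e|]; [move: nv; rewrite e size_tuple eqxx|rewrite mulr0].
move/eqP: sv => sv; rewrite (bigD1 (Tuple sv)) //= big1 => [|w nw].
  by rewrite addr0 lmulE /unitA eqxx mulr1.
by rewrite -val_eqE /= eq_sym in nw; rewrite lmulE /unitA (negPf nw) mulr0.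
Qed.

Lemma fword_mpo w y : size w = 3 -> w != mpo -> eps3 w != 0%ZZ -> fword mpo w y = 0.
Proof.
by case: w => [|[] [|[] [|[] []]]] //= _ _ _; rewrite ?linear0 ?scaler0.
Qed.

Lemma rmul_mpo y : rmul (omS mpo) y = lmul (K (K y)) (omS mpo).
Proof.
rewrite (@rmul_expand 3) // (bigD1 [tuple wm; wp; w0]) // big1; first exact: addr0.
move=> w nw.
have nw' : tval w != mpo by rewrite -val_eqE /= in nw.
have [zw|zw] := boolP (wz \in tval w); first by rewrite fword_z // lmul0.
have [e0|e0] := eqVneq (eps3 w) 0%ZZ; last by rewrite fword_mpo ?size_tuple ?lmul0.
by rewrite (omA_eps q_gt0) ?size_tuple // /eps e0 scale0r lmulr0.
Qed.

Lemma KK_Lsp u y : L (- wt u) y -> K (K y) = (sq ^ (- wt u) * sq ^ (- wt u)) *: y.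
Proof. by move=> e; rewrite e linearZ /= e scalerA. Qed.

(** ** The pairing with left coefficients *)

Section Pair.
Variable k : nat.
Hypothesis k3 : (k <= 3)%N.
Variables X Y : seq gen -> S.
Hypothesis LX : forall u, u \in comps k -> L (- wt u) (X u).
Hypothesis LY : forall u, u \in comps k -> L (- wt u) (Y u).
Let k4 : (k <= 4)%N := leq_trans k3 (leqnSn 3).
Let kl : (k + (3 - k) <= 4)%N. Proof. by rewrite subnKC. Qed.
Local Notation sg := ((-1) ^+ 'C(k.+1, 2) : C).

Lemma sg_eps u v : u \in comps k -> v \in comps k ->
  sg * eps R (barw u ++ dual v) = (if u == v then psg u else 0).
Proof.
move=> uk vk; have := congr1 (fun n : int => n%:~R : C) (eps3_dual uk vk).
by rewrite /= rmorphM rmorphXn rmorphN1 => ->; case: (u == v).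
Qed.

Lemma size_pair u v : u \in comps k -> v \in comps k -> forall w : k.-tuple gen, size (w ++ dual v) = 3.
Proof.
by move=> uk vk w; rewrite size_cat size_tuple (comps_size (dual_comps vk)) subnKC.
Qed.

(** The adjoint puts the coefficient of X on the right, next to that of Y, and
    their product is moved to the left across the conjugate word.  By invariance of
    h only the term with unchanged word contributes, and its Haar value is that
    of the product. *)
Lemma left_pairing (mc : R) : mc != 0 ->
  integralS mc (k + (3 - k)) (wedge k (3 - k) (fstar k (\sum_(u <- comps k) lmul (X u) (omS u)))
     (\sum_(v <- comps k) lmul (Y v) (omS (dual v)))) =
  \sum_(u <- comps k) (mc^-1)%:C * psg u * h (st (X u) * Y u).
Proof.
move=> m0; rewrite fstar_sumF //; last by move=> u uk; apply: formA_lmul; exact: comps_size uk.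
pose x u := sg *: st (X u).
rewrite (eq_big_seq (fun u => rmul (omS (barw u)) (x u))) => [|u uk]; last first.
  by rewrite (fstar_lmul q_gt0 q_lt1) ?(comps_size uk) // /x rmulZr.
rewrite wedge_sumF //; first last.
- by move=> v vk; apply: formA_lmul; exact: comps_size (dual_comps vk).
- by move=> u uk; apply: formA_rmul; rewrite size_barw (comps_size uk).
pose f u v (w : k.-tuple gen) := eps R (w ++ dual v) *: fword (barw u) w (x u * Y v).
have e u v : u \in comps k -> v \in comps k ->
    wedge k (3 - k) (rmul (omS (barw u)) (x u)) (lmul (Y v) (omS (dual v))) =
    lmul (\sum_w f u v w) (omS mpo).
  move=> uk vk; rewrite (wedge_rl q_gt0 q_lt1) ?size_barw ?(comps_size uk) //; last first.
    exact: comps_size (dual_comps vk).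
  rewrite lmul_suml; apply: eq_bigr => w _; rewrite /f lmulZl.
  have [zw|zw] := boolP (wz \in tval w).
    rewrite fword_z ?(barw_zfree (comps_zfree uk)) //.
    by apply: etrans (lmul0 _) _; rewrite (lmul0 (omS mpo)) scaler0.
  rewrite (omA_eps q_gt0) ?lmulZr //; first exact: size_pair uk vk w.
  by rewrite mem_cat negb_or zw (dual_zfree vk).
rewrite (eq_big_seq (fun u => \sum_(v <- comps k) lmul (\sum_w f u v w) (omS mpo))); last first.
  by move=> u uk; apply: eq_big_seq => v vk; exact: e.
have -> : \sum_(u <- comps k) \sum_(v <- comps k) lmul (\sum_w f u v w) (omS mpo) =
    lmul (\sum_(u <- comps k) \sum_(v <- comps k) \sum_w f u v w) (omS mpo).
  by rewrite lmul_suml; apply: eq_bigr => u _; rewrite lmul_suml.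
rewrite [X in integralS _ X]subnKC // integralS_top //; last first.
  rewrite big_seq; apply: Lsp_sum => u uk; rewrite big_seq; apply: Lsp_sum => v vk.
  apply: Lsp_sum => w _; rewrite /f /eps.
  have [->|e0] := eqVneq (eps3 (w ++ dual v)) 0%ZZ; first by rewrite scale0r; exact: Lsp0.
  have := eps3_wt (size_pair uk vk w) e0.
  have -> : wt (w ++ dual v) = wt w + wt v.
    rewrite -(wt_dual vk); elim: (tval w) => [|a b IH] /=; rewrite ?add0r // IH addrA.
    by [].
  move=> ew; apply: LspZ.
  have Lx : L (- - wt u + - wt v) (x u * Y v).
    by apply: (LspM q_gt0); [apply: LspZ; apply: (Lsp_st q_gt0); apply: LX|apply: LY].
  have := Lsp_fword q_gt0 w (barw_zfree (comps_zfree uk)) Lx; rewrite wt_barw.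
  by have -> : - - wt u + - wt v + - wt u - wt w = 0 by move: ew; lia.
rewrite !linear_sum mulr_sumr /=; apply: eq_big_seq => u uk.
rewrite linear_sum (bigD1_seq u) ?comps_uniq //=.
have hf v : v \in comps k -> h (\sum_w f u v w) = (if u == v then psg u else 0) * h (st (X u) * Y v).
  move=> vk; rewrite linear_sum /= -(sg_eps uk vk).
  have sb : size (barw u) == k by rewrite size_barw (comps_size uk).
  rewrite (bigD1 (Tuple sb)) //= big1 ?addr0 => [|w nw]; rewrite /f linearZ /=.
    rewrite (haar_fword q_gt0 q_lt1) // ?(barw_zfree (comps_zfree uk)) // eqxx.
    by rewrite /x -scalerAl linearZ /= -mulrA mulrCA mulrA.
  rewrite (haar_fword q_gt0 q_lt1) ?size_barw ?(comps_size uk) ?size_tuple //.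
    by rewrite -val_eqE /= eq_sym in nw; rewrite (negPf nw); exact: mulr0.
  exact: barw_zfree (comps_zfree uk).
rewrite hf // eqxx big_seq_cond big1 ?addr0 ?mulrA // => v /andP [vk nv].
by rewrite hf // eq_sym (negPf nv) mul0r.
Qed.

(** Now x^* stands on the left and y on the right of the top form.  Moving y
    across that form is an action of K^2, whence the power of q; the resulting
    product x^* y has weight 0, and terms with different components have no top
    part. *)
Lemma right_pairing (mc : R) : mc != 0 ->
  integralS mc (k + (3 - k)) (wedge k (3 - k) (fstar k (\sum_(u <- comps k) rmul (omS u) (X u)))
     (\sum_(v <- comps k) rmul (omS (dual v)) (Y v))) =
  \sum_(u <- comps k) (mc^-1)%:C * psg u * (sq ^ (- wt u) * sq ^ (- wt u)) * h (st (X u) * Y u).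
Proof.
move=> m0; rewrite fstar_sumF //; last by move=> u uk; apply: formA_rmul; exact: comps_size uk.
pose x u := sg *: st (X u).
rewrite (eq_big_seq (fun u => lmul (x u) (omS (barw u)))) => [|u uk]; last first.
  by rewrite (fstar_rmul q_gt0 q_lt1) ?(comps_size uk) ?(comps_zfree uk) // /x lmulZl.
rewrite wedge_sumF //; first last.
- by move=> v vk; apply: formA_rmul; exact: comps_size (dual_comps vk).
- by move=> u uk; apply: formA_lmul; rewrite size_barw (comps_size uk).
pose g u := (psg u * (sq ^ (- wt u) * sq ^ (- wt u))) *: (st (X u) * Y u).
have e u v : u \in comps k -> v \in comps k ->
    wedge k (3 - k) (lmul (x u) (omS (barw u))) (rmul (omS (dual v)) (Y v)) =
    lmul (if u == v then g u else 0) (omS mpo).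
  move=> uk vk; rewrite (wedge_lr q_gt0 q_lt1) ?size_barw ?(comps_size uk) //; last first.
    exact: comps_size (dual_comps vk).
  rewrite (omA_eps q_gt0); first last.
  - by rewrite mem_cat negb_or (barw_zfree (comps_zfree uk)) (dual_zfree vk).
  - by rewrite size_cat size_barw (comps_size uk) (comps_size (dual_comps vk)) subnKC.
  rewrite rmulZl lmulZr /x lmulZl scalerA [eps R _ * _]mulrC sg_eps //.
  have [<-|_] := eqVneq u v; last by rewrite scale0r lmul0.
  rewrite rmul_mpo -lmulM (KK_Lsp (LY uk)) -scalerAr lmulZl scalerA /g lmulZl.
  by [].
rewrite (eq_big_seq (fun u => lmul (g u) (omS mpo))) => [|u uk]; last first.
  rewrite (bigD1_seq u) ?comps_uniq //= e // eqxx big_seq_cond big1 ?addr0 // => v /andP [vk nv].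
  by rewrite e // eq_sym (negPf nv) lmul0.
rewrite -lmul_suml [X in integralS _ X]subnKC // integralS_top //; last first.
  rewrite big_seq; apply: Lsp_sum => u uk; apply: LspZ.
  have := LspM q_gt0 (Lsp_st q_gt0 (LX uk)) (LY uk).
  by rewrite opprK subrr.
rewrite linear_sum mulr_sumr; apply: eq_bigr => u _ /=.
by rewrite /g linearZ /= !mulrA.
Qed.

End Pair.

(** ** Coefficients on the eigenvector basis *)

(** The invariant 2-form w_- w_+ is a multiple of a difference of two eigenvectors; every
    other component of a form on the sphere is, up to sign, one of them. *)
Definition ecoef (u : seq gen) (i : nat) : R :=
  match u with
  | [:: wp] => (i == 1%N)%:R
  | [:: w0] => (i == 3)%:R
  | [:: wm; wp] => mp_coef q i
  | [:: w0; wp] => - (i == 4)%:R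
  | _ => (i == 0%N)%:R
  end.

Lemma sum_delta (W : lmodType C) n (f : nat -> W) j (c : R) : (j < n)%N ->
  \sum_(i < n) (c * (i == j :> nat)%:R)%:C *: f i = c%:C *: f j.
Proof.
move=> jn; rewrite (bigD1 (Ordinal jn)) //= eqxx mulr1 big1 ?addr0 // => i ni.
by rewrite -val_eqE /= in ni; rewrite (negPf ni) mulr0 scale0r.
Qed.

Definition check_0p : bool := veq (nf [:: w0; wp]) (vopp (nf [:: wp; w0])).
Lemma check_0pT : check_0p. Proof. by vm_compute. Qed.

Lemma om_0p : om q [:: w0; wp] = - om q [:: wp; w0].
Proof.
rewrite !(om_nf [::] s0 qs) //.
by rewrite (vsum_eq s [::] (om q) check_0pT) vsum_opp.
Qed.

Lemma om_ecoef k u : u \in comps k ->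
  om q u = \sum_(i < size (ebas q k)) (ecoef u i)%:C *: (ebas q k)`_i.
Proof.
have d1 k' u' n j : size (ebas q k') = n -> (j < n)%N -> (forall i, ecoef u' i = (i == j)%:R) ->
    (ebas q k')`_j = om q u' ->
    om q u' = \sum_(i < size (ebas q k')) (ecoef u' i)%:C *: (ebas q k')`_i.
  move=> sn jn eu <-; rewrite sn.
  under eq_bigr => i _ do rewrite eu -[X in X%:C]mul1r.
  by rewrite (sum_delta (fun i => (ebas q k')`_i)) // scale1r.
move: k u; apply: comps_case.
- exact: (d1 0%N [::] 1%N 0%N).
- exact: (d1 1%N [:: wm] 4 0%N).
- exact: (d1 1%N [:: wp] 4 1%N).
- exact: (d1 1%N [:: w0] 4 3).
- exact: (d1 2%N [:: wm; w0] 6 0%N).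
- exact: (om_mp q_gt0 q_lt1).
- rewrite om_0p.
  have -> : \sum_(i < size (ebas q 2)) (ecoef [:: w0; wp] i)%:C *: (ebas q 2)`_i =
      \sum_(i < 6) (-1 * (i == 4 :> nat)%:R)%:C *: (ebas q 2)`_i.
    by apply: eq_bigr => i _; rewrite /= mulN1r.
  rewrite (sum_delta (fun i => (ebas q 2)`_i)) // (rmorphN1 (real_complex R)) scaleN1r.
  by [].
- exact: (d1 3 mpo 4 0%N).
Qed.

Definition coefs k (X : seq gen -> S) : {ffun 'I_(size (ebas q k)) -> S} :=
  [ffun i : 'I_(size (ebas q k)) => \sum_(u <- comps k) (ecoef u i)%:C *: X u].

Lemma omA_ecoef k u : u \in comps k ->
  omS u = \sum_(i < size (ebas q k)) (ecoef u i)%:C *: of_inv S (ebas q k)`_i.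
Proof.
move=> uk; apply: funext => w; rewrite sum_funE /omA /of_inv (om_ecoef uk) sum_funE scaler_suml.
by apply: eq_bigr => i _; rewrite !tensZ scalerA.
Qed.

Lemma left_lcomb k X : \sum_(u <- comps k) lmul (X u) (omS u) = lcomb (coefs k X).
Proof.
rewrite (eq_big_seq (fun u => \sum_(i < size (ebas q k)) lmul ((ecoef u i)%:C *: X u) (of_inv S (ebas q k)`_i))).
  rewrite exchange_big; apply: funext => w; rewrite /lcomb sum_funE; apply: eq_bigr => i _ /=.
  rewrite -lmul_suml lmulE /coefs ffunE /of_inv -scalerAr mulr1.
  by [].
move=> u uk; rewrite (omA_ecoef uk) lmul_sumr; apply: eq_bigr => i _.
by rewrite lmulZl lmulZr.
Qed.

Lemma right_rcomb k X : \sum_(u <- comps k) rmul (omS u) (X u) = rcomb (coefs k X).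
Proof.
rewrite (eq_big_seq (fun u => \sum_(i < size (ebas q k)) rmul (of_inv S (ebas q k)`_i) ((ecoef u i)%:C *: X u))).
  rewrite exchange_big /rcomb; apply: eq_bigr => i _ /=.
  by rewrite -rmul_sumr /coefs ffunE.
move=> u uk; rewrite (omA_ecoef uk) rmul_suml; apply: eq_bigr => i _.
by rewrite rmulZl rmulZr.
Qed.

Lemma coefs_inj k X Y : coefs k X = coefs k Y -> forall u, u \in comps k -> X u = Y u.
Proof.
move=> e u uk; have {e}e i : (i < size (ebas q k))%N ->
    \sum_(u <- comps k) (ecoef u i)%:C *: X u = \sum_(u <- comps k) (ecoef u i)%:C *: Y u.
  by move=> ik; have := congr1 (fun f : {ffun _ -> S} => f (Ordinal ik)) e; rewrite !ffunE.
suff [j jk [j0 jd]] : exists2 j, (j < size (ebas q k))%N &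
    ecoef u j != 0 /\ forall v, v \in comps k -> v != u -> ecoef v j = 0.
  have := e j jk; rewrite !(bigD1_seq u) ?comps_uniq //=.
  rewrite !(big_seq_cond (fun v => v != u)) !big1 => [|v /andP [vk vu]|v /andP [vk vu]];
    try by rewrite jd // scale0r.
  by rewrite !addr0 => /(scalerI _); apply; rewrite (inj_eq (@complexI R) _ 0).
have mp0 : mp_scale q != 0 by rewrite /mp_scale invr_eq0 (mp_scale_neq0 q_gt0 q_lt1).
move: k u uk e; apply: (comps_case (P := fun k u => _ -> exists2 j, _ & _)) => _;
  [exists 0%N|exists 0%N|exists 1%N|exists 3|exists 0%N|exists 2|exists 4|exists 0%N] => //;
  split; rewrite /= ?oner_eq0 ?oppr_eq0 ?oner_eq0 // => v; rewrite !inE;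
  first [move/eqP->|case/or3P => /eqP ->]; rewrite /= ?mulr0n ?oppr0 //.
Qed.

End Pairing.

Section InnerProducts.
Variables (R : realType) (q : R).
Hypotheses (q_gt0 : 0 < q) (q_lt1 : q < 1).
Variable S : quantum_SU2 q.
Local Notation C := R[i].
Let s := Num.sqrt q.
Local Notation K := (qK S).
Local Notation Ki := (qKi S).
Local Notation h := (qh S).
Local Notation st := (@qst R q S).
Local Notation act := (qactP S).
Local Notation s0 := (s_neq0 q_gt0).
Local Notation qs := (q_sqr q_gt0).
Local Notation q2 := (qX_neq1 q_gt0 q_lt1 (isT : (0 < 2)%N)).
Local Notation q4 := (qX_neq1 q_gt0 q_lt1 (isT : (0 < 4)%N)).
Local Notation L := (@Lsp R q S).
Local Notation omS := (@omA R q S).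
Local Notation mpo := [:: wm; wp; w0].
Local Notation form := (seq gen -> S).
Implicit Types x y z : S.

Lemma sum_gen (V : zmodType) (f : gen -> V) : \sum_c f c = f wm + f wp + f wz + f w0.
Proof.
rewrite (bigD1 wm) //= (bigD1 wp) //= (bigD1 wz) //= (bigD1 w0) //= big1.
  by rewrite addr0 !addrA.
by case.
Qed.

(** Left and right coefficients determine each other, the structure functions
    being triangular for the order w_z, w_-, w_+, w_0 of the letters. *)
Lemma fcoef_inj (Z : gen -> S) : (forall b, \sum_a fcoef a b (Z a) = 0) -> forall a, Z a = 0.
Proof.
move=> hZ.
have Zz : Z wz = 0.
  have := hZ wz; rewrite sum_gen /= !add0r addr0 => e.
  by rewrite -(Uq_KKi act (Z wz)) -(Uq_KKi act (Ki _)) e !linear0.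
have Zm : Z wm = 0 by have := hZ wm; rewrite sum_gen Zz fcoef0 /= !addr0.
have Zp : Z wp = 0 by have := hZ wp; rewrite sum_gen Zz fcoef0 /= !addr0 add0r.
have Z0 : Z w0 = 0.
  have := hZ w0; rewrite sum_gen Zz Zm Zp !fcoef0 !add0r /= => e.
  by rewrite -(Uq_KiK act (Z w0)) -(Uq_KiK act (K _)) e !linear0.
by case.
Qed.

Lemma fword_inj k (Z : seq gen -> S) :
  (forall v, size v = k -> \sum_(u : k.-tuple gen) fword u v (Z u) = 0) ->
  forall u, size u = k -> Z u = 0.
Proof.
elim: k Z => [|k IH] Z hZ [|a u] //= => [_|[su]].
  have := hZ [::] erefl; rewrite (bigD1 [tuple]) //= big1 ?addr0 // => w.
  by case/negP; apply/eqP; exact: tuple0.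
apply: (IH (fun u => Z (a :: u))) => // v sv.
pose W a := \sum_(u : k.-tuple gen) fword u v (Z (a :: u)).
apply: (fcoef_inj (Z := W)) => b; have sv' : size (b :: v) = k.+1 by rewrite /= sv.
rewrite -[RHS](hZ _ sv').
rewrite (sum_tuple_cons _ (fun w => fword w (b :: v) (Z w))).
by apply: eq_bigr => c _; rewrite /W fcoef_sum.
Qed.

Lemma rcomb_lcomb k (X : {ffun 'I_(size (ebas q k)) -> S}) v :
  rcomb X v = \sum_(u : (size v).-tuple gen) fword u v (lcomb X u).
Proof.
rewrite /rcomb sum_funE.
under eq_bigr => i _ do rewrite (rmulE _ _ (erefl (size v))).
rewrite exchange_big; apply: eq_bigr => u _ /=; rewrite /lcomb fword_sum.
by apply: eq_bigr => i _; rewrite fwordZ /of_inv -scalerAl mul1r.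
Qed.

Lemma rcomb_inj k (X Y : {ffun 'I_(size (ebas q k)) -> S}) : (k <= 4)%N ->
  rcomb X = rcomb Y -> X = Y.
Proof.
move=> k4 e; apply: (lcomb_inj [::] s0 qs q2 q4 k4); apply: funext => u.
apply/eqP; rewrite -subr_eq0; apply/eqP.
apply: (fword_inj (k := size u) (Z := fun u => lcomb X u - lcomb Y u)) => // v sv.
have fB w a b : fword w v (a - b) = fword w v a - fword w v b.
  by rewrite fwordD -scaleN1r fwordZ scaleN1r.
under eq_bigr do rewrite fB; rewrite sumrB -sv -!rcomb_lcomb e subrr.
by [].
Qed.

Lemma free_left k X Y : (k <= 3)%N ->
  \sum_(u <- comps k) lmul (X u) (omS u) = \sum_(u <- comps k) lmul (Y u) (omS u) ->
  forall u, u \in comps k -> X u = Y u.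
Proof.
move=> k3; rewrite !(left_lcomb q_gt0 q_lt1) => /(lcomb_inj [::] s0 qs q2 q4 (leq_trans k3 (leqnSn 3))).
exact: coefs_inj.
Qed.

Lemma free_right k X Y : (k <= 3)%N ->
  \sum_(u <- comps k) rmul (omS u) (X u) = \sum_(u <- comps k) rmul (omS u) (Y u) ->
  forall u, u \in comps k -> X u = Y u.
Proof.
move=> k3; rewrite !(right_rcomb q_gt0 q_lt1) => /(rcomb_inj (leq_trans k3 (leqnSn 3))).
exact: coefs_inj.
Qed.

Lemma lcoef_comps k X : (k <= 3)%N ->
  lcoef q k (\sum_(u <- comps k) lmul (X u) (omS u)) = coefs k X.
Proof.
move=> k3; rewrite (left_lcomb q_gt0 q_lt1).
exact: (lcoef_lcomb [::] s0 qs q2 q4 _ (leq_trans k3 (leqnSn 3))).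
Qed.

Lemma rcoef_comps k X : (k <= 3)%N ->
  rcoef k (\sum_(u <- comps k) rmul (omS u) (X u)) = coefs k X.
Proof.
move=> k3; rewrite (right_rcomb q_gt0 q_lt1) /rcoef.
case: xgetP => [Y _ e|/(_ (coefs k X)) []//].
exact: (rcomb_inj (leq_trans k3 (leqnSn 3)) e).
Qed.

Section Coefficients.
Variable k : nat.
Variables X Y : seq gen -> S.
Hypothesis LX : forall u, u \in comps k -> L (- wt u) (X u).
Hypothesis LY : forall u, u \in comps k -> L (- wt u) (Y u).
Variable B : 'I_(size (ebas q k)) -> 'I_(size (ebas q k)) -> C.

(** Components of different types are orthogonal because their coefficients
    have different weights. *)
Lemma ip_coefs :
  \sum_(i < size (ebas q k)) \sum_(j < size (ebas q k)) h (st (coefs k X i) * coefs k Y j) * B i j =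
  \sum_(u <- comps k) (\sum_(i < size (ebas q k)) \sum_(j < size (ebas q k))
     (ecoef q u i)%:C * (ecoef q u j)%:C * B i j) * h (st (X u) * Y u).
Proof.
have [inv stD stZ stM] := SUq2_star (qalgP S).
have Zh c y : h (c *: y) = c * h y by rewrite linearZ.
have hc i j : h (st (coefs k X i) * coefs k Y j) =
    \sum_(u <- comps k) (ecoef q u i)%:C * (ecoef q u j)%:C * h (st (X u) * Y u).
  rewrite !ffunE st_sum mulr_suml linear_sum /=; apply: eq_big_seq => u uk.
  rewrite mulr_sumr linear_sum (bigD1_seq u) ?comps_uniq //= stZ conjcR.
  have e v : h ((ecoef q u i)%:C *: st (X u) * ((ecoef q v j)%:C *: Y v)) =
      (ecoef q u i)%:C * (ecoef q v j)%:C * h (st (X u) * Y v).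
    by rewrite -scalerAl -scalerAr !Zh mulrA.
  rewrite e big_seq_cond big1 ?addr0 // => v /andP [vk nv]; rewrite e.
  rewrite (haar_weight q_gt0 q_lt1 (LspM q_gt0 (Lsp_st q_gt0 (LX uk)) (LY vk))) ?mulr0 //.
  rewrite opprK subr_eq0; apply: contra nv => /eqP ew.
  by rewrite (wt_inj uk vk ew).
under eq_bigr => i _ do under eq_bigr => j _ do rewrite hc mulr_suml.
under eq_bigr do rewrite exchange_big /=.
rewrite exchange_big; apply: eq_bigr => u _ /=.
rewrite mulr_suml; apply: eq_bigr => i _; rewrite mulr_suml; apply: eq_bigr => j _.
by rewrite mulrAC.
Qed.

End Coefficients.

Lemma sum3 (I : Type) (V : zmodType) (f : I -> V) a b c :
  \sum_(i <- [:: a; b; c]) f i = f a + f b + f c.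
Proof. by rewrite !big_cons big_nil addr0 addrA. Qed.

(** ** Left and right decompositions of forms on the sphere *)

Definition left_form k (t : form) := exists2 X, (forall u, u \in comps k -> L (- wt u) (X u)) &
  t = \sum_(u <- comps k) lmul (X u) (omS u).
Definition right_form k (t : form) := exists2 X, (forall u, u \in comps k -> L (- wt u) (X u)) &
  t = \sum_(u <- comps k) rmul (omS u) (X u).

Lemma OmegaS_left k t : (k <= 3)%N -> OmegaS k t <-> left_form k t.
Proof.
case: k => [|[|[|[|k]]]] //= _; split.
- case=> f Lf ->; exists (fun=> f); last by rewrite big_seq1.
  by move=> u; rewrite inE => /eqP ->.
- by case=> X LX ->; exists (X [::]); [exact: (LX [::])|rewrite big_seq1].
- case=> x [y [z [Lx Ly Lz ->]]].
  exists (fun u => if u == [:: wm] then x else if u == [:: wp] then y else z).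
    by move=> u; rewrite !inE => /or3P [] /eqP ->.
  by rewrite sum3.
- case=> X LX ->; exists (X [:: wm]), (X [:: wp]), (X [:: w0]); split.
  + exact: (LX [:: wm]).
  + exact: (LX [:: wp]).
  + exact: (LX [:: w0]).
  by rewrite sum3.
- case=> x [y [z [Lx Ly Lz ->]]].
  exists (fun u => if u == [:: wm; w0] then x else if u == [:: wm; wp] then y else z).
    by move=> u; rewrite !inE => /or3P [] /eqP ->.
  by rewrite sum3.
- case=> X LX ->; exists (X [:: wm; w0]), (X [:: wm; wp]), (X [:: w0; wp]); split.
  + exact: (LX [:: wm; w0]).
  + exact: (LX [:: wm; wp]).
  + exact: (LX [:: w0; wp]).
  by rewrite sum3.
- case=> f Lf ->; exists (fun=> f); last by rewrite big_seq1.
  by move=> u; rewrite inE => /eqP ->.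
- by case=> X LX ->; exists (X mpo); [exact: (LX mpo)|rewrite big_seq1].
Qed.

Lemma omA_00 : omS [:: w0; w0] = 0.
Proof.
have e : om q [:: w0; w0] = 0.
  rewrite (om_nf [::] s0 qs) // (vsum_eq s [::] (om q) (u := nf [:: w0; w0]) (v := [::])) //.
  by rewrite /linext big_nil.
by apply: funext => w; rewrite /omA /of_inv e; exact: scale0r.
Qed.

Lemma rmul_om0 x : rmul (omS [::]) x = lmul x (omS [::]).
Proof.
rewrite (@rmul_expand _ _ q_gt0 q_lt1 _ 0) // (bigD1 [tuple]) //= big1 ?addr0 // => w.
by case/negP; apply/eqP; exact: tuple0.
Qed.

Lemma rmul_om1 a x : rmul (omS [:: a]) x = \sum_b lmul (fcoef a b x) (omS [:: b]).
Proof.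
rewrite (@rmul_expand _ _ q_gt0 q_lt1 _ 1) //.
rewrite (sum_tuple_cons _ (fun w => lmul (fword [:: a] w x) (omS w))).
apply: eq_bigr => b _; rewrite (bigD1 [tuple]) //= big1 ?addr0 // => w.
by case/negP; apply/eqP; exact: tuple0.
Qed.

Lemma rmul_om2 a b x : rmul (omS [:: a; b]) x =
  \sum_c \sum_d lmul (fcoef a c (fcoef b d x)) (omS [:: c; d]).
Proof.
rewrite (@rmul_expand _ _ q_gt0 q_lt1 _ 2) //.
rewrite (sum_tuple_cons _ (fun w => lmul (fword [:: a; b] w x) (omS w))).
apply: eq_bigr => c _.
rewrite (sum_tuple_cons _ (fun w => lmul (fword [:: a; b] (c :: w) x) (omS (c :: w)))).
apply: eq_bigr => d _; rewrite (bigD1 [tuple]) //= big1 ?addr0 // => w.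
by case/negP; apply/eqP; exact: tuple0.
Qed.

Local Notation fm0 := (fcoef wm w0 : S -> S).
Local Notation fp0 := (fcoef wp w0 : S -> S).

Section Rows.
Variables (O : gen -> form) (O2 : gen -> gen -> form).
Hypothesis O00 : O2 w0 w0 = 0.
Lemma row_m x : \sum_b lmul (fcoef wm b x) (O b) = lmul x (O wm) + lmul (fm0 x) (O w0).
Proof. by rewrite sum_gen /fcoef !lmul0 !addr0. Qed.
Lemma row_p x : \sum_b lmul (fcoef wp b x) (O b) = lmul x (O wp) + lmul (fp0 x) (O w0).
Proof. by rewrite sum_gen /fcoef !lmul0 add0r addr0. Qed.
Lemma row_0 x : \sum_b lmul (fcoef w0 b x) (O b) = lmul (K (K x)) (O w0).
Proof. by rewrite sum_gen /fcoef !lmul0 !add0r. Qed.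
Lemma row_m0 x : \sum_c \sum_d lmul (fcoef wm c (fcoef w0 d x)) (O2 c d) =
  lmul (K (K x)) (O2 wm w0).
Proof.
by rewrite !sum_gen /fcoef O00 !linear0 ?scaler0 !lmul0 lmulr0 ?(addr0, add0r).
Qed.
Lemma row_0p x : \sum_c \sum_d lmul (fcoef w0 c (fcoef wp d x)) (O2 c d) =
  lmul (K (K x)) (O2 w0 wp).
Proof.
by rewrite !sum_gen /fcoef O00 !linear0 ?scaler0 !lmul0 lmulr0 ?(addr0, add0r).
Qed.
Lemma row_mp x : \sum_c \sum_d lmul (fcoef wm c (fcoef wp d x)) (O2 c d) =
  lmul x (O2 wm wp) + lmul (fp0 x) (O2 wm w0) + lmul (fm0 x) (O2 w0 wp).
Proof.
by rewrite !sum_gen /fcoef O00 !linear0 ?scaler0 !lmul0 lmulr0 ?(addr0, add0r).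
Qed.
End Rows.

Lemma rmul_m x : rmul (omS [:: wm]) x = lmul x (omS [:: wm]) + lmul (fm0 x) (omS [:: w0]).
Proof. exact: etrans (rmul_om1 wm x) (row_m (fun b => omS [:: b]) x). Qed.

Lemma rmul_p x : rmul (omS [:: wp]) x = lmul x (omS [:: wp]) + lmul (fp0 x) (omS [:: w0]).
Proof. exact: etrans (rmul_om1 wp x) (row_p (fun b => omS [:: b]) x). Qed.

Lemma rmul_0 x : rmul (omS [:: w0]) x = lmul (K (K x)) (omS [:: w0]).
Proof. exact: etrans (rmul_om1 w0 x) (row_0 (fun b => omS [:: b]) x). Qed.

Lemma rmul_m0 x : rmul (omS [:: wm; w0]) x = lmul (K (K x)) (omS [:: wm; w0]).
Proof.
exact: etrans (rmul_om2 wm w0 x) (row_m0 (O2 := fun b c => omS [:: b; c]) omA_00 x).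
Qed.

Lemma rmul_0p x : rmul (omS [:: w0; wp]) x = lmul (K (K x)) (omS [:: w0; wp]).
Proof.
exact: etrans (rmul_om2 w0 wp x) (row_0p (O2 := fun b c => omS [:: b; c]) omA_00 x).
Qed.

Lemma rmul_mp x : rmul (omS [:: wm; wp]) x = lmul x (omS [:: wm; wp])
  + lmul (fp0 x) (omS [:: wm; w0]) + lmul (fm0 x) (omS [:: w0; wp]).
Proof.
exact: etrans (rmul_om2 wm wp x) (row_mp (O2 := fun b c => omS [:: b; c]) omA_00 x).
Qed.

Lemma right_left1 X : \sum_(u <- comps 1) rmul (omS u) (X u) =
  lmul (X [:: wm]) (omS [:: wm]) + lmul (X [:: wp]) (omS [:: wp]) +
  lmul (fm0 (X [:: wm]) + fp0 (X [:: wp]) + K (K (X [:: w0]))) (omS [:: w0]).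
Proof.
have gen (a b t : form) u v w : a + lmul u t + (b + lmul v t) + lmul w t =
    a + b + lmul (u + v + w) t.
  by rewrite !lmulDl addrACA -!addrA.
apply: etrans (sum3 _ _ _ _) _.
apply: etrans (congr2 +%R (congr2 +%R (rmul_m _) (rmul_p _)) (rmul_0 _)) _.
exact: gen.
Qed.

Lemma right_left2 X : \sum_(u <- comps 2) rmul (omS u) (X u) =
  lmul (K (K (X [:: wm; w0])) + fp0 (X [:: wm; wp])) (omS [:: wm; w0])
  + lmul (X [:: wm; wp]) (omS [:: wm; wp])
  + lmul (fm0 (X [:: wm; wp]) + K (K (X [:: w0; wp]))) (omS [:: w0; wp]).
Proof.
have gen (a t t' : form) u v w z : lmul u t + (a + lmul v t + lmul w t') + lmul z t' =
    lmul (u + v) t + a + lmul (w + z) t'.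
  by rewrite !lmulDl !addrA; congr (_ + _ + _); rewrite -!addrA; congr (_ + _); exact: addrC.
apply: etrans (sum3 _ _ _ _) _.
apply: etrans (congr2 +%R (congr2 +%R (rmul_m0 _) (rmul_mp _)) (rmul_0p _)) _.
exact: gen.
Qed.

Lemma addrNK_swap x y : x + (y - x) = y.
Proof. by rewrite addrC subrK. Qed.

Lemma Lsp_KiKi n x : L n x -> L n (Ki (Ki x)).
Proof.
have h1 y : L n y -> L n (Ki y) by move=> e; rewrite (Lsp_Ki q_gt0 e); apply: LspZ.
by move=> e; exact: (h1 _ (h1 _ e)).
Qed.

Lemma KKKiKi x : K (K (Ki (Ki x))) = x.
Proof. by rewrite !(Uq_KKi act). Qed.

Lemma Lsp_fm0 n x : L n x -> L (n + 2) (fm0 x).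
Proof. by move=> e; have := Lsp_fcoef q_gt0 w0 (isT : wm != wz) e; rewrite /= subr0. Qed.
Lemma Lsp_fp0 n x : L n x -> L (n - 2) (fp0 x).
Proof. by move=> e; have := Lsp_fcoef q_gt0 w0 (isT : wp != wz) e; rewrite /= subr0. Qed.

(** Passing from left to right coefficients is triangular: the structure functions
    only replace w_- or w_+ by w_0, and the added terms have the weight of the
    component to which they are added. *)
Lemma OmegaS_right k t : (k <= 3)%N -> OmegaS k t <-> right_form k t.
Proof.
move=> k3; split; last first.
  case: k k3 => [|[|[|[|k]]]] //= _ [X LX ->].
  - by exists (X [::]); [exact: (LX [::])|rewrite big_seq1 rmul_om0].
  - have Lm := LX [:: wm] isT; have Lp := LX [:: wp] isT; have L0 := LX [:: w0] isT.
    exists (X [:: wm]), (X [:: wp]), (fm0 (X [:: wm]) + fp0 (X [:: wp]) + K (K (X [:: w0]))).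
    split; [exact: Lm|exact: Lp| |exact: right_left1].
    apply: LspD; last exact: Lsp_K (Lsp_K L0).
    by apply: LspD; [exact: (Lsp_fm0 Lm)|exact: (Lsp_fp0 Lp)].
  - have Lm := LX [:: wm; w0] isT; have L0 := LX [:: wm; wp] isT; have Lp := LX [:: w0; wp] isT.
    exists (K (K (X [:: wm; w0])) + fp0 (X [:: wm; wp])), (X [:: wm; wp]),
      (fm0 (X [:: wm; wp]) + K (K (X [:: w0; wp]))).
    split; [|exact: L0| |exact: right_left2].
      by apply: LspD; [exact: Lsp_K (Lsp_K Lm)|exact: (Lsp_fp0 L0)].
    by apply: LspD; [exact: (Lsp_fm0 L0)|exact: Lsp_K (Lsp_K Lp)].
  - exists (K (K (X mpo))); first exact: Lsp_K (Lsp_K (LX mpo isT)).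
    by rewrite big_seq1 (rmul_mpo q_gt0 q_lt1).
case: k k3 => [|[|[|[|k]]]] //= _.
- case=> f Lf ->; exists (fun=> f); last by rewrite big_seq1 rmul_om0.
  by move=> u; rewrite inE => /eqP ->.
- case=> x [y [z [Lx Ly Lz ->]]].
  pose z' := Ki (Ki (z - (fm0 x + fp0 y))).
  pose X (u : seq gen) := if u == [:: wm] then x else if u == [:: wp] then y else z'.
  exists X; last first.
    have ez : fm0 x + fp0 y + K (K z') = z by rewrite /z' KKKiKi; exact: addrNK_swap.
    by rewrite right_left1 -[in LHS]ez.
  move=> u; rewrite !inE => /or3P [] /eqP -> //.
  apply: Lsp_KiKi; apply: LspD => //; apply: LspN.
  by apply: LspD; [exact: (Lsp_fm0 Lx)|exact: (Lsp_fp0 Ly)].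
- case=> x [y [z [Lx Ly Lz ->]]].
  pose x' := Ki (Ki (x - fp0 y)); pose z' := Ki (Ki (z - fm0 y)).
  pose X (u : seq gen) := if u == [:: wm; w0] then x' else if u == [:: wm; wp] then y else z'.
  exists X; last first.
    have ex : K (K x') + fp0 y = x by rewrite /x' KKKiKi subrK.
    have ez : fm0 y + K (K z') = z by rewrite /z' KKKiKi; exact: addrNK_swap.
    by rewrite right_left2 -[in LHS]ex -[in LHS]ez.
  move=> u; rewrite !inE => /or3P [] /eqP -> //; apply: Lsp_KiKi; apply: LspD => //; apply: LspN.
    exact: (Lsp_fp0 Ly).
  exact: (Lsp_fm0 Ly).
- case=> f Lf ->; exists (fun=> Ki (Ki f)); last first.
    by rewrite big_seq1 (rmul_mpo q_gt0 q_lt1) KKKiKi.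
  by move=> u; rewrite inE => /eqP ->; apply: Lsp_KiKi.
Qed.

End InnerProducts.

(** * The Hodge operators *)

Section Hodge.
Variables (R : realType) (q : R).
Hypotheses (q_gt0 : 0 < q) (q_lt1 : q < 1).
Variable S : quantum_SU2 q.
Local Notation C := R[i].
Local Notation h := (qh S).
Local Notation st := (@qst R q S).
Local Notation L := (@Lsp R q S).
Local Notation form := (seq gen -> S).
Implicit Types x y z : S.

(** The left and the right operators are two instances of one construction.  [io u x] is
    the word w_u with the coefficient x on the chosen side, [act] and [mulf] are
    the multiplication by functions on forms and on coefficients, and [rho] and
    [beta] are the constants of the pairing and of the inner product. *)
Section Abstract.
Variable mc : R.
Variables (io : seq gen -> S -> form) (act : S -> form -> form) (mulf : S -> S -> S).
Variables (ip : nat -> form -> form -> C) (rho beta : seq gen -> C).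
Hypothesis ioP : forall u (c : C) x y, io u (c *: x + y) = c *: io u x + io u y.
Hypothesis io_omega : forall k t, (k <= 3)%N -> OmegaS k t <->
  exists2 X, (forall u, u \in comps k -> L (- wt u) (X u)) & t = \sum_(u <- comps k) io u (X u).
Hypothesis io_free : forall k X Y, (k <= 3)%N ->
  \sum_(u <- comps k) io u (X u) = \sum_(u <- comps k) io u (Y u) ->
  forall u, u \in comps k -> X u = Y u.
Hypothesis mulfP : forall f (c : C) x y, mulf f (c *: x + y) = c *: mulf f x + mulf f y.
Hypothesis mulf_weight : forall f n x, L 0 f -> L n x -> L n (mulf f x).
Hypothesis act_sum : forall f k X, act f (\sum_(u <- comps k) io u (X u)) =
  \sum_(u <- comps k) io u (mulf f (X u)).
Hypothesis io_int : forall k X Y, (k <= 3)%N ->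
  (forall u, u \in comps k -> L (- wt u) (X u)) ->
  (forall u, u \in comps k -> L (- wt u) (Y u)) ->
  integralS mc (k + (3 - k)) (wedge k (3 - k) (fstar k (\sum_(u <- comps k) io u (X u)))
     (\sum_(u <- comps k) io (dual u) (Y u))) =
  \sum_(u <- comps k) rho u * h (st (X u) * Y u).
Hypothesis io_ip : forall k X Y, (k <= 3)%N ->
  (forall u, u \in comps k -> L (- wt u) (X u)) ->
  (forall u, u \in comps k -> L (- wt u) (Y u)) ->
  ip k (\sum_(u <- comps k) io u (X u)) (\sum_(u <- comps k) io u (Y u)) =
  \sum_(u <- comps k) beta u * h (st (X u) * Y u).
Hypothesis rho0 : forall k u, u \in comps k -> rho u != 0.
Hypothesis beta0 : forall k u, u \in comps k -> beta u != 0.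

Definition hodge_op k (H : form -> form) : Prop :=
  [/\ set_bij (OmegaS k) (OmegaS (3 - k)%N) H,
      forall (f : S) (x y : form), Lsp 0 f -> OmegaS k x -> OmegaS k y ->
        H (act f x + y) = act f (H x) + H y
    & forall x y : form, OmegaS k x -> OmegaS k y ->
        integralS mc (k + (3 - k))%N (wedge k (3 - k)%N (fstar k x) (H y)) = ip k x y].

Lemma io0 u : io u 0 = 0.
Proof. by have := ioP u (-1) 0 0; rewrite scaler0 addr0 scaleN1r addNr. Qed.
Lemma ioD u x y : io u (x + y) = io u x + io u y.
Proof. by have := ioP u 1 x y; rewrite !scale1r. Qed.
Lemma ioZ u (c : C) x : io u (c *: x) = c *: io u x.
Proof. by have := ioP u c x 0; rewrite io0 !addr0. Qed.
Lemma mulfZ f (c : C) x : mulf f (c *: x) = c *: mulf f x.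
Proof.
have m0 : mulf f 0 = 0 by have := mulfP f (-1) 0 0; rewrite scaler0 addr0 scaleN1r addNr.
by have := mulfP f c x 0; rewrite m0 !addr0.
Qed.

Definition hodge_ratio u : C := beta u / rho u.

Lemma ratio0 k u : u \in comps k -> hodge_ratio u != 0.
Proof. by move=> uk; rewrite mulf_neq0 ?invr_eq0 ?(beta0 uk) ?(rho0 uk). Qed.

Definition comp_coefs k (t : form) : seq gen -> S :=
  xget (fun=> 0) [set X | (forall u, u \in comps k -> L (- wt u) (X u)) /\
                          t = \sum_(u <- comps k) io u (X u)].

(** Multiplication by [hodge_ratio] takes the component of u to that of the dual
    word, so that the pairing rho becomes the inner product beta. *)
Definition hodge_map k (t : form) : form :=
  \sum_(u <- comps k) io (dual u) (hodge_ratio u *: comp_coefs k t u).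

Lemma hodge_mapE k X : (k <= 3)%N -> (forall u, u \in comps k -> L (- wt u) (X u)) ->
  hodge_map k (\sum_(u <- comps k) io u (X u)) =
  \sum_(u <- comps k) io (dual u) (hodge_ratio u *: X u).
Proof.
move=> k3 LX; rewrite /hodge_map /comp_coefs.
case: xgetP => [Y _ [LY e]|/(_ X) []//].
by apply: eq_big_seq => u uk; rewrite (io_free k3 e uk).
Qed.

Lemma dual_sum k (W : lmodType C) (G : seq gen -> seq gen -> W) : (k <= 3)%N ->
  \sum_(u <- comps k) G (dual u) u = \sum_(v <- comps (3 - k)) G v (dual v).
Proof.
move=> k3; rewrite -(perm_big _ (perm_dual k3)) big_map.
by apply: eq_big_seq => u uk; rewrite (dualK uk).
Qed.

Lemma dual_sum_io k X : (k <= 3)%N ->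
  \sum_(u <- comps k) io (dual u) (X u) = \sum_(v <- comps (3 - k)) io v (X (dual v)).
Proof. by move=> k3; exact: (dual_sum (fun v u => io v (X u)) k3). Qed.

Lemma omega_dual k X : (k <= 3)%N -> (forall u, u \in comps k -> L (- wt u) (X u)) ->
  OmegaS (3 - k) (\sum_(u <- comps k) io (dual u) (X u)).
Proof.
move=> k3 LX; apply/io_omega; first exact: leq_subr.
exists (fun v => X (dual v)); last exact: dual_sum_io.
move=> v vk; have := dual_comps vk; rewrite subKn // => dk.
by rewrite -(wt_dual vk); apply: LX.
Qed.

Lemma omega_dual_inv k t : (k <= 3)%N -> OmegaS (3 - k) t ->
  exists2 X, (forall u, u \in comps k -> L (- wt u) (X u)) &
    t = \sum_(u <- comps k) io (dual u) (X u).
Proof.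
move=> k3 /(io_omega _ (leq_subr k 3)) [Y LY ->].
exists (fun u => Y (dual u)).
  by move=> u uk; rewrite -(wt_dual uk); apply: LY; exact: dual_comps.
rewrite (dual_sum_io (fun u => Y (dual u)) k3).
by apply: eq_big_seq => v vk; rewrite (dualK vk).
Qed.

Lemma free_dual k X Y : (k <= 3)%N ->
  \sum_(u <- comps k) io (dual u) (X u) = \sum_(u <- comps k) io (dual u) (Y u) ->
  forall u, u \in comps k -> X u = Y u.
Proof.
move=> k3; rewrite !dual_sum_io // => /(io_free (leq_subr k 3)) e u uk.
by have := e _ (dual_comps uk); rewrite (dualK uk).
Qed.

Lemma hodge_map_op k : (k <= 3)%N -> hodge_op k (hodge_map k).
Proof.
move=> k3.
have LZ X : (forall u, u \in comps k -> L (- wt u) (X u)) ->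
    forall u, u \in comps k -> L (- wt u) (hodge_ratio u *: X u).
  by move=> LX u uk; apply: LspZ; apply: LX.
split.
- split.
  + move=> t /(io_omega _ k3) [X LX ->]; rewrite hodge_mapE //.
    by apply: omega_dual => //; apply: LZ.
  + move=> t t'; rewrite !inE => /(io_omega _ k3) [X LX ->] /(io_omega _ k3) [Y LY ->].
    rewrite !hodge_mapE // => /(free_dual k3) e; apply: eq_big_seq => u uk.
    by congr io; apply: (scalerI (ratio0 uk)); apply: e.
  + move=> t /(omega_dual_inv k3) [Y LY ->].
    exists (\sum_(u <- comps k) io u ((hodge_ratio u)^-1 *: Y u)).
      apply/(io_omega _ k3); eexists; last by [].
      by move=> u uk; apply: LspZ; apply: LY.
    rewrite hodge_mapE => [|//|u uk]; last by apply: LspZ; apply: LY.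
    by apply: eq_big_seq => u uk; rewrite scalerA mulfV ?scale1r // (ratio0 uk).
- move=> f x y Lf /(io_omega _ k3) [X LX ->] /(io_omega _ k3) [Y LY ->].
  have Lm u : u \in comps k -> L (- wt u) (mulf f (X u)).
    by move=> uk; apply: mulf_weight => //; apply: LX.
  rewrite act_sum -big_split /=.
  rewrite (eq_bigr (fun u => io u (mulf f (X u) + Y u))) => [|u _]; last by rewrite ioD.
  rewrite !hodge_mapE //; last by move=> u uk; apply: LspD; [exact: Lm|exact: LY].
  rewrite (dual_sum_io (fun u => hodge_ratio u *: X u) k3) act_sum.
  rewrite -(dual_sum (fun v u => io v (mulf f (hodge_ratio u *: X u))) k3) -big_split /=.
  by apply: eq_bigr => u _; rewrite mulfZ scalerDr ioD.
- move=> x y /(io_omega _ k3) [X LX ->] /(io_omega _ k3) [Y LY ->].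
  rewrite hodge_mapE // (io_int k3 LX (LZ _ LY)) (io_ip k3 LX LY).
  apply: eq_big_seq => u uk; rewrite -scalerAr linearZ /= mulrA /hodge_ratio.
  by rewrite mulrCA mulfV ?mulr1 // (rho0 uk).
Qed.

(** Two operators with the same pairing agree because the Haar state is
    nondegenerate on each weight space. *)
Lemma hodge_op_unique k H : (k <= 3)%N -> hodge_op k H ->
  forall x : form, OmegaS k x -> H x = hodge_map k x.
Proof.
move=> k3 [[Hfun _ _] _ Hint] x Ox.
have [_ _ Mint] := hodge_map_op k3.
have /(omega_dual_inv k3) [Y LY eY] := Hfun _ Ox.
have /(io_omega _ k3) [X LX eX] := Ox.
rewrite eY [in RHS]eX hodge_mapE //; apply: eq_big_seq => u uk; congr io.
have LZ : L (- wt u) (hodge_ratio u *: X u) by apply: LspZ; apply: LX.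
apply/eqP; rewrite -subr_eq0; apply/eqP.
apply: (haar_nondeg q_gt0 q_lt1 (n := - wt u)).
  by apply: LspD; [exact: LY|apply: LspN].
move=> y Ly; pose Z v := if v == u then y else 0.
have LZv v : v \in comps k -> L (- wt v) (Z v).
  by rewrite /Z; have [->|_] := eqVneq v u; [|move=> _; exact: Lsp0].
have Oz : OmegaS k (\sum_(v <- comps k) io v (Z v)) by apply/(io_omega _ k3); exists Z.
(* Testing against the single component y w_u isolates the coefficient at u. *)
have := Hint _ _ Oz Ox; rewrite -(Mint _ _ Oz Ox) eY eX hodge_mapE //.
have LZX v : v \in comps k -> L (- wt v) (hodge_ratio v *: X v).
  by move=> vk; apply: LspZ; apply: LX.
rewrite (io_int k3 LZv LY) (io_int k3 LZv LZX).
have [inv stD stZ stM] := SUq2_star (qalgP S).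
have st0 : st 0 = 0 by rewrite -(scale0r (0 : S)) stZ conjc0 !scale0r.
have pick (T : seq gen -> S) : \sum_(v <- comps k) rho v * h (st (Z v) * T v) =
    rho u * h (st y * T u).
  rewrite (bigD1_seq u) ?comps_uniq //= {1}/Z eqxx big1 ?addr0 // => v nv.
  by rewrite /Z (negPf nv) st0 mul0r linear0 mulr0.
rewrite !pick => /(mulfI (rho0 uk)) e.
by rewrite mulrBr linearB /= e subrr.
Qed.

Lemma hodge_map_io k u x : (k <= 3)%N -> u \in comps k -> L (- wt u) x ->
  hodge_map k (io u x) = hodge_ratio u *: io (dual u) x.
Proof.
move=> k3 uk Lx; pose X v := if v == u then x else 0.
have LX v : v \in comps k -> L (- wt v) (X v).
  by rewrite /X; have [->|_] := eqVneq v u; [|move=> _; exact: Lsp0].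
have -> : io u x = \sum_(v <- comps k) io v (X v).
  rewrite (bigD1_seq u) ?comps_uniq //= {1}/X eqxx big1 ?addr0 // => v nv.
  by rewrite /X (negPf nv) io0.
rewrite hodge_mapE // (bigD1_seq u) ?comps_uniq //= {1}/X eqxx big1 => [|v nv].
  by rewrite addr0 ioZ.
by rewrite /X (negPf nv) scaler0 io0.
Qed.

End Abstract.
End Hodge.

Lemma sum_delta2 (R : rcfType) n (B : 'I_n -> 'I_n -> R[i]) (e : nat -> R) (j : 'I_n) (c : R) :
  (forall i : nat, e i = c * (i == j)%:R) ->
  \sum_(i < n) \sum_(k < n) (e i)%:C * (e k)%:C * B i k = (c ^+ 2)%:C * B j j.
Proof.
move=> ee.
have ej : e j = c by rewrite ee eqxx mulr1.
have e0 (i : 'I_n) : i != j -> e i = 0 by move=> ij; rewrite ee (negPf (ij : (i : nat) != j)) mulr0.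
rewrite (bigD1 j) //= [X in _ + X]big1 ?addr0 => [|i ij]; last first.
  by rewrite big1 // => k _; rewrite e0 // rmorph0 !mul0r.
rewrite (bigD1 j) //= big1 ?addr0 => [|i ij]; last by rewrite (e0 i) // rmorph0 mulr0 mul0r.
by rewrite ej -rmorphM -expr2.
Qed.

Section Instances.
Variables (R : realType) (q : R).
Hypotheses (q_gt0 : 0 < q) (q_lt1 : q < 1).
Variable S : quantum_SU2 q.
Local Notation C := R[i].
Variables (G : gen -> gen -> C) (m mc : R).
Hypotheses (m0 : m != 0) (mc0 : mc != 0).
Hypotheses (ndG : nondegenerate_contraction G)
  (hermG : hermitian_contraction q G m) (realG : real_contraction q G m).
Local Notation h := (qh S).
Local Notation st := (@qst R q S).
Local Notation L := (@Lsp R q S).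
Local Notation omS := (@omA R q S).
Local Notation mpo := [:: wm; wp; w0].
Local Notation form := (seq gen -> S).
Local Notation psg u := ((int_of_Z (psgn u))%:~R : C).
Local Notation br k u := (brace q G m k (om q u) (om q u)).
Local Notation sq := (sqrtq q : C).

(** The brace of w_u with itself, expanded over eigenvectors. *)
Definition beta (u : seq gen) : C :=
  \sum_(i < size (ebas q (size u))) \sum_(j < size (ebas q (size u)))
    (ecoef q u i)%:C * (ecoef q u j)%:C * brace q G m (size u) (ebas q (size u))`_i (ebas q (size u))`_j.

Lemma beta_delta u (j : 'I_(size (ebas q (size u)))) (c : R) : c ^+ 2 = 1 ->
  (forall i : nat, ecoef q u i = c * (i == j)%:R) ->
  beta u = brace q G m (size u) (ebas q (size u))`_j (ebas q (size u))`_j.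
Proof.
move=> c1 e; rewrite /beta.
rewrite (sum_delta2 (fun i j => brace q G m (size u) (ebas q (size u))`_i (ebas q (size u))`_j) e).
by rewrite c1 rmorph1 mul1r.
Qed.

Lemma beta_nil : beta [::] = 1.
Proof.
apply: etrans (brace_unit q_gt0 q_lt1 G m0).
by apply: (@beta_delta [::] (@Ordinal 1 0 isT) 1); rewrite ?expr1n // => i; rewrite mul1r.
Qed.
Lemma beta_m : beta [:: wm] = G wm wm.
Proof.
apply: etrans (hermG wm wm).
by apply: (@beta_delta [:: wm] (@Ordinal 4 0 isT) 1); rewrite ?expr1n // => i; rewrite mul1r.
Qed.
Lemma beta_p : beta [:: wp] = (q ^+ 2)%:C * G wm wm.
Proof.
apply: etrans (Gpp q_gt0 q_lt1 m0 ndG hermG realG); apply: etrans (hermG wp wp).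
by apply: (@beta_delta [:: wp] (@Ordinal 4 1 isT) 1); rewrite ?expr1n // => i; rewrite mul1r.
Qed.
Lemma beta_0 : beta [:: w0] = G w0 w0.
Proof.
apply: etrans (hermG w0 w0).
by apply: (@beta_delta [:: w0] (@Ordinal 4 3 isT) 1); rewrite ?expr1n // => i; rewrite mul1r.
Qed.
Lemma beta_m0 : beta [:: wm; w0] = br 2 [:: wm; w0].
Proof.
by apply: (@beta_delta [:: wm; w0] (@Ordinal 6 0 isT) 1); rewrite ?expr1n // => i; rewrite mul1r.
Qed.
(** w_0 w_+ = - w_+ w_0, and the sign disappears from the brace. *)
Lemma beta_0p : beta [:: w0; wp] = br 2 [:: wp; w0].
Proof.
by apply: (@beta_delta [:: w0; wp] (@Ordinal 6 4 isT) (-1)); rewrite ?sqrrN ?expr1n // => i; rewrite mulN1r.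
Qed.
Lemma beta_mp : beta [:: wm; wp] = br 2 [:: wm; wp].
Proof. exact: esym (brace_mp q_gt0 q_lt1 m0 ndG hermG realG). Qed.
Lemma beta_mpo : beta mpo = br 3 mpo.
Proof.
by apply: (@beta_delta mpo (@Ordinal 4 0 isT) 1); rewrite ?expr1n // => i; rewrite mul1r.
Qed.

Lemma beta_neq0 k u : u \in comps k -> beta u != 0.
Proof.
move: k u; apply: comps_case.
- by rewrite beta_nil oner_eq0.
- by rewrite beta_m (Gmm_neq0 q_gt0 q_lt1 m0 ndG hermG realG).
- rewrite beta_p mulf_neq0 ?(Gmm_neq0 q_gt0 q_lt1 m0 ndG hermG realG) //.
  by rewrite (inj_eq (@complexI R) _ 0) expf_neq0 // q_neq0.
- by rewrite beta_0 (G00_neq0 q_gt0 q_lt1 m0 ndG hermG realG).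
- by rewrite beta_m0 (brace_mo_neq0 q_gt0 q_lt1 m0 ndG hermG realG).
- by rewrite beta_mp (brace_mp_neq0 q_gt0 q_lt1 m0 ndG hermG realG).
- by rewrite beta_0p (brace_po_neq0 q_gt0 q_lt1 m0 ndG hermG realG).
- by rewrite beta_mpo (brace_mpo_neq0 q_gt0 q_lt1 m0 ndG hermG realG).
Qed.

Definition rhoL (u : seq gen) : C := (mc^-1)%:C * psg u.
(** The additional power of q comes from moving the right coefficient across the volume
    form, which amounts to an action of K^2 on it. *)
Definition rhoR (u : seq gen) : C := (mc^-1)%:C * psg u * (sq ^ (- wt u) * sq ^ (- wt u)).

Lemma psg_neq0 u : psg u != 0.
Proof.
have e : psgn u = 1%ZZ \/ psgn u = (-1)%ZZ.
  by rewrite /psgn; case: u => [|[] [|[] [|]]]; auto.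
by case: e => ->; rewrite /= ?oppr_eq0 oner_eq0.
Qed.

Lemma mcV_neq0 : (mc^-1)%:C != 0 :> C.
Proof. by rewrite (inj_eq (@complexI R) _ 0) invr_eq0. Qed.

Lemma rhoL_neq0 k u : u \in comps k -> rhoL u != 0.
Proof. by move=> _; rewrite mulf_neq0 ?mcV_neq0 ?psg_neq0. Qed.

Lemma rhoR_neq0 k u : u \in comps k -> rhoR u != 0.
Proof.
move=> uk; apply: mulf_neq0; first exact: rhoL_neq0 uk.
by apply: mulf_neq0; exact: expfz_neq0 (sq_neq0 q_gt0).
Qed.

Definition ioL (u : seq gen) (x : S) : form := lmul x (omS u).
Definition ioR (u : seq gen) (x : S) : form := rmul (omS u) x.

Lemma ioLP u (c : C) x y : ioL u (c *: x + y) = c *: ioL u x + ioL u y.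
Proof. by rewrite /ioL lmulDl lmulZl. Qed.
Lemma ioRP u (c : C) x y : ioR u (c *: x + y) = c *: ioR u x + ioR u y.
Proof. by rewrite /ioR rmulDr rmulZr. Qed.

Lemma mulLP f (c : C) (x y : S) : f * (c *: x + y) = c *: (f * x) + f * y.
Proof. by rewrite mulrDr scalerAr. Qed.
Lemma mulRP f (c : C) (x y : S) : (c *: x + y) * f = c *: (x * f) + y * f.
Proof. by rewrite mulrDl scalerAl. Qed.

Lemma mulL_weight f n x : L 0 f -> L n x -> L n (f * x).
Proof. by move=> Lf Lx; have := LspM q_gt0 Lf Lx; rewrite add0r. Qed.
Lemma mulR_weight f n x : L 0 f -> L n x -> L n (x * f).
Proof. by move=> Lf Lx; have := LspM q_gt0 Lx Lf; rewrite addr0. Qed.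

Lemma actL_sum f k X : lmul f (\sum_(u <- comps k) ioL u (X u)) =
  \sum_(u <- comps k) ioL u (f * X u).
Proof. by rewrite lmul_sumr; apply: eq_bigr => u _; rewrite /ioL lmulM. Qed.
Lemma actR_sum f k X : rmul (\sum_(u <- comps k) ioR u (X u)) f =
  \sum_(u <- comps k) ioR u (X u * f).
Proof. by rewrite rmul_suml; apply: eq_bigr => u _; rewrite /ioR (rmulM q_gt0). Qed.

Lemma ipL_comps k X Y : (k <= 3)%N ->
  (forall u, u \in comps k -> L (- wt u) (X u)) ->
  (forall u, u \in comps k -> L (- wt u) (Y u)) ->
  ipL G m k (\sum_(u <- comps k) ioL u (X u)) (\sum_(u <- comps k) ioL u (Y u)) =
  \sum_(u <- comps k) beta u * h (st (X u) * Y u).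
Proof.
move=> k3 LX LY; rewrite /ipL /ioL !(lcoef_comps q_gt0 q_lt1) //.
rewrite (ip_coefs q_gt0 q_lt1 LX LY (fun i j => brace q G m k (ebas q k)`_i (ebas q k)`_j)).
by apply: eq_big_seq => u uk; rewrite /beta (comps_size uk).
Qed.

Lemma ipR_comps k X Y : (k <= 3)%N ->
  (forall u, u \in comps k -> L (- wt u) (X u)) ->
  (forall u, u \in comps k -> L (- wt u) (Y u)) ->
  ipR G m k (\sum_(u <- comps k) ioR u (X u)) (\sum_(u <- comps k) ioR u (Y u)) =
  \sum_(u <- comps k) beta u * h (st (X u) * Y u).
Proof.
move=> k3 LX LY; rewrite /ipR /ioR !(rcoef_comps q_gt0 q_lt1) //.
rewrite (ip_coefs q_gt0 q_lt1 LX LY (fun i j => brace q G m k (ebas q k)`_i (ebas q k)`_j)).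
by apply: eq_big_seq => u uk; rewrite /beta (comps_size uk).
Qed.

Definition left_map := hodge_map ioL rhoL beta.
Definition right_map := hodge_map ioR rhoR beta.

Lemma left_map_hodge k : (k <= 3)%N -> left_hodge G m mc k (left_map k).
Proof.
move=> k3; apply: (hodge_map_op (mc := mc) (act := fun f t => lmul f t) (mulf := fun f x => f * x)
  (ip := fun k => ipL G m k) ioLP _ _ mulLP mulL_weight actL_sum _ _ rhoL_neq0 beta_neq0 k3).
- by move=> k' t k'3; exact: OmegaS_left.
- by move=> k' X Y k'3; exact: free_left.
- by move=> k' X Y k'3 LX LY; exact: (left_pairing q_gt0 q_lt1).
- by move=> k' X Y k'3 LX LY; exact: ipL_comps.
Qed.

Lemma right_map_hodge k : (k <= 3)%N -> right_hodge G m mc k (right_map k).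
Proof.
move=> k3; apply: (hodge_map_op (mc := mc) (act := fun f t => rmul t f) (mulf := fun f x => x * f)
  (ip := fun k => ipR G m k) ioRP _ _ mulRP mulR_weight actR_sum _ _ rhoR_neq0 beta_neq0 k3).
- by move=> k' t k'3; exact: OmegaS_right.
- by move=> k' X Y k'3; exact: free_right.
- by move=> k' X Y k'3 LX LY; exact: (right_pairing q_gt0 q_lt1).
- by move=> k' X Y k'3 LX LY; exact: ipR_comps.
Qed.

Lemma left_map_unique k H : (k <= 3)%N -> left_hodge G m mc k H ->
  forall t : form, OmegaS k t -> H t = left_map k t.
Proof.
move=> k3; apply: (hodge_op_unique q_gt0 q_lt1 (mc := mc) (act := fun f t => lmul f t)
  (mulf := fun f x => f * x)
  (ip := fun k => ipL G m k) ioLP _ _ mulLP mulL_weight actL_sum _ _ rhoL_neq0 beta_neq0 k3).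
- by move=> k' t k'3; exact: OmegaS_left.
- by move=> k' X Y k'3; exact: free_left.
- by move=> k' X Y k'3 LX LY; exact: (left_pairing q_gt0 q_lt1).
- by move=> k' X Y k'3 LX LY; exact: ipL_comps.
Qed.

Lemma right_map_unique k H : (k <= 3)%N -> right_hodge G m mc k H ->
  forall t : form, OmegaS k t -> H t = right_map k t.
Proof.
move=> k3; apply: (hodge_op_unique q_gt0 q_lt1 (mc := mc) (act := fun f t => rmul t f)
  (mulf := fun f x => x * f)
  (ip := fun k => ipR G m k) ioRP _ _ mulRP mulR_weight actR_sum _ _ rhoR_neq0 beta_neq0 k3).
- by move=> k' t k'3; exact: OmegaS_right.
- by move=> k' X Y k'3; exact: free_right.
- by move=> k' X Y k'3 LX LY; exact: (right_pairing q_gt0 q_lt1).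
- by move=> k' X Y k'3 LX LY; exact: ipR_comps.
Qed.

Lemma left_map_io k u x : (k <= 3)%N -> u \in comps k -> L (- wt u) x ->
  left_map k (lmul x (omS u)) = hodge_ratio rhoL beta u *: lmul x (omS (dual u)).
Proof.
move=> k3 uk Lx; apply: (hodge_map_io rhoL beta ioLP _ k3 uk Lx).
by move=> k' X Y k'3; exact: free_left.
Qed.

Lemma right_map_io k u x : (k <= 3)%N -> u \in comps k -> L (- wt u) x ->
  right_map k (rmul (omS u) x) = hodge_ratio rhoR beta u *: rmul (omS (dual u)) x.
Proof.
move=> k3 uk Lx; apply: (hodge_map_io rhoR beta ioRP _ k3 uk Lx).
by move=> k' X Y k'3; exact: free_right.
Qed.

Lemma mcE : ((mc^-1)%:C)^-1 = mc%:C :> C.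
Proof. by rewrite -(fmorphV (real_complex R)) invrK. Qed.

Lemma ratioL_pos u : psgn u = 1%ZZ -> hodge_ratio rhoL beta u = mc%:C * beta u.
Proof. by move=> e; rewrite /hodge_ratio /rhoL e mulr1 mcE mulrC. Qed.

Lemma ratioL_neg u : psgn u = (-1)%ZZ -> hodge_ratio rhoL beta u = - (mc%:C * beta u).
Proof. by move=> e; rewrite /hodge_ratio /rhoL e mulrN1 invrN mcE mulrN mulrC. Qed.

Lemma ratioR_L u : hodge_ratio rhoR beta u = hodge_ratio rhoL beta u * (sq ^ wt u * sq ^ wt u).
Proof.
rewrite /hodge_ratio /rhoR -/(rhoL u) invfM mulrA; congr (_ * _).
by rewrite invfM !invr_expz opprK.
Qed.

Lemma E1 : qE S 1 = 0.
Proof.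
have Ki1 : qKi S 1 = 1 by rewrite -{1}K1 (Uq_KiK (qactP S)).
have := Uq_EM (qactP S) 1 1; rewrite K1 Ki1 !mulr1 mul1r => e.
by apply: (addrI (qE S 1)); rewrite -e addr0.
Qed.

Lemma lmul1 (t : form) : lmul 1 t = t.
Proof. by apply: funext => w; rewrite lmulE mul1r. Qed.

Lemma rmul1_nil : rmul (omS [::]) 1 = omS [::].
Proof. by rewrite rmul_om0 // lmul1. Qed.
Lemma rmul1_0 : rmul (omS [:: w0]) 1 = omS [:: w0].
Proof. by rewrite (rmul_0 q_gt0 q_lt1) !K1 lmul1. Qed.
Lemma rmul1_mpo : rmul (omS mpo) 1 = omS mpo.
Proof. by rewrite (rmul_mpo q_gt0 q_lt1) !K1 lmul1. Qed.
Lemma rmul1_mp : rmul (omS [:: wm; wp]) 1 = omS [:: wm; wp].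
Proof.
apply: etrans (rmul_mp q_gt0 q_lt1 _) _.
have -> : fcoef wp w0 (1 : S) = 0 by rewrite /= K1 (F1 S) scaler0.
have -> : fcoef wm w0 (1 : S) = 0 by rewrite /= E1 linear0 scaler0.
apply: etrans (congr2 +%R (congr2 +%R (lmul1 _) (lmul0 _)) (lmul0 _)) _.
exact: etrans (addr0 _) (addr0 _).
Qed.

(** For words of weight zero the basis form itself belongs to the sphere, with
    right coefficient 1; E and F kill 1. *)
Lemma rmul1 k u : u \in comps k -> wt u = 0 -> rmul (omS u) 1 = omS u.
Proof.
move=> uk; move: k u uk; apply: (comps_case (P := fun k u => wt u = 0 -> _)) => // _.
- exact: rmul1_nil.
- exact: rmul1_0.
- exact: rmul1_mp.
- exact: rmul1_mpo.
Qed.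

Lemma left_map_om k u c : (k <= 3)%N -> u \in comps k -> wt u = 0 ->
  left_map k (c *: omS u) = (hodge_ratio rhoL beta u * c) *: omS (dual u).
Proof.
move=> k3 uk u0; have Lc : L (- wt u) (c *: (1 : S)).
  by rewrite u0; apply: LspZ; exact: Lsp1.
have e v : lmul (c *: (1 : S)) (omS v) = c *: omS v by rewrite lmulZl lmul1.
apply: etrans (congr1 (left_map k) (esym (e u))) _.
apply: etrans (left_map_io k3 uk Lc) _.
by apply: etrans (congr1 (fun t : form => hodge_ratio rhoL beta u *: t) (e (dual u))) _; exact: scalerA.
Qed.

Lemma right_map_om k u c : (k <= 3)%N -> u \in comps k -> wt u = 0 ->
  right_map k (c *: omS u) = (hodge_ratio rhoR beta u * c) *: omS (dual u).
Proof.
move=> k3 uk u0; have Lc : L (- wt u) (c *: (1 : S)).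
  by rewrite u0; apply: LspZ; exact: Lsp1.
have du : wt (dual u) = 0 by rewrite (wt_dual uk).
have e v : rmul (omS v) 1 = omS v -> rmul (omS v) (c *: (1 : S)) = c *: omS v.
  by move=> ev; rewrite rmulZr ev.
apply: etrans (congr1 (right_map k) (esym (e u (rmul1 uk u0)))) _.
apply: etrans (right_map_io k3 uk Lc) _.
have e' := e _ (rmul1 (dual_comps uk) du).
by apply: etrans (congr1 (fun t : form => hodge_ratio rhoR beta u *: t) e') _; exact: scalerA.
Qed.

Lemma volE : of_inv S (volumeS q mc) = mc%:C *: omS mpo.
Proof. by apply: funext => w; rewrite tensZ /omA /of_inv /volumeS tensZ scalerA. Qed.

Lemma brvolE : brace q G m 3 (volumeS q mc) (volumeS q mc) = (mc ^+ 2)%:C * br 3 mpo.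
Proof. exact: (brace_mpo_scale q_gt0 q_lt1 m0 ndG hermG realG mc). Qed.

End Instances.

Theorem proposition4p3 (R : realType) (q : R) (S : quantum_SU2 q)
    (G : gen -> gen -> R[i]) (m mc : R) :
  0 < q -> q < 1 -> m != 0 -> mc != 0 ->
  nondegenerate_contraction G -> hermitian_contraction q G m -> real_contraction q G m ->
  let alpha := G wm wm in
  let nu := G w0 w0 in
  let w := @omA R q S in
  let vol := of_inv S (volumeS q mc) in
  let br k u := brace q G m k (om q u) (om q u) in
  let brvol := brace q G m 3 (volumeS q mc) (volumeS q mc) in
  (exists L : nat -> (seq gen -> S) -> (seq gen -> S),
    [/\ forall k, (k <= 3)%N -> left_hodge G m mc k (L k),
        forall k L', (k <= 3)%N -> left_hodge G m mc k L' ->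
          forall x, OmegaS k x -> L' x = L k x,
        L 0%N (w [::]) = vol /\ L 3%N vol = brvol *: w [::],
        forall phi : S, Lsp (-2) phi ->
          L 1%N (lmul phi (w [:: wm])) =
            (mc%:C * alpha) *: lmul phi (w [:: wm; w0]) /\
          L 2%N (lmul phi (w [:: wm; w0])) =
            (mc%:C * br 2%N [:: wm; w0]) *: lmul phi (w [:: wm])
      & (forall phi' : S, Lsp 2 phi' ->
          L 1%N (lmul phi' (w [:: wp])) =
            (mc%:C * (q ^+ 2)%:C * alpha) *: lmul phi' (w [:: w0; wp]) /\
          L 2%N (lmul phi' (w [:: w0; wp])) =
            (mc%:C * br 2%N [:: wp; w0]) *: lmul phi' (w [:: wp])) /\
        L 1%N (w [:: w0]) = - (mc%:C * nu) *: w [:: wm; wp] /\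
        L 2%N (w [:: wm; wp]) = - (mc%:C * br 2%N [:: wm; wp]) *: w [:: w0]])
  /\
  (exists L : nat -> (seq gen -> S) -> (seq gen -> S),
    [/\ forall k, (k <= 3)%N -> right_hodge G m mc k (L k),
        forall k L', (k <= 3)%N -> right_hodge G m mc k L' ->
          forall x, OmegaS k x -> L' x = L k x,
        L 0%N (w [::]) = vol /\ L 3%N vol = brvol *: w [::],
        forall phi : S, Lsp (-2) phi ->
          L 1%N (rmul (w [:: wm]) phi) =
            (mc%:C * (q ^+ 2)%:C * alpha) *: rmul (w [:: wm; w0]) phi /\
          L 2%N (rmul (w [:: wm; w0]) phi) =
            (mc%:C * (q ^+ 2)%:C * br 2%N [:: wm; w0]) *: rmul (w [:: wm]) phi
      & (forall phi' : S, Lsp 2 phi' ->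
          L 1%N (rmul (w [:: wp]) phi') =
            (mc%:C * alpha) *: rmul (w [:: w0; wp]) phi' /\
          L 2%N (rmul (w [:: w0; wp]) phi') =
            (mc%:C * (q ^- 2)%:C * br 2%N [:: wp; w0]) *: rmul (w [:: wp]) phi') /\
        L 1%N (w [:: w0]) = - (mc%:C * nu) *: w [:: wm; wp] /\
        L 2%N (w [:: wm; wp]) = - (mc%:C * br 2%N [:: wm; wp]) *: w [:: w0]]).
Proof.
move=> q_gt0 q_lt1 m0 mc0 ndG hermG realG alpha nu w vol br brvol.
have L1 : Lsp 0 (1 : S) by exact: Lsp1.
have qC0 : (q ^+ 2)%:C != 0 :> R[i] by rewrite (inj_eq (@complexI R) _ 0) expf_neq0 // q_neq0.
have sq4 : sqrtq q ^ 2 * sqrtq q ^ 2 = (q ^+ 2)%:C.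
  by rewrite sq2 // -(rmorphM (real_complex R)).
have sq4V : sqrtq q ^ (-2) * sqrtq q ^ (-2) = (q ^- 2)%:C.
  by rewrite -!invr_expz -invfM sq4 -(fmorphV (real_complex R)).
have mcm : mc%:C * mc%:C = (mc ^+ 2)%:C :> R[i] by rewrite -(rmorphM (real_complex R)).
have mulVK (a b c : R[i]) : b != 0 -> a * (b * c) * b^-1 = a * c.
  by move=> bn; rewrite -mulrA [b * c * _]mulrAC mulfV ?mul1r.
have lio := left_map_io q_gt0 q_lt1 (S := S) G m mc.
have rio := right_map_io q_gt0 q_lt1 (S := S) G m mc.
have lom k u := left_map_om q_gt0 q_lt1 S G m mc 1 (k := k) (u := u).
have rom k u := right_map_om q_gt0 q_lt1 S G m mc 1 (k := k) (u := u).
have rL := @ratioL_pos R q G m mc; have rLN := @ratioL_neg R q G m mc.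
have rR := @ratioR_L R q G m mc.
have bm := beta_m hermG; have bp := beta_p q_gt0 q_lt1 m0 ndG hermG realG.
have b0 := beta_0 hermG; have bn := beta_nil q_gt0 q_lt1 G m0.
have bmp := beta_mp q_gt0 q_lt1 m0 ndG hermG realG.
split.
- exists (@left_map R q S G m mc); split.
  + by move=> k k3; apply: left_map_hodge.
  + by move=> k L' k3 hL x; apply: left_map_unique.
  + split.
      have := lom 0%N [::] isT isT (erefl _); rewrite scale1r => ->.
      by rewrite rL // bn !mulr1 /vol volE.
    rewrite /vol volE; apply: etrans (left_map_om q_gt0 q_lt1 S G m mc mc%:C (k := 3) (u := [:: wm; wp; w0]) isT isT (erefl _)) _.
    rewrite rL // beta_mpo /brvol brvolE //; congr (_ *: _).
    by rewrite -mcm mulrAC.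
  + move=> phi Lphi; split.
      by rewrite (lio 1%N [:: wm] phi) // rL // bm.
    by rewrite (lio 2%N [:: wm; w0] phi) // rL // beta_m0.
  split; last split.
  + move=> phi Lphi; split.
      by rewrite (lio 1%N [:: wp] phi) // rL // bp mulrA.
    by rewrite (lio 2%N [:: w0; wp] phi) // rL // beta_0p.
  + by have := lom 1%N [:: w0] isT isT (erefl _); rewrite scale1r mulr1 => ->; rewrite rLN // b0.
  + have := lom 2%N [:: wm; wp] isT isT (erefl _); rewrite scale1r mulr1 => ->.
    by rewrite rLN // bmp.
- exists (@right_map R q S G m mc); split.
  + by move=> k k3; apply: right_map_hodge.
  + by move=> k L' k3 hL x; apply: right_map_unique.
  + split.
      have := rom 0%N [::] isT isT (erefl _); rewrite scale1r => ->.
      by rewrite rR rL // bn !expr0z !mulr1 /vol volE.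
    rewrite /vol volE; apply: etrans (right_map_om q_gt0 q_lt1 S G m mc mc%:C (k := 3) (u := [:: wm; wp; w0]) isT isT (erefl _)) _.
    rewrite rR rL // beta_mpo !expr0z !mulr1 /brvol brvolE //; congr (_ *: _).
    by rewrite -mcm mulrAC.
  + move=> phi Lphi; split.
      by rewrite (rio 1%N [:: wm] phi) // rR rL // bm sq4 mulrAC.
    by rewrite (rio 2%N [:: wm; w0] phi) // rR rL // beta_m0 sq4 mulrAC.
  split; last split.
  + move=> phi Lphi; split.
      rewrite (rio 1%N [:: wp] phi) // rR rL // bp sq4V; congr (_ *: _).
      by rewrite (fmorphV (real_complex R)) mulVK.
    by rewrite (rio 2%N [:: w0; wp] phi) // rR rL // beta_0p sq4V mulrAC.
  + have := rom 1%N [:: w0] isT isT (erefl _); rewrite scale1r mulr1 => ->.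
    by rewrite rR rLN // b0 !expr0z !mulr1.
  + have := rom 2%N [:: wm; wp] isT isT (erefl _); rewrite scale1r mulr1 => ->.
    by rewrite rR rLN // bmp !expr0z !mulr1.
Qed.
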